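(* Let $1 \le p < \frac{4}{3}$ and let $f \in L^p(\mathbb{R}^2)$. Then, with respect to arclength measure $\sigma$ on the unit circle $\mathbb{S}^1\subset\mathbb{R}^2$, $\sigma$-almost every point $x \in \mathbb{S}^1$ is a Lebesgue point of $\widehat{f}$, and for $\sigma$-almost every $x\in\mathbb{S}^1$ the regularised value of $\widehat{f}$ at $x$ coincides with $\mathcal{R}f(x)$.
   Context: For $1\le p\le 2$ and $f\in L^p(\mathbb{R}^2)$, $\widehat{f}$ denotes the Fourier transform, a locally integrable function on $\mathbb{R}^2$ (an $L^{p'}$ function by Hausdorff–Young). A point $x$ is a Lebesgue point of $\widehat f$ if there is a number $c$ (the regularised value of $\widehat f$ at $x$) with $\lim_{r\to 0}\frac{1}{|B(x,r)|}\int_{B(x,r)}|\widehat f(y)-c|\,\mathrm{d}y=0$. The restriction operator $\mathcal{R}$ is the unique bounded linear operator from $L^p(\mathbb{R}^2)$ (for $1\le p<4/3$) to $L^1(\mathbb{S}^1,\sigma)$ which agrees with $f\mapsto \widehat f|_{\mathbb{S}^1}$ on Schwartz functions $f$. *)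

(* Defs.v *)
From HB Require Import structures.
From mathcomp Require Import all_boot all_order all_algebra.
From mathcomp Require Import all_classical all_reals all_analysis.
Set Implicit Arguments. Unset Strict Implicit. Unset Printing Implicit Defensive.
Import Order.TTheory GRing.Theory Num.Theory.
Import numFieldNormedType.Exports.
Local Open Scope classical_set_scope.
Local Open Scope ring_scope.

(* Points of R^2 and complex numbers are both represented as pairs in R * R.
   A complex number z is (Re z, Im z). *)

Section Defs.
Variable R : realType.

Definition leb2 := ((@lebesgue_measure R) \x (@lebesgue_measure R))%E.

Definition cmod (z : R * R) : R := Num.sqrt (z.1 ^+ 2 + z.2 ^+ 2).
Definition cmul (z w : R * R) : R * R := (z.1 * w.1 - z.2 * w.2, z.1 * w.2 + z.2 * w.1).
Definition cadd (z w : R * R) : R * R := (z.1 + w.1, z.2 + w.2).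
Definition csub (z w : R * R) : R * R := (z.1 - w.1, z.2 - w.2).

Definition dot (x y : R * R) : R := x.1 * y.1 + x.2 * y.2.
Definition eball (x : R * R) (r : R) : set (R * R) :=
  [set y | (y.1 - x.1) ^+ 2 + (y.2 - x.2) ^+ 2 < r ^+ 2].

Definition cmeasurable {d} {T : measurableType d} (D : set T) (F : T -> R * R) :=
  measurable_fun D (fun x => (F x).1) /\ measurable_fun D (fun x => (F x).2).
Definition cintegrable {d} {T : measurableType d}
    (mu : {measure set T -> \bar R}) (D : set T) (F : T -> R * R) :=
  mu.-integrable D (EFin \o (fun x => (F x).1)) /\
  mu.-integrable D (EFin \o (fun x => (F x).2)).
Definition cint {d} {T : measurableType d}
    (mu : {measure set T -> \bar R}) (D : set T) (F : T -> R * R) : R * R :=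
  (Rintegral mu D (fun x => (F x).1), Rintegral mu D (fun x => (F x).2)).

Definition inLp (p : R) (f : R * R -> R * R) :=
  cmeasurable setT f /\ (\int[leb2]_x ((cmod (f x)) `^ p)%:E < +oo)%E.
Definition Lpnorm (p : R) (f : R * R -> R * R) : R :=
  (fine (\int[leb2]_x ((cmod (f x)) `^ p)%:E)) `^ p^-1.

Definition expi (t : R) : R * R := (cos t, sin t).
Definition fourier1 (f : R * R -> R * R) (xi : R * R) : R * R :=
  cint leb2 setT (fun x => cmul (f x) (expi (- (2 * pi * dot x xi)))).

Definition edir (b : bool) : R * R := if b then (0, 1) else (1, 0).
Fixpoint dpart (s : seq bool) (f : R * R -> R * R) : R * R -> R * R :=
  match s with
  | [::] => f
  | b :: s' => fun x => derive (dpart s' f) x (edir b)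
  end.

Definition schwartz (f : R * R -> R * R) :=
  (forall (s : seq bool) (b : bool) (x : R * R), derivable (dpart s f) x (edir b)) /\
  (forall (s : seq bool) (N : nat), exists C : R, forall x : R * R,
     (1 + dot x x) ^+ N * cmod (dpart s f x) <= C).

Definition locint (g : R * R -> R * R) :=
  cmeasurable setT g /\
  forall (x : R * R) (r : R), 0 < r -> cintegrable leb2 (eball x r) g.

(* g is (a representative of) the Fourier transform of f, in the sense of
   tempered distributions: <g, psi> = <f, psi^> for every Schwartz psi. *)
Definition is_fourier (f g : R * R -> R * R) :=
  locint g /\
  forall psi, schwartz psi ->
    cintegrable leb2 setT (fun x => cmul (g x) (psi x)) /\
    cint leb2 setT (fun x => cmul (g x) (psi x)) =
    cint leb2 setT (fun x => cmul (f x) (fourier1 psi x)).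

(* Lebesgue point of g at x with regularised value c (Euclidean balls) *)
Definition lebesgue_point (g : R * R -> R * R) (x : R * R) (c : R * R) :=
  (fun r : R => ((pi * r ^+ 2)^-1)%:E *
                \int[leb2]_(y in eball x r) (cmod (csub (g y) c))%:E)%E
    @ 0^'+ --> 0%E.

(* The unit circle parametrised by arclength; arclength measure sigma is the
   image of Lebesgue measure on [0, 2 pi[. *)
Definition arc : set R := `[0, 2 * pi[%classic.
Definition circ (t : R) : R * R := (cos t, sin t).
Definition sigma_ae (P : R * R -> Prop) :=
  {ae (@lebesgue_measure R), forall t, arc t -> P (circ t)}.
Definition sigma_int (h : R * R -> R) : \bar R :=
  (\int[@lebesgue_measure R]_(t in arc) (h (circ t))%:E)%E.

Definition restriction_operator (p : R) (T : (R * R -> R * R) -> R * R -> R * R) :=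
  (forall f g a b, inLp p f -> inLp p g ->
     sigma_ae (fun x => T (fun y => cadd (cmul a (f y)) (cmul b (g y))) x =
                        cadd (cmul a (T f x)) (cmul b (T g x)))) /\
  (forall f, inLp p f -> cmeasurable arc (T f \o circ)) /\
  (exists C : R, forall f, inLp p f ->
     (sigma_int (fun x => cmod (T f x)) <= (C * Lpnorm p f)%:E)%E) /\
  (forall f, schwartz f -> sigma_ae (fun x => T f x = fourier1 f x)).

End Defs.

(* Main.v *)
Require Import Defs.
From HB Require Import structures.
From mathcomp Require Import all_boot all_order all_algebra.
From mathcomp Require Import all_classical all_reals all_analysis.
From mathcomp Require Import measurable_realfun ring lra.
Set Implicit Arguments. Unset Strict Implicit. Unset Printing Implicit Defensive.
Import Order.TTheory GRing.Theory Num.Theory.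
Import numFieldNormedType.Exports.
Local Open Scope classical_set_scope.
Local Open Scope ring_scope.

(** By a Lebesgue-differentiation argument it suffices to bound the maximal
function of the square averages of a Fourier transform on the circle. Linearise
it: if [r] is a measurable choice among finitely many radii, then integrating
the averages of [|g|] over the arc is pairing [|g|] with the density
[Kc r y] = (arc integral of the normalised indicator of the square of centre
[circ t] and half-side [r t]). By duality this pairing is controlled by the
Fourier transform of functions [a] with [|a| <= Kc r], for which one needs
[L^m] bounds with [m > 4], uniform in [r].

These come from the autocorrelation [Gam] of [Kc]. Parametrising the
differences of two points of the circle, and absorbing the averages by the L^2
bound of the Hardy-Littlewood maximal function, shows that the integral of
[Gam * min (Gam, M)] is [O (1 + ln (1 + M))]. Parseval applied to the indicator
of the level set [E] of [a^] bounds [lam^2 |E|] by the pairing of [Gam] with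
the transform of [1_E], whence [|E| = O (lam^-4 ln (1 / lam))].

The L^2 maximal bound is proved by a TT* argument halving the constant, so no
covering lemma is needed. The test functions used for density and duality are
products of a Gaussian with polynomials in the coordinates and logistic
functions: they are Schwartz, and the logistic functions converge to indicators
of half-planes, hence generate the Borel sets. *)

(** * The plane Lebesgue measure *)

(** The exponent 4 is the conjugate of 4/3: for [p < 4/3] the transform of the dual function [a] is
    needed in L^m with some m > 4. At m = 4 one would want [Gam] in L^2; but the autocorrelation of
    arclength itself behaves like 1/|x| near 0, which fails by a logarithm. Truncating at [M] makes
    this loss explicit, and it is harmless for m > 4. The map from (t, t') to the difference of the
    two circle points has Jacobian |sin (t - t')|, degenerate at equal and at antipodal points.
    Where it is small a uniform bound by a multiple of [M] is used, elsewhere a quadratic bound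
    whose constant is so small that the term is absorbed into the left-hand side. Each absorption
    needs a quantity known in advance to be finite: hence finitely many radii, the truncation, and
    level sets cut by boxes. As the bounds are uniform in the radii, a limit reaches all dyadic
    radii. The maximal function of the transform of [f - phi] is then small for test functions [phi]
    near [f], and the boundedness of the operator identifies the regularised value. *)

Section Inst.
Variable R : realType.
Notation T1 := (measurableTypeR R).
Let leb2_sigma_finite : sigma_finite [set: T1 * T1] (@leb2 R).
Proof.
pose I n : set T1 := `[- n%:R, n%:R]%classic.
have mI n : measurable (I n) by exact: measurable_itv.
exists (fun n => I n `*` I n).
  apply/esym/seteqP; split => // -[x y] _.
  exists (maxn (Num.truncn `|x|) (Num.truncn `|y|)).+1 => //; split; rewrite /I/= in_itv/= -ler_norml.
    by rewrite (le_trans (ltW (truncnS_gt _)))// ler_nat ltnS leq_maxl.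
  by rewrite (le_trans (ltW (truncnS_gt _)))// ler_nat ltnS leq_maxr.
move=> n; split; first exact: measurableX.
have := @product_measure1E _ _ T1 T1 R (@lebesgue_measure R) (@lebesgue_measure R) (I n) (I n) (mI n) (mI n).
rewrite /leb2 => ->; apply: lte_mul_pinfty => //.
- rewrite ge0_fin_numE//; have := @lebesgue_measure_itv R (`[- n%:R, n%:R]).
  by rewrite /I /= => ->; case: ifPn => // _; rewrite -EFinB ltry.
- have := @lebesgue_measure_itv R (`[- n%:R, n%:R]).
  by rewrite /I /= => ->; case: ifPn => // _; rewrite -EFinB ltry.
Qed.

HB.instance Definition _ := Measure.on (@leb2 R).
HB.instance Definition _ := Measure_isSigmaFinite.Build _ _ _ (@leb2 R) leb2_sigma_finite.
End Inst.

(** * One-sided change of variables for nonnegative integrands *)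

Section Transfer.
Context {R : realType} d1 d2 (S : measurableType d1) (T : measurableType d2).
Variables (m1 : {measure set S -> \bar R}) (m2 : {measure set T -> \bar R}).
Import HBNNSimple.

(** Substitutions serve for upper bounds or come in inverse pairs, so an inequality suffices. Both
    sides are monotone along simple functions approximating [F], and a simple function is a finite
    nonnegative combination of the indicators in the hypothesis. *)
Lemma integral_comp_le_measure (D : set S) (phi : S -> T) (w : S -> R)
    (F : T -> \bar R) :
  measurable D -> measurable_fun D phi -> measurable_fun D w ->
  (forall t, D t -> 0 <= w t) ->
  (forall B, measurable B ->
    (\int[m1]_(t in D) ((\1_B (phi t))%:E * (w t)%:E) <= m2 B)%E) ->
  measurable_fun setT F -> (forall x, (0 <= F x)%E) ->
  (\int[m1]_(t in D) (F (phi t) * (w t)%:E) <= \int[m2]_x F x)%E.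
Proof.
move=> mD mphi mw w0 H mF F0.
have mwE : measurable_fun D (fun t => (w t)%:E) by exact/measurable_EFinP.
pose g := nnsfun_approx measurableT mF.
have mgT n : measurable_fun setT (g n : T -> R) by exact: measurable_funPT.
have mg n : measurable_fun D (fun t => (g n (phi t))%:E * (w t)%:E)%E.
  apply: emeasurable_funM => //; apply/measurable_EFinP.
  exact: (measurableT_comp (mgT n) mphi).
have g0 n t : D t -> (0 <= (g n (phi t))%:E * (w t)%:E)%E.
  by move=> tab; rewrite mule_ge0// lee_fin ?fun_ge0// w0.
have gcvg x : (g n x)%:E @[n --> \oo] --> F x.
  by apply: cvg_nnsfun_approx => //.
have gnd x i j : (i <= j)%N -> g i x <= g j x.
  by move=> ij; exact/lefP/nd_nnsfun_approx.
have E : (\int[m1]_(t in D) (F (phi t) * (w t)%:E) =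
    limn (fun n => \int[m1]_(t in D) ((g n (phi t))%:E * (w t)%:E)))%E.
  rewrite -monotone_convergence//.
  - apply: eq_integral => t; rewrite inE => tab; apply/esym/cvg_lim => //.
    by apply: cvgeZr => //; exact: gcvg.
  - move=> t tab i j ij; apply: lee_wpmul2r; first by rewrite lee_fin w0.
    by rewrite lee_fin gnd.
rewrite E; apply: lime_le.
  apply: ereal_nondecreasing_is_cvgn => i j ij.
  apply: ge0_le_integral => //; first exact: g0.
  move=> t tab; apply: lee_wpmul2r; first by rewrite lee_fin w0.
  by rewrite lee_fin gnd.
near=> n.
apply: (@le_trans _ _ (\int[m2]_x (g n x)%:E)%E); last first.
  apply: ge0_le_integral => //.
  - by move=> x _; rewrite lee_fin.
  - exact/measurable_EFinP.
  - by move=> x _; rewrite /g nnsfun_approxE; apply: le_approx => // y _.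
rewrite integralT_nnsfun sintegralE.
rewrite (eq_integral (fun t => \sum_(y \in range (g n))
   (y%:E * ((\1_(g n @^-1` [set y]) (phi t))%:E * (w t)%:E)))%E); last first.
  move=> t; rewrite inE => tab; rewrite {1}(fimfunE (g n)) -fsumEFin//.
  rewrite ge0_mule_fsuml.
  - by apply: eq_fsbigr => y _; rewrite EFinM muleA.
  - by move=> y; rewrite lee_fin; case: (pselect (range (g n) y)) => [[x _ <-]|ny];
      [rewrite mulr_ge0//|rewrite indicE memNset ?mulr0// => gy; apply: ny; exists (phi t)].
have gE y : range (g n) y -> 0 <= y by case=> x _ <-.
have my y : measurable (g n @^-1` [set y]) by [].
have h0 y t : D t ->
    (0 <= y%:E * ((\1_(g n @^-1` [set y]) (phi t))%:E * (w t)%:E))%E.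
  move=> tab; have [/gE y0|ny] := pselect (range (g n) y).
    by rewrite mule_ge0 ?lee_fin// mulr_ge0// w0.
  rewrite indicE memNset ?mul0e ?mule0// => gy; apply: ny.
  by exists (phi t).
have mh y : measurable_fun D
    (fun t => ((\1_(g n @^-1` [set y]) (phi t))%:E * (w t)%:E)%E).
  apply: emeasurable_funM => //; apply/measurable_EFinP.
  exact: (measurableT_comp (measurable_indic (my y)) mphi).
rewrite ge0_integral_fsum//; last first.
  by move=> y; apply: emeasurable_funM.
apply: lee_fsum => // y /gE y0.
rewrite ge0_integralZl_EFin//; last first.
  by move=> t tab; rewrite mule_ge0// lee_fin w0.
by apply: lee_wpmul2l; [rewrite lee_fin|exact: H].
Unshelve. all: by end_near. Qed.

Lemma ge0_integral_bigcup_le (D : nat -> set S) (f : S -> \bar R) (c : \bar R) :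
  {homo D : n m / (n <= m)%N >-> n `<=` m} -> (forall n, measurable (D n)) ->
  (forall n, measurable_fun (D n) f) -> (forall n t, D n t -> (0 <= f t)%E) ->
  (forall n, (\int[m1]_(t in D n) f t <= c)%E) ->
  (\int[m1]_(t in \bigcup_n D n) f t <= c)%E.
Proof.
move=> ndD mD mf f0 H.
have := @ge0_nondecreasing_set_cvg_integral _ _ _ D f m1.
move=> /(_ _ mD mf f0)/cvg_lim <-//.
- apply: lime_le.
    apply: ereal_nondecreasing_is_cvgn => i j ij.
    apply: ge0_subset_integral => //; [exact: f0|exact: ndD].
  by near=> n; apply: H.
- by move=> i j ij; apply/subsetPset; exact: ndD.
Unshelve. all: by end_near. Qed.

End Transfer.

Section Substitution.
Context {R : realType}.
Notation mu := (@lebesgue_measure R).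
Implicit Types (phi dphi : R -> R) (a b c d : R) (F : R -> \bar R).

Lemma FTC_is_derive phi dphi a b : a <= b ->
  (forall t, t \in `[a, b] -> is_derive t 1 phi (dphi t)) ->
  {within `[a, b], continuous dphi} ->
  (\int[mu]_(x in `[a, b]) (dphi x)%:E = (phi b - phi a)%:E)%E.
Proof.
rewrite le_eqVlt => /predU1P[-> _ _|ab dp cd].
  by rewrite set_itv1 integral_set1 subrr.
have cp : {within `[a, b], continuous phi}.
  by apply: derivable_within_continuous => x xab; have [] := dp x xab.
have [ca cb] : phi x @[x --> a^'+] --> phi a /\ phi x @[x --> b^'-] --> phi b.
  by have /(continuous_within_itvP _ ab)[] := cp.
rewrite (@continuous_FTC2 _ dphi phi)// ?EFinB//.
- split => // x xab; have [] // := dp x _.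
  by move: xab; rewrite !in_itv/= => /andP[/ltW-> /ltW->].
- move=> x xab; rewrite derive1E; apply: derive_val.
  apply: dp.
  by move: xab; rewrite !in_itv/= => /andP[/ltW-> /ltW->].
Qed.

Lemma strict_mono_is_derive phi dphi a b :
  (forall t, t \in `[a, b] -> is_derive t 1 phi (dphi t)) ->
  (forall t, t \in `[a, b] -> 0 < dphi t) ->
  {in `[a, b] &, {mono phi : x y / x <= y}}.
Proof.
move=> dp d0; apply: le_mono_in => x y xab yab xy.
have cp : {within `[a, b], continuous phi}.
  by apply: derivable_within_continuous => z zab; have [] := dp z zab.
have sub z : z \in `]a, b[ -> z \in `[a, b].
  by rewrite !in_itv/= => /andP[/ltW-> /ltW->].
apply: (@gtr0_derive1_incr _ _ a b) => //.
- by move=> z /sub zab; have [] := dp z zab.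
- move=> z /sub zab; rewrite derive1E (_ : 'D_1 phi z = dphi z) ?d0//.
  by apply: derive_val; exact: dp.
- by rewrite (itvP xab).
- by rewrite (itvP yab).
Qed.

(** By the intermediate value theorem the preimage of the interval, clipped to the range of [phi],
    is again an interval, and the fundamental theorem of calculus evaluates the integral of [dphi]
    over it. If the clipped interval is empty the integrand vanishes. *)
Lemma integral_preimage_itv_le phi dphi a b c d : a <= b -> c <= d ->
  (forall t, t \in `[a, b] -> is_derive t 1 phi (dphi t)) ->
  (forall t, t \in `[a, b] -> 0 < dphi t) ->
  {within `[a, b], continuous dphi} ->
  (\int[mu]_(t in `[a, b]) ((\1_(`]c, d]) (phi t))%:E * (dphi t)%:E)
     <= (d - c)%:E)%E.
Proof.
move=> ab cd dp d0 cdp.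
have mp := strict_mono_is_derive dp d0.
have cp : {within `[a, b], continuous phi}.
  by apply: derivable_within_continuous => z zab; have [] := dp z zab.
have mdp : measurable_fun `[a, b] (fun t => (dphi t)%:E).
  apply/measurable_EFinP; exact: subspace_continuous_measurable_fun.
have mph : measurable_fun `[a, b] (fun t => (\1_(`]c, d]) (phi t) : R)%:E).
  apply/measurable_EFinP; apply: (@measurable_comp _ _ _ _ _ _ setT) => //.
  exact: subspace_continuous_measurable_fun.
have aab : a \in `[a, b] by rewrite in_itv/= lexx.
have bab : b \in `[a, b] by rewrite in_itv/= lexx ab.
have pab : phi a <= phi b by rewrite mp.
pose c' := Num.max c (phi a); pose d' := Num.min d (phi b).
have [cd'|cd'] := leP c' d'; last first.
  rewrite integral0_eq ?lee_fin ?subr_ge0// => t tab.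
  rewrite indicE memNset ?mul0e//= in_itv/= => /andP[ct td].
  have : c' <= d'.
    rewrite ge_max !le_min; rewrite /= in tab.
    by rewrite cd pab (le_trans (ltW ct)) ?(le_trans _ td)// mp// (itvP tab).
  by rewrite leNgt cd'.
have E := min_idPl pab. have E' := max_idPr pab.
have [al alab pal] : exists2 x, x \in `[a, b] & phi x = c'.
  apply: IVT => //; rewrite E E' /c' le_max lexx orbT/=.
  by rewrite (le_trans cd')// /d' ge_min lexx orbT.
have [be beab pbe] : exists2 x, x \in `[a, b] & phi x = d'.
  apply: IVT => //; rewrite E E' /d' ge_min lexx orbT andbT/=.
  by rewrite (le_trans _ cd')// /c' le_max lexx orbT.
have albe : al <= be by rewrite -mp// pal pbe.
have sub : `[al, be]%classic `<=` `[a, b]%classic.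
  by move=> x/=; rewrite !in_itv/= => /andP[h1 h2];
    rewrite (le_trans _ h1) ?(le_trans h2) ?(itvP alab) ?(itvP beab).
apply: (@le_trans _ _ (\int[mu]_(t in `[al, be]) (dphi t)%:E)%E).
  rewrite integral_mkcond [leRHS]integral_mkcond.
  apply: ge0_le_integral => //.
  - move=> t _; rewrite patchE; case: ifPn => //; rewrite inE => tab.
    by rewrite mule_ge0// lee_fin// ?ltW// d0.
  - apply/(measurable_restrictT _ _).1 => //; exact: emeasurable_funM.
  - apply/(measurable_restrictT _ _).1 => //; exact: measurable_funS mdp.
  move=> t _; rewrite !patchE; case: ifPn; rewrite ?inE => tab; last first.
    by case: ifPn => //; rewrite inE => /sub/d0 /ltW; rewrite lee_fin.
  rewrite indicE; have [|] := boolP (phi t \in _); last first.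
    rewrite mul0e => _; case: ifPn => //; rewrite inE => /sub/d0 /ltW.
    by rewrite lee_fin.
  rewrite inE/= in_itv/= => /andP[ct td]; rewrite mul1e mem_set//= in_itv/=.
  rewrite -[al <= t]mp// -[t <= be]mp// pal pbe /c' /d' ge_max le_min.
  by rewrite (ltW ct) td !mp// !(itvP tab).
have dab : {within `[al, be], continuous dphi} by exact: continuous_subspaceW cdp.
have dab2 : (forall t, t \in `[al, be] -> is_derive t 1 phi (dphi t)).
  by move=> t tab; apply: dp; apply: sub.
rewrite (FTC_is_derive albe dab2 dab).
by rewrite lee_fin pal pbe lerB// ?/c' ?/d' ?ge_min ?le_max lexx.
Qed.

(** This unfolds the construction of Lebesgue measure as an outer measure from half-open intervals,
    the form in which [integral_preimage_itv_le] can be summed. *)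
Lemma lebesgue_measure_cover (B : set R) (e : R) : (0 < e)%R ->
  (mu B < +oo)%E ->
  exists I : nat -> R * R, [/\ forall k, (I k).1 <= (I k).2,
    B `<=` \bigcup_k `](I k).1, (I k).2]%classic &
    (\sum_(0 <= k <oo) ((I k).2 - (I k).1)%:E <= mu B + e%:E)%E].
Proof.
move=> e0 Bfin.
have B0 : (mu B \is a fin_num)%E by rewrite ge0_fin_numE ?outer_measure_ge0.
have /= [_ [F [mF BF] <-] Fe] := lb_ereal_inf_adherent e0 B0.
have /choice[I HI] : forall k, exists x : R * R, x.1 <= x.2 /\
    F k = `]x.1, x.2]%classic.
  move=> k; have [[x y] _ /= <-] := mF k.
  have [xy|xy] := leP x y; first by exists (x, y).
  (* A pair with reversed endpoints denotes the empty interval and is replaced by a degenerate one,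
     so that all lengths are nonnegative. *)
  exists (x, x); split => //=; rewrite !set_itv_ge//= bnd_simp ?ltxx//.
  by rewrite -leNgt ltW.
exists I; split; first by move=> k; exact: (HI k).1.
  by move=> x /BF [k _]; rewrite (HI k).2 => ?; exists k.
rewrite (le_trans _ (ltW Fe))//; apply: lee_nneseries => [k _ _|k _].
  by rewrite lee_fin subr_ge0 (HI k).1.
rewrite (HI k).2 wlength_itv/= lte_fin; case: ltP => // h.
by rewrite lee_fin subr_le0.
Qed.

Lemma integral_preimage_le phi dphi a b (B : set R) : a <= b ->
  (forall t, t \in `[a, b] -> is_derive t 1 phi (dphi t)) ->
  (forall t, t \in `[a, b] -> 0 < dphi t) ->
  {within `[a, b], continuous dphi} -> measurable B ->
  (\int[mu]_(t in `[a, b]) ((\1_B (phi t))%:E * (dphi t)%:E) <= mu B)%E.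
Proof.
move=> ab dp d0 cdp mB.
have cp : {within `[a, b], continuous phi}.
  by apply: derivable_within_continuous => z zab; have [] := dp z zab.
have mphi : measurable_fun `[a, b] phi by exact: subspace_continuous_measurable_fun.
have mdp : measurable_fun `[a, b] (fun t => (dphi t)%:E).
  apply/measurable_EFinP; exact: subspace_continuous_measurable_fun.
have mph (C : set R) : measurable C ->
    measurable_fun `[a, b] (fun t => (\1_C (phi t) : R)%:E).
  move=> mC; apply/measurable_EFinP.
  by apply: (@measurable_comp _ _ _ _ _ _ setT).
have [->|] := eqVneq (mu B) +oo%E; first by rewrite leey.
rewrite -ltey => Bfin; apply/lee_addgt0Pr => e e0.
have [I [I12 BI Ie]] := lebesgue_measure_cover e0 Bfin.
apply: le_trans Ie.
pose h k t := ((\1_(`](I k).1, (I k).2]) (phi t))%:E * (dphi t)%:E)%E.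
apply: (@le_trans _ _ (\sum_(0 <= k <oo) \int[mu]_(t in `[a, b]) h k t)%E); last first.
  apply: lee_nneseries => [k _ _|k _]; last exact: integral_preimage_itv_le.
  by apply: integral_ge0 => t tab; rewrite mule_ge0// lee_fin ltW// d0.
rewrite -integral_nneseries//; last 2 first.
- by move=> k; apply: emeasurable_funM => //; exact: mph.
- by move=> k t tab; rewrite mule_ge0// lee_fin ltW// d0.
apply: ge0_le_integral => //.
- by move=> t tab; rewrite mule_ge0// lee_fin ltW// d0.
- by apply: emeasurable_funM => //; exact: mph.
- apply: ge0_emeasurable_sum => k //.
  + by move=> t tab _; rewrite mule_ge0// lee_fin ltW// d0.
  + by move=> _; apply: emeasurable_funM => //; exact: mph.
- move=> t tab.
  have h0 k : xpredT k -> (0 <= h k t)%E.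
    by move=> _; rewrite mule_ge0// lee_fin ltW// d0.
  rewrite indicE; have [|_] := boolP (_ \in _); last first.
    by rewrite mul0e; apply: nneseries_ge0 => k _ _; exact: h0.
  rewrite inE => /BI[k _ tk].
  apply: (@le_trans _ _ (h k t)); first by rewrite /h indicE mem_set.
  rewrite (nneseriesD1 (n := k))//.
  by apply: leeDl; apply: nneseries_ge0 => i _ _; exact: h0.
Qed.

Lemma integral_comp_le_itv phi dphi a b F : a <= b ->
  (forall t, t \in `[a, b] -> is_derive t 1 phi (dphi t)) ->
  (forall t, t \in `[a, b] -> 0 < dphi t) ->
  {within `[a, b], continuous dphi} ->
  measurable_fun setT F -> (forall x, (0 <= F x)%E) ->
  (\int[mu]_(t in `[a, b]) (F (phi t) * (dphi t)%:E) <= \int[mu]_x F x)%E.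
Proof.
move=> ab dp d0 cdp mF F0.
have cp : {within `[a, b], continuous phi}.
  by apply: derivable_within_continuous => z zab; have [] := dp z zab.
apply: (@integral_comp_le_measure R _ _ (measurableTypeR R) (measurableTypeR R) mu mu) => //.
- exact: subspace_continuous_measurable_fun.
- exact: subspace_continuous_measurable_fun.
- by move=> t /d0/ltW.
- by move=> B mB; exact: integral_preimage_le.
Qed.

Lemma integral_comp_le_bigcup phi dphi (a b : nat -> R) F :
  (forall n, a n <= b n) ->
  {homo (fun n => `[a n, b n]%classic) : n m / (n <= m)%N >-> n `<=` m} ->
  (forall n t, t \in `[a n, b n] -> is_derive t 1 phi (dphi t)) ->
  (forall n t, t \in `[a n, b n] -> 0 < dphi t) ->
  (forall n, {within `[a n, b n], continuous dphi}) ->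
  measurable_fun setT F -> (forall x, (0 <= F x)%E) ->
  (\int[mu]_(t in \bigcup_n `[a n, b n]%classic) (F (phi t) * (dphi t)%:E)
     <= \int[mu]_x F x)%E.
Proof.
move=> ab abn dp d0 cdp mF F0.
have mf n : measurable_fun `[a n, b n] (fun t => F (phi t) * (dphi t)%:E)%E.
  apply: emeasurable_funM.
  - apply: (@measurable_comp _ _ _ _ _ _ setT) => //.
    apply: subspace_continuous_measurable_fun => //.
    by apply: derivable_within_continuous => z zab; have [] := dp n z zab.
  - apply/measurable_EFinP; exact: subspace_continuous_measurable_fun.
apply: (@ge0_integral_bigcup_le R _ (measurableTypeR R) mu _ _ _ abn) => //.
- by move=> i t ti; rewrite mule_ge0// lee_fin ltW// (d0 i).
- by move=> n; apply: integral_comp_le_itv => //; exact: (d0 n).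
Qed.

(** The derivative is controlled inside the interval only: at the endpoints used below, [sin] has
    zero derivative and [tan] a pole. Compact subintervals exhaust the open one. *)
Lemma integral_comp_le_oo phi dphi a b F : a < b ->
  (forall t, a < t < b -> is_derive t 1 phi (dphi t)) ->
  (forall t, a < t < b -> 0 < dphi t) ->
  (forall t, a < t < b -> {for t, continuous dphi}) ->
  measurable_fun setT F -> (forall x, (0 <= F x)%E) ->
  (\int[mu]_(t in `]a, b[) (F (phi t) * (dphi t)%:E) <= \int[mu]_x F x)%E.
Proof.
move=> ab dp d0 cdp mF F0.
(* The denominator starts at 2 so that [a + e n <= b - e n] already holds for [n = 0]. *)
pose e n : R := (b - a) / n.+2%:R.
have ba : 0 < b - a by rewrite subr_gt0.
have e0 n : 0 < e n by rewrite divr_gt0.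
have e2 n : e n <= (b - a) / 2.
  by rewrite /e ler_pM2l// lef_pV2 ?posrE// ler_nat.
have sub n t : t \in `[a + e n, b - e n] -> a < t < b.
  rewrite in_itv/= => /andP[h1 h2]; apply/andP; split.
    by rewrite (lt_le_trans _ h1)// ltrDl.
  by rewrite (le_lt_trans h2)// ltrBlDr ltrDl.
rewrite (_ : `]a, b[%classic = \bigcup_n `[a + e n, b - e n]%classic); last first.
  apply/seteqP; split => t; last first.
    by case=> n _ /sub; rewrite /= in_itv.
  rewrite /= in_itv/= => /andP[at_ tb].
  pose d := Num.min (t - a) (b - t).
  have dpos : 0 < d by rewrite lt_min !subr_gt0 at_ tb.
  have [n] : exists n : nat, (b - a) / d < n%:R.
    by exists (Num.truncn ((b - a) / d)).+1; exact: truncnS_gt.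
  move=> nd; exists n => //=; have : e n <= d.
    rewrite /e ler_pdivrMr// mulrC -ler_pdivrMr// (le_trans (ltW nd))//.
    by rewrite ler_nat -addn2 leq_addr.
  by rewrite /d le_min in_itv/= => /andP[h1 h2]; apply/andP; split; lra.
apply: integral_comp_le_bigcup => //.
- by move=> n; have := e2 n; lra.
- move=> n m nm t /=; rewrite !in_itv/=.
  have : e m <= e n by rewrite /e ler_pM2l// lef_pV2 ?posrE// ler_nat.
  by move=> h /andP[h1 h2]; apply/andP; split; lra.
- by move=> n t /sub; exact: dp.
- by move=> n t /sub; exact: d0.
- move=> n; apply: continuous_in_subspaceT => t; rewrite inE => /sub; exact: cdp.
Qed.

Lemma integral_comp_le_T phi dphi F :
  (forall t : R, is_derive t 1 phi (dphi t)) ->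
  (forall t, 0 < dphi t) -> continuous dphi ->
  measurable_fun setT F -> (forall x, (0 <= F x)%E) ->
  (\int[mu]_t (F (phi t) * (dphi t)%:E) <= \int[mu]_x F x)%E.
Proof.
move=> dp d0 cdp mF F0.
have E : [set: R] = \bigcup_n `[- n%:R, n%:R : R]%classic.
  apply/esym/seteqP; split => // t _; exists (Num.truncn `|t|).+1 => //=.
  by rewrite in_itv/= -ler_norml ltW// truncnS_gt.
have := @integral_comp_le_bigcup phi dphi (fun n => - n%:R) (fun n => n%:R) F.
rewrite -E; apply => //.
- by move=> n; rewrite (@le_trans _ _ 0)// oppr_le0.
- move=> n m nm t /=; rewrite !in_itv/=.
  rewrite -!ler_norml => /le_trans; apply; by rewrite ler_nat.
- by move=> n; apply: continuous_subspaceT.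
Qed.

(** Reflection is its own inverse, so the one-sided rule applied to [F] and then to the reflected
    function gives equality. *)
Lemma integral_oppr F : measurable_fun setT F -> (forall x, (0 <= F x)%E) ->
  (\int[mu]_x F (- x)%R = \int[mu]_x F x)%E.
Proof.
move=> mF F0.
have H G : measurable_fun setT G -> (forall x, (0 <= G x)%E) ->
    (\int[mu]_x G (- x)%R <= \int[mu]_x G x)%E.
  move=> mG G0.
  have := @integral_comp_le_measure R _ _ (measurableTypeR R) (measurableTypeR R)
    mu mu setT (-%R : R -> R) (fun=> 1) G measurableT.
  under eq_integral do rewrite mule1.
  apply => //.
  move=> B mB; under eq_integral do rewrite mule1.
  have mNB : measurable ((-%R : R -> R) @^-1` B).
    rewrite -[X in measurable X]setTI; exact: oppr_measurable.
  have -> : (\int[mu]_x (\1_B (- x)%R)%:E = \int[mu]_x (\1_((-%R : R -> R) @^-1` B) x)%:E)%E.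
    by apply: eq_integral => x _; rewrite !indicE; congr (_%:R%:E); apply/idP/idP; rewrite !inE.
  rewrite (@integral_indic _ (measurableTypeR R) _ _ setT) ?setIT//.
  have := lebesgue_measureN mB; rewrite /pushforward => H; exact: (eq_ind_r (fun x => x <= _)%E (lexx _) H).
apply/eqP; rewrite eq_le H//=.
have := H (fun x => F (- x)).
under eq_integral do rewrite opprK.
by apply => //; apply: measurableT_comp => //; exact: oppr_measurable.
Qed.

Lemma integral_comp_le_oo_decr phi dphi a b F : a < b ->
  (forall t, a < t < b -> is_derive t 1 phi (- dphi t)) ->
  (forall t, a < t < b -> 0 < dphi t) ->
  (forall t, a < t < b -> {for t, continuous dphi}) ->
  measurable_fun setT F -> (forall x, (0 <= F x)%E) ->
  (\int[mu]_(t in `]a, b[) (F (phi t) * (dphi t)%:E) <= \int[mu]_x F x)%E.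
Proof.
move=> ab dp d0 cdp mF F0; rewrite -(integral_oppr mF)//.
have := @integral_comp_le_oo (- phi) dphi a b (F \o -%R) ab.
under eq_integral do rewrite /= !fctE opprK.
apply => //.
- move=> t tab; rewrite -[dphi t]opprK; apply: is_deriveN; exact: dp.
- exact: measurableT_comp.
- by move=> x /=.
Qed.

Lemma integral_affine_le (k c : R) F : 0 < k ->
  measurable_fun setT F -> (forall x, (0 <= F x)%E) ->
  (\int[mu]_x F (k * x + c)%R <= (k^-1)%:E * \int[mu]_x F x)%E.
Proof.
move=> k0 mF F0.
have := @integral_comp_le_T (fun x => k * x + c) (fun=> k) F.
move=> /(_ _ _ _ mF F0) H.
have mk : measurable_fun setT (fun x => F (k * x + c)).
  apply: measurableT_comp => //; apply: measurable_funD => //.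
have {}H : (k%:E * \int[mu]_x F (k * x + c)%R <= \int[mu]_x F x)%E.
  rewrite -(@ge0_integralZl_EFin _ (measurableTypeR R))//; last exact: ltW.
  under eq_integral do rewrite muleC.
  apply: H => //; last exact: cst_continuous.
  move=> t; apply: is_derive_eq.
  by rewrite addr0 /GRing.scale/= mulr1.
by rewrite lee_pdivlMl.
Qed.

Lemma integral_shift c F :
  measurable_fun setT F -> (forall x, (0 <= F x)%E) ->
  (\int[mu]_x F (x + c)%R = \int[mu]_x F x)%E.
Proof.
move=> mF F0.
have H c' G : measurable_fun setT G -> (forall x, (0 <= G x)%E) ->
    (\int[mu]_x G (x + c')%R <= \int[mu]_x G x)%E.
  move=> mG G0; have := integral_affine_le c' ltr01 mG G0.
  rewrite invr1 mul1e; under eq_integral do rewrite mul1r.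
  done.
apply/eqP; rewrite eq_le H//=.
have := H (- c) (fun x => F (x + c)); under eq_integral do rewrite subrK.
by apply => //; apply: measurableT_comp => //; exact: measurable_funD.
Qed.

End Substitution.

(** * Linearised maximal functions *)

Lemma measurable_invr {R : realType} : measurable_fun setT (fun x : R => x^-1).
Proof.
rewrite (_ : setT = [set~ 0] `|` [set (0 : R)]); last first.
  by apply/seteqP; split => // x _; have [->|/eqP] := eqVneq x 0; [right|left].
apply/measurable_funU => //; first exact: measurableC.
split; last exact: measurable_fun_set1.
apply: open_continuous_measurable_fun; first exact/closed_openC/accessible_closed_set1/hausdorff_accessible.
by move=> x; rewrite inE/= => /eqP x0; exact: inv_continuous.
Qed.

(** Measurability by recursion on the head symbol. The clauses with hypotheses apply an assumed
    measurable [h], of one variable or jointly of two, to composed arguments. *)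
Ltac mfun :=
  match goal with
  | H : ?P |- ?P => exact: H
  | |- measurable_fun _ (fun x => (@?f x)%:E) => apply/measurable_EFinP; mfun
  | |- measurable_fun _ (fun _ => ?c) => exact: measurable_cst
  | |- measurable_fun _ (@sin _) => apply: continuous_measurable_fun; exact: continuous_sin
  | |- measurable_fun _ (@cos _) => apply: continuous_measurable_fun; exact: continuous_cos
  | |- measurable_fun _ Num.norm => exact: normr_measurable
  | |- measurable_fun _ fst => exact: measurable_fst
  | |- measurable_fun _ snd => exact: measurable_snd
  | |- measurable_fun _ (fun x => x) => exact: measurable_id
  | |- measurable_fun _ (fun x => (@?f x * @?g x)%E) =>
      apply: (@emeasurable_funM _ _ _ _ f g); mfun
  | |- measurable_fun _ (fun x => (@?f x + @?g x)%E) =>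
      apply: (@emeasurable_funD _ _ _ _ f g); mfun
  | |- measurable_fun _ (fun x => (@?f x - @?g x)%R) =>
      apply: (@measurable_funB _ _ _ _ f g); mfun
  | |- measurable_fun _ (fun x => (@?f x * @?g x)%R) =>
      apply: (@measurable_funM _ _ _ _ f g); mfun
  | |- measurable_fun _ (fun x => (@?f x + @?g x)%R) =>
      apply: (@measurable_funD _ _ _ _ f g); mfun
  | |- measurable_fun _ (fun x => (- (@?f x))%R) =>
      apply: (@measurable_funN _ _ _ _ f); mfun
  | |- measurable_fun _ (fun x => (@?f x ^+ ?n)%R) =>
      apply: (@measurable_funX _ _ _ _ f n); mfun
  | |- measurable_fun _ (fun x => ((@?f x)^-1)%R) =>
      apply: (measurableT_comp measurable_invr); mfun
  | |- measurable_fun _ (fun x => (Num.norm (@?f x))%R) =>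
      apply: (measurableT_comp (@normr_measurable _ setT)); mfun
  | |- measurable_fun _ (fun x => cos (@?f x)) =>
      apply: (@measurableT_comp _ _ _ _ _ _ cos _ f);
      [apply: continuous_measurable_fun; exact: continuous_cos|mfun]
  | |- measurable_fun _ (fun x => sin (@?f x)) =>
      apply: (@measurableT_comp _ _ _ _ _ _ sin _ f);
      [apply: continuous_measurable_fun; exact: continuous_sin|mfun]
  | |- measurable_fun _ (fun x => (@?f x, @?g x)) =>
      apply: (@measurable_fun_pair _ _ _ _ _ _ f g); mfun
  | |- measurable_fun _ (fun x => fst (@?f x)) =>
      apply: (@measurableT_comp _ _ _ _ _ _ fst _ f); [exact: measurable_fst|mfun]
  | |- measurable_fun _ (fun x => snd (@?f x)) =>
      apply: (@measurableT_comp _ _ _ _ _ _ snd _ f); [exact: measurable_snd|mfun]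
  | H : measurable_fun _ (fun p => ?h (fst p) (snd p))
      |- measurable_fun _ (fun x => ?h (@?f x) (@?g x)) =>
      refine (@measurableT_comp _ _ _ _ _ _ _ _ (fun x => (f x, g x)) H _); mfun
  | H : measurable_fun _ ?h |- measurable_fun _ (fun x => ?h (@?f x)) =>
      apply: (@measurableT_comp _ _ _ _ _ _ h _ f); [exact: H|mfun]
  | |- _ => try done
  end.

Section Tonelli.
Local Open Scope ereal_scope.
Context {R : realType} d1 d2 (X : measurableType d1) (Y : measurableType d2).
Variables (m1 : {sigma_finite_measure set X -> \bar R})
  (m2 : {sigma_finite_measure set Y -> \bar R}).

Lemma tonelli (f : X -> Y -> \bar R) :
  measurable_fun setT (fun p : X * Y => f p.1 p.2) -> (forall x y, 0 <= f x y) ->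
  \int[m1]_x \int[m2]_y f x y = \int[m2]_y \int[m1]_x f x y.
Proof.
move=> mf f0; exact: (@fubini_tonelli _ _ _ _ _ m1 m2 (fun p => f p.1 p.2)).
Qed.

Lemma measurable_integral (f : X -> Y -> \bar R) :
  measurable_fun setT (fun p : X * Y => f p.1 p.2) -> (forall x y, 0 <= f x y) ->
  measurable_fun setT (fun x => \int[m2]_y f x y).
Proof.
move=> mf f0.
exact: (@measurable_fun_fubini_tonelli_F _ _ _ _ _ m2 (fun p => f p.1 p.2)).
Qed.

End Tonelli.

Section ERealFacts.
Context {R : realType}.
Local Open Scope ereal_scope.

Lemma amgm_ereal (e : R) (x y : \bar R) : (0 < e)%R -> 0 <= x -> 0 <= y ->
  2%:E * (x * y) <= e%:E * (x * x) + e^-1%:E * (y * y).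
Proof.
move=> e0; have e1 : (0 < e^-1)%R by rewrite invr_gt0.
case: x => [x| |]; case: y => [y| |] => //= x0 y0.
- rewrite -!EFinM -EFinD lee_fin -subr_ge0.
  have -> : (e * (x * x) + e^-1 * (y * y) - 2 * (x * y) = e^-1 * (e * x - y) ^+ 2)%R.
    by field; rewrite gt_eqF.
  by rewrite mulr_ge0 ?sqr_ge0 ?ltW.
- by rewrite [X in _ + X](_ : _ = +oo) ?addey ?leey// mulyy gt0_muley ?lte_fin.
- by rewrite [X in X + _](_ : _ = +oo) ?addye ?leey// mulyy gt0_muley ?lte_fin.
- by rewrite [X in X + _](_ : _ = +oo) ?addye ?leey// mulyy gt0_muley ?lte_fin.
Qed.

Lemma integral_amgm d (G : measurableType d) (m : {measure set G -> \bar R})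
    (a b : G -> \bar R) (e : R) : (0 < e)%R ->
  measurable_fun setT a -> (forall y, 0 <= a y) ->
  measurable_fun setT b -> (forall y, 0 <= b y) ->
  2%:E * \int[m]_y (a y * b y) <= e%:E * \int[m]_y (a y * a y) +
    e^-1%:E * \int[m]_y (b y * b y).
Proof.
move=> e0 ma a0 mb b0.
have aa0 y : 0 <= a y * a y by exact: mule_ge0.
have bb0 y : 0 <= b y * b y by exact: mule_ge0.
have ab0 y : 0 <= a y * b y by exact: mule_ge0.
have maa : measurable_fun setT (fun y => a y * a y) by exact: emeasurable_funM.
have mbb : measurable_fun setT (fun y => b y * b y) by exact: emeasurable_funM.
have mab : measurable_fun setT (fun y => a y * b y) by exact: emeasurable_funM.
have e1 : (0 <= e)%R by exact: ltW.
have ei0 : (0 <= e^-1)%R by rewrite invr_ge0.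
rewrite -!ge0_integralZl_EFin// -ge0_integralD//; first last.
- exact: measurable_funeM.
- by move=> y _; rewrite mule_ge0.
- exact: measurable_funeM.
- by move=> y _; rewrite mule_ge0.
apply: ge0_le_integral => //.
- by move=> y _; rewrite mule_ge0.
- exact: measurable_funeM.
- by apply: emeasurable_funD; exact: measurable_funeM.
by move=> y _; exact: amgm_ereal.
Qed.

End ERealFacts.

(** With h the average of g, the letters stand for the integrals of h^2, of g^2, of (coavg h)^2, of
    h times its average over doubled radii, and of the square of that average. The last three
    inequalities give A <= theta S with theta = 16 (64 + c / 64), so the first yields 2 S <= theta
    G2 + S. Finiteness of S allows cancellation, and theta <= c / 2 holds exactly when c >= 4096,
    which is the origin of [64 * 64]. *)
Lemma maximal_bound_algebra {R : realType} (c : R) (S G2 A B C : \bar R) :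
  64 * 64 <= c -> (0 <= S -> S < +oo -> 0 <= G2 -> G2 < +oo ->
  0 <= A -> 0 <= B -> 0 <= C ->
  2%:E * S <= (16 * (64 + c / 64))%:E * G2 + (16 * (64 + c / 64))^-1%:E * A ->
  A <= 32%:E * B -> 2%:E * B <= 64%:E * S + 64^-1%:E * C -> C <= c%:E * S ->
  S <= (c / 2)%:E * G2)%E.
Proof.
move=> hc.
have c0 : (0 < c)%R by apply: lt_le_trans hc; rewrite mulr_gt0.
have th0 : (0 < 16 * (64 + c / 64))%R by rewrite mulr_gt0// addr_gt0// divr_gt0.
case: S => [S| |]//; case: G2 => [G2| |]// S0 _ G0 _ A0 B0 C0 + + + H2.
case: C C0 H2 => [C| |]// C0 H2.
case: B B0 => [B| |]// B0; last first.
  by move=> _ _; rewrite gt0_muley ?lte_fin// leye_eq.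
case: A A0 => [A| |]// A0 K1 K2 K3.
rewrite !lee_fin in S0 G0 A0 B0 C0.
rewrite -!EFinM -?EFinD !lee_fin in K1 K2 K3 H2 *.
have e1 : (A <= 16 * (64 + c / 64) * S)%R.
  by apply: le_trans K2 _; nra.
have e2 : ((16 * (64 + c / 64))^-1 * A <= S)%R.
  by rewrite mulrC ler_pdivrMr// mulrC.
have e3 : (S <= 16 * (64 + c / 64) * G2)%R by lra.
by apply: le_trans e3 _; apply: ler_wpM2r => //; lra.
Qed.

Section MaximalFunction.
Local Open Scope ereal_scope.
Context {R : realType} d (G : measurableType d).
Variables (m : {sigma_finite_measure set G -> \bar R}) (near : R -> G -> G -> bool).
Hypothesis near_measurable :
  measurable_fun setT (fun p : R * (G * G) => near p.1 p.2.1 p.2.2).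
Hypothesis near_sym : forall r x y, near r x y = near r y x.
Hypothesis near_triangle : forall r s x y z,
  near r x y -> near s y z -> near (r + s) x z.
Hypothesis near_mono : forall r s x y, (r <= s)%R -> near r x y -> near s x y.
Hypothesis near_growth : forall r x, (0 < r)%R ->
  \int[m]_y ((near r x y)%:R : R)%:E <= (4 * r ^+ 2)%:E.

Implicit Types (r : G -> R) (g h : G -> \bar R).

(** Normalised by a power of the radius instead of the measure of the neighbourhood; by the growth
    hypothesis the mass of [nker r z] is at most 4. *)
Definition nker (r : G -> R) (z y : G) : R := ((r z) ^- 2 * (near (r z) z y)%:R)%R.

Definition avg (r : G -> R) (g : G -> \bar R) (z : G) : \bar R :=
  \int[m]_y ((nker r z y)%:E * g y).

Definition coavg (r : G -> R) (h : G -> \bar R) (y : G) : \bar R :=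
  \int[m]_z ((nker r z y)%:E * h z).

Lemma nker_ge0 r z y : (0 <= nker r z y)%R.
Proof. by rewrite /nker mulr_ge0// invr_ge0 sqr_ge0. Qed.

Lemma measurable_nker r : measurable_fun setT r ->
  measurable_fun setT (fun p : G * G => nker r p.1 p.2).
Proof.
move=> mr; rewrite /nker; apply: measurable_funM.
  apply: (@measurableT_comp _ _ _ _ _ _ (fun x : R => x ^- 2)%R _ (fun p => r p.1)); last mfun.
  have -> : (fun x : R => x ^- 2)%R = (fun x : R => (x^-1) ^+ 2)%R.
    by apply/funext => x; rewrite exprVn.
  by apply: measurable_funX; exact: measurable_invr.
apply: (@measurableT_comp _ _ _ _ _ _ (fun b : bool => b%:R : R) _
  (fun p : G * G => near (r p.1) p.1 p.2)) => //.
apply: (@measurableT_comp _ _ _ _ _ _ (fun p : R * (G * G) => near p.1 p.2.1 p.2.2) _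
  (fun p : G * G => (r p.1, p))) => //.
mfun.
Qed.

Lemma avg_ge0 r g z : (forall y, 0 <= g y) -> 0 <= avg r g z.
Proof.
by move=> g0; apply: integral_ge0 => y _; rewrite mule_ge0// lee_fin nker_ge0.
Qed.

Lemma coavg_ge0 r g z : (forall y, 0 <= g y) -> 0 <= coavg r g z.
Proof.
by move=> g0; apply: integral_ge0 => y _; rewrite mule_ge0// lee_fin nker_ge0.
Qed.

Lemma measurable_avg r g : measurable_fun setT r -> measurable_fun setT g ->
  (forall y, 0 <= g y) -> measurable_fun setT (avg r g).
Proof.
move=> /measurable_nker mk mg g0; apply: measurable_integral.
- by apply: emeasurable_funM; [exact/measurable_EFinP|mfun].
- by move=> x y; rewrite mule_ge0// lee_fin nker_ge0.
Qed.

Lemma measurable_coavg r g : measurable_fun setT r -> measurable_fun setT g ->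
  (forall y, 0 <= g y) -> measurable_fun setT (coavg r g).
Proof.
move=> /measurable_nker mk mg g0.
apply: (@measurable_integral R _ _ _ _ m (fun y z => (nker r z y)%:E * g z)).
- apply: emeasurable_funM; last mfun.
  apply/measurable_EFinP.
  apply: (@measurableT_comp _ _ _ _ _ _ (fun p : G * G => nker r p.1 p.2) _
    (fun p : G * G => (p.2, p.1))) => //; mfun.
- by move=> x y; rewrite mule_ge0// lee_fin nker_ge0.
Qed.

Lemma avg_coavg r g h : measurable_fun setT r ->
  measurable_fun setT g -> (forall y, 0 <= g y) ->
  measurable_fun setT h -> (forall y, 0 <= h y) ->
  \int[m]_z (h z * avg r g z) = \int[m]_y (g y * coavg r h y).
Proof.
move=> mr mg g0 mh h0; have mk := measurable_nker mr.
have mkz z : measurable_fun setT (fun y => (nker r z y)%:E * g y).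
  apply: emeasurable_funM => //; apply/measurable_EFinP.
  exact: (@measurable_fun_pair2 _ _ _ _ _ _ (fun p => nker r p.1 p.2)).
have mky y : measurable_fun setT (fun z => (nker r z y)%:E * h z).
  apply: emeasurable_funM => //; apply/measurable_EFinP.
  exact: (@measurable_fun_pair1 _ _ _ _ _ _ (fun p => nker r p.1 p.2)).
have E1 z : h z * avg r g z = \int[m]_y (h z * ((nker r z y)%:E * g y)).
  by rewrite ge0_integralZl// => y _; rewrite mule_ge0// lee_fin nker_ge0.
under eq_integral do rewrite E1.
rewrite tonelli//.
- apply: eq_integral => y _; rewrite -ge0_integralZl//.
  + by apply: eq_integral => z _; rewrite muleC (muleC _ (g y)) -muleA.
  + by move=> z _; rewrite mule_ge0// lee_fin nker_ge0.
- apply: emeasurable_funM; first mfun.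
  by apply: emeasurable_funM; [exact/measurable_EFinP|mfun].
- by move=> x y; rewrite !mule_ge0// lee_fin nker_ge0.
Qed.

Lemma measurable_nker2 r z : measurable_fun setT r ->
  measurable_fun setT (nker r z).
Proof.
move=> /measurable_nker.
exact: (@measurable_fun_pair2 _ _ _ _ _ _ (fun p => nker r p.1 p.2)).
Qed.

Lemma integral_nker r z : measurable_fun setT r -> (0 < r z)%R ->
  \int[m]_y (nker r z y)%:E <= 4%:E.
Proof.
move=> mr rz0; have mk := measurable_nker2 z mr.
have c0 : (0 < r z ^- 2)%R by rewrite invr_gt0 exprn_gt0.
have mn : measurable_fun setT (fun y => ((near (r z) z y)%:R : R)%:E).
  have -> : (fun y => ((near (r z) z y)%:R : R)%:E) =
      (fun y => (r z ^+ 2 * nker r z y)%:E).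
    apply/funext => y; rewrite /nker mulrA mulfV ?mul1r// gt_eqF//.
    exact: exprn_gt0.
  by apply/measurable_EFinP; apply: measurable_funM.
rewrite /nker; under eq_integral do rewrite EFinM.
rewrite ge0_integralZl_EFin//; last exact: ltW.
apply: (@le_trans _ _ ((r z ^- 2)%:E * (4 * r z ^+ 2)%:E)).
  by apply: lee_wpmul2l; [rewrite lee_fin ltW|exact: near_growth].
by rewrite -EFinM lee_fin mulrCA mulVf ?mulr1// gt_eqF// exprn_gt0.
Qed.

Definition dbl (r : G -> R) : G -> R := fun z => (2 * r z)%R.

(** If both kernels are nonzero at [y], the triangle property puts [z'] within [2 * r z] of [z].
    Then [r z ^- 2 = 4 * (2 * r z) ^- 2] bounds the kernel of larger radius, and the other one has
    mass at most 4. *)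
Lemma integral_nkerM_le_half r z z' : measurable_fun setT r ->
  (0 < r z')%R -> (r z' <= r z)%R ->
  \int[m]_y (nker r z y * nker r z' y)%:E <= (16 * nker (dbl r) z z')%:E.
Proof.
move=> mr rz' rzz'; have rz : (0 < r z)%R by exact: lt_le_trans rzz'.
have mk := measurable_nker2 z mr; have mk' := measurable_nker2 z' mr.
have n0 := nker_ge0 (dbl r) z z'.
apply: (@le_trans _ _ (\int[m]_y ((4 * nker (dbl r) z z')%:E * (nker r z' y)%:E))).
  apply: ge0_le_integral => //.
  - by move=> y _; rewrite lee_fin mulr_ge0 ?nker_ge0.
  - by apply/measurable_EFinP; apply: measurable_funM.
  - by apply: emeasurable_funM => //; exact/measurable_EFinP.
  move=> y _; rewrite -EFinM lee_fin.
  have [ny'|ny'] := boolP (near (r z') z' y); last first.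
    by rewrite {2 4}/nker (negbTE ny') !mulr0.
  apply: ler_wpM2r; first exact: nker_ge0.
  rewrite /nker /dbl; have [ny|ny] := boolP (near (r z) z y); last first.
    by rewrite mulr0 !mulr_ge0// invr_ge0 exprn_ge0// mulr_ge0// ltW.
  have -> : near (2 * r z) z z'.
    rewrite mulr_natl mulr2n; apply: near_triangle ny _.
    by rewrite near_sym; exact: near_mono ny'.
  rewrite !mulr1 (_ : 4 * (2 * r z) ^- 2 = r z ^- 2)%R//.
  by field; rewrite gt_eqF.
rewrite ge0_integralZl_EFin//.
- apply: (@le_trans _ _ ((4 * nker (dbl r) z z')%:E * 4%:E)).
    by apply: lee_wpmul2l; [rewrite lee_fin mulr_ge0|exact: integral_nker].
  by rewrite -EFinM lee_fin mulrAC -natrM.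
- by move=> y _; rewrite lee_fin nker_ge0.
- exact/measurable_EFinP.
- by rewrite mulr_ge0.
Qed.

Lemma integral_nkerM_le r z z' : measurable_fun setT r ->
  (0 < r z)%R -> (0 < r z')%R ->
  \int[m]_y (nker r z y * nker r z' y)%:E <=
  (16 * (nker (dbl r) z z' + nker (dbl r) z' z))%:E.
Proof.
move=> mr rz rz'; have [h|/ltW h] := leP (r z') (r z).
  apply: le_trans (integral_nkerM_le_half mr rz' h) _.
  by rewrite lee_fin ler_pM2l// lerDl nker_ge0.
under eq_integral do rewrite mulrC.
apply: le_trans (integral_nkerM_le_half mr rz h) _.
by rewrite lee_fin ler_pM2l// lerDr nker_ge0.
Qed.

Lemma measurable_dbl r : measurable_fun setT r -> measurable_fun setT (dbl r).
Proof. by move=> mr; apply: measurable_funM. Qed.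

(** Writing T for the averaging operator, T T* is dominated by 16 times the sum of the same operator
    with doubled radii and its adjoint; whichever of [z], [z'] has the larger radius decides which
    of the two occurs. *)
Lemma avg_coavg_le r h z : measurable_fun setT r -> (forall z, (0 < r z)%R) ->
  measurable_fun setT h -> (forall y, 0 <= h y) ->
  avg r (coavg r h) z <= 16%:E * (avg (dbl r) h z + coavg (dbl r) h z).
Proof.
move=> mr r0 mh h0; have mk := measurable_nker mr.
have mr2 := measurable_dbl mr; have mk2 := measurable_nker mr2.
have k0 r' a b : 0 <= (nker r' a b)%:E by rewrite lee_fin nker_ge0.
have mky y : measurable_fun setT (fun z => (nker r z y)%:E * h z).
  apply: emeasurable_funM => //; apply/measurable_EFinP.
  exact: (@measurable_fun_pair1 _ _ _ _ _ _ (fun p => nker r p.1 p.2)).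
have mkyE y : measurable_fun setT (fun z => (nker r z y)%:E).
  apply/measurable_EFinP.
  exact: (@measurable_fun_pair1 _ _ _ _ _ _ (fun p => nker r p.1 p.2)).
rewrite /avg /coavg.
rewrite (eq_integral (fun y => \int[m]_z' ((nker r z y)%:E * ((nker r z' y)%:E * h z')))); last first.
  by move=> y _; rewrite ge0_integralZl// => z' _; rewrite mule_ge0.
rewrite (@tonelli R _ _ _ _ m m (fun y z' => (nker r z y)%:E * ((nker r z' y)%:E * h z')));
  last 2 first.
- apply: emeasurable_funM.
    apply/measurable_EFinP.
    apply: (@measurableT_comp _ _ _ _ _ _ (nker r z) _ fst) => //.
    exact: measurable_nker2.
  apply: emeasurable_funM; last mfun.
  apply/measurable_EFinP.
  apply: (@measurableT_comp _ _ _ _ _ _ (fun p : G * G => nker r p.1 p.2) _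
    (fun p : G * G => (p.2, p.1))) => //; mfun.
- by move=> y z'; rewrite !mule_ge0.
rewrite (eq_integral (fun z' => h z' * \int[m]_y (nker r z y * nker r z' y)%:E)); last first.
  move=> z' _; rewrite -ge0_integralZl//.
  - by apply: eq_integral => y _; rewrite EFinM muleA muleC.
  - by apply/measurable_EFinP; apply: measurable_funM; exact: measurable_nker2.
  - by move=> y _; rewrite EFinM mule_ge0.
have mA : measurable_fun setT (fun z' => (nker (dbl r) z z')%:E * h z').
  apply: emeasurable_funM => //; apply/measurable_EFinP; exact: measurable_nker2.
have mB : measurable_fun setT (fun z' => (nker (dbl r) z' z)%:E * h z').
  apply: emeasurable_funM => //; apply/measurable_EFinP.
  exact: (@measurable_fun_pair1 _ _ _ _ _ _ (fun p => nker (dbl r) p.1 p.2)).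
rewrite -ge0_integralD//; last 2 first.
- by move=> y _; rewrite mule_ge0.
- by move=> y _; rewrite mule_ge0.
rewrite -ge0_integralZl//; last 2 first.
- by apply: emeasurable_funD.
- by move=> y _; rewrite adde_ge0// mule_ge0.
apply: ge0_le_integral => //.
- by move=> z' _; rewrite mule_ge0// integral_ge0// => y _; rewrite EFinM mule_ge0.
- apply: emeasurable_funM => //.
  apply: (@measurable_integral R _ _ _ _ m (fun z' y => (nker r z y * nker r z' y)%:E)).
    apply/measurable_EFinP; apply: measurable_funM => //.
    apply: (@measurableT_comp _ _ _ _ _ _ (nker r z) _ snd) => //.
    exact: measurable_nker2.
  by move=> x y; rewrite EFinM mule_ge0.
- by apply: emeasurable_funM => //; apply: emeasurable_funD.
move=> z' _; rewrite -ge0_muleDl// muleA [leLHS]muleC.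
apply: lee_wpmul2r => //; rewrite -EFinD -EFinM.
exact: integral_nkerM_le.
Qed.

(** The squared norm of T* h is the pairing of h with T T* h, and the two terms of [avg_coavg_le]
    contribute equally because they are adjoint to each other. *)
Lemma coavg_sq_le r h : measurable_fun setT r -> (forall z, (0 < r z)%R) ->
  measurable_fun setT h -> (forall y, 0 <= h y) ->
  \int[m]_y (coavg r h y * coavg r h y) <=
  32%:E * \int[m]_z (h z * avg (dbl r) h z).
Proof.
move=> mr r0 mh h0; have mr2 := measurable_dbl mr.
have mc := measurable_coavg mr mh h0; have c0 y := coavg_ge0 r y h0.
have ma2 := measurable_avg mr2 mh h0; have mc2 := measurable_coavg mr2 mh h0.
have a20 y := avg_ge0 (dbl r) y h0; have c20 y := coavg_ge0 (dbl r) y h0.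
rewrite -avg_coavg//.
apply: (@le_trans _ _ (\int[m]_z (16%:E * (h z * avg (dbl r) h z + h z * coavg (dbl r) h z)))).
  apply: ge0_le_integral => //.
  - by move=> z _; rewrite mule_ge0// avg_ge0.
  - by apply: emeasurable_funM => //; exact: measurable_avg.
  - by apply: emeasurable_funM => //; apply: emeasurable_funD; apply: emeasurable_funM.
  move=> z _; rewrite -ge0_muleDr// muleCA.
  by apply: lee_wpmul2l => //; exact: avg_coavg_le.
rewrite ge0_integralZl//; last 2 first.
- by apply: emeasurable_funD; apply: emeasurable_funM.
- by move=> z _; rewrite adde_ge0// mule_ge0.
rewrite ge0_integralD//; last 4 first.
- by move=> z _; rewrite mule_ge0.
- by apply: emeasurable_funM.
- by move=> z _; rewrite mule_ge0.
- by apply: emeasurable_funM.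
rewrite -(avg_coavg mr2 mh h0 mh h0).
have I0 : 0 <= \int[m]_z (h z * avg (dbl r) h z).
  by apply: integral_ge0 => z _; exact: mule_ge0.
rewrite ge0_muleDr// -ge0_muleDl// -EFinD.
by rewrite (_ : 16 + 16 = 32 :> R)%R// -natrD.
Qed.

(** Quantified over all lists of [n] radii, so that the doubled radii produced by T T* are covered
    by the same constant. *)
Definition maximal_bound (n : nat) (c : R) := forall (r : G -> R) (s : seq R) g,
  measurable_fun setT r -> size s = n -> (forall x, x \in s -> (0 < x)%R) ->
  (forall z, r z \in s) -> measurable_fun setT g -> (forall y, 0 <= g y) ->
  \int[m]_z (avg r g z * avg r g z) <= c%:E * \int[m]_y (g y * g y).

Lemma maximal_boundW n (c c' : R) : (c <= c')%R ->
  maximal_bound n c -> maximal_bound n c'.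
Proof.
move=> cc' H r s g mr ss s0 rs mg g0; apply: le_trans (H r s g mr ss s0 rs mg g0) _.
by apply: lee_wpmul2r; [apply: integral_ge0 => y _; exact: mule_ge0|rewrite lee_fin].
Qed.

Lemma maximal_bound_half n (c : R) : (64 * 64 <= c)%R ->
  maximal_bound n c -> maximal_bound n (c / 2).
Proof.
move=> hc H r s g mr ss s0 rs mg g0.
have c0 : (0 < c)%R by apply: lt_le_trans hc; rewrite mulr_gt0.
have r0 z : (0 < r z)%R by exact: s0.
have mr2 := measurable_dbl mr.
set h := avg r g.
have mh : measurable_fun setT h := measurable_avg mr mg g0.
have h0 y : 0 <= h y := avg_ge0 r y g0.
have mc := measurable_coavg mr mh h0; have cc0 y := coavg_ge0 r y h0.
have ma2 := measurable_avg mr2 mh h0; have a20 y := avg_ge0 (dbl r) y h0.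
(* The hypothesis is used twice: for [r], to know that the left-hand side is finite, and for the
   doubled radii. *)
have H1 := H r s g mr ss s0 rs mg g0.
have H2 : \int[m]_z (avg (dbl r) h z * avg (dbl r) h z) <= c%:E * \int[m]_z (h z * h z).
  apply: (H (dbl r) [seq (2 * x)%R | x <- s]) => //; first by rewrite size_map.
    by move=> _ /mapP[x /s0 x0 ->]; rewrite mulr_gt0.
  by move=> z; apply: map_f; exact: rs.
have [Goo|] := eqVneq (\int[m]_y (g y * g y)) +oo.
  by rewrite Goo gt0_muley ?leey// lte_fin divr_gt0.
rewrite -ltey => Gfin.
have G0 : 0 <= \int[m]_y (g y * g y) by apply: integral_ge0 => y _; exact: mule_ge0.
have S0 : 0 <= \int[m]_y (h y * h y) by apply: integral_ge0 => y _; exact: mule_ge0.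
have Sfin : \int[m]_y (h y * h y) < +oo.
  by apply: le_lt_trans H1 _; apply: lte_mul_pinfty => //; rewrite lee_fin ltW.
have th0 : (0 < 16 * (64 + c / 64))%R by rewrite mulr_gt0// addr_gt0// divr_gt0.
have K1 : 2%:E * \int[m]_y (h y * h y) <= (16 * (64 + c / 64))%:E * \int[m]_y (g y * g y)
   + (16 * (64 + c / 64))^-1%:E * \int[m]_y (coavg r h y * coavg r h y).
  by rewrite [X in 2%:E * X](avg_coavg mr mg g0 mh h0); exact: integral_amgm.
have K2 := coavg_sq_le mr r0 mh h0.
have K3 : 2%:E * \int[m]_z (h z * avg (dbl r) h z) <=
    64%:E * \int[m]_y (h y * h y) + 64^-1%:E * \int[m]_y (avg (dbl r) h y * avg (dbl r) h y).
  exact: integral_amgm.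
have K4 : 0 <= \int[m]_y (coavg r h y * coavg r h y).
  by apply: integral_ge0 => y _; exact: (mule_ge0 (cc0 y) (cc0 y)).
have K5 : 0 <= \int[m]_z (h z * avg (dbl r) h z).
  by apply: integral_ge0 => y _; exact: (mule_ge0 (h0 y) (a20 y)).
have K6 : 0 <= \int[m]_z (avg (dbl r) h z * avg (dbl r) h z).
  by apply: integral_ge0 => y _; exact: (mule_ge0 (a20 y) (a20 y)).
have Q := (@maximal_bound_algebra R c _ _ _ _ _ hc S0 Sfin G0 Gfin K4 K5 K6 K1 K2 K3 H2).
exact: Q.
Qed.

(** Schur's test for a symmetric kernel: rows and columns have mass at most 4, whence 16. *)
Lemma avg_cst_sq_le (rho : R) g : (0 < rho)%R -> measurable_fun setT g ->
  (forall y, 0 <= g y) ->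
  \int[m]_z (avg (cst rho) g z * avg (cst rho) g z) <= 16%:E * \int[m]_y (g y * g y).
Proof.
move=> rho0 mg g0; set k := nker (cst rho).
have mr : measurable_fun setT (cst rho : G -> R) by [].
have mk : measurable_fun setT (fun p : G * G => k p.1 p.2) by exact: measurable_nker.
have k0 a b : 0 <= (k a b)%:E by rewrite lee_fin nker_ge0.
have mkz z : measurable_fun setT (fun y => (k z y)%:E).
  by apply/measurable_EFinP; exact: measurable_nker2.
have ksym a b : k a b = k b a by rewrite /k /nker /= near_sym.
have ik z : \int[m]_y (k z y)%:E <= 4%:E by exact: integral_nker.
have mgg : measurable_fun setT (fun y => g y * g y) by exact: emeasurable_funM.
have gg0 y : 0 <= g y * g y by exact: mule_ge0.
have a0 z := avg_ge0 (cst rho) z g0.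
have ma := measurable_avg mr mg g0.
have mkgg z : measurable_fun setT (fun y => (k z y)%:E * (g y * g y)).
  exact: emeasurable_funM.
have mkg z : measurable_fun setT (fun y => (k z y)%:E * g y).
  exact: emeasurable_funM.
(* Cauchy-Schwarz with respect to the kernel: the square is a double integral in [y] and [y'], where
   [2 * (g y * g y')] is at most the sum of the two squares. The two resulting terms are equal by
   symmetry. *)
have key z : avg (cst rho) g z * avg (cst rho) g z <= 4%:E * \int[m]_y ((k z y)%:E * (g y * g y)).
  rewrite -(@lee_pmul2l _ 2%:E)//.
  have mkk (b : G -> \bar R) : measurable_fun setT b ->
      measurable_fun setT (fun p : G * G => (k z p.1)%:E * (k z p.2)%:E * b p.1).
    move=> mb; apply: emeasurable_funM; last mfun.
    by apply: emeasurable_funM;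
       [apply: (@measurableT_comp _ _ _ _ _ _ (fun y => (k z y)%:E) _ fst)|
        apply: (@measurableT_comp _ _ _ _ _ _ (fun y => (k z y)%:E) _ snd)].
  have mkk' (b : G -> \bar R) : measurable_fun setT b ->
      measurable_fun setT (fun p : G * G => (k z p.1)%:E * (k z p.2)%:E * b p.2).
    move=> mb; apply: emeasurable_funM; last mfun.
    by apply: emeasurable_funM;
       [apply: (@measurableT_comp _ _ _ _ _ _ (fun y => (k z y)%:E) _ fst)|
        apply: (@measurableT_comp _ _ _ _ _ _ (fun y => (k z y)%:E) _ snd)].
  have E y : (k z y)%:E * g y * avg (cst rho) g z =
      \int[m]_y' ((k z y)%:E * (k z y')%:E * (g y * g y')).
    rewrite /avg -ge0_integralZl//.
    - by apply: eq_integral => y' _; rewrite muleACA.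
    - by move=> y' _; rewrite mule_ge0.
    - by rewrite mule_ge0.
  rewrite {1}/avg -ge0_integralZr//; last by move=> y _; rewrite mule_ge0.
  under eq_integral do rewrite E.
  have X1 : \int[m]_y \int[m]_y' ((k z y)%:E * (k z y')%:E * (g y * g y)) <=
      4%:E * \int[m]_y ((k z y)%:E * (g y * g y)).
    rewrite -ge0_integralZl//; last by move=> y _; rewrite mule_ge0.
    apply: ge0_le_integral => //.
    - by move=> y _; apply: integral_ge0 => y' _; rewrite !mule_ge0.
    - apply: measurable_integral; first exact: (mkk (fun y => g y * g y)).
      by move=> *; rewrite !mule_ge0.
    - exact: measurable_funeM.
    move=> y _; rewrite (eq_integral (fun y' => (k z y)%:E * (g y * g y) * (k z y')%:E)).
      rewrite ge0_integralZl//; last by rewrite mule_ge0.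
      by rewrite muleC; apply: lee_wpmul2r; rewrite ?mule_ge0.
    by move=> y' _; rewrite muleAC.
  have X2 : \int[m]_y \int[m]_y' ((k z y)%:E * (k z y')%:E * (g y' * g y')) <=
      4%:E * \int[m]_y ((k z y)%:E * (g y * g y)).
    rewrite (@tonelli R _ _ _ _ m m (fun y y' => (k z y)%:E * (k z y')%:E * (g y' * g y'))).
    - apply: le_trans X1; rewrite le_eqVlt; apply/orP; left; apply/eqP.
      by apply: eq_integral => y _; apply: eq_integral => y' _; rewrite (muleC (k z y')%:E).
    - exact: (mkk' (fun y => g y * g y)).
    - by move=> *; rewrite !mule_ge0.
  rewrite (_ : 2%:E * (4%:E * _) = 4%:E * \int[m]_y ((k z y)%:E * (g y * g y)) +
     4%:E * \int[m]_y ((k z y)%:E * (g y * g y))); last by rewrite mule_natl mule2n.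
  apply: le_trans (leeD X1 X2).
  have m1 : measurable_fun setT (fun y => \int[m]_y' ((k z y)%:E * (k z y')%:E * (g y * g y))).
    apply: measurable_integral; first exact: (mkk (fun y => g y * g y)).
    by move=> *; rewrite !mule_ge0.
  have m2 : measurable_fun setT (fun y => \int[m]_y' ((k z y)%:E * (k z y')%:E * (g y' * g y'))).
    apply: measurable_integral; first exact: (mkk' (fun y => g y * g y)).
    by move=> *; rewrite !mule_ge0.
  have mkkg : measurable_fun setT (fun p : G * G => (k z p.1)%:E * (k z p.2)%:E * (g p.1 * g p.2)).
    have -> : (fun p : G * G => (k z p.1)%:E * (k z p.2)%:E * (g p.1 * g p.2)) =
      (fun p => (k z p.1)%:E * (k z p.2)%:E * g p.1 * g p.2).
      by apply/funext => p; rewrite muleA.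
    by apply: emeasurable_funM; [exact: mkk|mfun].
  have m3 : measurable_fun setT (fun y => \int[m]_y' ((k z y)%:E * (k z y')%:E * (g y * g y'))).
    by apply: measurable_integral => // *; rewrite !mule_ge0.
  rewrite -ge0_integralZl// -?ge0_integralD//; first last.
  - by move=> y _; apply: integral_ge0 => y' _; rewrite !mule_ge0.
  - by move=> y _; apply: integral_ge0 => y' _; rewrite !mule_ge0.
  - by move=> y _; apply: integral_ge0 => y' _; rewrite !mule_ge0.
  apply: ge0_le_integral => //.
  - by move=> y _; rewrite mule_ge0//; apply: integral_ge0 => y' _; rewrite !mule_ge0.
  - exact: measurable_funeM.
  - exact: emeasurable_funD.
  move=> y _.
  have mkk1 : measurable_fun setT (fun y' => (k z y)%:E * (k z y')%:E) by exact: measurable_funeM.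
  rewrite -ge0_integralZl//; first last.
  - by move=> y' _; rewrite !mule_ge0.
  - by apply: emeasurable_funM => //; exact: measurable_funeM.
  rewrite -ge0_integralD//; first last.
  - exact: emeasurable_funM.
  - by move=> y' _; rewrite !mule_ge0.
  - exact: emeasurable_funM.
  - by move=> y' _; rewrite !mule_ge0.
  apply: ge0_le_integral => //.
  - by move=> y' _; rewrite !mule_ge0.
  - apply: measurable_funeM; apply: emeasurable_funM => //; exact: measurable_funeM.
  - by apply: emeasurable_funD; exact: emeasurable_funM.
  move=> y' _; rewrite muleCA -ge0_muleDr//; apply: lee_wpmul2l; first by rewrite mule_ge0.
  by have := @amgm_ereal R 1 (g y) (g y') ltr01 (g0 _) (g0 _); rewrite invr1 !mul1e.
apply: (@le_trans _ _ (\int[m]_z (4%:E * \int[m]_y ((k z y)%:E * (g y * g y))))).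
  apply: ge0_le_integral => //.
  - by move=> z _; rewrite mule_ge0.
  - exact: emeasurable_funM.
  - apply: measurable_funeM; apply: measurable_integral.
      by apply: emeasurable_funM; [exact/measurable_EFinP|mfun].
    by move=> *; rewrite !mule_ge0.
rewrite ge0_integralZl//; first last.
- by move=> z _; apply: integral_ge0 => y _; rewrite mule_ge0.
- apply: measurable_integral.
    by apply: emeasurable_funM; [exact/measurable_EFinP|mfun].
  by move=> *; rewrite !mule_ge0.
rewrite (@tonelli R _ _ _ _ m m (fun z y => (k z y)%:E * (g y * g y))); first last.
- by move=> *; rewrite !mule_ge0.
- by apply: emeasurable_funM; [exact/measurable_EFinP|mfun].
rewrite (_ : 16%:E = 4%:E * 4%:E); last by rewrite -EFinM -natrM.
rewrite -muleA; apply: lee_wpmul2l => //.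
rewrite -ge0_integralZl//.
have mky y : measurable_fun setT (fun z => (k z y)%:E).
  by under eq_fun do rewrite ksym; exact: mkz.
apply: ge0_le_integral => //.
- by move=> y _; apply: integral_ge0 => z _; rewrite mule_ge0.
- apply: (@measurable_integral R _ _ _ _ m (fun y z => (k z y)%:E * (g y * g y))).
    under eq_fun do rewrite ksym.
    by apply: emeasurable_funM; [exact/measurable_EFinP|mfun].
  by move=> *; rewrite !mule_ge0.
- exact: measurable_funeM.
move=> y _; rewrite ge0_integralZr//.
by apply: lee_wpmul2r => //; under eq_integral do rewrite ksym.
Qed.

End MaximalFunction.

Section MaximalFunction.
Local Open Scope ereal_scope.
Context {R : realType} d (G : measurableType d).
Variables (m : {sigma_finite_measure set G -> \bar R}) (near : R -> G -> G -> bool).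
Hypothesis near_measurable :
  measurable_fun setT (fun p : R * (G * G) => near p.1 p.2.1 p.2.2).
Hypothesis near_sym : forall r x y, near r x y = near r y x.
Hypothesis near_triangle : forall r s x y z,
  near r x y -> near s y z -> near (r + s) x z.
Hypothesis near_mono : forall r s x y, (r <= s)%R -> near r x y -> near s x y.
Hypothesis near_growth : forall r x, (0 < r)%R ->
  \int[m]_y ((near r x y)%:R : R)%:E <= (4 * r ^+ 2)%:E.
Implicit Types (r : G -> R) (g h : G -> \bar R).
Notation avg := (avg m near).

Lemma avgE r g z : avg r g z = avg (cst (r z)) g z.
Proof. by []. Qed.

(** A maximum over [n] radii is at most the sum over them. This bound, which grows with [n], only
    starts the halving. *)
Lemma maximal_bound_trivial n : maximal_bound m near n (16 * n%:R).
Proof.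
move=> r s g mr ss s0 rs mg g0.
pose a (rho : R) z := avg (cst rho) g z.
have mcst (rho : R) : measurable_fun setT (cst rho : G -> R) by [].
have a0 rho z : 0 <= a rho z by exact: avg_ge0.
have ma rho : measurable_fun setT (a rho).
  exact: (measurable_avg m near_measurable (mcst rho) mg g0).
apply: (@le_trans _ _ (\int[m]_z (\sum_(rho <- s) (a rho z * a rho z)))).
  apply: ge0_le_integral => //.
  - by move=> z _; rewrite mule_ge0// avg_ge0.
  - by apply: emeasurable_funM; exact: measurable_avg.
  - by apply: emeasurable_sum => rho; exact: emeasurable_funM.
  move=> z _; rewrite avgE -/(a (r z) z) (big_rem (r z))//= leeDl//.
  by apply: sume_ge0 => rho _; rewrite mule_ge0.
rewrite ge0_integral_sum//; last 2 first.
- by move=> rho; exact: emeasurable_funM.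
- by move=> rho z _; rewrite mule_ge0.
have I0 : 0 <= \int[m]_y (g y * g y) by apply: integral_ge0 => y _; exact: mule_ge0.
apply: (@le_trans _ _ (\sum_(rho <- s) (16%:E * \int[m]_y (g y * g y)))).
  rewrite big_seq [leRHS]big_seq; apply: lee_sum => rho /s0 rho0.
  exact: (avg_cst_sq_le near_measurable near_sym near_growth).
rewrite -ss; elim: {ss s0 rs} s => [|rho s IH]; first by rewrite big_nil mulr0 mul0e.
rewrite big_cons; apply: le_trans (leeD (lexx _) IH) _.
rewrite -ge0_muleDl ?lee_fin ?mulr_ge0// -EFinD.
rewrite (_ : 16 + 16 * (size s)%:R = 16 * (size (rho :: s))%:R)%R//.
by rewrite /= -[(size s).+1]addn1 natrD; ring.
Qed.

Lemma maximal_bound_pow n k :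
  maximal_bound m near n (64 * 64 * 2 ^+ k) -> maximal_bound m near n (64 * 64).
Proof.
elim: k => [|k IH] H; first by move: H; rewrite expr0 mulr1.
apply: IH; rewrite (_ : (64 * 64 * 2 ^+ k = 64 * 64 * 2 ^+ k.+1 / 2)%R); last first.
  by rewrite exprS; field.
apply: maximal_bound_half => //.
by rewrite -[leLHS]mulr1 ler_pM2l ?mulr_gt0// exprn_ege1// ler1n.
Qed.

Theorem maximal_bound_all n : maximal_bound m near n (64 * 64).
Proof.
apply: (@maximal_bound_pow n n).
(* Since [16 * n <= 64 * 64 * 2 ^ n], at most [n] halvings lead to the constant independent of
   [n]. *)
refine (@maximal_boundW _ _ _ _ _ _ (16 * n%:R)%R _ _ (@maximal_bound_trivial n)).
apply: ler_pM => //.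
  by rewrite -natrM ler_nat.
by rewrite -natrX ler_nat ltnW// ltn_expl.
Qed.

(** Finiteness of the list makes a maximising radius measurable: it is selected by finitely many
    comparisons of measurable averages. *)
Lemma argmax_radius (s : seq R) g : s != [::] -> measurable_fun setT g ->
  (forall y, 0 <= g y) ->
  exists r, [/\ measurable_fun setT r, forall z, r z \in s &
    forall rho z, rho \in s -> avg (cst rho) g z <= avg r g z].
Proof.
move=> + mg g0; elim: s => // rho s IH _.
have [->|/IH [r [mr rs rmax]]] := eqVneq s [::].
  exists (cst rho); split => //; first by move=> z; rewrite mem_head.
  by move=> rho' z; rewrite inE => /eqP ->.
have mcst : measurable_fun setT (cst rho : G -> R) by [].
exists (fun z => if avg r g z <= avg (cst rho) g z then rho else r z); split.
- apply: measurable_fun_ifT => //.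
  by apply: measurable_fun_lee; exact: measurable_avg.
- by move=> z; case: ifPn => _; rewrite inE ?eqxx ?rs ?orbT.
move=> rho' z; rewrite inE => /predU1P[->|/rmax h].
  rewrite [leRHS]avgE; case: ifPn => // /negP/negP; rewrite -ltNge => /ltW.
  by rewrite [X in _ <= X -> _]avgE.
rewrite [leRHS]avgE; case: ifPn => [h'|_]; last by rewrite -[leRHS]avgE.
exact: le_trans (h z) h'.
Qed.

End MaximalFunction.

Lemma integral_indicM {R : realType} d (X : measurableType d)
    (m : {measure set X -> \bar R}) (D : set X) (g : X -> \bar R) :
  (\int[m]_(x in D) g x = \int[m]_x ((\1_D x)%:E * g x))%E.
Proof.
rewrite integral_mkcond; apply: eq_integral => x _.
by rewrite epatch_indic /= muleC.
Qed.

Lemma sume_cst_le {R : realType} (n : nat) (x : \bar R) : (0 <= x)%E ->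
  (\sum_(k < n) x <= n%:R%:E * x)%E.
Proof.
move=> x0; elim: n => [|n IH]; first by rewrite big_ord0 mul0e.
rewrite big_ord_recr/= -natr1 EFinD ge0_muleDl ?lee_fin// mul1e.
exact: leeD.
Qed.

Section RestrictedTonelli.
Local Open Scope ereal_scope.
Context {R : realType} d1 d2 (X : measurableType d1) (Y : measurableType d2).
Variables (m1 : {sigma_finite_measure set X -> \bar R})
  (m2 : {sigma_finite_measure set Y -> \bar R}).

Lemma tonelliD (D1 : set X) (D2 : set Y) (f : X -> Y -> \bar R) :
  measurable D1 -> measurable D2 ->
  measurable_fun setT (fun p : X * Y => f p.1 p.2) -> (forall x y, 0 <= f x y) ->
  \int[m1]_(x in D1) \int[m2]_(y in D2) f x y = \int[m2]_(y in D2) \int[m1]_(x in D1) f x y.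
Proof.
move=> mD1 mD2 mf f0.
have i10 x : 0 <= (\1_D1 x : R)%:E by rewrite lee_fin.
have i20 x : 0 <= (\1_D2 x : R)%:E by rewrite lee_fin.
have mi1 : measurable_fun setT (fun x => (\1_D1 x : R)%:E) by exact/measurable_EFinP.
have mi2 : measurable_fun setT (fun x => (\1_D2 x : R)%:E) by exact/measurable_EFinP.
have mfx x : measurable_fun setT (f x).
  exact: (@measurable_fun_pair2 _ _ _ _ _ _ (fun p => f p.1 p.2)).
have mfy y : measurable_fun setT (f^~ y).
  exact: (@measurable_fun_pair1 _ _ _ _ _ _ (fun p => f p.1 p.2)).
have mi1p : measurable_fun setT (fun p : X * Y => (\1_D1 p.1 : R)%:E).
  exact: (@measurableT_comp _ _ _ _ _ _ (fun x => (\1_D1 x : R)%:E) _ fst).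
have mi2p : measurable_fun setT (fun p : X * Y => (\1_D2 p.2 : R)%:E).
  exact: (@measurableT_comp _ _ _ _ _ _ (fun x => (\1_D2 x : R)%:E) _ snd).
rewrite integral_indicM [RHS]integral_mkcond.
have -> : (\int[m1]_x ((\1_D1 x)%:E * \int[m2]_(y in D2) f x y) =
   \int[m1]_x \int[m2]_y ((\1_D1 x)%:E * ((\1_D2 y)%:E * f x y))).
  apply: eq_integral => x _; rewrite ge0_integralZl//.
  - by congr (_ * _); exact: integral_indicM.
  - exact: emeasurable_funM.
  - by move=> y _; rewrite mule_ge0.
rewrite tonelli//; first last.
- by move=> x y; rewrite !mule_ge0.
- by apply: emeasurable_funM => //; apply: emeasurable_funM.
apply: eq_integral => y _; rewrite epatch_indic /= muleC (integral_indicM m1 D1) -ge0_integralZl//.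
- by apply: eq_integral => x _; rewrite muleCA.
- exact: emeasurable_funM.
- by move=> x _; rewrite mule_ge0.
Qed.

Lemma measurable_integralD (D2 : set Y) (f : X -> Y -> \bar R) :
  measurable D2 ->
  measurable_fun setT (fun p : X * Y => f p.1 p.2) -> (forall x y, 0 <= f x y) ->
  measurable_fun setT (fun x => \int[m2]_(y in D2) f x y).
Proof.
move=> mD2 mf f0.
have E x : \int[m2]_(y in D2) f x y = \int[m2]_y ((\1_D2 y)%:E * f x y).
  exact: integral_indicM.
under eq_fun do rewrite E.
have mi2 : measurable_fun setT (fun x => (\1_D2 x : R)%:E) by exact/measurable_EFinP.
apply: measurable_integral.
- apply: emeasurable_funM => //.
  exact: (@measurableT_comp _ _ _ _ _ _ (fun x => (\1_D2 x : R)%:E) _ snd).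
- by move=> x y; rewrite mule_ge0// lee_fin.
Qed.

End RestrictedTonelli.

(** * One-dimensional substitutions by sine, tangent and logarithm *)

Section OneDim.
Context {R : realType}.
Notation mu := (@lebesgue_measure R).
Notation T1 := (measurableTypeR R).
Implicit Types (F : R -> \bar R).

Lemma integral_scale_le (k : R) F : k != 0 ->
  measurable_fun setT F -> (forall x, (0 <= F x)%E) ->
  (\int[mu]_x F (k * x)%R <= (`|k|^-1)%:E * \int[mu]_x F x)%E.
Proof.
move=> k0 mF F0.
have H l G : 0 < l -> measurable_fun setT G -> (forall x, (0 <= G x)%E) ->
    (\int[mu]_x G (l * x)%R <= l^-1%:E * \int[mu]_x G x)%E.
  move=> l0 mG G0; have := integral_affine_le 0 l0 mG G0.
  by under eq_integral do rewrite addr0.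
have [kp|kn|k00] := ltgtP k 0; last by rewrite k00 eqxx in k0.
- rewrite ltr0_norm//; have := H (- k) (fun x => F (- x)%R).
  rewrite oppr_gt0 => /(_ kp); under eq_integral do rewrite mulNr opprK.
  rewrite integral_oppr//; apply => //.
  exact: measurableT_comp.
- by rewrite gtr0_norm//; exact: H.
Qed.

Lemma integral_itv_split (a L : R) (n : nat) F : 0 < L ->
  measurable_fun setT F -> (forall x, (0 <= F x)%E) ->
  (\int[mu]_(x in `]a, (a + n%:R * L)%R[) F x <=
   \sum_(k < n) \int[mu]_(x in `](a + k%:R * L)%R, (a + k.+1%:R * L)%R[) F x)%E.
Proof.
move=> L0 mF F0; elim: n => [|n IH].
  by rewrite mul0r addr0 set_itvoo0 integral_set0 big_ord0.
rewrite big_ord_recr/=.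
have h1 : (a <= a + n%:R * L) by rewrite lerDl mulr_ge0// ltW.
have h2 : (a + n%:R * L < a + n.+1%:R * L) by rewrite ltrD2l ltr_pM2r// ltr_nat.
have sub : `]a, a + n.+1%:R * L[%classic `<=`
   `]a, a + n%:R * L[%classic `|` `[a + n%:R * L, a + n.+1%:R * L[%classic.
  move=> x/=; rewrite !in_itv/= => /andP[h3 h4].
  by have [h|h] := ltP x (a + n%:R * L); [left|right]; apply/andP.
have mFD D : measurable_fun D F by exact: measurable_funTS.
apply: le_trans (leeD IH (lexx _)).
apply: (@le_trans _ _ (\int[mu]_(x in `]a, (a + n%:R * L)%R[ `|`
    `[(a + n%:R * L)%R, (a + n.+1%:R * L)%R[) F x)%E).
  by apply: ge0_subset_integral => //; first [exact: mFD|exact: measurableU].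
rewrite ge0_integral_setU//.
- by rewrite leeD2l// -integral_itv_obnd_cbnd//; exact: mFD.
- exact: mFD.
- rewrite disj_set2E; apply/eqP/seteqP; split => // x/= [].
  rewrite !in_itv/= => /andP[_ h3] /andP[h4 _].
  by move: (lt_le_trans h3 h4); rewrite ltxx.
Qed.

Lemma cosDnpi (x : R) n : cos (x + n%:R * pi) = (-1) ^+ n * cos x.
Proof.
elim: n => [|n IH]; first by rewrite mul0r addr0 expr0 mul1r.
by rewrite -natr1 mulrDl mul1r addrA cosDpi IH exprS mulN1r mulNr.
Qed.

(* Base point of a partition of the line into the intervals where [cos] has no zero. *)
Definition cosbase : R := - (pi / 2) - 2 * pi.

Lemma cos_piece (k : nat) (t : R) :
  cosbase + k%:R * pi < t < cosbase + k.+1%:R * pi -> 0 < (-1) ^+ k * cos t.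
Proof.
move=> /andP[h1 h2]; pose e := t + 2%:R * pi - k%:R * pi.
have te : t + 2%:R * pi = e + k%:R * pi by rewrite /e subrK.
have := cosDnpi t 2; rewrite te cosDnpi sqrrN expr1n mul1r => <-.
rewrite mulrA -exprMn mulrNN mulr1 expr1n mul1r.
have E : k.+1%:R * pi = k%:R * pi + pi :> R by rewrite -addn1 natrD mulrDl mul1r.
apply: cos_gt0_pihalf; rewrite /e; move: h1 h2; rewrite /cosbase E => h1 h2.
by apply/andP; split; lra.
Qed.

(** The parity of [k] gives the sign of the cosine, hence whether the increasing or the decreasing
    substitution rule applies. *)
Lemma integral_sin_piece (k : nat) F :
  measurable_fun setT F -> (forall x, (0 <= F x)%E) ->
  (\int[mu]_(t in `](cosbase + k%:R * pi)%R, (cosbase + k.+1%:R * pi)%R[)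
     (F (sin t) * `|cos t|%:E) <= \int[mu]_x F x)%E.
Proof.
move=> mF F0.
have ab : cosbase + k%:R * pi < cosbase + k.+1%:R * pi.
  by rewrite ltrD2l ltr_pM2r ?pi_gt0// ltr_nat.
have cN t : `|cos t| = `|(-1) ^+ k * cos t| by rewrite normrM normrX normrN1 expr1n mul1r.
have c0 t (h : cosbase + k%:R * pi < t < cosbase + k.+1%:R * pi) : `|cos t| = (-1) ^+ k * cos t.
  by rewrite cN gtr0_norm// cos_piece.
rewrite (@eq_integral _ T1 _ _ _ (fun t => F (sin t) * ((-1) ^+ k * cos t)%:E)%E); last first.
  by move=> t; rewrite inE/= in_itv/= => /c0 ->.
have cc (c : R) : continuous (fun t : R => c * cos t).
  by move=> t; apply: continuousM; [exact: cst_continuous|exact: continuous_cos].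
have := @cos_piece k; rewrite -signr_odd; case: (odd k) => /=; rewrite ?expr0 ?expr1 => cp.
- apply: (@integral_comp_le_oo_decr R sin) => //.
  + by move=> t _; rewrite mulN1r opprK; exact: is_derive_sin.
  + by move=> t _; exact: cc.
- apply: (@integral_comp_le_oo R sin) => //.
  + by move=> t _; rewrite mul1r; exact: is_derive_sin.
  + by move=> t _; exact: cc.
Qed.

Lemma integral_sin_le (n : nat) F :
  measurable_fun setT F -> (forall x, (0 <= F x)%E) ->
  (\int[mu]_(t in `]cosbase, (cosbase + n%:R * pi)%R[)
     (F (sin t) * `|cos t|%:E) <= n%:R%:E * \int[mu]_x F x)%E.
Proof.
move=> mF F0.
have mG : measurable_fun setT (fun t => (F (sin t) * `|cos t|%:E)%E).
  mfun.
have G0 x : (0 <= F (sin x) * `|cos x|%:E)%E by rewrite mule_ge0// lee_fin.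
apply: le_trans (integral_itv_split cosbase n (pi_gt0 R) mG G0) _.
apply: (@le_trans _ _ (\sum_(k < n) \int[mu]_x F x)%E).
  by apply: lee_sum => k _; exact: integral_sin_piece.
by apply: sume_cst_le; apply: integral_ge0.
Qed.

Lemma integral_tan_piece (k : nat) F :
  measurable_fun setT F -> (forall x, (0 <= F x)%E) ->
  (\int[mu]_(t in `](cosbase + k%:R * pi)%R, (cosbase + k.+1%:R * pi)%R[)
     (F (tan t) * (cos t ^- 2)%:E) <= \int[mu]_x F x)%E.
Proof.
move=> mF F0.
have ab : cosbase + k%:R * pi < cosbase + k.+1%:R * pi.
  by rewrite ltrD2l ltr_pM2r ?pi_gt0// ltr_nat.
have c0 t (h : cosbase + k%:R * pi < t < cosbase + k.+1%:R * pi) : cos t != 0.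
  by have := cos_piece h; have [->|//] := eqVneq (cos t) 0; rewrite mulr0 ltxx.
apply: (@integral_comp_le_oo R tan) => //.
- by move=> t /c0 ct; exact: is_derive_tan.
- by move=> t /c0 ct; rewrite invr_gt0 exprn_even_gt0.
- move=> t /c0 ct; apply: (@continuousV _ _ (fun t => cos t ^+ 2)).
    by rewrite sqrf_eq0.
  have -> : (fun t : R => cos t ^+ 2) = (fun t => cos t * cos t) by apply/funext => x; rewrite expr2.
  by apply: continuousM; exact: continuous_cos.
Qed.

(** Substitution [x = ln (1 + a * v)] on []0, 1[], and reflection for the negative half. *)
Lemma integral_log_le (a : R) : 0 < a ->
  (\int[mu]_(v in `](-1)%R, 1%R[) (a / (1 + a * `|v|))%:E <= (2 * ln (1 + a))%:E)%E.
Proof.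
move=> a0; have a1 : 1 < 1 + a by rewrite ltrDl.
have H : (\int[mu]_(v in `]0%R, 1%R[) (a / (1 + a * v))%:E <= (ln (1 + a))%:E)%E.
  have E : (\int[mu]_x (\1_(`]0%R, ln (1 + a)[%classic : set R) x)%:E = (ln (1 + a))%:E)%E.
    rewrite (@integral_indic _ T1)// setIT.
    have := @lebesgue_measure_itv R (`]0, ln (1 + a)[).
    by rewrite /= lte_fin ln_gt0// sube0.
  have HH := @integral_comp_le_oo R (fun v => ln (1 + a * v)) (fun v => a / (1 + a * v))
    0 1 (fun x => (\1_(`]0, ln (1 + a)[%classic : set R) x)%:E) ltr01.
  rewrite E in HH.
  rewrite (@eq_integral _ T1 _ _ _ (fun t => (\1_(`]0, ln (1 + a)[%classic : set R) (ln (1 + a * t)))%:E *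
     (a / (1 + a * t))%:E)%E).
    apply: HH => //.
    - move=> t /andP[t0 t1]; have p : 0 < 1 + a * t by rewrite addr_gt0// mulr_gt0.
      have := @is_derive1_comp R (@ln R) (fun v => 1 + a * v) t _ _ (is_derive1_ln p).
      move=> /(_ a) D; rewrite mulrC; apply: D.
      apply: is_derive_eq.
      by rewrite add0r mul1r /GRing.scale/= mulr1.
    - by move=> t /andP[t0 t1]; rewrite divr_gt0// addr_gt0// mulr_gt0.
    - move=> t /andP[t0 t1]; apply: continuousM; first exact: cst_continuous.
      apply: continuousV; first by rewrite gt_eqF// addr_gt0// mulr_gt0.
      apply: continuousD; first exact: cst_continuous.
      exact: mulrl_continuous.
    - by apply/measurable_EFinP; exact: measurable_indic.
  move=> t; rewrite inE/= in_itv/= => /andP[t0 t1].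
  rewrite indicE mem_set ?mul1e//= in_itv/= ln_gt0 ?ltrDl ?mulr_gt0//=.
  by rewrite ltr_ln ?posrE ?addr_gt0 ?mulr_gt0// ltrD2l gtr_pMr.
have mG : measurable_fun setT (fun v : R => (a / (1 + a * `|v|))%:E).
  by apply/measurable_EFinP; mfun.
have G0 (v : R) : (0 <= (a / (1 + a * `|v|))%:E)%E.
  by rewrite lee_fin divr_ge0 ?addr_ge0 ?mulr_ge0 ?normr_ge0 ?(ltW a0).
have := integral_itv_split (-1) 2 ltr01 mG G0.
rewrite (_ : -1 + 2%:R * 1 = 1 :> R); last by rewrite mulr1; lra.
move/le_trans; apply; rewrite !big_ord_recr big_ord0/= add0e.
rewrite !mulr1 addr0 addNr (_ : -1 + 2%:R = 1 :> R); last by lra.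
rewrite mulr_natl mulr2n EFinD; apply: leeD; last first.
  rewrite (@eq_integral _ T1 _ _ _ (fun v => (a / (1 + a * v))%:E))//.
  by move=> v; rewrite inE/= in_itv/= => /andP[v0 _]; rewrite gtr0_norm.
apply: le_trans H.
rewrite (@integral_indicM _ _ (measurableTypeR R)) [leRHS](@integral_indicM _ _ (measurableTypeR R)).
rewrite -[leRHS]integral_oppr.
- rewrite le_eqVlt; apply/orP; left; apply/eqP; apply: eq_integral => v _.
  rewrite !indicE; case: (boolP (v \in _)) => vi; last first.
    rewrite mul0e memNset ?mul0e//= in_itv/=.
    by move: vi; rewrite notin_setE/= in_itv/= => vi h; apply: vi; lra.
  move: vi; rewrite inE/= in_itv/= => /andP[v1 v0].
  rewrite mem_set/= ?in_itv/= ?ltr0_norm ?mul1e// ; lra.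
- apply: emeasurable_funM; first exact/measurable_EFinP.
  by apply/measurable_EFinP; mfun.
- move=> v; rewrite indicE; case: (boolP (v \in _)) => vi; last by rewrite mul0e.
  move: vi; rewrite inE/= in_itv/= => /andP[v0 v1].
  by rewrite mul1e lee_fin divr_ge0 ?addr_ge0 ?mulr_ge0 ?(ltW a0) ?(ltW v0).
Qed.

End OneDim.

(** * Integration over differences of two points of the circle *)

Section CircleDifference.
Local Open Scope ereal_scope.
Context {R : realType}.
Notation mu := (@lebesgue_measure R).
Notation T1 := (measurableTypeR R).
Notation mu2 := (mu \x mu).
Notation arcR := (@Defs.arc R).
Variable Phi : T1 * T1 -> \bar R.
Hypothesis mPhi : measurable_fun setT Phi.
Hypothesis Phi0 : forall z, 0 <= Phi z.

(** With [t = s + d] and [t' = s - d] the difference of the two circle points is [2 * sin d] times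
    the unit vector [(- sin s, cos s)], and [|sin (t - t')| = 2 * |sin d| * |cos d|]. *)
Definition psi (d s : R) : \bar R :=
  Phi (- (2 * sin d) * sin s, 2 * sin d * cos s)%R * (2 * `|sin d| * `|cos d|)%:E.

Let psi0 d s : 0 <= psi d s.
Proof. by rewrite mule_ge0// lee_fin !mulr_ge0. Qed.

Let mpsi : measurable_fun setT (fun p : T1 * T1 => psi p.1 p.2).
Proof. rewrite /psi; mfun. Qed.

Let mpsi1 d : measurable_fun setT (psi d).
Proof. rewrite /psi; mfun. Qed.

(** Generous ranges for [d] and for [s = t' + d], made of 5 and of 7 whole intervals between zeros
    of the cosine; they end at [5 * pi / 2] and [9 * pi / 2]. *)
Definition domA : set T1 := `](@cosbase R), (cosbase + 5%:R * pi)%R[%classic.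
Definition domB : set T1 := `](@cosbase R), (cosbase + 7%:R * pi)%R[%classic.

Let mA : measurable domA. Proof. exact: measurable_itv. Qed.
Let mB : measurable domB. Proof. exact: measurable_itv. Qed.
Let marc : measurable (arcR : set T1). Proof. exact: measurable_itv. Qed.
Let p0 : (0 < pi :> R)%R. Proof. exact: pi_gt0. Qed.

(** Substitution [t = t' + 2 * d] at fixed [t'], which produces the factor 2. *)
Lemma circle_step1 (t' : R) : arcR t' ->
  \int[mu]_(t in arcR) (Phi (cos t - cos t', sin t - sin t')%R * `|sin (t - t')|%:E)
  <= 2%:E * \int[mu]_(d in domA) psi d (t' + d)%R.
Proof.
move=> at'.
pose H (t : R) := (\1_(arcR) t)%:E *
  (Phi (cos t - cos t', sin t - sin t')%R * `|sin (t - t')|%:E).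
have H0 t : 0 <= H t by rewrite !mule_ge0// lee_fin.
have mH : measurable_fun setT H.
  apply: emeasurable_funM; first by apply/measurable_EFinP; exact: measurable_indic.
  mfun.
rewrite (@integral_indicM R _ T1 mu (arcR)) -/H.
have -> : \int[mu]_x H x = \int[mu]_x H (2 * (2^-1 * x + - (2^-1 * t')) + t')%R.
  by apply: eq_integral => x _; congr H; field.
have h2 : (0 < 2^-1 :> R)%R by rewrite invr_gt0.
have mH2 : measurable_fun setT (fun d : R => H (2 * d + t')%R) by mfun.
have := @integral_affine_le R 2^-1 (- (2^-1 * t'))%R _ h2 mH2 (fun d => H0 _).
rewrite invrK => /le_trans; apply; apply: lee_wpmul2l => //.
rewrite (@integral_indicM R _ T1 mu domA).
apply: ge0_le_integral => //.
- apply: emeasurable_funM; first by apply/measurable_EFinP; exact: measurable_indic.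
  rewrite /psi; mfun.
move=> d _; rewrite /H indicE; case: (boolP (_ \in _)) => hd; last first.
  by rewrite mul0e mule_ge0// lee_fin.
move: hd at'; rewrite inE /Defs.arc/= !in_itv/= => /andP[h1 h2'] /andP[h3 h4].
rewrite indicE mem_set; last first.
  by rewrite /domA/= in_itv/= /cosbase; move: p0 => pp0; lra.
rewrite !mul1e /psi.
have e1 : (2 * d + t' = (t' + d) + d)%R by ring.
have e2 : (t' = (t' + d) - d)%R by ring.
have -> : (cos (2 * d + t') - cos t' = - (2 * sin d) * sin (t' + d))%R.
  by rewrite [in cos t']e2 e1 cosD cosB; ring.
have -> : (sin (2 * d + t') - sin t' = 2 * sin d * cos (t' + d))%R.
  by rewrite [in sin t']e2 e1 sinD sinB; ring.
have -> : (2 * d + t' - t' = d + d)%R by ring.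
have -> : (sin (d + d) = 2 * (sin d * cos d))%R by rewrite sinD; ring.
by rewrite !normrM ger0_norm// mulrA.
Qed.

Lemma circle_step2 (d : R) : domA d ->
  \int[mu]_(t' in arcR) psi d (t' + d)%R <= \int[mu]_(s in domB) psi d s.
Proof.
move=> Ad; rewrite (@integral_indicM R _ T1 mu (arcR)) (@integral_indicM R _ T1 mu domB).
have mi : measurable_fun setT (fun x : R => (\1_(arcR) x : R)%:E).
  by apply/measurable_EFinP; exact: measurable_indic.
have mG : measurable_fun setT (fun s : R => (\1_(arcR) (s - d)%R)%:E * psi d s).
  apply: emeasurable_funM => //.
  apply: (@measurableT_comp _ _ _ _ _ _ (fun x : R => (\1_(arcR) x : R)%:E) _ (fun s : R => s - d)%R) => //.
  mfun.
have G0 s : 0 <= (\1_(arcR) (s - d)%R : R)%:E * psi d s by rewrite mule_ge0// lee_fin.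
have := @integral_shift R d _ mG G0; rewrite /=.
under eq_integral do rewrite addrK.
move=> ->; apply: ge0_le_integral => //.
- apply: emeasurable_funM; last exact: mpsi1.
  by apply/measurable_EFinP; exact: measurable_indic.
move=> s _; apply: lee_wpmul2r => //.
rewrite !indicE; case: (boolP (_ \in _)) => hd; last by rewrite lee_fin.
rewrite mem_set//; move: hd Ad.
rewrite inE /Defs.arc /domA /domB/= !in_itv/= /cosbase => /andP[h1 h2'] /andP[h3 h4].
by move: p0 => pp0; lra.
Qed.

(** Polar integration along the line of direction [(- sin s, cos s)], with the signed radius
    [2 * v]. *)
Definition radial (s : R) : \bar R :=
  \int[mu]_v (Phi (- (2 * v) * sin s, 2 * v * cos s)%R * (2 * `|v|)%:E).

(** Substitution [v = sin d], whose Jacobian is the factor [|cos d|], on 5 intervals. *)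
Lemma circle_step3 (s : R) : \int[mu]_(d in domA) psi d s <= 5%:R%:E * radial s.
Proof.
have mF : measurable_fun setT
  (fun v : R => Phi (- (2 * v) * sin s, 2 * v * cos s)%R * (2 * `|v|)%:E) by mfun.
have F0 (v : R) : 0 <= Phi (- (2 * v) * sin s, 2 * v * cos s)%R * (2 * `|v|)%:E.
  by rewrite mule_ge0// lee_fin mulr_ge0.
apply: le_trans (integral_sin_le 5 mF F0).
rewrite le_eqVlt; apply/orP; left; apply/eqP; apply: eq_integral => d _.
by rewrite /psi EFinM muleA.
Qed.

Let mradial : measurable_fun setT radial.
Proof.
apply: (@measurable_integral R _ _ T1 T1 mu (fun s v =>
  Phi (- (2 * v) * sin s, 2 * v * cos s)%R * (2 * `|v|)%:E)).
- mfun.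
- by move=> x y; rewrite mule_ge0// lee_fin mulr_ge0.
Qed.

(** The angle is traded for the slope: with [y = 2 * v * cos s] the point becomes
    [(- y * tan s, y)], so that for fixed [y] the remaining substitution is one-dimensional in
    [tan s]. *)
Lemma circle_step4 (s : R) : (cos s != 0)%R ->
  radial s <= \int[mu]_y (Phi (- y * tan s, y)%R * (2^-1 * `|y| * cos s ^- 2)%:E).
Proof.
move=> cs; have c2 : (2 * cos s != 0)%R by rewrite mulf_neq0.
pose F (y : R) := Phi (- y * tan s, y)%R * (`|y| / `|cos s|)%:E.
have F0 y : 0 <= F y by rewrite mule_ge0// lee_fin divr_ge0.
have mF : measurable_fun setT F by rewrite /F; mfun.
have := integral_scale_le c2 mF F0.
have -> : \int[mu]_x F (2 * cos s * x)%R = radial s.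
  apply: eq_integral => v _; rewrite /F /tan; congr (Phi _ * _%:E).
    by congr pair; field.
  by rewrite !normrM ger0_norm// (mulrAC 2%R) mulfK// normr_eq0.
move=> /le_trans; apply.
rewrite -(@ge0_integralZl_EFin _ T1)//.
rewrite le_eqVlt; apply/orP; left; apply/eqP; apply: eq_integral => y _.
rewrite /F muleCA -EFinM; congr (_ * _%:E).
rewrite normrM ger0_norm// -[(cos s ^+ 2)%R]real_normK ?num_real//.
by field; rewrite normr_eq0.
Qed.

(** The map [x = - y * tan s] has Jacobian [|y| * cos s ^- 2], the given weight up to the factor
    1/2. For [y = 0] the weight is zero. *)
Lemma circle_step5 (y : R) k :
  \int[mu]_(s in `](cosbase + k%:R * pi)%R, (cosbase + k.+1%:R * pi)%R[)
    (Phi (- y * tan s, y)%R * (2^-1 * `|y| * cos s ^- 2)%:E)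
  <= 2^-1%:E * \int[mu]_x Phi (x, y).
Proof.
have [->|y0] := eqVneq y 0%R.
  rewrite (@eq_integral _ T1 _ mu _ (cst 0)); last first.
    by move=> s _; rewrite normr0 mulr0 mul0r mule0.
  by rewrite integral0 mule_ge0// integral_ge0.
pose F (t : R) := Phi (- y * t, y)%R * (2^-1 * `|y|)%:E.
have F0 t : 0 <= F t by rewrite mule_ge0// lee_fin mulr_ge0.
have mF : measurable_fun setT F by rewrite /F; mfun.
have := integral_tan_piece k mF F0.
rewrite (@eq_integral _ T1 _ mu _ (fun s => Phi (- y * tan s, y)%R * (2^-1 * `|y| * cos s ^- 2)%:E)); last first.
  by move=> s _; rewrite /F -muleA -EFinM.
move=> /le_trans; apply.
pose F2 (x : R) := Phi (x, y) * (2^-1 * `|y|)%:E.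
have F20 t : 0 <= F2 t by rewrite mule_ge0// lee_fin mulr_ge0.
have mF2 : measurable_fun setT F2 by rewrite /F2; mfun.
have yN : (- y != 0)%R by rewrite oppr_eq0.
have := integral_scale_le yN mF2 F20.
move=> /le_trans; apply; rewrite /F2 (@ge0_integralZr _ T1)//; last first.
- mfun.
by rewrite muleCA -EFinM muleC normrN mulrCA mulVf ?mulr1// normr_eq0.
Qed.

Lemma circle_step6 : \int[mu]_(s in domB) radial s <= (7%:R / 2)%:E * \int[mu2]_z Phi z.
Proof.
have r0 s : 0 <= radial s.
  by apply: integral_ge0 => v _; rewrite mule_ge0// lee_fin mulr_ge0.
have P0 : 0 <= \int[mu2]_z Phi z by exact: integral_ge0.
apply: le_trans (integral_itv_split cosbase 7 p0 mradial r0) _.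
apply: (@le_trans _ _ (\sum_(k < 7) (2^-1%:E * \int[mu2]_z Phi z))).
  apply: lee_sum => k _.
  pose I : set T1 := `](cosbase + k%:R * pi)%R, (cosbase + k.+1%:R * pi)%R[%classic.
  have mI : measurable I by exact: measurable_itv.
  pose f (s y : R) := Phi (- y * tan s, y)%R * (2^-1 * `|y| * cos s ^- 2)%:E.
  have f0 s y : 0 <= f s y by rewrite mule_ge0// lee_fin !mulr_ge0// invr_ge0 exprn_even_ge0.
  have mf : measurable_fun setT (fun p : T1 * T1 => f p.1 p.2).
    by rewrite /f /tan; mfun.
  apply: (@le_trans _ _ (\int[mu]_(s in I) \int[mu]_y f s y)).
    apply: ge0_le_integral => //.
    - exact: measurable_funTS.
    - apply: measurable_funTS; exact: (@measurable_integral R _ _ T1 T1 mu f).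
    move=> s; rewrite /I/= in_itv/= => /cos_piece cs; apply: circle_step4.
    by apply/eqP => c0; move: cs; rewrite c0 mulr0 ltxx.
  rewrite (@tonelliD R _ _ T1 T1 mu mu I setT f)//.
  rewrite (@fubini_tonelli2 _ _ T1 T1 R mu mu Phi)//.
  have mG : measurable_fun setT (fun y : T1 => \int[mu]_x Phi (x, y)).
    exact: (@measurable_fun_fubini_tonelli_G _ _ T1 T1 R mu Phi).
  rewrite -(@ge0_integralZl_EFin _ T1)//.
  - apply: ge0_le_integral => //.
    + by move=> y _; exact: integral_ge0.
    + apply: (@measurable_integralD R _ _ T1 T1 mu I (fun y s => f s y)) => //.
      by rewrite /f /tan; mfun.
    + by apply: measurable_funeM.
    by move=> y _; exact: circle_step5.
  - by move=> y _; exact: integral_ge0.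
apply: le_trans (sume_cst_le _ _) _; first by rewrite mule_ge0.
by rewrite muleA -EFinM.
Qed.

(** The constant is [2 * 5 * (7 / 2)]: the Jacobian of [t = t' + 2 * d], the 5 intervals for [d],
    and the 7 intervals for [s] with weight 1/2 each. *)
Theorem circle_difference_le :
  \int[mu]_(t' in arcR) \int[mu]_(t in arcR)
    (Phi (cos t - cos t', sin t - sin t')%R * `|sin (t - t')|%:E)
  <= 35%:R%:E * \int[mu2]_z Phi z.
Proof.
have mp1 : measurable_fun setT (fun p : T1 * T1 => psi p.2 (p.1 + p.2)%R).
  by rewrite /psi; mfun.
apply: (@le_trans _ _ (\int[mu]_(t' in arcR) (2%:E * \int[mu]_(d in domA) psi d (t' + d)%R))).
  apply: ge0_le_integral => //.
  - by move=> t' _; apply: integral_ge0 => t _; rewrite mule_ge0// lee_fin.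
  - apply: measurable_funTS.
    apply: (@measurable_integralD R _ _ T1 T1 mu (arcR) (fun t' t =>
      (Phi (cos t - cos t', sin t - sin t')%R * `|sin (t - t')|%:E))) => //.
      mfun.
    by move=> x y; rewrite mule_ge0// lee_fin.
  - apply: measurable_funTS; apply: measurable_funeM.
    exact: (@measurable_integralD R _ _ T1 T1 mu domA (fun t' d => psi d (t' + d)%R)).
  by move=> t' at'; exact: circle_step1.
rewrite (@ge0_integralZl_EFin _ T1)//; last 2 first.
- by move=> t' _; exact: integral_ge0.
- apply: measurable_funTS.
  exact: (@measurable_integralD R _ _ T1 T1 mu domA (fun t' d => psi d (t' + d)%R)).
rewrite (@tonelliD R _ _ T1 T1 mu mu (arcR) domA (fun t' d => psi d (t' + d)%R))//.
have mswap : measurable_fun setT (fun p : T1 * T1 => psi p.2 p.1) by rewrite /psi; mfun.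
have S2 : \int[mu]_(d in domA) \int[mu]_(t' in arcR) psi d (t' + d)%R <=
    \int[mu]_(d in domA) \int[mu]_(s in domB) psi d s.
  apply: ge0_le_integral => //.
  - by move=> d _; exact: integral_ge0.
  - apply: measurable_funTS.
    apply: (@measurable_integralD R _ _ T1 T1 mu (arcR) (fun d t' => psi d (t' + d)%R)) => //.
    by rewrite /psi; mfun.
  - apply: measurable_funTS.
    exact: (@measurable_integralD R _ _ T1 T1 mu domB psi).
  by move=> d Ad; exact: circle_step2.
have S3 : \int[mu]_(d in domA) \int[mu]_(s in domB) psi d s <=
    5%:R%:E * \int[mu]_(s in domB) radial s.
  rewrite (@tonelliD R _ _ T1 T1 mu mu domA domB psi)//.
  have r0 s : 0 <= radial s.
    by apply: integral_ge0 => v _; rewrite mule_ge0// lee_fin mulr_ge0.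
  rewrite -(@ge0_integralZl_EFin _ T1)//; last exact: measurable_funTS.
  apply: ge0_le_integral => //.
  - by move=> s _; exact: integral_ge0.
  - apply: measurable_funTS.
    exact: (@measurable_integralD R _ _ T1 T1 mu domA (fun s d => psi d s)).
  - by apply: measurable_funTS; apply: measurable_funeM.
  by move=> s _; exact: circle_step3.
have S4 := circle_step6.
have P0 : 0 <= \int[mu2]_z Phi z by exact: integral_ge0.
apply: (@le_trans _ _ (2%:E * (5%:R%:E * ((7%:R / 2)%:E * \int[mu2]_z Phi z)))).
  apply: lee_wpmul2l => //; apply: le_trans S2 _; apply: le_trans S3 _.
  by apply: lee_wpmul2l => //.
rewrite !muleA -!EFinM (_ : (2 * 5%:R * (7%:R / 2) = 35%:R :> R)%R)//.
by field.
Qed.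

End CircleDifference.

(** * The density of linearised averages over the circle *)

Section Plane.
Local Open Scope ereal_scope.
Context {R : realType}.
Notation mu := (@lebesgue_measure R).
Notation T1 := (measurableTypeR R).
Notation T2 := (T1 * T1)%type.
Notation mu2 := (@leb2 R).
Notation arcR := (@Defs.arc R).
Notation padd := (@Defs.cadd R).
Notation psub := (@Defs.csub R).

(** Squares instead of discs: they are products of intervals, so their measure comes directly from
    the product measure, and sums or differences of points are treated one coordinate at a time. *)
Definition near2 (r : R) (x y : T2) : bool :=
  ((`|x.1 - y.1| < r) && (`|x.2 - y.2| < r))%R.

Lemma near2_measurable :
  measurable_fun setT (fun p : R * (T2 * T2) => near2 p.1 p.2.1 p.2.2).
Proof. by apply: measurable_and; apply: measurable_fun_ltr; mfun. Qed.

Lemma near2_sym r x y : near2 r x y = near2 r y x.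
Proof. by rewrite /near2 distrC (distrC x.2). Qed.

Lemma near2_triangle r s x y z : near2 r x y -> near2 s y z -> near2 (r + s) x z.
Proof.
move=> /andP[a1 a2] /andP[b1 b2]; apply/andP; split.
  by rewrite (le_lt_trans (ler_distD y.1 _ _))// ltrD.
by rewrite (le_lt_trans (ler_distD y.2 _ _))// ltrD.
Qed.

Lemma near2_mono r s x y : (r <= s)%R -> near2 r x y -> near2 s x y.
Proof.
by move=> rs /andP[a1 a2]; rewrite /near2 (lt_le_trans a1)// (lt_le_trans a2).
Qed.

Lemma near2_growth (r : R) x : (0 < r)%R ->
  \int[mu2]_y ((near2 r x y)%:R : R)%:E <= (4 * r ^+ 2)%:E.
Proof.
move=> r0; pose A (c : R) : set T1 := `](c - r)%R, (c + r)%R[%classic.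
have mA c : measurable (A c) by exact: measurable_itv.
have lA c : mu (A c) = (2 * r)%:E.
  have := @lebesgue_measure_itv R (`](c - r)%R, (c + r)%R[).
  rewrite /= lte_fin (_ : (c - r < c + r)%R); last by lra.
  by move=> ->; rewrite -EFinD; congr (_%:E); ring.
have -> : \int[mu2]_y ((near2 r x y)%:R : R)%:E = \int[mu2]_y (\1_(A x.1 `*` A x.2) y)%:E.
  apply: eq_integral => y _; rewrite indicE; congr ((nat_of_bool _)%:R%:E); apply/idP/idP.
    rewrite /near2 distrC (distrC x.2) !ltr_distl => /andP[/andP[h1 h2] /andP[h3 h4]].
    by rewrite inE /A/=; split; rewrite /= in_itv/=; apply/andP.
  rewrite inE /A => -[/=]; rewrite !in_itv/= => /andP[h1 h2] /andP[h3 h4].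
  by rewrite /near2 distrC (distrC x.2) !ltr_distl h1 h2 h3 h4.
rewrite integral_indic ?setIT//; last exact: measurableX.
have := @product_measure1E _ _ T1 T1 R mu mu (A x.1) (A x.2) (mA _) (mA _).
rewrite /= !lA => E; rewrite (_ : (4 * r ^+ 2)%:E = (2 * r)%:E * (2 * r)%:E).
  by apply: (eq_ind_r (fun e => e <= _) (lexx _) E).
by rewrite -EFinM; congr (_%:E); ring.
Qed.

Implicit Types (F : T2 -> \bar R).

Lemma leb2_tonelli F : measurable_fun setT F -> (forall z, 0 <= F z) ->
  \int[mu2]_z F z = \int[mu]_x \int[mu]_y F (x, y).
Proof. exact: (@fubini_tonelli1 _ _ T1 T1 R mu mu F). Qed.

Lemma integral2_shift (c : T2) F : measurable_fun setT F -> (forall z, 0 <= F z) ->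
  \int[mu2]_z F (padd z c) = \int[mu2]_z F z.
Proof.
move=> mF F0.
have mFc : measurable_fun setT (fun z : T2 => F (padd z c)) by rewrite /Defs.cadd; mfun.
rewrite (leb2_tonelli mFc (fun z => F0 _)) (leb2_tonelli mF F0).
have mG : measurable_fun setT (fun x : R => \int[mu]_y F (x, y)).
  by apply: (@measurable_fun_fubini_tonelli_F _ _ T1 T1 R mu F).
rewrite -(integral_shift c.1 mG); last by move=> x; exact: integral_ge0.
apply: eq_integral => x _.
have mFx : measurable_fun setT (fun y : R => F (x + c.1, y)%R) by mfun.
by rewrite -(integral_shift c.2 mFx).
Qed.

Lemma integral2_opp F : measurable_fun setT F -> (forall z, 0 <= F z) ->
  \int[mu2]_z F (- z.1, - z.2)%R = \int[mu2]_z F z.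
Proof.
move=> mF F0.
have mFc : measurable_fun setT (fun z : T2 => F (- z.1, - z.2)%R) by mfun.
rewrite (leb2_tonelli mFc (fun z => F0 _)) (leb2_tonelli mF F0).
have mG : measurable_fun setT (fun x : R => \int[mu]_y F (x, y)).
  by apply: (@measurable_fun_fubini_tonelli_F _ _ T1 T1 R mu F).
rewrite -(integral_oppr mG); last by move=> x; exact: integral_ge0.
apply: eq_integral => x _.
have mFx : measurable_fun setT (fun y : R => F (- x, y)%R) by mfun.
by rewrite -(integral_oppr mFx).
Qed.

Lemma integral2_csub (c : T2) F : measurable_fun setT F -> (forall z, 0 <= F z) ->
  \int[mu2]_z F (psub c z) = \int[mu2]_z F z.
Proof.
move=> mF F0.
have mG : measurable_fun setT (fun z : T2 => F (padd z c)) by rewrite /Defs.cadd; mfun.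
rewrite -(integral2_shift c mF F0) -(integral2_opp mG (fun z => F0 _)).
by apply: eq_integral => z _; rewrite /Defs.cadd /Defs.csub /= addrC (addrC c.2).
Qed.

Section Kernel.
Variable r : T1 -> R.
Hypothesis mr : measurable_fun setT r.
Hypothesis r0 : forall t, (0 < r t)%R.

Definition wk (t : T1) (y : T2) : R := (r t ^- 2 * (near2 (r t) (circ t) y)%:R)%R.

Lemma wk_ge0 t y : (0 <= wk t y)%R.
Proof. by rewrite mulr_ge0// invr_ge0 sqr_ge0. Qed.

Lemma measurable_wk : measurable_fun setT (fun p : T1 * T2 => wk p.1 p.2).
Proof.
rewrite /wk; apply: measurable_funM; first by mfun.
apply: (@measurableT_comp _ _ _ _ _ _ (fun b : bool => b%:R : R) _
  (fun p : T1 * T2 => near2 (r p.1) (circ p.1) p.2)) => //.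
apply: (@measurableT_comp _ _ _ _ _ _ (fun p : R * (T2 * T2) => near2 p.1 p.2.1 p.2.2) _
  (fun p : T1 * T2 => (r p.1, (circ p.1, p.2)))); first exact: near2_measurable.
rewrite /circ; mfun.
Qed.

Lemma integral_wk t : \int[mu2]_y (wk t y)%:E <= 4%:E.
Proof.
have mrt : measurable_fun setT (cst (r t) : T2 -> R) by [].
have H := @integral_nker R _ T2 mu2 near2 near2_measurable near2_growth (cst (r t)) (circ t) mrt (r0 t).
exact H.
Qed.

Definition Kc (y : T2) : \bar R := \int[mu]_(t in arcR) (wk t y)%:E.

Lemma Kc_ge0 y : 0 <= Kc y.
Proof. by apply: integral_ge0 => t _; rewrite lee_fin wk_ge0. Qed.

Let marc : measurable (arcR : set T1). Proof. exact: measurable_itv. Qed.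

Lemma measurable_Kc : measurable_fun setT Kc.
Proof.
apply: (@measurable_integralD R _ _ T2 T1 mu arcR (fun y t => (wk t y)%:E)) => //.
- have mw := measurable_wk; mfun.
- by move=> y t; rewrite lee_fin wk_ge0.
Qed.

Lemma integral_Kc F : measurable_fun setT F -> (forall z, 0 <= F z) ->
  \int[mu2]_y (Kc y * F y) = \int[mu]_(t in arcR) \int[mu2]_y ((wk t y)%:E * F y).
Proof.
move=> mF F0; have mw := measurable_wk.
rewrite (@tonelliD R _ _ T1 T2 mu mu2 arcR setT (fun t y => (wk t y)%:E * F y))//.
- apply: eq_integral => y _; rewrite -(@ge0_integralZr _ T1)//.
  + by apply: measurable_funTS; mfun.
  + by move=> t _; rewrite lee_fin wk_ge0.
- mfun.
- by move=> t y; rewrite mule_ge0// lee_fin wk_ge0.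
Qed.

End Kernel.
End Plane.

Section Autocorrelation.
Local Open Scope ereal_scope.
Context {R : realType}.
Notation mu := (@lebesgue_measure R).
Notation T1 := (measurableTypeR R).
Notation T2 := (T1 * T1)%type.
Notation mu2 := (@leb2 R).
Notation arcR := (@Defs.arc R).
Notation padd := (@Defs.cadd R).
Notation psub := (@Defs.csub R).
Notation avg := (avg mu2 (@near2 R)).
Implicit Types (F : T2 -> \bar R).

Variable r : T1 -> R.
Hypothesis mr : measurable_fun setT r.
Hypothesis r0 : forall t, (0 < r t)%R.
Notation K := (Kc r).
Notation w := (wk r).

Let marc : measurable (arcR : set T1). Proof. exact: measurable_itv. Qed.
Let mK : measurable_fun setT K. Proof. exact: measurable_Kc. Qed.
Let K0 y : 0 <= K y. Proof. exact: Kc_ge0. Qed.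
Let mw : measurable_fun setT (fun p : T1 * T2 => w p.1 p.2).
Proof. exact: measurable_wk. Qed.
Let w0 t y : 0 <= (w t y)%:E. Proof. by rewrite lee_fin wk_ge0. Qed.

Lemma lebesgue_arc : mu arcR = (2 * pi)%:E.
Proof.
have := @lebesgue_measure_itv R (`[0%R, (2 * pi)%R[).
by rewrite /= lte_fin mulr_gt0 ?pi_gt0// sube0.
Qed.

(** Arc length [2 * pi] times the bound 4 for the mass of each normalised square. *)
Lemma integral_Kc_le : \int[mu2]_y K y <= (8 * pi)%:E.
Proof.
have -> : \int[mu2]_y K y = \int[mu2]_y (K y * (cst 1) y).
  by apply: eq_integral => y _; rewrite mule1.
rewrite integral_Kc//.
apply: (@le_trans _ _ (\int[mu]_(t in arcR) (cst 4%:E) t)).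
  apply: ge0_le_integral => //.
  - by move=> t _; apply: integral_ge0 => y _; rewrite mule1.
  - apply: measurable_funTS.
    apply: (@measurable_integral R _ _ T1 T2 mu2 (fun t y => (w t y)%:E * cst 1 y)).
      by apply: emeasurable_funM => //; exact/measurable_EFinP.
    by move=> t y; rewrite mule1.
  move=> t _; under eq_integral do rewrite mule1.
  exact: integral_wk.
rewrite (@integral_cst _ T1)//.
have -> : (8 * pi)%:E = 4%:E * (2 * pi)%:E :> \bar R by rewrite -EFinM; congr (_%:E); ring.
by apply: lee_wpmul2l => //; rewrite le_eqVlt; apply/orP; left; apply/eqP; exact: lebesgue_arc.
Qed.

(** Up to normalisation, the density of the difference of two independent points distributed with
    density [Kc r]. *)
Definition Gam (v : T2) : \bar R := \int[mu2]_y (K (padd v y) * K y).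

Lemma Gam_ge0 v : 0 <= Gam v.
Proof. by apply: integral_ge0 => y _; rewrite mule_ge0. Qed.

Let mKK : measurable_fun setT (fun p : T2 * T2 => K (padd p.1 p.2) * K p.2).
Proof. by rewrite /Defs.cadd; mfun. Qed.

Lemma measurable_Gam : measurable_fun setT Gam.
Proof.
apply: (@measurable_integral R _ _ T2 T2 mu2 (fun v y => K (padd v y) * K y)) => //.
by move=> x y; rewrite mule_ge0.
Qed.

Lemma integral_Gam F : measurable_fun setT F -> (forall z, 0 <= F z) ->
  \int[mu2]_v (Gam v * F v) =
  \int[mu2]_y (K y * \int[mu2]_z (K z * F (psub z y))).
Proof.
move=> mF F0.
have E v : Gam v * F v = \int[mu2]_y (K (padd v y) * K y * F v).
  rewrite ge0_integralZr//.
  - by rewrite /Defs.cadd; mfun.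
  - by move=> y _; rewrite mule_ge0.
under eq_integral do rewrite E.
rewrite (@tonelli R _ _ T2 T2 mu2 mu2 (fun v y => K (padd v y) * K y * F v)).
- apply: eq_integral => y _.
  have mG : measurable_fun setT (fun z : T2 => K z * F (psub z y)).
    by rewrite /Defs.csub; mfun.
  have G0 z : 0 <= K z * F (psub z y) by rewrite mule_ge0.
  rewrite -(integral2_shift y mG G0) -ge0_integralZl//; last first.
    by rewrite /Defs.cadd /Defs.csub; mfun.
  apply: eq_integral => v _; rewrite -muleA muleCA; congr (_ * (_ * F _)).
  by rewrite /Defs.cadd /Defs.csub /= !addrK -surjective_pairing.
- by apply: emeasurable_funM; mfun.
- by move=> v y; rewrite !mule_ge0.
Qed.

Lemma integral_Gam_le : \int[mu2]_v Gam v <= (8 * pi * (8 * pi))%:E.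
Proof.
have -> : \int[mu2]_v Gam v = \int[mu2]_v (Gam v * (cst 1) v).
  by apply: eq_integral => y _; rewrite mule1.
rewrite integral_Gam//.
under eq_integral do under eq_integral do rewrite mule1.
rewrite ge0_integralZr//; last by apply: integral_ge0.
rewrite EFinM; apply: lee_pmul => //; try exact: integral_Kc_le.
- exact: integral_ge0.
- exact: integral_ge0.
Qed.

(** The share of one pair of base points in the integral of [Gam * F]: [F (z - y)] averaged over [z]
    in the square at [circ t] and [y] in the square at [circ t']. *)
Definition biavg F (t t' : T1) : \bar R :=
  \int[mu2]_y ((w t' y)%:E * \int[mu2]_z ((w t z)%:E * F (psub z y))).

Let mwF F : measurable_fun setT F -> (forall z, 0 <= F z) ->
  measurable_fun setT (fun p : T1 * T2 => \int[mu2]_z ((w p.1 z)%:E * F (psub z p.2))).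
Proof.
move=> mF F0.
apply: (@measurable_integral R _ _ (T1 * T2)%type T2 mu2
  (fun p z => (w p.1 z)%:E * F (psub z p.2))).
- by rewrite /Defs.csub; mfun.
- by move=> p z; rewrite mule_ge0.
Qed.

Let wF0 F t y : (forall z, 0 <= F z) -> 0 <= \int[mu2]_z ((w t z)%:E * F (psub z y)).
Proof. by move=> F0; apply: integral_ge0 => z _; rewrite mule_ge0. Qed.

Lemma integral_Gam_biavg F : measurable_fun setT F -> (forall z, 0 <= F z) ->
  \int[mu2]_v (Gam v * F v) =
  \int[mu]_(t' in arcR) \int[mu]_(t in arcR) biavg F t t'.
Proof.
move=> mF F0; rewrite integral_Gam// integral_Kc//; first last.
- by move=> y; apply: integral_ge0 => z _; rewrite mule_ge0.
- apply: (@measurable_integral R _ _ T2 T2 mu2 (fun y z => K z * F (psub z y))).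
    by rewrite /Defs.csub; mfun.
  by move=> y z; rewrite mule_ge0.
have mwF' := mwF mF F0.
apply: eq_integral => t' _; rewrite /biavg.
rewrite (@tonelliD R _ _ T1 T2 mu mu2 arcR setT (fun t y =>
  (w t' y)%:E * \int[mu2]_z ((w t z)%:E * F (psub z y))))//.
- apply: eq_integral => y _.
  have mFy : measurable_fun setT (fun z : T2 => F (psub z y)) by rewrite /Defs.csub; mfun.
  rewrite integral_Kc// -(@ge0_integralZl _ T1)//.
  + apply: measurable_funTS.
    exact: (@measurable_fun_pair1 _ _ _ _ _ _ (fun p => \int[mu2]_z ((w p.1 z)%:E * F (psub z p.2)))).
  + by move=> t _; exact: wF0.
- apply: emeasurable_funM => //; mfun.
- by move=> t y; rewrite mule_ge0// wF0.
Qed.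

Lemma measurable_biavg F : measurable_fun setT F -> (forall z, 0 <= F z) ->
  measurable_fun setT (fun p : T1 * T1 => biavg F p.2 p.1).
Proof.
move=> mF F0; have mwF' := mwF mF F0.
apply: (@measurable_integral R _ _ (T1 * T1)%type T2 mu2 (fun p y =>
  (w p.1 y)%:E * \int[mu2]_z ((w p.2 z)%:E * F (psub z y)))).
- apply: emeasurable_funM; first by apply/measurable_EFinP; mfun.
  apply: (@measurableT_comp _ _ _ _ _ _
    (fun p : T1 * T2 => \int[mu2]_z ((w p.1 z)%:E * F (psub z p.2))) _
    (fun q : (T1 * T1) * T2 => (q.1.2, q.2))) => //; mfun.
- by move=> p y; rewrite mule_ge0// wF0.
Qed.

Lemma biavg_ge0 F t t' : (forall z, 0 <= F z) -> 0 <= biavg F t t'.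
Proof. by move=> F0; apply: integral_ge0 => y _; rewrite mule_ge0// wF0. Qed.

Notation cc t t' := (psub (circ t) (circ t')).

(** If [y] lies in the smaller square and [v + y] in the larger one, then [v] is within [2 * r t] of
    the difference of the centres; the factor 4 compensates the doubled half-side. *)
Lemma wk_le_nker1 (t t' : T1) (v y : T2) : (r t' <= r t)%R -> near2 (r t') (circ t') y ->
  (w t (padd v y) <= 4 * nker (@near2 R) (cst (2 * r t)%R) (cc t t') v)%R.
Proof.
move=> rr /andP[n1 n2]; rewrite /wk /nker /=.
have rt := r0 t.
have e : (4 * (2 * r t) ^- 2 = r t ^- 2)%R by field; rewrite gt_eqF.
have i0 : (0 <= r t ^- 2)%R by rewrite invr_ge0 exprn_ge0// ltW.
rewrite mulrA e; apply: ler_wpM2l => //.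
case: (boolP (near2 _ _ (padd v y))) => // /andP[m1 m2].
rewrite (_ : near2 _ _ _ = true)//; apply/andP; split.
  move: n1 m1; rewrite /Defs.cadd /Defs.csub/= !ltr_norml => /andP[a1 a2] /andP[b1 b2].
  by apply/andP; split; lra.
move: n2 m2; rewrite /Defs.cadd /Defs.csub/= !ltr_norml => /andP[a1 a2] /andP[b1 b2].
by apply/andP; split; lra.
Qed.

Lemma wk_le_nker2 (t t' : T1) (v z : T2) : (r t <= r t')%R -> near2 (r t) (circ t) z ->
  (w t' (psub z v) <= 4 * nker (@near2 R) (cst (2 * r t')%R) (cc t t') v)%R.
Proof.
move=> rr /andP[n1 n2]; rewrite /wk /nker /=.
have rt := r0 t'.
have e : (4 * (2 * r t') ^- 2 = r t' ^- 2)%R by field; rewrite gt_eqF.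
have i0 : (0 <= r t' ^- 2)%R by rewrite invr_ge0 exprn_ge0// ltW.
rewrite mulrA e; apply: ler_wpM2l => //.
case: (boolP (near2 _ _ (psub z v))) => // /andP[m1 m2].
rewrite (_ : near2 _ _ _ = true)//; apply/andP; split.
  move: n1 m1; rewrite /Defs.csub/= !ltr_norml => /andP[a1 a2] /andP[b1 b2].
  by apply/andP; split; lra.
move: n2 m2; rewrite /Defs.csub/= !ltr_norml => /andP[a1 a2] /andP[b1 b2].
by apply/andP; split; lra.
Qed.

Let mnk (rho : R) z : measurable_fun setT (fun v : T2 => (nker (@near2 R) (cst rho) z v)%:E).
Proof.
apply/measurable_EFinP; apply: (@measurable_nker2 R _ T2 (@near2 R)) => //.
exact: near2_measurable.
Qed.

Let mwt t : measurable_fun setT (fun y : T2 => (w t y)%:E).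
Proof.
apply/measurable_EFinP.
exact: (@measurable_fun_pair2 _ _ _ _ _ _ (fun p : T1 * T2 => w p.1 p.2)).
Qed.

Let outer_le (t : T1) (h : T2 -> \bar R) (c : \bar R) : 0 <= c ->
  measurable_fun setT h -> (forall y, 0 <= h y) ->
  (forall y, near2 (r t) (circ t) y -> h y <= c) ->
  \int[mu2]_y ((w t y)%:E * h y) <= 4%:E * c.
Proof.
move=> c0 mh h0 H.
apply: (@le_trans _ _ (\int[mu2]_y ((w t y)%:E * c))).
  apply: ge0_le_integral => //.
  - by move=> y _; rewrite mule_ge0.
  - exact: emeasurable_funM.
  - exact: emeasurable_funM.
  move=> y _; have [/H hc|n] := boolP (near2 (r t) (circ t) y).
    exact: lee_wpmul2l.
  by rewrite /wk (negbTE n) mulr0 !mul0e.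
rewrite ge0_integralZr//.
by apply: lee_wpmul2r => //; exact: integral_wk.
Qed.

(** The square of larger half-side is integrated first: the inner integral is at most 4 doubled
    averages, and the outer kernel has mass at most 4. *)
Lemma biavg_le1 F t t' : measurable_fun setT F -> (forall z, 0 <= F z) ->
  (r t' <= r t)%R -> biavg F t t' <= 16%:E * avg (cst (2 * r t)%R) F (cc t t').
Proof.
move=> mF F0 rr.
have a0 : 0 <= avg (cst (2 * r t)%R) F (cc t t') by exact: avg_ge0.
have -> : 16%:E = 4%:E * 4%:E :> \bar R by rewrite -EFinM; congr (_%:E); ring.
rewrite -muleA; apply: outer_le.
- by rewrite mule_ge0.
- exact: (@measurable_fun_pair2 _ _ _ _ _ _
    (fun p : T1 * T2 => \int[mu2]_z ((w p.1 z)%:E * F (psub z p.2))) t (mwF mF F0)).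
- by move=> y; exact: wF0.
move=> y ny.
have mG : measurable_fun setT (fun z : T2 => (w t z)%:E * F (psub z y)).
  apply: emeasurable_funM => //; rewrite /Defs.csub; mfun.
rewrite -(integral2_shift y mG); last by move=> z; rewrite mule_ge0.
rewrite /avg -ge0_integralZl//; last 2 first.
- exact: emeasurable_funM.
- by move=> v _; rewrite mule_ge0// lee_fin nker_ge0.
apply: ge0_le_integral => //.
- by move=> v _; rewrite mule_ge0.
- have mwt' := mwt t; rewrite /Defs.cadd /Defs.csub.
  apply: emeasurable_funM; last mfun.
  apply: (@measurableT_comp _ _ _ _ _ _ (fun y : T2 => (w t y)%:E) _
    (fun x : T2 => (x.1 + y.1, x.2 + y.2)%R)) => //; mfun.
- by apply: measurable_funeM; exact: emeasurable_funM.
move=> v _; rewrite muleA (_ : psub (padd v y) y = v); last first.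
  by rewrite /Defs.cadd /Defs.csub /= !addrK -surjective_pairing.
by apply: lee_wpmul2r => //; rewrite -EFinM lee_fin; exact: wk_le_nker1.
Qed.

(** Tonelli exchanges [y] and [z], so that again the larger square is integrated first. *)
Lemma biavg_le2 F t t' : measurable_fun setT F -> (forall z, 0 <= F z) ->
  (r t <= r t')%R -> biavg F t t' <= 16%:E * avg (cst (2 * r t')%R) F (cc t t').
Proof.
move=> mF F0 rr.
have a0 : 0 <= avg (cst (2 * r t')%R) F (cc t t') by exact: avg_ge0.
have -> : 16%:E = 4%:E * 4%:E :> \bar R by rewrite -EFinM; congr (_%:E); ring.
have mFz z : measurable_fun setT (fun y : T2 => F (psub z y)) by rewrite /Defs.csub; mfun.
have mFy y : measurable_fun setT (fun z : T2 => F (psub z y)) by rewrite /Defs.csub; mfun.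
have mFp : measurable_fun setT (fun p : T2 * T2 => F (psub p.2 p.1)) by rewrite /Defs.csub; mfun.
have -> : biavg F t t' = \int[mu2]_z ((w t z)%:E * \int[mu2]_y ((w t' y)%:E * F (psub z y))).
  rewrite /biavg.
  transitivity (\int[mu2]_y \int[mu2]_z ((w t' y)%:E * ((w t z)%:E * F (psub z y)))).
    apply: eq_integral => y _; rewrite ge0_integralZl//.
    - exact: emeasurable_funM.
    - by move=> z _; rewrite mule_ge0.
  rewrite (@tonelli R _ _ T2 T2 mu2 mu2 (fun y z => (w t' y)%:E * ((w t z)%:E * F (psub z y)))).
  - apply: eq_integral => z _; rewrite -ge0_integralZl//.
    + by apply: eq_integral => y _; rewrite muleCA.
    + exact: emeasurable_funM.
    + by move=> y _; rewrite mule_ge0.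
  - apply: emeasurable_funM; first by apply/measurable_EFinP; mfun.
    by apply: emeasurable_funM => //; apply/measurable_EFinP; mfun.
  - by move=> y z; rewrite !mule_ge0.
rewrite -muleA; apply: outer_le.
- by rewrite mule_ge0.
- apply: (@measurable_integral R _ _ T2 T2 mu2 (fun z y => (w t' y)%:E * F (psub z y))).
    by rewrite /Defs.csub; apply: emeasurable_funM; [apply/measurable_EFinP; mfun|mfun].
  by move=> z y; rewrite mule_ge0.
- by move=> z; apply: integral_ge0 => y _; rewrite mule_ge0.
move=> z nz.
have mG : measurable_fun setT (fun y : T2 => (w t' y)%:E * F (psub z y)).
  exact: emeasurable_funM.
rewrite -(integral2_csub z mG); last by move=> y; rewrite mule_ge0.
rewrite /avg -ge0_integralZl//; last 2 first.
- exact: emeasurable_funM.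
- by move=> v _; rewrite mule_ge0// lee_fin nker_ge0.
apply: ge0_le_integral => //.
- by move=> v _; rewrite mule_ge0.
- have mwt' := mwt t'; rewrite /Defs.csub.
  apply: emeasurable_funM; last mfun.
  apply: (@measurableT_comp _ _ _ _ _ _ (fun y : T2 => (w t' y)%:E) _
    (fun x : T2 => (z.1 - x.1, z.2 - x.2)%R)) => //; mfun.
- by apply: measurable_funeM; exact: emeasurable_funM.
move=> v _; rewrite muleA (_ : psub z (psub z v) = v); last first.
  by rewrite /Defs.csub /= !subKr -surjective_pairing.
by apply: lee_wpmul2r => //; rewrite -EFinM lee_fin; exact: wk_le_nker2.
Qed.

End Autocorrelation.

(** * Truncated square integral of the autocorrelation *)

Section LogBound.
Local Open Scope ereal_scope.
Context {R : realType}.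
Notation mu := (@lebesgue_measure R).
Notation T1 := (measurableTypeR R).
Notation arcR := (@Defs.arc R).
Let marc : measurable (arcR : set T1). Proof. exact: measurable_itv. Qed.
Let mA : measurable (@domA R). Proof. exact: measurable_itv. Qed.
Let p0 : (0 < pi :> R)%R. Proof. exact: pi_gt0. Qed.

(** Since [|sin u| + |cos u| >= 1], the integrand is at most 1 plus the same quotient times
    [|cos u|]. The first part gives the length [5 * pi] of [domA]; the second becomes the
    logarithmic integral by [v = sin u]. *)
Lemma integral_inv_sin_le (b : R) : (0 < b)%R ->
  \int[mu]_(u in @domA R) (b / (1 + b * `|sin u|))%:E <= (5 * pi + 10 * ln (1 + b))%:E.
Proof.
move=> b0.
have den (x : R) : (0 < 1 + b * `|x|)%R by rewrite ltr_wpDr// mulr_ge0// ltW.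
pose F (v : R) : \bar R := (\1_(`](-1)%R, 1%R[%classic : set R) v)%:E * (b / (1 + b * `|v|))%:E.
have F0 v : 0 <= F v by rewrite mule_ge0// lee_fin divr_ge0// ltW.
have mF : measurable_fun setT F.
  apply: emeasurable_funM; first by apply/measurable_EFinP; exact: measurable_indic.
  by apply/measurable_EFinP; mfun.
have IF : \int[mu]_v F v <= (2 * ln (1 + b))%:E.
  rewrite -(@integral_indicM R _ T1 mu (`](-1)%R, 1%R[%classic)).
  exact: integral_log_le.
apply: (@le_trans _ _ (\int[mu]_(u in @domA R) (1 + F (sin u) * `|cos u|%:E))).
  apply: ge0_le_integral => //.
  - by move=> u _; rewrite lee_fin divr_ge0// ltW.
  - by apply: measurable_funTS; apply/measurable_EFinP; mfun.
  - by apply: measurable_funTS; apply: emeasurable_funD => //; mfun.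
  move=> u _.
  have -> : F (sin u) * `|cos u|%:E = (b / (1 + b * `|sin u|) * `|cos u|)%:E.
    rewrite /F indicE; case: (boolP (sin u \in _)) => [_|]; first by rewrite mul1e.
    rewrite notin_setE/= in_itv/= => su.
    (* The indicator in [F] omits the values 1 and -1 of the sine, where the factor [|cos u|] is
       zero anyway. *)
    have -> : cos u = 0%R.
      have := cos2Dsin2 u; have /andP[h1 h2] : (-1 <= sin u <= 1)%R.
        by rewrite sin_geN1 sin_le1.
      have : (sin u ^+ 2 = 1)%R.
        have [e|ne] := eqVneq (sin u) 1%R; first by rewrite e expr1n.
        have [e|ne'] := eqVneq (sin u) (-1)%R; first by rewrite e sqrrN expr1n.
        by exfalso; apply: su; rewrite !lt_neqAle h1 h2 eq_sym ne ne'.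
      move=> -> h; have {}h : (cos u ^+ 2 = 0)%R by lra.
      by move/eqP: h; rewrite sqrf_eq0 => /eqP.
    by rewrite normr0 mulr0 mule0.
  rewrite -EFinD lee_fin.
  have d := den (sin u).
  have c2 : (`|cos u| ^+ 2 + `|sin u| ^+ 2 = 1)%R.
    by rewrite !real_normK ?num_real// cos2Dsin2.
  have s0 := normr_ge0 (sin u); have c0 := normr_ge0 (cos u).
  have s1 : (`|sin u| <= 1)%R by nra.
  have c1 : (`|cos u| <= 1)%R by nra.
  have cc1 : (1 <= `|cos u| + `|sin u|)%R by nra.
  rewrite (_ : 1 + b / (1 + b * `|sin u|) * `|cos u| =
    (1 + b * `|sin u| + b * `|cos u|) / (1 + b * `|sin u|))%R; last first.
    by field; rewrite gt_eqF.
  rewrite ler_pM2r ?invr_gt0//; nra.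
rewrite (@ge0_integralD _ T1)//; last 2 first.
- by move=> u _; rewrite mule_ge0// lee_fin.
- by apply: measurable_funTS; mfun.
rewrite EFinD; apply: leeD.
  rewrite (@integral_cst _ T1)// mul1e.
  have := @lebesgue_measure_itv R (`](@cosbase R), (cosbase + 5%:R * pi)%R[).
  rewrite /= lte_fin ltrDl mulr_gt0// => E; rewrite le_eqVlt; apply/orP; left; apply/eqP.
  by rewrite [LHS]E -EFinB; congr (_%:E); ring.
apply: le_trans (integral_sin_le 5 mF F0) _.
apply: le_trans (lee_wpmul2l _ IF) _; first by rewrite lee_fin.
by rewrite -EFinM lee_fin mulrA -natrM.
Qed.

Lemma integral_arc_inv_sin_le (b : R) : (0 < b)%R ->
  \int[mu]_(t' in arcR) \int[mu]_(t in arcR) (b / (1 + b * `|sin (t - t')|))%:E <=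
  (2 * pi * (5 * pi + 10 * ln (1 + b)))%:E.
Proof.
move=> b0.
have den (x : R) : (0 < 1 + b * `|x|)%R by rewrite ltr_wpDr// mulr_ge0// ltW.
have mH : measurable_fun setT (fun u : R => (b / (1 + b * `|sin u|))%:E).
  by apply/measurable_EFinP; mfun.
have H0 (u : R) : 0 <= (b / (1 + b * `|sin u|))%:E by rewrite lee_fin divr_ge0// ltW.
apply: (@le_trans _ _ (\int[mu]_(t' in arcR) (cst (5 * pi + 10 * ln (1 + b))%:E) t')).
  apply: ge0_le_integral => //.
  - by move=> t' _; exact: integral_ge0.
  - apply: measurable_funTS.
    apply: (@measurable_integralD R _ _ T1 T1 mu arcR (fun t' t => (b / (1 + b * `|sin (t - t')|))%:E)) => //.
    by apply/measurable_EFinP; mfun.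
  move=> t' at'; apply: le_trans (integral_inv_sin_le b0).
  rewrite (@integral_indicM R _ T1 mu arcR) (@integral_indicM R _ T1 mu (@domA R)).
  have mi : measurable_fun setT (fun x : R => (\1_(@domA R) x : R)%:E).
    by apply/measurable_EFinP; exact: measurable_indic.
  have mG : measurable_fun setT (fun u : R => (\1_(@domA R) u)%:E * (b / (1 + b * `|sin u|))%:E).
    exact: emeasurable_funM.
  rewrite -(integral_shift (- t')%R mG); last by move=> u; rewrite mule_ge0// lee_fin.
  apply: ge0_le_integral => //.
  - by move=> t _; rewrite mule_ge0// lee_fin.
  - apply: emeasurable_funM; first by apply/measurable_EFinP; exact: measurable_indic.
    by apply/measurable_EFinP; mfun.
  - refine (@measurableT_comp _ _ _ _ _ _ _ _ (fun t : R => (t - t')%R) mG _); mfun.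
  move=> t _; apply: lee_wpmul2r => //.
  rewrite !indicE; case: (boolP (t \in _)) => ht; last by rewrite lee_fin.
  rewrite mem_set//; move: ht at'.
  rewrite inE /Defs.arc /domA/= !in_itv/= /cosbase => /andP[h1 h2'] /andP[h3 h4].
  by move: p0 => pp0; lra.
rewrite (@integral_cst _ T1)//.
rewrite [(2 * pi * _)%R]mulrC EFinM; apply: lee_wpmul2l.
  rewrite lee_fin addr_ge0// mulr_ge0// ?ln_ge0 ?lerDl ?ltW//.
by rewrite le_eqVlt; apply/orP; left; apply/eqP; exact: lebesgue_arc.
Qed.

End LogBound.

Section GammaBound.
Local Open Scope ereal_scope.
Context {R : realType}.
Notation mu := (@lebesgue_measure R).
Notation T1 := (measurableTypeR R).
Notation T2 := (T1 * T1)%type.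
Notation mu2 := (@leb2 R).
Notation arcR := (@Defs.arc R).
Notation psub := (@Defs.csub R).
Notation avg := (avg mu2 (@near2 R)).
Let marc : measurable (arcR : set T1). Proof. exact: measurable_itv. Qed.
Let p0 : (0 < pi :> R)%R. Proof. exact: pi_gt0. Qed.

(** Chosen so that [16 * tau0 * 35 * (64 * 64) = 1 / 2]: in [Gam_trunc_le] the quadratic term then
    costs half of the left-hand side. *)
Definition tau0 : R := (32 * 35 * (64 * 64))^-1.

Lemma tau0_gt0 : (0 < tau0)%R.
Proof. by rewrite invr_gt0 !mulr_gt0. Qed.

(** If [tau0 * J * x >= 1], then [x] is at most the quadratic term. Otherwise [x <= a] and
    [x * J < 1 / tau0] together give the second term, which up to constants is the minimum of [a]
    and [1 / J]. *)
Lemma split_bound (a J : R) (x : \bar R) : (0 < a)%R -> (0 <= J)%R -> 0 <= x -> x <= a%:E ->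
  x <= tau0%:E * (x * x * J%:E) + (2 / tau0)%:E * ((a * tau0) / (1 + a * tau0 * J))%:E.
Proof.
have := tau0_gt0; move: tau0 => tau t0 a0 J0.
case: x => [x| |]//; rewrite -!EFinM -EFinD !lee_fin => x0 xa.
have aw := ltW a0; have tw := ltW t0.
have d0 : (0 < 1 + a * tau * J)%R by rewrite ltr_wpDr// !mulr_ge0.
have dw := ltW d0.
have -> : (2 / tau * (a * tau / (1 + a * tau * J)) = 2 * a / (1 + a * tau * J))%R.
  by field; rewrite !gt_eqF.
have [h|h] := leP 1%R (tau * J * x)%R.
  apply: (@le_trans _ _ (tau * (x * x * J))%R).
    rewrite (_ : (tau * (x * x * J) = tau * J * x * x)%R); last by ring.
    by rewrite ler_peMl.
  by rewrite lerDl divr_ge0 ?mulr_ge0.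
apply: (@le_trans _ _ (2 * a / (1 + a * tau * J))%R).
  rewrite ler_pdivlMr// mulrDr mulr1.
  rewrite (_ : (x * (a * tau * J) = a * (tau * J * x))%R); last by ring.
  nra.
by rewrite lerDr !mulr_ge0.
Qed.

Let measurable_c1 (m : T2 -> \bar R) : measurable_fun setT m ->
  measurable_fun setT (fun p : T1 * T1 => m (psub (circ p.2) (circ p.1)) *
    m (psub (circ p.2) (circ p.1)) * `|sin (p.2 - p.1)|%:E).
Proof.
move=> mm.
have mc : measurable_fun setT (fun p : T1 * T1 => m (psub (circ p.2) (circ p.1))).
  by rewrite /Defs.csub /circ /=; mfun.
have ms : measurable_fun setT (fun p : T1 * T1 => `|sin (p.2 - p.1)|%:E).
  by apply/measurable_EFinP; mfun.
by apply: emeasurable_funM => //; apply: emeasurable_funM.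
Qed.

Let measurable_c2 (b : R) :
  measurable_fun setT (fun p : T1 * T1 => (b / (1 + b * `|sin (p.2 - p.1)|))%:E).
Proof. by apply/measurable_EFinP; mfun. Qed.

(** The factor [64 / tau0 * (2 * pi)] is what the logarithmic term carries after absorption, and
    [5 * pi + 10 * ln (1 + M)] is at most [(5 * pi + 10) * (1 + ln (1 + M))]. *)
Definition CGam : R := (64 / tau0 * (2 * pi) * (5 * pi + 10))%R.

Lemma CGam_gt0 : (0 < CGam)%R.
Proof.
by rewrite /CGam !mulr_gt0// ?invr_gt0 ?tau0_gt0// addr_gt0// mulr_gt0.
Qed.

(** With [g] the truncated [Gam], the integral of [Gam * g] is that of [biavg] over pairs of
    parameters, hence at most 16 times that of a linearised maximal function [m] of [g] at
    differences of circle points. By [split_bound] this has two parts. The one with [m * m] and the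
    Jacobian returns to the plane by [circle_difference_le], then to the integral of [g * g] by the
    maximal inequality, and is absorbed; the other is the logarithmic integral. *)
Theorem Gam_trunc_le (r : T1 -> R) (s : seq R) (M : R) : measurable_fun setT r ->
  (forall x, x \in s -> (0 < x)%R) -> (forall t, r t \in s) -> (0 < M)%R ->
  \int[mu2]_v (Gam r v * mine (Gam r v) M%:E) <= (CGam * (1 + ln (1 + M)))%:E.
Proof.
move=> mr s0 rs M0; have r0 t : (0 < r t)%R by exact: s0.
have mG := measurable_Gam mr; have G0 v := Gam_ge0 r v.
pose g v := mine (Gam r v) M%:E.
have mg : measurable_fun setT g by apply: measurable_mine.
have g0 v : 0 <= g v by rewrite le_min G0 lee_fin ltW.
have gM v : g v <= M%:E by rewrite ge_min lexx orbT.
have gG v : g v <= Gam r v by rewrite ge_min lexx.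
(* Doubled radii, as in [biavg_le1]. Any value of [r] shows that the list is nonempty. *)
have s2N : [seq (2 * x)%R | x <- s] != [::] by case: (s) (rs 0%R).
have [rho [mrho rhos rhomax]] :=
  argmax_radius mu2 (@near2_measurable R) s2N mg g0.
have s20 x : x \in [seq (2 * y)%R | y <- s] -> (0 < x)%R.
  by move=> /mapP[y /s0 y0 ->]; rewrite mulr_gt0.
have rho0 z : (0 < rho z)%R by exact: s20.
pose m := avg rho g.
have mm : measurable_fun setT m := measurable_avg mu2 (@near2_measurable R) mrho mg g0.
have m0 z : 0 <= m z by exact: avg_ge0.
have mM z : m z <= (4 * M)%:E.
  have mk : measurable_fun setT (fun y : T2 => (nker (@near2 R) rho z y)%:E).
    by apply/measurable_EFinP; apply: measurable_nker2 => //; exact: near2_measurable.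
  apply: (@le_trans _ _ (\int[mu2]_y ((nker (@near2 R) rho z y)%:E * M%:E))).
    apply: ge0_le_integral => //.
    - by move=> y _; rewrite mule_ge0// lee_fin nker_ge0.
    - exact: emeasurable_funM.
    - exact: emeasurable_funM.
    by move=> y _; apply: lee_wpmul2l => //; rewrite lee_fin nker_ge0.
  rewrite ge0_integralZr//; last 2 first.
  - by move=> y _; rewrite lee_fin nker_ge0.
  - by rewrite lee_fin ltW.
  rewrite EFinM; apply: lee_wpmul2r; first by rewrite lee_fin ltW.
  exact: (integral_nker (@near2_measurable R) (@near2_growth R)).
have X0 : 0 <= \int[mu2]_v (Gam r v * g v) by apply: integral_ge0 => v _; rewrite mule_ge0.
(* [Gam] is integrable and [g] is bounded by [M]; this finiteness is what permits the absorption at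
   the end. *)
have Xfin : \int[mu2]_v (Gam r v * g v) < +oo.
  apply: (@le_lt_trans _ _ (\int[mu2]_v (Gam r v * M%:E))).
    apply: ge0_le_integral => //.
    - by move=> v _; rewrite mule_ge0.
    - exact: emeasurable_funM.
    - exact: emeasurable_funM.
    by move=> v _; exact: lee_wpmul2l.
  rewrite ge0_integralZr//; last by rewrite lee_fin ltW.
  rewrite muleC; apply: lte_mul_pinfty => //; first by rewrite lee_fin ltW.
  by apply: le_lt_trans (integral_Gam_le mr r0) _; rewrite ltry.
have gg : \int[mu2]_v (g v * g v) <= \int[mu2]_v (Gam r v * g v).
  apply: ge0_le_integral => //.
  - by move=> v _; rewrite mule_ge0.
  - exact: emeasurable_funM.
  - exact: emeasurable_funM.
  by move=> v _; exact: lee_wpmul2r.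
have mb : \int[mu2]_z (m z * m z) <= (64 * 64)%:E * \int[mu2]_v (Gam r v * g v).
  have H := @maximal_bound_all R _ T2 mu2 (@near2 R) (@near2_measurable R) (@near2_sym R)
    (@near2_triangle R) (@near2_mono R) (@near2_growth R) (size [seq (2 * x)%R | x <- s]).
  have {}H := H rho [seq (2 * x)%R | x <- s] g mrho erefl s20 rhos mg g0.
  apply: le_trans H _; apply: lee_wpmul2l => //.
have mmm : measurable_fun setT (fun z => m z * m z) by exact: emeasurable_funM.
have mm0 z : 0 <= m z * m z by rewrite mule_ge0.
have cd := @circle_difference_le R (fun z => m z * m z) mmm mm0.
(* The bound [4 * M] of [m] plays the part of [a] in [split_bound]. *)
pose b : R := (4 * M * tau0)%R.
have t0 := tau0_gt0.
have b0 : (0 < b)%R by rewrite /b !mulr_gt0.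
have ia := integral_arc_inv_sin_le b0.
have den (x : R) : (0 < 1 + b * `|x|)%R by rewrite ltr_wpDr// mulr_ge0// ltW.
pose c1 (t' t : R) := m (psub (circ t) (circ t')) * m (psub (circ t) (circ t')) * `|sin (t - t')|%:E.
pose c2 (t' t : R) : \bar R := (b / (1 + b * `|sin (t - t')|))%:E.
have c10 t' t : 0 <= c1 t' t by rewrite !mule_ge0// lee_fin.
have c20 t' t : 0 <= c2 t' t by rewrite lee_fin divr_ge0// ltW.
have mc1 : measurable_fun setT (fun p : T1 * T1 => c1 p.1 p.2).
  exact: measurable_c1.
have mc2 : measurable_fun setT (fun p : T1 * T1 => c2 p.1 p.2).
  exact: measurable_c2.
have key : \int[mu2]_v (Gam r v * g v) <=
  16%:E * (tau0%:E * \int[mu]_(t' in arcR) \int[mu]_(t in arcR) c1 t' t +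
           (2 / tau0)%:E * \int[mu]_(t' in arcR) \int[mu]_(t in arcR) c2 t' t).
  rewrite (integral_Gam_biavg mr mg g0).
  pose h (t' t : R) := 16%:E * (tau0%:E * c1 t' t + (2 / tau0)%:E * c2 t' t).
  have tt0 : 0 <= tau0%:E :> \bar R by rewrite lee_fin ltW.
  have tt1 : 0 <= (2 / tau0)%:E :> \bar R by rewrite lee_fin divr_ge0// ltW.
  have mI1 : measurable_fun setT (fun t' : T1 => \int[mu]_(t in arcR) c1 t' t).
    exact: (@measurable_integralD R _ _ T1 T1 mu arcR c1 marc mc1 c10).
  have mI2 : measurable_fun setT (fun t' : T1 => \int[mu]_(t in arcR) c2 t' t).
    exact: (@measurable_integralD R _ _ T1 T1 mu arcR c2 marc mc2 c20).
  have mh : measurable_fun setT (fun p : T1 * T1 => h p.1 p.2).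
    apply: measurable_funeM; apply: emeasurable_funD; exact: measurable_funeM.
  have h0 t' t : 0 <= h t' t by rewrite mule_ge0// adde_ge0// mule_ge0.
  have mc1t t' : measurable_fun setT (c1 t').
    exact: (@measurable_fun_pair2 _ _ _ _ _ _ (fun p => c1 p.1 p.2)).
  have mc2t t' : measurable_fun setT (c2 t').
    exact: (@measurable_fun_pair2 _ _ _ _ _ _ (fun p => c2 p.1 p.2)).
  have mbi := measurable_biavg mr mg g0.
  have hE t' : \int[mu]_(t in arcR) h t' t = 16%:E * (tau0%:E * \int[mu]_(t in arcR) c1 t' t +
           (2 / tau0)%:E * \int[mu]_(t in arcR) c2 t' t).
    rewrite -!(@ge0_integralZl_EFin _ T1)//; first last.
    - by apply: measurable_funTS; first [exact: mc1t|exact: mc2t].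
    - by apply: measurable_funTS; first [exact: mc1t|exact: mc2t].
    rewrite -(@ge0_integralD _ T1)//; first last.
    - by apply: measurable_funTS; apply: measurable_funeM; first [exact: mc1t|exact: mc2t].
    - by move=> t _; rewrite mule_ge0.
    - by apply: measurable_funTS; apply: measurable_funeM; first [exact: mc1t|exact: mc2t].
    - by move=> t _; rewrite mule_ge0.
    rewrite -(@ge0_integralZl_EFin _ T1)//.
    - by move=> t _; rewrite adde_ge0// mule_ge0.
    - by apply: measurable_funTS; apply: emeasurable_funD; apply: measurable_funeM; first [exact: mc1t|exact: mc2t].
  have hEE : \int[mu]_(t' in arcR) \int[mu]_(t in arcR) h t' t =
    16%:E * (tau0%:E * \int[mu]_(t' in arcR) \int[mu]_(t in arcR) c1 t' t +
           (2 / tau0)%:E * \int[mu]_(t' in arcR) \int[mu]_(t in arcR) c2 t' t).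
    under eq_integral do rewrite hE.
    have i10 t' : 0 <= \int[mu]_(t in arcR) c1 t' t by exact: integral_ge0.
    have i20 t' : 0 <= \int[mu]_(t in arcR) c2 t' t by exact: integral_ge0.
    rewrite (@ge0_integralZl_EFin _ T1)//; first last.
    - apply: measurable_funTS; apply: emeasurable_funD; exact: measurable_funeM.
    - by move=> t _; rewrite adde_ge0// mule_ge0.
    rewrite (@ge0_integralD _ T1)//; first last.
    - by apply: measurable_funTS; exact: measurable_funeM.
    - by move=> t _; rewrite mule_ge0.
    - by apply: measurable_funTS; exact: measurable_funeM.
    - by move=> t _; rewrite mule_ge0.
    rewrite !(@ge0_integralZl_EFin _ T1)//.
    - exact: measurable_funTS.
    - exact: measurable_funTS.
  rewrite -hEE.
  have bi0 t t' : 0 <= biavg r g t t' by exact: biavg_ge0.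
  have mbi1 t' : measurable_fun setT (fun t : T1 => biavg r g t t').
    exact: (@measurable_fun_pair2 _ _ _ _ _ _ (fun p : T1 * T1 => biavg r g p.2 p.1) t' mbi).
  apply: ge0_le_integral => //.
  - by move=> t' _; exact: integral_ge0.
  - apply: measurable_funTS.
    exact: (@measurable_integralD R _ _ T1 T1 mu arcR (fun t' t => biavg r g t t') marc mbi (fun x y => bi0 y x)).
  - apply: measurable_funTS.
    exact: (@measurable_integralD R _ _ T1 T1 mu arcR h marc mh h0).
  move=> t' _; apply: ge0_le_integral => //.
  - apply: measurable_funTS; exact: mbi1.
  - apply: measurable_funTS.
    exact: (@measurable_fun_pair2 _ _ _ _ _ _ (fun p : T1 * T1 => h p.1 p.2) t' mh).
  move=> t _.
  apply: (@le_trans _ _ (16%:E * m (psub (circ t) (circ t')))).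
    have [rr|/ltW rr] := leP (r t') (r t).
      apply: le_trans (biavg_le1 mr r0 mg g0 rr) _; apply: lee_wpmul2l => //.
      by apply: rhomax; apply: map_f.
    apply: le_trans (biavg_le2 mr r0 mg g0 rr) _; apply: lee_wpmul2l => //.
    by apply: rhomax; apply: map_f.
  apply: lee_wpmul2l => //; apply: split_bound => //.
  by rewrite mulr_gt0.
move: key X0 Xfin mb cd ia.
rewrite -/g.
set X := \int[mu2]_v (Gam r v * g v).
rewrite -/(c1 _ _).
move=> key X0 Xfin mb cd ia.
have {}key : X <= 16%:E * (tau0%:E * (35%:R%:E * ((64 * 64)%:E * X)) +
    (2 / tau0)%:E * (2 * pi * (5 * pi + 10 * ln (1 + b)))%:E).
  apply: le_trans key _; apply: lee_wpmul2l => //; apply: leeD.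
    apply: lee_wpmul2l; first by rewrite lee_fin ltW.
    apply: le_trans cd _; apply: lee_wpmul2l => //.
  by apply: lee_wpmul2l; first by rewrite lee_fin divr_ge0// ltW.
clear -key X0 Xfin t0 M0.
case: X X0 Xfin key => [x| |]// x0 _.
have -> : 16%:E * (tau0%:E * (35%:R%:E * ((64 * 64)%:E * x%:E)) +
    (2 / tau0)%:E * (2 * pi * (5 * pi + 10 * ln (1 + b)))%:E) =
  (16 * (tau0 * (35%:R * (64 * 64 * x)) + 2 / tau0 * (2 * pi * (5 * pi + 10 * ln (1 + b)))))%:E.
  by [].
rewrite !lee_fin => key; rewrite lee_fin in x0.
(* As [4 * tau0 <= 1], the logarithm may be stated with [M] in place of [b]. *)
have tb : (b <= M)%R.
  rewrite /b -[leRHS]mulr1 -mulrA mulrCA ler_pM2l//.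
  rewrite /tau0 ler_pdivrMr ?mulr_gt0// mul1r.
  by rewrite -!natrM ler_nat.
have lb : (ln (1 + b) <= ln (1 + M))%R.
  have b0 : (0 < b)%R by rewrite /b !mulr_gt0.
  by rewrite ler_ln ?posrE ?addr_gt0// lerD2l.
have l0 : (0 <= ln (1 + M))%R by rewrite ln_ge0// lerDl ltW.
have e : (16 * (tau0 * (35%:R * (64 * 64 * x))) = x / 2)%R.
  by rewrite /tau0; field.
have k2 : (x <= 64 / tau0 * (2 * pi * (5 * pi + 10 * ln (1 + b))))%R.
  move: key; rewrite mulrDr e.
  move: (2 * pi * _)%R => L.
  rewrite (_ : (16 * (2 / tau0 * L) = 32 / tau0 * L)%R); last by ring.
  rewrite (_ : (64 / tau0 * L = 2 * (32 / tau0 * L))%R); last by ring.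
  by move: (32 / tau0 * L)%R => z; lra.
apply: le_trans k2 _; rewrite /CGam -!mulrA; apply: ler_wpM2l => //.
apply: ler_wpM2l; first by rewrite invr_ge0 ltW.
apply: ler_wpM2l => //; apply: ler_wpM2l; first exact: pi_ge0.
by have := pi_gt0 R; nra.
Qed.

End GammaBound.

(** * Parseval and Plancherel inequalities *)

Notation L1 m f := (m.-integrable setT (EFin \o f)).

Section L1Facts.
Context {R : realType} d (T : measurableType d) (m : {measure set T -> \bar R}).
Implicit Types f g h : T -> R.

Lemma L1_measurable f : L1 m f -> measurable_fun setT f.
Proof. by move=> /integrableP[/measurable_EFinP]. Qed.

Lemma L1_le f g : measurable_fun setT f -> (forall x, `|f x| <= g x) -> L1 m g -> L1 m f.
Proof.
move=> mf fg; apply: le_integrable => //; first exact/measurable_EFinP.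
by move=> x _ /=; rewrite lee_fin (le_trans (fg x))// ler_norm.
Qed.

Lemma L1_bmul f h (C : R) : L1 m f -> measurable_fun setT h -> (forall x, `|h x| <= C) ->
  L1 m (fun x => f x * h x).
Proof.
move=> Lf mh hC.
have LC : L1 m (fun x => C * `|f x|).
  exact: (integrableZl (measurableT) C (integrable_norm Lf)).
apply: L1_le LC; first by apply: measurable_funM => //; exact: L1_measurable Lf.
by move=> x; rewrite normrM mulrC ler_wpM2r.
Qed.

Lemma L1D f g : L1 m f -> L1 m g -> L1 m (fun x => f x + g x).
Proof. by move=> Lf Lg; exact: (integrableD measurableT Lf Lg). Qed.

Lemma L1B f g : L1 m f -> L1 m g -> L1 m (fun x => f x - g x).
Proof. by move=> Lf Lg; exact: (integrableB measurableT Lf Lg). Qed.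

Lemma L1Z (c : R) f : L1 m f -> L1 m (fun x => c * f x).
Proof. by move=> Lf; exact: (integrableZl measurableT c Lf). Qed.

Lemma L1_norm f : L1 m f -> L1 m (fun x => `|f x|).
Proof. exact: integrable_norm. Qed.

Lemma L1P f : measurable_fun setT f -> (\int[m]_x `|f x|%:E < +oo)%E -> L1 m f.
Proof. by move=> mf fi; apply/integrableP; split => //; exact/measurable_EFinP. Qed.

Lemma L1_lty f : L1 m f -> (\int[m]_x `|f x|%:E < +oo)%E.
Proof. by move=> /integrableP[]. Qed.

Lemma EFin_Rint f : L1 m f -> ((\int[m]_x f x)%R%:E = \int[m]_x (f x)%:E)%E.
Proof. by move=> Lf; rewrite /Rintegral fineK// integrable_fin_num. Qed.

Lemma Rint_norm_le f : L1 m f -> `|(\int[m]_x f x)%R| <= (\int[m]_x `|f x|)%R.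
Proof. by move=> Lf; exact: le_normr_Rintegral. Qed.

Lemma Rint_le f g : L1 m f -> L1 m g -> (forall x, f x <= g x) ->
  (\int[m]_x f x <= \int[m]_x g x)%R.
Proof. by move=> Lf Lg fg; apply: le_Rintegral. Qed.

Lemma Rint_bmul_le f h (C : R) : L1 m f -> measurable_fun setT h ->
  (forall x, `|h x| <= C) -> `|(\int[m]_x (f x * h x))%R| <= C * (\int[m]_x `|f x|)%R.
Proof.
move=> Lf mh hC; apply: le_trans (Rint_norm_le (L1_bmul Lf mh hC)) _.
rewrite -RintegralZl//; last exact: L1_norm.
apply: Rint_le; [exact/L1_norm/L1_bmul| exact/L1Z/L1_norm|].
by move=> x; rewrite normrM mulrC ler_wpM2r.
Qed.

End L1Facts.

Section FubiniKernel.
Context {R : realType} d1 d2 (X : measurableType d1) (Y : measurableType d2).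
Variables (m1 : {sigma_finite_measure set X -> \bar R})
  (m2 : {sigma_finite_measure set Y -> \bar R}).

Lemma measurable_Rint (F : X -> Y -> R) :
  measurable_fun setT (fun p : X * Y => F p.1 p.2) ->
  measurable_fun setT (fun x => (\int[m2]_y F x y)%R).
Proof.
move=> mF; rewrite /Rintegral.
apply: (@measurableT_comp _ _ _ _ _ _ fine _ (fun x => \int[m2]_y (F x y)%:E)%E).
  exact: fine_measurable.
have -> : (fun x => \int[m2]_y (F x y)%:E)%E =
  (fun x => \int[m2]_y (Num.max (F x y) 0)%:E - \int[m2]_y (Num.max (- F x y) 0)%:E)%E.
  apply/funext => x; rewrite integralE; congr (_ - _)%E; apply: eq_integral => y _.
    by rewrite funeposE -EFin_max.
  by rewrite funenegE -EFinN -EFin_max.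
apply: emeasurable_funB.
- apply: measurable_integral => [|x y]; last by rewrite lee_fin le_max lexx orbT.
  by apply/measurable_EFinP; exact: measurable_maxr.
- apply: measurable_integral => [|x y]; last by rewrite lee_fin le_max lexx orbT.
  by apply/measurable_EFinP; apply: measurable_maxr => //; exact: measurable_funN.
Qed.

Lemma fubini_kernel (f : X -> R) (g : Y -> R) (k : X -> Y -> R) (C : R) :
  L1 m1 f -> L1 m2 g -> measurable_fun setT (fun p : X * Y => k p.1 p.2) ->
  0 <= C -> (forall x y, `|k x y| <= C) ->
  (\int[m1]_x (f x * \int[m2]_y (g y * k x y)) =
   \int[m2]_y (g y * \int[m1]_x (f x * k x y)))%R.
Proof.
move=> Lf Lg mk C0 kC.
have mf := L1_measurable Lf; have mg := L1_measurable Lg.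
have mkx x : measurable_fun setT (k x).
  exact: (@measurable_fun_pair2 _ _ _ _ _ _ (fun p => k p.1 p.2)).
have mky y : measurable_fun setT (k^~ y).
  exact: (@measurable_fun_pair1 _ _ _ _ _ _ (fun p => k p.1 p.2)).
have mF : measurable_fun setT (fun p : X * Y => (f p.1 * (g p.2 * k p.1 p.2))%:E).
  apply/measurable_EFinP; apply: measurable_funM; first mfun.
  by apply: measurable_funM => //; mfun.
have Lgk x : L1 m2 (fun y => g y * k x y) by exact: (L1_bmul Lg (mkx x) (kC x)).
have Lfk y : L1 m1 (fun x => f x * k x y).
  exact: (L1_bmul Lf (mky y) (fun x => kC x y)).
have iF : (m1 \x m2)%E.-integrable setT (fun p : X * Y => (f p.1 * (g p.2 * k p.1 p.2))%:E).
  apply/(integrable12ltyP m1 m2 mF).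
  apply: (@le_lt_trans _ _ (\int[m1]_x (`|f x|%:E * (C%:E * \int[m2]_y `|g y|%:E)))%E).
    apply: ge0_le_integral => //.
    - by move=> x _; exact: integral_ge0.
    - apply: (@measurable_integral R _ _ X Y m2 (fun x y => `|(f x * (g y * k x y))%:E|%E)) => //.
      exact: measurableT_comp.
    - apply: emeasurable_funM => //; apply/measurable_EFinP; exact: measurableT_comp.
    move=> x _; rewrite muleA -EFinM -ge0_integralZl//; first last.
    - by rewrite lee_fin mulr_ge0.
    - by apply/measurable_EFinP; exact: measurableT_comp.
    apply: ge0_le_integral => //.
    - apply: measurableT_comp => //; apply/measurable_EFinP.
      apply: (@measurable_funM _ _ _ _ (cst (f x)) (fun y => g y * k x y)) => //.
      exact: measurable_funM.
    - by apply: emeasurable_funM => //; apply/measurable_EFinP; exact: measurableT_comp.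
    move=> y _; rewrite -EFinM /= lee_fin !normrM -mulrA ler_wpM2l// mulrC.
    exact: ler_wpM2r.
  rewrite ge0_integralZr//; first last.
  - by rewrite mule_ge0 ?lee_fin// integral_ge0.
  - by apply/measurable_EFinP; exact: measurableT_comp.
  rewrite muleCA; apply: lte_mul_pinfty; rewrite ?lee_fin//.
  apply: lte_mul_pinfty; [exact: integral_ge0| |exact: L1_lty].
  rewrite ge0_fin_numE; [exact: L1_lty|exact: integral_ge0].
have := Fubini iF; rewrite /=.
have e1 x : (\int[m2]_y (f x * (g y * k x y))%:E = (f x * \int[m2]_y (g y * k x y))%:E)%E.
  rewrite EFinM EFin_Rint; last exact: Lgk.
  rewrite -integralZl; [|exact: measurableT|exact: Lgk].
  by apply: eq_integral => y _; rewrite -EFinM.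
have e2 y : (\int[m1]_x (f x * (g y * k x y))%:E = (g y * \int[m1]_x (f x * k x y))%:E)%E.
  rewrite EFinM EFin_Rint; last exact: Lfk.
  rewrite -integralZl; [|exact: measurableT|exact: Lfk].
  by apply: eq_integral => x _; rewrite /= -EFinM; congr (_%:E); ring.
under eq_integral do rewrite e1.
under [X in _ = X -> _]eq_integral do rewrite e2.
by move=> E; rewrite /Rintegral E.
Qed.

End FubiniKernel.

Section Parseval.
Context {R : realType} d1 d2 (X : measurableType d1) (Y : measurableType d2).
Variables (m1 : {sigma_finite_measure set X -> \bar R})
  (m2 : {sigma_finite_measure set Y -> \bar R}).
Variables (c s : X -> Y -> R) (a : X -> R) (W : Y -> R).
Hypothesis mc : measurable_fun setT (fun p : X * Y => c p.1 p.2).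
Hypothesis ms : measurable_fun setT (fun p : X * Y => s p.1 p.2).
Hypothesis c1 : forall x y, `|c x y| <= 1.
Hypothesis s1 : forall x y, `|s x y| <= 1.
Hypothesis La : L1 m1 a.
Hypothesis LW : L1 m2 W.

Definition ktrans (k : X -> Y -> R) (y : Y) : R := (\int[m1]_x (a x * k x y))%R.
Definition kcorr (k : X -> Y -> R) (x x' : X) : R := (\int[m2]_y (W y * (k x y * k x' y)))%R.

Section OneKernel.
Variable k : X -> Y -> R.
Hypothesis mk : measurable_fun setT (fun p : X * Y => k p.1 p.2).
Hypothesis k1 : forall x y, `|k x y| <= 1.

Let mkx x : measurable_fun setT (k x).
Proof. exact: (@measurable_fun_pair2 _ _ _ _ _ _ (fun p => k p.1 p.2)). Qed.
Let mky y : measurable_fun setT (k^~ y).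
Proof. exact: (@measurable_fun_pair1 _ _ _ _ _ _ (fun p => k p.1 p.2)). Qed.
Let mks : measurable_fun setT (fun p : Y * X => k p.2 p.1).
Proof. mfun. Qed.

Lemma measurable_ktrans : measurable_fun setT (ktrans k).
Proof.
apply: (@measurable_Rint R _ _ Y X m1 (fun y x => a x * k x y)).
have ma := L1_measurable La; mfun.
Qed.

Lemma ktrans_bound y : `|ktrans k y| <= (\int[m1]_x `|a x|)%R.
Proof. by rewrite -[leRHS]mul1r; apply: Rint_bmul_le. Qed.

Lemma kcorr_bound x x' : `|kcorr k x x'| <= (\int[m2]_y `|W y|)%R.
Proof.
rewrite -[leRHS]mul1r; apply: Rint_bmul_le => //; first exact: measurable_funM.
by move=> y; rewrite normrM mulr_ile1.
Qed.

Lemma measurable_kcorr : measurable_fun setT (fun p : X * X => kcorr k p.1 p.2).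
Proof.
apply: (@measurable_Rint R _ _ (X * X)%type Y m2 (fun p y => W y * (k p.1 y * k p.2 y))).
have mW := L1_measurable LW; mfun.
Qed.

Lemma L1_Wktrans : L1 m2 (fun y => W y * (ktrans k y * ktrans k y)).
Proof.
apply: (L1_bmul (C := (\int[m1]_x `|a x|)%R * (\int[m1]_x `|a x|)%R)) => //.
  by apply: measurable_funM; exact: measurable_ktrans.
by move=> y; rewrite normrM ler_pM ?ktrans_bound.
Qed.

(** The integrable weight [W] makes every integral absolutely convergent, so Fubini applies twice,
    once for each factor [ktrans]. *)
Lemma parseval_kernel : (\int[m2]_y (W y * (ktrans k y * ktrans k y)) =
  \int[m1]_x (a x * \int[m1]_x' (a x' * kcorr k x x')))%R.
Proof.
have mt := measurable_ktrans.
have LWt : L1 m2 (fun y => W y * ktrans k y) by exact: (L1_bmul LW mt ktrans_bound).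
have := @fubini_kernel R _ _ _ _ m2 m1 (fun y => W y * ktrans k y) a (fun y x => k x y) 1
  LWt La mks ler01 (fun y x => k1 x y).
rewrite (@eq_Rintegral _ _ _ _ _ (fun y => W y * (ktrans k y * ktrans k y))); last first.
  by move=> y _; rewrite -mulrA.
move=> ->; apply: eq_Rintegral => x _; congr (_ * _)%R.
have LWk : L1 m2 (fun y => W y * k x y) by exact: (L1_bmul LW (mkx x) (k1 x)).
have := @fubini_kernel R _ _ _ _ m2 m1 (fun y => W y * k x y) a (fun y x => k x y) 1
  LWk La mks ler01 (fun y x => k1 x y).
rewrite (@eq_Rintegral _ _ _ _ _ (fun y => W y * ktrans k y * k x y)); last first.
  by move=> y _; rewrite mulrAC.
move=> ->; apply: eq_Rintegral => x' _; congr (_ * _)%R.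
by apply: eq_Rintegral => y _; rewrite mulrA.
Qed.

End OneKernel.

(** The two kernels are added before absolute values are taken: for cosine and sine it is the sum of
    the correlations that depends on the difference of the points alone. *)
Lemma parseval_le : (\int[m2]_y (W y * (ktrans c y ^+ 2 + ktrans s y ^+ 2))%R%:E <=
  \int[m1]_x \int[m1]_x' (`|a x| * `|a x'| * `|kcorr c x x' + kcorr s x x'|)%:E)%E.
Proof.
have mta := L1_measurable La.
have L2 : L1 m2 (fun y => W y * (ktrans c y ^+ 2 + ktrans s y ^+ 2)).
  have -> : (fun y => W y * (ktrans c y ^+ 2 + ktrans s y ^+ 2)) =
    (fun y => W y * (ktrans c y * ktrans c y) + W y * (ktrans s y * ktrans s y)).
    by apply/funext => y; rewrite mulrDr !expr2.
  by apply: L1D; exact: L1_Wktrans.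
rewrite -EFin_Rint//.
pose Q x x' := kcorr c x x' + kcorr s x x'.
pose NW := (\int[m2]_y `|W y|)%R.
have mQ : measurable_fun setT (fun p : X * X => Q p.1 p.2).
  by apply: measurable_funD; exact: measurable_kcorr.
have bk (k : X -> Y -> R) (x : X) : measurable_fun setT (fun p : X * Y => k p.1 p.2) ->
   (forall x y, `|k x y| <= 1) -> L1 m1 (fun x' => a x' * kcorr k x x').
  move=> mk k1; apply: (L1_bmul La _ (kcorr_bound mk k1 x)).
  exact: (@measurable_fun_pair2 _ _ _ _ _ _ (fun p => kcorr k p.1 p.2) x (measurable_kcorr mk)).
have LQ x : L1 m1 (fun x' => a x' * Q x x').
  have -> : (fun x' => a x' * Q x x') = (fun x' => a x' * kcorr c x x' + a x' * kcorr s x x').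
    by apply/funext => x'; rewrite mulrDr.
  by apply: L1D; exact: bk.
have IQ x : (\int[m1]_x' (a x' * Q x x') =
    \int[m1]_x' (a x' * kcorr c x x') + \int[m1]_x' (a x' * kcorr s x x'))%R.
  rewrite -RintegralD//; [|exact: bk|exact: bk].
  by apply: eq_Rintegral => x' _; rewrite mulrDr.
have mI (k : X -> Y -> R) : measurable_fun setT (fun p : X * Y => k p.1 p.2) ->
   measurable_fun setT (fun x => (\int[m1]_x' (a x' * kcorr k x x'))%R).
  move=> mk; apply: (@measurable_Rint R _ _ X X m1 (fun x x' => a x' * kcorr k x x')).
  have mkc := measurable_kcorr mk; mfun.
have bI (k : X -> Y -> R) (x : X) : measurable_fun setT (fun p : X * Y => k p.1 p.2) ->
   (forall x y, `|k x y| <= 1) ->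
   `|(\int[m1]_x' (a x' * kcorr k x x'))%R| <= NW * (\int[m1]_x `|a x|)%R.
  move=> mk k1; apply: Rint_bmul_le => //; last exact: kcorr_bound.
  exact: (@measurable_fun_pair2 _ _ _ _ _ _ (fun p => kcorr k p.1 p.2) x (measurable_kcorr mk)).
have LI (k : X -> Y -> R) : measurable_fun setT (fun p : X * Y => k p.1 p.2) ->
   (forall x y, `|k x y| <= 1) ->
   L1 m1 (fun x => a x * (\int[m1]_x' (a x' * kcorr k x x'))%R).
  by move=> mk k1; apply: (L1_bmul La (mI k mk) (fun x => bI k x mk k1)).
have E : (\int[m2]_y (W y * (ktrans c y ^+ 2 + ktrans s y ^+ 2)) =
    \int[m1]_x (a x * \int[m1]_x' (a x' * Q x x')))%R.
  transitivity (\int[m2]_y (W y * (ktrans c y * ktrans c y)) +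
                \int[m2]_y (W y * (ktrans s y * ktrans s y)))%R.
    rewrite -RintegralD//; [|exact: L1_Wktrans|exact: L1_Wktrans].
    by apply: eq_Rintegral => y _; rewrite mulrDr !expr2.
  rewrite !parseval_kernel// -RintegralD//; [|exact: LI|exact: LI].
  by apply: eq_Rintegral => x _; rewrite -mulrDr IQ.
rewrite E.
have LIQ : L1 m1 (fun x => a x * (\int[m1]_x' (a x' * Q x x'))%R).
  have -> : (fun x => a x * (\int[m1]_x' (a x' * Q x x'))%R) =
    (fun x => a x * (\int[m1]_x' (a x' * kcorr c x x'))%R + a x * (\int[m1]_x' (a x' * kcorr s x x'))%R).
    by apply/funext => x; rewrite IQ mulrDr.
  by apply: L1D; exact: LI.
rewrite EFin_Rint//.
apply: (@le_trans _ _ (\int[m1]_x `|a x * (\int[m1]_x' (a x' * Q x x'))%R|%:E)%E).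
  rewrite -EFin_Rint// -EFin_Rint; last exact: L1_norm.
  by rewrite lee_fin; apply: le_trans (ler_norm _) (Rint_norm_le LIQ).
have mfin : measurable_fun setT (fun p : X * X => (`|a p.1| * `|a p.2| * `|Q p.1 p.2|)%:E).
  by apply/measurable_EFinP; mfun.
apply: ge0_le_integral => //.
- apply/measurable_EFinP; apply: measurableT_comp => //; exact: L1_measurable LIQ.
- exact: (@measurable_integral R _ _ X X m1 (fun x x' => (`|a x| * `|a x'| * `|Q x x'|)%:E)).
move=> x _; rewrite normrM EFinM.
have mQx : measurable_fun setT (Q x).
  exact: (@measurable_fun_pair2 _ _ _ _ _ _ (fun p => Q p.1 p.2) x mQ).
rewrite (@eq_integral _ _ _ _ _ (fun x' => `|a x|%:E * (`|a x' * Q x x'|)%:E)%E); last first.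
  by move=> x' _; rewrite -EFinM normrM mulrA.
rewrite ge0_integralZl_EFin//; last first.
  apply/measurable_EFinP; apply: measurableT_comp => //; exact: measurable_funM.
apply: lee_wpmul2l => //; rewrite -EFin_Rint; last exact: L1_norm.
by rewrite lee_fin; exact: Rint_norm_le.
Qed.

End Parseval.

Section ProductIntegral.
Context {R : realType}.
Notation mu := (@lebesgue_measure R).
Notation T1 := (measurableTypeR R).
Notation T2 := (T1 * T1)%type.
Notation mu2 := (@leb2 R).
Implicit Types u v : T1 -> R.

Lemma L1_prod u v : L1 mu u -> L1 mu v -> L1 mu2 (fun z : T2 => u z.1 * v z.2).
Proof.
move=> Lu Lv; have mu_ := L1_measurable Lu; have mv := L1_measurable Lv.
have mF : measurable_fun setT (fun z : T2 => u z.1 * v z.2) by mfun.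
apply: L1P => //; rewrite (@leb2_tonelli R (fun z => `|u z.1 * v z.2|%:E)) //; last first.
  by apply/measurable_EFinP; exact: measurableT_comp.
have e x : (\int[mu]_y `|u (x, y).1 * v (x, y).2|%:E = `|u x|%:E * \int[mu]_y `|v y|%:E)%E.
  rewrite -ge0_integralZl_EFin//; last by apply/measurable_EFinP; exact: measurableT_comp.
  by apply: eq_integral => y _; rewrite -EFinM normrM.
under eq_integral do rewrite e.
rewrite ge0_integralZr//; first last.
- exact: integral_ge0.
- by apply/measurable_EFinP; exact: measurableT_comp.
apply: lte_mul_pinfty; [exact: integral_ge0| |exact: L1_lty].
rewrite ge0_fin_numE; [exact: L1_lty|exact: integral_ge0].
Qed.

Lemma Rintegral_prod u v : L1 mu u -> L1 mu v ->
  (\int[mu2]_z (u z.1 * v z.2) = \int[mu]_x u x * \int[mu]_y v y)%R.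
Proof.
move=> Lu Lv; have L := L1_prod Lu Lv.
apply: EFin_inj; rewrite EFin_Rint//.
transitivity (\int[mu]_x \int[mu]_y (u x * v y)%:E)%E.
  by rewrite -(@integral12_prod_meas1 _ _ T1 T1 R mu mu _ L).
have e x : (\int[mu]_y (u x * v y)%:E = (u x * \int[mu]_y v y)%:E)%E.
  rewrite EFinM (EFin_Rint Lv) -(integralZl measurableT Lv).
  by apply: eq_integral => y _; rewrite -EFinM.
rewrite EFinM (EFin_Rint Lu) -(integralZr measurableT Lu).
by apply: (@eq_integral _ T1) => x _; rewrite e EFinM.
Qed.

Lemma norm_sin_le (x : R) : `|sin x| <= `|x|.
Proof.
wlog x0 : x / 0 <= x.
  move=> H; have [|/ltW x0] := leP 0 x; first exact: H.
  by rewrite -normrN -sinN -[leRHS]normrN; apply: H; rewrite oppr_ge0.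
move: x0; rewrite le_eqVlt => /predU1P[<-|x0]; first by rewrite sin0.
have ds y : y \in `]0, x[ -> is_derive y 1 sin (cos y) by move=> _; exact: is_derive_sin.
have cs : {within `[0, x], continuous (@sin R)}.
  by apply: continuous_subspaceT => y; exact: continuous_sin.
have [c _] := MVT x0 ds cs.
by rewrite sin0 !subr0 => ->; rewrite normrM ler_piMl// ler_norml cos_geN1 cos_le1.
Qed.

End ProductIntegral.

(** * A compactly supported weight with integrable transform *)

Section Tent.
Context {R : realType}.
Notation mu := (@lebesgue_measure R).
Notation T1 := (measurableTypeR R).

Variable L : R.
Hypothesis L0 : 0 < L.

Let I : set R := `[- L, L]%classic.
Let mI : measurable (I : set T1). Proof. exact: measurable_itv. Qed.

(** A truncated parabola. It vanishes at the endpoints, so its transform decays quadratically and is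
    integrable, and its products with cosine and sine have elementary primitives. *)
Definition tent (t : T1) : R := \1_(`[- L, L]%classic : set R) t * (1 - (t / L) ^+ 2).

Lemma tent_itv t : (t \in `[- L, L]) -> tent t = 1 - (t / L) ^+ 2.
Proof. by move=> h; rewrite /tent indicE mem_set// mul1r. Qed.

Lemma tent_ge0 t : 0 <= tent t.
Proof.
rewrite /tent indicE; case: (boolP (t \in _)) => [|_]; last by rewrite mul0r.
rewrite inE /= in_itv/= => /andP[h1 h2]; rewrite mul1r subr_ge0 -real_normK ?num_real//.
by rewrite exprn_ile1// normrM normfV (gtr0_norm L0) ler_pdivrMr// mul1r ler_norml h1.
Qed.

Lemma measurable_tent : measurable_fun setT tent.
Proof. by apply: measurable_funM; [exact: measurable_indic|mfun]. Qed.

Lemma muI : mu I = (2 * L)%:E.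
Proof.
have := @lebesgue_measure_itv R (`[- L, L]).
rewrite /= lte_fin gtrN// => ->; rewrite -EFinB; congr (_%:E); ring.
Qed.

Lemma tent_norm_le t : `|tent t| <= \1_I t.
Proof.
rewrite ger0_norm ?tent_ge0// /I /tent indicE; case: (t \in _); rewrite ?mul0r ?mul1r//.
by rewrite lerBlDr lerDl sqr_ge0.
Qed.

Lemma integral_indicI : (\int[mu]_x (\1_I x)%:E = (2 * L)%:E)%E.
Proof.
transitivity (mu I); last exact: muI.
by rewrite (@integral_indic _ T1)// setIT.
Qed.

Lemma L1_tent : L1 mu tent.
Proof.
apply: (@L1_le R _ T1 mu tent (fun t => \1_I t)); [exact: measurable_tent|exact: tent_norm_le|].
apply: L1P; first exact: measurable_indic.
have -> : (\int[mu]_x `|\1_I x : R|%:E = \int[mu]_x (\1_I x)%:E)%E.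
  by apply: eq_integral => x _; rewrite ger0_norm.
by rewrite integral_indicI ltry.
Qed.

Lemma tent_int_bound (k : R -> R) : measurable_fun (setT : set T1) k -> (forall t, `|k t| <= 1) ->
  `|(\int[mu]_t (tent t * k t))%R| <= 2 * L.
Proof.
move=> mk k1; apply: le_trans (Rint_bmul_le L1_tent mk k1) _.
rewrite mul1r -lee_fin EFin_Rint; last exact: L1_norm L1_tent.
apply: (@le_trans _ _ (\int[mu]_x (\1_I x)%:E)%E); last first.
  by rewrite integral_indicI.
apply: ge0_le_integral => //.
- by apply/measurable_EFinP; apply: measurableT_comp => //; exact: measurable_tent.
- by apply/measurable_EFinP; exact: measurable_indic.
- by move=> x _; rewrite lee_fin tent_norm_le.
Qed.

Lemma tent_int_itv (k : R -> R) : continuous k ->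
  (\int[mu]_t (tent t * k t))%R = fine (\int[mu]_(t in I) ((1 - (t / L) ^+ 2) * k t)%:E)%E.
Proof.
move=> ck; rewrite /Rintegral; congr (fine _).
rewrite (@integral_indicM R _ T1 mu I).
by apply: eq_integral => t _; rewrite -EFinM mulrA.
Qed.

Let cont (k : R -> R) : continuous k -> {within `[- L, L], continuous (fun t : R => (1 - (t / L) ^+ 2) * k t)}.
Proof.
move=> ck; apply: continuous_subspaceT => t.
apply: cvgM; last exact: ck.
apply: cvgB; first exact: cvg_cst.
apply: cvgM; apply: cvgM; [exact: cvg_id|exact: cvg_cst|exact: cvg_id|exact: cvg_cst].
Qed.

Lemma cos_scale_continuous c : continuous (fun t : R => cos (c * t)).
Proof.
move=> t; apply: continuous_comp; last exact: continuous_cos.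
by apply: cvgM; [exact: cvg_cst|exact: cvg_id].
Qed.

Lemma sin_scale_continuous c : continuous (fun t : R => sin (c * t)).
Proof.
move=> t; apply: continuous_comp; last exact: continuous_sin.
by apply: cvgM; [exact: cvg_cst|exact: cvg_id].
Qed.

Lemma tent_sin c : (\int[mu]_t (tent t * sin (c * t)))%R = 0.
Proof.
have [->|c0] := eqVneq c 0.
  under eq_Rintegral do rewrite mul0r sin0 mulr0.
  by rewrite /Rintegral integral0.
rewrite tent_int_itv; last exact: sin_scale_continuous.
(* An even primitive, so that its values at [L] and [- L] cancel. *)
pose phi (t : R) : R := - (1 - (t / L) ^+ 2) * cos (c * t) / c - 2 * t * sin (c * t) / (L ^+ 2 * c ^+ 2)
  - 2 * cos (c * t) / (L ^+ 2 * c ^+ 3).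
have Lz : L != 0 by rewrite gt_eqF.
have D (t : R) : is_derive t 1 phi ((1 - (t / L) ^+ 2) * sin (c * t)).
  rewrite /phi; apply: is_derive_eq; rewrite /GRing.scale/=; field.
  by rewrite Lz c0.
have LL : - L <= L by rewrite ge0_cp// ltW.
rewrite (FTC_is_derive LL (fun t _ => D t) (cont (@sin_scale_continuous c))).
by rewrite /= /phi (mulrN c L) cosN sinN; ring.
Qed.

(** Sum of two bounds: the trivial [2 * L], and [8 * L] after multiplication by [(L * c) ^+ 2], read
    off from an explicit primitive. *)
Lemma tent_cos_le c : `|(\int[mu]_t (tent t * cos (c * t)))%R| <= 10 * L / (1 + (L * c) ^+ 2).
Proof.
have b1 : `|(\int[mu]_t (tent t * cos (c * t)))%R| <= 2 * L.
  apply: tent_int_bound; last by move=> t; rewrite ler_norml cos_geN1 cos_le1.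
  exact: continuous_measurable_fun (@cos_scale_continuous c).
have q0 : 0 <= (L * c) ^+ 2 by exact: sqr_ge0.
rewrite ler_pdivlMr; last by rewrite ltr_pwDl.
have [c00|c0] := eqVneq c 0.
  have -> : (L * c) ^+ 2 = 0 by rewrite c00 mulr0 expr0n.
  by rewrite addr0 mulr1; apply: le_trans b1 _; move: L0; lra.
suff b2 : `|(\int[mu]_t (tent t * cos (c * t)))%R| * (L * c) ^+ 2 <= 8 * L.
  by rewrite mulrDr mulr1; move: b1 b2; lra.
rewrite tent_int_itv; last exact: cos_scale_continuous.
pose phi (t : R) : R := (1 - (t / L) ^+ 2) * sin (c * t) / c - 2 * t * cos (c * t) / (L ^+ 2 * c ^+ 2)
  + 2 * sin (c * t) / (L ^+ 2 * c ^+ 3).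
have Lz : L != 0 by rewrite gt_eqF.
have D (t : R) : is_derive t 1 phi ((1 - (t / L) ^+ 2) * cos (c * t)).
  rewrite /phi; apply: is_derive_eq; rewrite /GRing.scale/=; field.
  by rewrite Lz c0.
have LL : - L <= L by rewrite ge0_cp// ltW.
rewrite (FTC_is_derive LL (fun t _ => D t) (cont (@cos_scale_continuous c))).
have -> : phi L - phi (- L) = 4 * (- L * cos (c * L) + sin (c * L) / c) / (L * c) ^+ 2.
  rewrite /phi (mulrN c L) cosN sinN; field.
  by rewrite Lz c0.
have q1 : 0 <= ((L * c) ^+ 2)^-1 by rewrite invr_ge0.
rewrite /= normrM (ger0_norm q1).
rewrite -mulrA mulVf ?mulr1; last by rewrite expf_neq0// mulf_neq0.
rewrite normrM ger0_norm//.
suff : `|- L * cos (c * L) + sin (c * L) / c| <= 2 * L by lra.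
rewrite mulr_natl mulr2n; apply: le_trans (ler_normD _ _) _; apply: lerD.
  rewrite normrM normrN (gtr0_norm L0); apply: ler_piMr; first exact: ltW.
  by rewrite ler_norml cos_geN1 cos_le1.
rewrite normrM normfV ler_pdivrMr ?normr_gt0//.
by apply: le_trans (norm_sin_le _) _; rewrite normrM (gtr0_norm L0) mulrC.
Qed.

End Tent.

Section Transform.
Context {R : realType}.
Notation mu := (@lebesgue_measure R).
Notation T1 := (measurableTypeR R).
Notation T2 := (T1 * T1)%type.
Notation mu2 := (@leb2 R).
Notation psub := (@Defs.csub R).
Implicit Types a W : T2 -> R.

Definition cosT a (xi : T2) : R := (\int[mu2]_y (a y * cos (2 * pi * dot y xi)))%R.
Definition sinT a (xi : T2) : R := (\int[mu2]_y (a y * sin (2 * pi * dot y xi)))%R.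
(** The squared modulus of the Fourier transform of a real function. *)
Definition powT a (xi : T2) : R := cosT a xi ^+ 2 + sinT a xi ^+ 2.

Let kc (x y : T2) : R := cos (2 * pi * dot x y).
Let ks (x y : T2) : R := sin (2 * pi * dot x y).

Lemma measurable_cos_dot : measurable_fun setT (fun p : T2 * T2 => cos (2 * pi * dot p.1 p.2)).
Proof. rewrite /dot; mfun. Qed.
Lemma measurable_sin_dot : measurable_fun setT (fun p : T2 * T2 => sin (2 * pi * dot p.1 p.2)).
Proof. rewrite /dot; mfun. Qed.
Lemma norm_cos_le1 (x : R) : `|cos x| <= 1.
Proof. by rewrite ler_norml cos_geN1 cos_le1. Qed.
Lemma norm_sin_le1 (x : R) : `|sin x| <= 1.
Proof. by rewrite ler_norml sin_geN1 sin_le1. Qed.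

Lemma measurable_cosT a : L1 mu2 a -> measurable_fun setT (cosT a).
Proof. move=> La; exact: (@measurable_ktrans R _ _ T2 T2 mu2 a La kc measurable_cos_dot). Qed.

Lemma measurable_sinT a : L1 mu2 a -> measurable_fun setT (sinT a).
Proof. move=> La; exact: (@measurable_ktrans R _ _ T2 T2 mu2 a La ks measurable_sin_dot). Qed.

Lemma measurable_powT a : L1 mu2 a -> measurable_fun setT (powT a).
Proof.
by move=> La; have h1 := measurable_cosT La; have h2 := measurable_sinT La; rewrite /powT; mfun.
Qed.

Lemma powT_ge0 a xi : 0 <= powT a xi.
Proof. by rewrite addr_ge0 ?sqr_ge0. Qed.

Lemma cosT_bound a xi : L1 mu2 a -> `|cosT a xi| <= (\int[mu2]_y `|a y|)%R.
Proof.
move=> La; exact: (@ktrans_bound R _ _ T2 T2 mu2 a La kc measurable_cos_dot (fun x y => norm_cos_le1 _)).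
Qed.

Lemma sinT_bound a xi : L1 mu2 a -> `|sinT a xi| <= (\int[mu2]_y `|a y|)%R.
Proof.
move=> La; exact: (@ktrans_bound R _ _ T2 T2 mu2 a La ks measurable_sin_dot (fun x y => norm_sin_le1 _)).
Qed.

Lemma kcorr_cosT W y y' : L1 mu2 W ->
  kcorr mu2 W kc y y' + kcorr mu2 W ks y y' = cosT W (psub y y').
Proof.
move=> LW; rewrite /kcorr -RintegralD//.
- apply: eq_Rintegral => x _; rewrite -mulrDr -cosB; congr (_ * cos _).
  by rewrite /dot /=; ring.
- apply: (L1_bmul (C := 1) LW) => [|x]; last by rewrite normrM mulr_ile1 ?norm_cos_le1.
  by rewrite /kc /dot; mfun.
- apply: (L1_bmul (C := 1) LW) => [|x]; last by rewrite normrM mulr_ile1 ?norm_sin_le1.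
  by rewrite /ks /dot; mfun.
Qed.

Lemma powT_parseval a W : L1 mu2 a -> L1 mu2 W ->
  (\int[mu2]_xi (W xi * powT a xi)%:E <=
   \int[mu2]_y \int[mu2]_y' (`|a y| * `|a y'| * `|cosT W (psub y y')|)%:E)%E.
Proof.
move=> La LW.
have := @parseval_le R _ _ T2 T2 mu2 mu2 kc ks a W measurable_cos_dot measurable_sin_dot
  (fun x y => norm_cos_le1 _) (fun x y => norm_sin_le1 _) La LW.
move=> /le_trans; apply.
rewrite le_eqVlt; apply/orP; left; apply/eqP; apply: eq_integral => y _; apply: eq_integral => y' _.
by rewrite kcorr_cosT.
Qed.

Lemma measurable_psubl (Q : T2 -> R) (y : T2) : measurable_fun setT Q ->
  measurable_fun setT (fun z => (Q (psub y z) / 2)%:E).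
Proof. by move=> mQ; rewrite /Defs.csub; mfun. Qed.

Lemma measurable_psubr (Q : T2 -> R) (y : T2) : measurable_fun setT Q ->
  measurable_fun setT (fun z => (Q (psub z y) / 2)%:E).
Proof. by move=> mQ; rewrite /Defs.csub; mfun. Qed.

End Transform.

Section Plancherel.
Context {R : realType}.
Notation mu := (@lebesgue_measure R).
Notation T1 := (measurableTypeR R).
Notation T2 := (T1 * T1)%type.
Notation mu2 := (@leb2 R).
Notation psub := (@Defs.csub R).

(** The Poisson kernel of the line at height [1 / k], times [pi]; its mass does not depend on the
    scale [k]. *)
Definition poisson (k : R) (t : T1) : R := k / (1 + (k * t) ^+ 2).

Lemma poisson_ge0 k t : 0 < k -> 0 <= poisson k t.
Proof. by move=> k0; rewrite divr_ge0 ?(ltW k0)// addr_ge0// sqr_ge0. Qed.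

Lemma measurable_poisson k : measurable_fun setT (poisson k).
Proof. rewrite /poisson; mfun. Qed.

Lemma integral_poisson k : 0 < k -> (\int[mu]_t (poisson k t)%:E <= pi%:E)%E.
Proof.
move=> k0.
pose I : set R := `]- (pi / 2), (pi / 2)[%classic.
have mI : measurable (I : set T1) by exact: measurable_itv.
have dn (t : R) : 0 < 1 + (k * t) ^+ 2 by rewrite ltr_pwDl// sqr_ge0.
have H := @integral_comp_le_T R (fun t => atan (k * t)) (fun t => k / (1 + (k * t) ^+ 2))
  (fun x => (\1_I x)%:E).
have -> : (pi%:E = \int[mu]_x (\1_I x)%:E)%E.
  transitivity (mu I); last by rewrite (@integral_indic _ T1)// setIT.
  have := @lebesgue_measure_itv R (`]- (pi / 2), (pi / 2)[).
  rewrite /= lte_fin gtrN ?divr_gt0 ?pi_gt0// => ->; rewrite -EFinB; congr (_%:E); lra.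
apply: le_trans (H _ _ _ _ _).
- apply: ge0_le_integral => //.
  + by move=> t _; rewrite lee_fin poisson_ge0.
  + by apply/measurable_EFinP; exact: measurable_poisson.
  + apply: emeasurable_funM; apply/measurable_EFinP; last exact: measurable_poisson.
    apply: (@measurableT_comp _ _ _ T1 T1 R (fun x => \1_I x) _ (fun t => atan (k * t))).
      exact: measurable_indic.
    apply: continuous_measurable_fun => t; apply: continuous_comp; last exact: continuous_atan.
    by apply: cvgM; [exact: cvg_cst|exact: cvg_id].
  + move=> t _; rewrite indicE mem_set ?mul1e//.
    by rewrite /I /= in_itv/= atan_gtNpi2 atan_ltpi2.
- move=> t; have := @is_derive1_comp R (@atan R) (fun t => k * t) t _ _ (is_derive1_atan _).
  move=> /(_ k); rewrite mulrC; apply.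
  by apply: is_derive_eq; rewrite /GRing.scale/= mulr1.
- by move=> t; rewrite divr_gt0.
- move=> t; apply: cvgM; first exact: cvg_cst.
  apply: cvgV; first by rewrite gt_eqF.
  apply: cvgD; first exact: cvg_cst.
  by apply: cvgM; apply: cvgM; by [exact: cvg_cst|exact: cvg_id].
- by apply/measurable_EFinP; exact: measurable_indic.
- by move=> x; rewrite lee_fin.
Qed.

Variable L : R.
Hypothesis L0 : 0 < L.

Definition tent2 (z : T2) : R := tent L z.1 * tent L z.2.

Lemma tent2_ge0 z : 0 <= tent2 z.
Proof. by rewrite mulr_ge0 ?tent_ge0. Qed.

Lemma L1_tent2 : L1 mu2 tent2.
Proof. by apply: L1_prod; exact: L1_tent. Qed.

(** The transform of a product splits; the sine parts vanish, and each cosine part is at most 5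
    times a normalised Poisson kernel, whence [25 = 5 * 5]. *)
Lemma cosT_tent2_le v : `|cosT tent2 v| <=
  25 * (poisson (2 * pi * L) v.1 / pi * (poisson (2 * pi * L) v.2 / pi)).
Proof.
have p0 : 0 < pi :> R by exact: pi_gt0.
pose u (b : R) (k : R -> R) (t : T1) : R := tent L t * k (2 * pi * b * t).
have Lc b : L1 mu (u b cos).
  apply: (@L1_bmul R _ T1 mu (tent L) (fun t => cos (2 * pi * b * t)) 1 (L1_tent L0)).
    by mfun.
  by move=> t; exact: norm_cos_le1.
have Ls b : L1 mu (u b sin).
  apply: (@L1_bmul R _ T1 mu (tent L) (fun t => sin (2 * pi * b * t)) 1 (L1_tent L0)).
    by mfun.
  by move=> t; exact: norm_sin_le1.
have -> : cosT tent2 v = (\int[mu]_x u v.1 cos x)%R * (\int[mu]_y u v.2 cos y)%R -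
   (\int[mu]_x u v.1 sin x)%R * (\int[mu]_y u v.2 sin y)%R.
  rewrite -!Rintegral_prod// -RintegralB//; [|exact: L1_prod|exact: L1_prod].
  apply: eq_Rintegral => z _; rewrite /tent2 /u.
  have -> : 2 * pi * dot z v = 2 * pi * v.1 * z.1 + 2 * pi * v.2 * z.2 by rewrite /dot; ring.
  by rewrite cosD; ring.
rewrite /u !tent_sin// mul0r subr0 normrM.
have b (s : R) : `|(\int[mu]_t (tent L t * cos (2 * pi * s * t)))%R| <= 5 * (poisson (2 * pi * L) s / pi).
  apply: le_trans (tent_cos_le L0 _) _; rewrite /poisson le_eqVlt; apply/orP; left; apply/eqP.
  have h (x : R) : 1 + x ^+ 2 != 0 by rewrite gt_eqF// ltr_pwDl// sqr_ge0.
  have h2 : pi != 0 :> R by rewrite gt_eqF.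
  have -> : L * (2 * pi * s) = 2 * pi * L * s by ring.
  move: (h (2 * pi * L * s)); set D := 1 + _ ^+ 2; clearbody D => D0.
  clear -D0 h2; move: (pi : R) h2 => q h2.
  by field; rewrite h2.
apply: (@le_trans _ _ (5 * (poisson (2 * pi * L) v.1 / pi) * (5 * (poisson (2 * pi * L) v.2 / pi)))).
  by apply: ler_pM.
by rewrite le_eqVlt; apply/orP; left; apply/eqP; ring.
Qed.

Let P (v : T2) : R := 25 * (poisson (2 * pi * L) v.1 / pi * (poisson (2 * pi * L) v.2 / pi)).

Let k0 : 0 < 2 * pi * L. Proof. by rewrite !mulr_gt0// pi_gt0. Qed.

Let P0 v : 0 <= P v.
Proof. by rewrite mulr_ge0// mulr_ge0// divr_ge0 ?pi_ge0 ?poisson_ge0. Qed.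

Let mP : measurable_fun setT P.
Proof. by have m := @measurable_poisson (2 * pi * L); rewrite /P; mfun. Qed.

Let IP : (\int[mu2]_v (P v)%:E <= 25%:E)%E.
Proof.
pose q t := poisson (2 * pi * L) t / pi.
have q0 t : 0 <= q t by rewrite divr_ge0 ?pi_ge0 ?poisson_ge0.
have mq : measurable_fun setT q.
  by have m := @measurable_poisson (2 * pi * L); rewrite /q; mfun.
have Iq : (\int[mu]_t (q t)%:E <= 1%:E)%E.
  have -> : (\int[mu]_t (q t)%:E = (pi^-1)%:E * \int[mu]_t (poisson (2 * pi * L) t)%:E)%E.
    rewrite -(@ge0_integralZl_EFin _ T1)//.
    - by apply: eq_integral => t _; rewrite -EFinM mulrC.
    - by move=> t _; rewrite lee_fin poisson_ge0.
    - by apply/measurable_EFinP; exact: measurable_poisson.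
    - by rewrite invr_ge0 pi_ge0.
  apply: (@le_trans _ _ ((pi^-1)%:E * pi%:E)%E).
    by apply: lee_wpmul2l; [rewrite lee_fin invr_ge0 pi_ge0|exact: integral_poisson].
  by rewrite -EFinM mulVf// gt_eqF ?pi_gt0.
rewrite (@leb2_tonelli R (fun v => (P v)%:E)); [|exact/measurable_EFinP|by move=> z; rewrite lee_fin].
apply: (@le_trans _ _ (\int[mu]_x (25%:E * (q x)%:E))%E).
  apply: ge0_le_integral => //.
  - by move=> x _; apply: integral_ge0 => y _; rewrite lee_fin.
  - apply: (@measurable_integral R _ _ T1 T1 mu (fun x y => (P (x, y))%:E)).
      by apply/measurable_EFinP; mfun.
    by move=> x y; rewrite lee_fin.
  - by mfun.
  move=> x _.
  have -> : (\int[mu]_y (P (x, y))%:E = (25 * q x)%:E * \int[mu]_y (q y)%:E)%E.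
    rewrite -(@ge0_integralZl_EFin _ T1)//.
    - by apply: eq_integral => t _; rewrite -EFinM -mulrA.
    - by move=> t _; rewrite lee_fin.
    - by apply/measurable_EFinP.
    - by rewrite mulr_ge0.
  rewrite -EFinM -[leRHS]mule1; apply: lee_wpmul2l => //.
  by rewrite lee_fin mulr_ge0.
rewrite (@ge0_integralZl_EFin _ T1)//; [|by move=> t _; rewrite lee_fin|exact/measurable_EFinP].
by rewrite -[leRHS]mule1; apply: lee_wpmul2l.
Qed.

(** Young's inequality for convolution with [P], a kernel of mass at most 25: the product of the
    values at [y] and [y'] is replaced by half the sum of the squares, and each half is integrated
    in the free variable first. The bound is independent of [L]. *)
Lemma tent2_plancherel (a : T2 -> R) : L1 mu2 a ->
  (\int[mu2]_xi (tent2 xi * powT a xi)%:E <= 25%:E * \int[mu2]_y (a y ^+ 2)%:E)%E.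
Proof.
move=> La; have ma := L1_measurable La.
apply: le_trans (powT_parseval La L1_tent2) _.
pose G (y y' : T2) : \bar R := ((a y ^+ 2)%:E * (P (psub y y') / 2)%:E)%E.
pose H (y y' : T2) : \bar R := ((a y' ^+ 2)%:E * (P (psub y y') / 2)%:E)%E.
have mPs : measurable_fun setT (fun p : T2 * T2 => P (psub p.1 p.2)).
  by rewrite /Defs.csub; mfun.
have mG : measurable_fun setT (fun p : T2 * T2 => G p.1 p.2) by rewrite /G; mfun.
have mH : measurable_fun setT (fun p : T2 * T2 => H p.1 p.2) by rewrite /H; mfun.
have G0 y y' : (0 <= G y y')%E by rewrite mule_ge0// lee_fin ?sqr_ge0// divr_ge0.
have H0 y y' : (0 <= H y y')%E by rewrite mule_ge0// lee_fin ?sqr_ge0// divr_ge0.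
have ma2 : measurable_fun setT (fun y => (a y ^+ 2)%:E).
  by apply/measurable_EFinP; exact: measurable_funX.
have mPl y := measurable_psubl y mP; have mPr y := measurable_psubr y mP.
have mGy y : measurable_fun setT (G y) by apply: emeasurable_funM; [exact: measurable_cst|exact: mPl].
have mHy y : measurable_fun setT (H y) by apply: emeasurable_funM; [exact: ma2|exact: mPl].
have mIG := @measurable_integral R _ _ T2 T2 mu2 G mG G0.
have mIH := @measurable_integral R _ _ T2 T2 mu2 H mH H0.
have IP2 : (\int[mu2]_v (P v / 2)%:E <= (25 / 2)%:E)%E.
  have -> : (\int[mu2]_v (P v / 2)%:E = 2^-1%:E * \int[mu2]_v (P v)%:E)%E.
    rewrite -(@ge0_integralZl_EFin _ T2)//.
    - by apply: eq_integral => t _; rewrite -EFinM mulrC.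
    - by move=> t _; rewrite lee_fin.
    - exact/measurable_EFinP.
  by rewrite EFinM muleC; apply: lee_wpmul2r.
have mP2 : measurable_fun setT (fun v => (P v / 2)%:E).
  by apply/measurable_EFinP; exact: measurable_funM.
have P20 v : (0 <= (P v / 2)%:E)%E by rewrite lee_fin divr_ge0.
have IG : (\int[mu2]_y \int[mu2]_y' G y y' <= (25 / 2)%:E * \int[mu2]_y (a y ^+ 2)%:E)%E.
  rewrite -(@ge0_integralZl_EFin _ T2)//; last by move=> y _; rewrite lee_fin sqr_ge0.
  apply: ge0_le_integral => //.
  - by move=> y _; apply: integral_ge0.
  - by mfun.
  move=> y _; rewrite /G (@ge0_integralZl_EFin _ T2)//; first last.
  - exact: sqr_ge0.
  - exact: mPl.
  rewrite (@integral2_csub R y (fun v => (P v / 2)%:E))// muleC.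
  by apply: lee_wpmul2r => //; rewrite lee_fin sqr_ge0.
have IH : (\int[mu2]_y \int[mu2]_y' H y y' <= (25 / 2)%:E * \int[mu2]_y (a y ^+ 2)%:E)%E.
  rewrite (@tonelli R _ _ T2 T2 mu2 mu2 H mH H0).
  rewrite -(@ge0_integralZl_EFin _ T2)//; last by move=> y _; rewrite lee_fin sqr_ge0.
  apply: ge0_le_integral => //.
  - by move=> y _; apply: integral_ge0.
  - apply: (@measurable_integral R _ _ T2 T2 mu2 (fun y' y => H y y')) => //.
    by rewrite /H /Defs.csub; mfun.
  - by mfun.
  move=> y' _; rewrite /H (@ge0_integralZl_EFin _ T2)//; first last.
  - exact: sqr_ge0.
  - exact: mPr.
  have := @integral2_shift R (- y'.1, - y'.2) (fun v => (P v / 2)%:E) mP2 P20.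
  rewrite /Defs.cadd /Defs.csub /= => ->; rewrite muleC.
  by apply: lee_wpmul2r => //; rewrite lee_fin sqr_ge0.
apply: (@le_trans _ _ (\int[mu2]_y (\int[mu2]_y' G y y' + \int[mu2]_y' H y y'))%E); last first.
  rewrite (@ge0_integralD _ T2)//; [|by move=> y _; apply: integral_ge0|by move=> y _; apply: integral_ge0].
  have -> : 25%:E = (25 / 2 + 25 / 2)%:E :> \bar R by congr (_%:E); lra.
  have c0 : (0 <= (25 / 2)%:E :> \bar R)%E by rewrite lee_fin divr_ge0.
  by rewrite EFinD (ge0_muleDl _ c0 c0); exact: leeD.
have mcT := measurable_cosT L1_tent2.
apply: ge0_le_integral => //.
- by move=> y _; apply: integral_ge0 => y' _; rewrite lee_fin !mulr_ge0.
- apply: (@measurable_integral R _ _ T2 T2 mu2 (fun y y' => (`|a y| * `|a y'| * `|cosT tent2 (psub y y')|)%:E)).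
    by rewrite /Defs.csub; mfun.
  by move=> y y'; rewrite lee_fin !mulr_ge0.
- exact: emeasurable_funD.
move=> y _; rewrite -(@ge0_integralD _ T2)//.
apply: ge0_le_integral => //.
- by rewrite /Defs.csub; mfun.
- by apply: emeasurable_funD; [exact: mGy|exact: mHy].
move=> y' _; rewrite /G /H -!EFinM -EFinD lee_fin.
apply: (@le_trans _ _ (`|a y| * `|a y'| * P (psub y y'))).
  by apply: ler_wpM2l; [rewrite mulr_ge0|exact: cosT_tent2_le].
have -> : a y ^+ 2 * (P (psub y y') / 2) + a y' ^+ 2 * (P (psub y y') / 2) =
  (a y ^+ 2 + a y' ^+ 2) / 2 * P (psub y y') by ring.
apply: ler_wpM2r => //.
rewrite -[a y ^+ 2]real_normK ?num_real// -[a y' ^+ 2]real_normK ?num_real//.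
have := sqr_ge0 (`|a y| - `|a y'|); rewrite sqrrB; lra.
Qed.

End Plancherel.

Lemma integral_exhaust {R : realType} d (T : measurableType d) (m : {measure set T -> \bar R})
   (W : nat -> T -> R) (F : T -> \bar R) (C : \bar R) :
  measurable_fun setT F -> (forall x, 0 <= F x)%E ->
  (forall n, measurable_fun setT (W n)) -> (forall n x, 0 <= W n x) ->
  (forall x, W n x @[n --> \oo] --> (1:R)) ->
  (forall n, \int[m]_x ((W n x)%:E * F x) <= C)%E ->
  (\int[m]_x F x <= C)%E.
Proof.
move=> mF F0 mW W0 W1 H.
have mWF n : measurable_fun setT (fun x => (W n x)%:E * F x)%E by apply: emeasurable_funM => //; exact/measurable_EFinP.
have E x : (F x = limn_einf (fun n => (W n x)%:E * F x))%E.
  have c : ((W n x)%:E * F x @[n --> \oo] --> 1%:E * F x)%E.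
    apply: cvgeM.
    - by rewrite /mule_def; case: (F x) => [z||] /=; rewrite ?mulr1 ?eqe ?oner_eq0 ?andbF ?orbF ?eqxx//=.
    - by apply: cvg_EFin; [exact: nearW|exact: W1].
    - exact: cvg_cst.
  by rewrite is_cvg_limn_einfE; [rewrite (cvg_lim _ c)// mul1e|apply/cvg_ex; eexists; exact: c].
rewrite (@eq_integral _ _ _ m _ _ _ (fun x _ => E x)).
apply: (@le_trans _ _ (limn_einf (fun n => \int[m]_x ((W n x)%:E * F x))%E)).
  by apply: fatou => // n x _; rewrite mule_ge0// lee_fin.
rewrite limn_einf_lim; apply: lime_le; first exact: is_cvg_einfs.
apply: nearW => n; apply: le_trans (H n); apply: ereal_inf_lbound.
by exists n => /=.
Qed.

Section PlancherelLimit.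
Context {R : realType}.
Notation T1 := (measurableTypeR R).
Notation T2 := (T1 * T1)%type.
Notation mu2 := (@leb2 R).

Lemma tent_cvg1 (t : T1) : tent (n.+1%:R : R) t @[n --> \oo] --> (1 : R).
Proof.
have c : (1 - (t * n.+1%:R^-1) ^+ 2 : R) @[n --> \oo] --> (1 : R).
  rewrite -[X in _ --> X](subr0 1); apply: cvgB; first exact: cvg_cst.
  rewrite -[X in _ --> X](_ : (t * 0) ^+ 2 = 0); last by rewrite mulr0 expr0n.
  apply: cvgM; apply: cvgM; by [exact: cvg_cst|exact: cvg_harmonic].
apply: cvg_trans c; apply: near_eq_cvg; near=> n; rewrite tent_itv//.
rewrite in_itv/= -ler_norml; apply: (@le_trans _ _ n%:R); last by rewrite ler_nat.
by near: n; exact: nbhs_infty_ger.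
Unshelve. all: by end_near. Qed.

(** The constant 25 in place of 1 is harmless for the level set estimate; in exchange neither an
    inversion formula nor a density argument enters. *)
Lemma plancherel_le (a : T2 -> R) : L1 mu2 a ->
  (\int[mu2]_xi (powT a xi)%:E <= 25%:E * \int[mu2]_y (a y ^+ 2)%:E)%E.
Proof.
move=> La.
apply: (@integral_exhaust R _ T2 mu2 (fun n => tent2 n.+1%:R)).
- by apply/measurable_EFinP; exact: measurable_powT.
- by move=> x; rewrite lee_fin powT_ge0.
- by move=> n; exact: L1_measurable (L1_tent2 _).
- by move=> n x; exact: tent2_ge0.
- move=> x; rewrite -[X in _ --> X]mulr1; apply: cvgM; exact: tent_cvg1.
- by move=> n; under eq_integral do rewrite -EFinM; exact: tent2_plancherel.
Qed.

End PlancherelLimit.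

Lemma measurable_indb {R : realType} d (T : measurableType d) (b : T -> bool) :
  measurable_fun setT b -> measurable_fun setT (fun x => (b x)%:R : R).
Proof.
by move=> mb; apply: (@measurableT_comp _ _ _ _ _ _ (fun b : bool => b%:R : R) _ b).
Qed.

(** * Level sets and strong bounds for the transform *)

Section LayerCake.
Context {R : realType} d (T : measurableType d) (m : {measure set T -> \bar R}).

(** One factor [q ^+ j] pays for the linear weight, by Bernoulli's inequality for [q^-1 = 1 + e];
    the other is summed as a geometric series. *)
Lemma geometric_weight_bound (q : R) (n : nat) : 0 < q -> q < 1 ->
  \sum_(j < n) (2 + j%:R) * (q * q) ^+ j <= (2 + q / (1 - q)) / (1 - q).
Proof.
move=> q0 q1; have u0 : 0 < 1 - q by rewrite subr_gt0.
pose e := (1 - q) / q.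
have e0 : 0 < e by rewrite divr_gt0.
have bern (j : nat) : j%:R * e * q ^+ j <= 1.
  rewrite -ler_pdivlMr ?exprn_gt0// mul1r -exprVn.
  have -> : q^-1 = 1 + e by rewrite /e; field; rewrite gt_eqF.
  elim: j => [|j IH]; first by rewrite mul0r expr0 ler01.
  have w1 : 1 <= (1 + e) ^+ j by rewrite exprn_ege1// lerDl ltW.
  rewrite exprS -natr1 mulrDl mul1r mulrDl mul1r; apply: lerD => //.
  by rewrite -[leLHS]mulr1; apply: ler_wpM2l => //; exact: ltW.
have b (j : nat) : (2 + j%:R) * (q * q) ^+ j <= (2 + q / (1 - q)) * q ^+ j.
  rewrite exprMn mulrA ler_wpM2r ?exprn_ge0 ?(ltW q0)// mulrDl; apply: lerD.
    by rewrite -[leRHS]mulr1 ler_wpM2l// exprn_ile1 ?ltW.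
  have := bern j.
  have -> : q / (1 - q) = 1 / e by rewrite /e mul1r invfM invrK mulrC.
  by rewrite mulrAC -ler_pdivlMr.
apply: (@le_trans _ _ (\sum_(j < n) (2 + q / (1 - q)) * q ^+ j)).
  by apply: ler_sum => j _; exact: b.
rewrite -mulr_sumr; apply: ler_wpM2l.
  by rewrite addr_ge0// divr_ge0 ?(ltW q0)// ltW.
have E : (1 - q) * \sum_(j < n) q ^+ j = 1 - q ^+ n.
  by rewrite -[LHS]opprK -mulNr opprB -subrX1 opprB.
rewrite -[leRHS]mul1r ler_pdivlMr// mulrC E lerBlDr lerDl.
by rewrite exprn_ge0// ltW.
Qed.

(** Shells in ratio 4: the sum has terms of order (1 + j) times the j-th power of 16 / 4^h, and
    [h > 2] makes this ratio smaller than 1. The constant is produced before [P], which is the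
    uniformity needed later. *)
Lemma layer_cake (B h D : R) : 0 < B -> 2 < h -> 0 <= D -> exists C : R, forall P : T -> R,
  measurable_fun setT P -> (forall x, 0 <= P x <= B) ->
  (forall j : nat, \int[m]_x ((B * 4^-1 ^+ j < P x)%R%:R)%:E <= (D * (1 + j%:R) * 16 ^+ j)%:E)%E ->
  (\int[m]_x (P x `^ h)%:E <= C%:E)%E.
Proof.
move=> B0 h2 D0.
pose th := 4^-1 `^ h.
have th0 : 0 < th by rewrite powR_gt0.
pose q := Num.sqrt (16 * th).
have q0 : 0 < q by rewrite sqrtr_gt0 mulr_gt0.
have qq : q * q = 16 * th by rewrite -expr2 sqr_sqrtr// ltW// mulr_gt0.
have th1 : 16 * th < 1.
  have : th < 4^-1 `^ 2.
    have -> : th = 4^-1 `^ 2 * 4^-1 `^ (h - 2).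
      by rewrite /th -powRD ?subrKC// invr_eq0 pnatr_eq0 implybT.
    rewrite -[ltRHS]mulr1 ltr_pM2l ?powR_gt0//.
    have k0 : 0 < h - 2 by rewrite subr_gt0.
    have k1 : 4^-1 < 1 :> R by rewrite invf_lt1// ltr1n.
    have := @gt0_ltr_powR R (h - 2) k0 4^-1 1.
    by rewrite powR1; apply; rewrite ?nnegrE.
  rewrite powR_mulrn// => h3; have e16 : 16 * (4^-1 ^+ 2) = 1 :> R by field.
  by rewrite -[ltRHS]e16 ltr_pM2l.
have q1 : q < 1.
  by rewrite -(ltr_pXn2r (n := 2))// ?nnegrE ?ltW// expr2 qq expr1n.
(* The factor 16, and the weight [2 + j] further down, come from applying the level estimate at
   [j.+1] to the shell between [B * 4^-1 ^+ j.+1] and [B * 4^-1 ^+ j]. *)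
pose K := B `^ h * D * 16.
have K0 : 0 <= K by rewrite !mulr_ge0// powR_ge0.
exists (K * ((2 + q / (1 - q)) / (1 - q))) => P mP PB Pj.
pose E j x := (B * 4^-1 ^+ j.+1 < P x)%R.
have mE j : measurable_fun setT (E j) by apply: measurable_fun_ltr.
pose c j := B `^ h * th ^+ j.
have c0 j : 0 <= c j by rewrite mulr_ge0 ?powR_ge0// exprn_ge0// ltW.
pose F j x : \bar R := (c j * (E j x)%:R)%:E.
have F0 j x : (0 <= F j x)%E by rewrite lee_fin mulr_ge0.
have mF j : measurable_fun setT (F j).
  by apply/measurable_EFinP; apply: measurable_funM => //; exact: measurable_indb.
apply: (@le_trans _ _ (\int[m]_x \sum_(0 <= j <oo) F j x)%E).
  apply: ge0_le_integral => //.
  - by move=> x _; rewrite lee_fin powR_ge0.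
  - by apply/measurable_EFinP; apply: (@measurableT_comp _ _ _ _ _ _ (@powR R ^~ h)) => //; exact: measurable_powR.
  - exact: ge0_emeasurable_sum.
  move=> x _; have /andP[P0 P1] := PB x.
  move: P0; rewrite le_eqVlt => /predU1P[<-|P0].
    by rewrite powR0 ?gt_eqF ?(lt_trans _ h2)//; apply: nneseries_ge0.
  have exE : exists j, (fun j => E j x) j.
    have cv : (4^-1 : R) ^+ n @[n --> \oo] --> (0 : R).
      by apply: cvg_expr; rewrite ger0_norm// invf_lt1// ltr1n.
    have : \forall n \near \oo, (4^-1 : R) ^+ n < P x / B.
      by apply: (cvgr_lt 0 cv); rewrite divr_gt0.
    case=> n _ /(_ n.+1 (leqnSn n)) /= h3; exists n; rewrite /E mulrC.
    by rewrite -ltr_pdivlMr.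
  have [j0 Ej0 minj] := find_ex_minn exE.
  have Pj0 : P x <= B * 4^-1 ^+ j0.
    case: j0 Ej0 minj => [|j0] Ej0 minj; first by rewrite expr0 mulr1.
    by rewrite leNgt; apply/negP => /minj; rewrite ltnn.
  apply: (@le_trans _ _ (F j0 x)); last first.
    apply: le_trans (nneseries_lim_ge (P := xpredT) (m := 0) j0.+1 _); last by move=> *; exact: F0.
    by rewrite big_nat_recr//= leeDr// sume_ge0.
  rewrite lee_fin Ej0 mulr1.
  apply: (@le_trans _ _ ((B * 4^-1 ^+ j0) `^ h)).
    by apply: ge0_ler_powR; rewrite ?nnegrE ?mulr_ge0 ?exprn_ge0 ?(ltW B0) ?(ltW P0)// ltW// (lt_trans _ h2).
  rewrite powRM ?exprn_ge0 ?(ltW B0)// /c /th ler_wpM2l ?powR_ge0//.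
  by rewrite -!powR_mulrn ?powR_ge0// -!powRrM mulrC.
rewrite integral_nneseries//.
apply: lime_le; first by apply: is_cvg_nneseries => j _ _; exact: integral_ge0.
apply: nearW => n; rewrite big_mkord.
apply: (@le_trans _ _ (\sum_(j < n) (K * ((2 + j%:R) * (q * q) ^+ j))%:E)%E).
  apply: lee_sum => j _.
  rewrite /F; under eq_integral do rewrite EFinM.
  rewrite ge0_integralZl_EFin//; last by apply/measurable_EFinP; exact: measurable_indb.
  apply: le_trans (lee_wpmul2l _ (Pj j.+1)) _; rewrite ?lee_fin//.
  rewrite /K /c qq exprMn -natr1 (exprS 16).
  by rewrite le_eqVlt; apply/orP; left; apply/eqP; ring.
rewrite sumEFin lee_fin -mulr_sumr ler_wpM2l//; exact: geometric_weight_bound.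
Qed.

End LayerCake.

Section Pairing.
Context {R : realType} d (T : measurableType d) (m : {measure set T -> \bar R}).
Local Open Scope ereal_scope.

(** Where [G > M], the bound [e <= N] is used and [G] is [1 / M] times the truncated square. Where
    [G <= M], the truncated square is [G * G], and the inequality of arithmetic and geometric means
    with parameter [eta] separates [G] from [e]. *)
Lemma truncated_pairing (G : T -> \bar R) (e : T -> R) (N M eta X Q : R) :
  measurable_fun setT G -> (forall x, 0 <= G x) -> measurable_fun setT e ->
  (forall x, (0 <= e x)%R) -> (forall x, (e x <= N)%R) -> (0 <= N)%R -> (0 < M)%R -> (0 < eta)%R ->
  \int[m]_x (G x * mine (G x) M%:E) <= X%:E -> \int[m]_x (e x ^+ 2)%:E <= Q%:E ->
  \int[m]_x (G x * (e x)%:E) <= (N / M * X + X / (2 * eta) + eta / 2 * Q)%:E.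
Proof.
move=> mG G0 me e0 eN N0 M0 eta0 HX HQ.
pose H x := G x * mine (G x) M%:E.
have mH : measurable_fun setT H by apply: emeasurable_funM => //; exact: measurable_mine.
have H0 x : 0 <= H x by rewrite mule_ge0// le_min G0 lee_fin ltW.
have me2 : measurable_fun setT (fun x => (e x ^+ 2)%:E) by mfun.
have k0 : (0 <= N / M + (2 * eta)^-1)%R.
  by rewrite addr_ge0 ?divr_ge0 ?invr_ge0 ?mulr_ge0// ltW.
apply: (@le_trans _ _ (\int[m]_x ((N / M + (2 * eta)^-1)%:E * H x + (eta / 2)%:E * (e x ^+ 2)%:E))).
  apply: ge0_le_integral => //.
  - by move=> x _; rewrite mule_ge0// lee_fin.
  - by mfun.
  - by apply: emeasurable_funD; apply: emeasurable_funM.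
  move=> x _; rewrite /H.
  have s1 := G0 x; have s2 := e0 x; have s3 := eN x.
  case: (leP (G x) M%:E) => GM.
    have Gf : G x \is a fin_num by rewrite ge0_fin_numE// (le_lt_trans GM) ?ltry.
    rewrite -(fineK Gf) in s1 *; move: (fine (G x)) s1 => g; rewrite lee_fin => g0.
    rewrite -!EFinM -EFinD lee_fin mulrDl.
    have : (0 <= N / M * (g * g))%R by have M1 := ltW M0; rewrite mulr_ge0 ?divr_ge0 ?mulr_ge0.
    have : (0 <= (2 * eta)^-1 * (g - eta * e x) ^+ 2)%R.
      by rewrite mulr_ge0 ?sqr_ge0// invr_ge0 mulr_ge0// ltW.
    have -> : ((2 * eta)^-1 * (g - eta * e x) ^+ 2 = (2 * eta)^-1 * (g * g) - g * e x + eta / 2 * e x ^+ 2)%R.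
      by field; rewrite gt_eqF.
    by lra.
  apply: (@le_trans _ _ ((N / M)%:E * (G x * M%:E))).
    rewrite muleCA -EFinM divfK ?gt_eqF//; apply: lee_wpmul2l => //.
  rewrite -[leLHS]adde0; apply: leeD; last by rewrite mule_ge0// lee_fin ?divr_ge0 ?sqr_ge0// ltW.
  apply: lee_wpmul2r; first by rewrite mule_ge0// lee_fin ltW.
  by rewrite lee_fin lerDl invr_ge0 mulr_ge0// ltW.
rewrite ge0_integralD//; first last.
- exact: emeasurable_funM.
- by move=> x _; rewrite mule_ge0// lee_fin ?divr_ge0 ?sqr_ge0// ltW.
- exact: emeasurable_funM.
- by move=> x _; rewrite mule_ge0.
rewrite !ge0_integralZl_EFin//; first last.
- by rewrite divr_ge0// ltW.
- by move=> x _; rewrite lee_fin sqr_ge0.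
apply: (@le_trans _ _ ((N / M + (2 * eta)^-1)%:E * X%:E + (eta / 2)%:E * Q%:E)).
  by apply: leeD; apply: lee_wpmul2l => //; rewrite lee_fin divr_ge0// ltW.
by rewrite -!EFinM -EFinD lee_fin mulrDl (mulrC X).
Qed.

End Pairing.

Section StrongBound.
Context {R : realType}.
Notation mu := (@lebesgue_measure R).
Notation T1 := (measurableTypeR R).
Notation T2 := (T1 * T1)%type.
Notation mu2 := (@leb2 R).
Notation psub := (@Defs.csub R).

Lemma cosT_psubC (W : T2 -> R) (y z : T2) : cosT W (psub y z) = cosT W (psub z y).
Proof.
apply: eq_Rintegral => x _; rewrite -cosN; congr (_ * cos _).
by rewrite /dot /=; ring.
Qed.

(** Each of the two real transforms is bounded by the bound [8 * pi] for the mass of [Kc r]. *)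
Definition supB : R := 2 * (8 * pi) ^+ 2.

Section OneRadius.
Variables (r : T1 -> R) (s : seq R).
Hypothesis mr : measurable_fun setT r.
Hypothesis s0 : forall x, x \in s -> 0 < x.
Hypothesis rs : forall t, r t \in s.
Let r0 t : 0 < r t. Proof. exact/s0/rs. Qed.
Variable a : T2 -> R.
Hypothesis ma : measurable_fun setT a.
Hypothesis aK : forall y, (`|a y|%:E <= Kc r y)%E.

Lemma Kdom_integral : (\int[mu2]_y `|a y|%:E <= (8 * pi)%:E)%E.
Proof.
apply: le_trans (integral_Kc_le mr r0); apply: ge0_le_integral => //.
- by apply/measurable_EFinP; exact: measurableT_comp.
- exact: measurable_Kc.
Qed.

Lemma Kdom_L1 : L1 mu2 a.
Proof. by apply: L1P => //; apply: le_lt_trans Kdom_integral (ltry _). Qed.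

Lemma Kdom_Rint : (\int[mu2]_y `|a y|)%R <= 8 * pi.
Proof. by rewrite -lee_fin EFin_Rint ?Kdom_integral//; exact: L1_norm Kdom_L1. Qed.

Lemma Kdom_powT_le xi : powT a xi <= supB.
Proof.
have h := Kdom_Rint.
have c1 := le_trans (cosT_bound xi Kdom_L1) h.
have c2 := le_trans (sinT_bound xi Kdom_L1) h.
rewrite /powT /supB mulr_natl mulr2n; apply: lerD.
  by rewrite -[leLHS]real_normK ?num_real// lerXn2r ?nnegrE// (le_trans _ c1).
by rewrite -[leLHS]real_normK ?num_real// lerXn2r ?nnegrE// (le_trans _ c1).
Qed.

Let box (n : nat) (x : T2) : bool := near2 n.+1%:R (0, 0) x.

Let mbox n : measurable_fun setT (box n).
Proof.
apply: (@measurableT_comp _ _ _ _ _ _ (fun p : R * (T2 * T2) => near2 p.1 p.2.1 p.2.2) _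
  (fun x : T2 => (n.+1%:R, ((0, 0) : T2, x)))); [exact: near2_measurable|mfun].
Qed.

(** Here [lam] is a level of the squared modulus. Let [e] be the indicator of a bounded piece of the
    level set, of measure [N]. By Parseval and [|a| <= Kc r], [lam * N] is at most the pairing of
    [Gam] with the transform of [e]; that transform is bounded by [N] and has square integral at
    most [25 * N], so [truncated_pairing] applies. *)
Lemma weak_bound (lam M : R) : 0 < lam -> 0 < M ->
  CGam * (1 + ln (1 + M)) <= M * lam / 4 ->
  (\int[mu2]_x ((lam < powT a x)%R%:R)%:E <= (50 * (CGam * (1 + ln (1 + M))) / lam ^+ 2)%:E)%E.
Proof.
move=> l0 M0 cond; set X := CGam * _ in cond *.
have La := Kdom_L1.
have mp := measurable_powT La.
have mlt : measurable_fun setT (fun x => lam < powT a x) by apply: measurable_fun_ltr.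
(* The level set is cut by boxes so that [N] is a number before any bound for it is known. *)
apply: (@integral_exhaust R _ T2 mu2 (fun n x => (box n x)%:R)).
- by apply/measurable_EFinP; exact: measurable_indb.
- by move=> x; rewrite lee_fin.
- by move=> n; exact: measurable_indb.
- by [].
- move=> x; apply: cvg_near_cst; near=> n.
  suff -> : box n x by [].
  rewrite /box /near2 !sub0r !normrN; apply/andP; split.
    apply: (@le_lt_trans _ _ n%:R); last by rewrite ltr_nat.
    by near: n; exact: nbhs_infty_ger.
  apply: (@le_lt_trans _ _ n%:R); last by rewrite ltr_nat.
  by near: n; exact: nbhs_infty_ger.
move=> n; pose E x := box n x && (lam < powT a x).
have mE : measurable_fun setT E by apply: measurable_and.
pose e x : R := (E x)%:R.
have me : measurable_fun setT e by exact: measurable_indb.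
have e0 x : 0 <= e x by rewrite ler0n.
have Ie : (\int[mu2]_x (e x)%:E <= (4 * n.+1%:R ^+ 2)%:E)%E.
  apply: le_trans (@near2_growth R n.+1%:R (0, 0) _); last by rewrite ltr0n.
  apply: ge0_le_integral => //.
  - by move=> x _; rewrite lee_fin.
  - by apply/measurable_EFinP.
  - by apply/measurable_EFinP; exact: (@measurable_indb R _ T2 (box n) (mbox n)).
  - by move=> x _; rewrite lee_fin /e /E /box; case: (near2 _ _ _) => //=; case: (_ < _).
have Le : L1 mu2 e.
  apply: L1P => //; under eq_integral do rewrite ger0_norm//.
  by apply: le_lt_trans Ie (ltry _).
pose N := (\int[mu2]_x e x)%R.
have EN : (\int[mu2]_x (e x)%:E = N%:E)%E by rewrite /N EFin_Rint.
have -> : (\int[mu2]_x ((box n x)%:R%:E * (lam < powT a x)%R%:R%:E) = N%:E)%E.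
  rewrite -EN; apply: eq_integral => x _; rewrite -EFinM /e /E.
  by case: (box n x); case: (_ < _); rewrite ?mulr0 ?mul0r ?mulr1.
have N0 : 0 <= N by rewrite -lee_fin -EN; apply: integral_ge0 => x _; rewrite lee_fin.
have eN x : `|cosT e x| <= N.
  apply: le_trans (cosT_bound x Le) _; rewrite le_eqVlt; apply/orP; left; apply/eqP.
  by apply: eq_Rintegral => y _; rewrite ger0_norm.
have mce := measurable_cosT Le.
have Q : (\int[mu2]_x (`|cosT e x| ^+ 2)%:E <= (25 * N)%:E)%E.
  apply: (@le_trans _ _ (\int[mu2]_x (powT e x)%:E)%E).
    apply: ge0_le_integral => //.
    - by mfun.
    - by apply/measurable_EFinP; exact: measurable_powT.
    - by move=> x _; rewrite lee_fin real_normK ?num_real// /powT lerDl sqr_ge0.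
  apply: le_trans (plancherel_le Le) _; rewrite EFinM -EN.
  rewrite le_eqVlt; apply/orP; left; apply/eqP; congr (_ * _)%E.
  by apply: eq_integral => x _; rewrite /e; case: (E x); rewrite ?expr1n ?expr0n.
have mG := measurable_Gam mr.
(* With [eta = lam / 50] the term [eta / 2 * (25 * N)] is [lam * N / 4]. The hypothesis on [M]
   bounds the first term by another [lam * N / 4], and half of the left-hand side remains. *)
have eta0 : 0 < lam / 50 by rewrite divr_gt0.
have pair := @truncated_pairing R _ T2 mu2 (Gam r) (fun x => `|cosT e x|) N M (lam / 50) X (25 * N)
  mG (@Gam_ge0 R r) (measurableT_comp (@normr_measurable R setT) mce) (fun x => normr_ge0 _) eN N0 M0 eta0
  (Gam_trunc_le mr s0 rs M0) Q.
have low : ((lam * N)%:E <= \int[mu2]_x (e x * powT a x)%:E)%E.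
  rewrite EFinM -EN -(@ge0_integralZl_EFin _ T2)//; last by rewrite ltW.
  - apply: ge0_le_integral => //.
    + by move=> x _; rewrite mule_ge0 ?lee_fin ?e0 ?(ltW l0).
    + by apply: emeasurable_funM => //; exact/measurable_EFinP.
    + by apply/measurable_EFinP; exact: measurable_funM.
    move=> x _; rewrite -EFinM lee_fin mulrC /e /E.
    case: (box n x) => /=; rewrite ?mul0r//.
    by case: (ltP lam) => [h|_]; rewrite ?mul0r// !mul1r ltW.
  - by move=> x _; rewrite lee_fin.
  - exact/measurable_EFinP.
have upp : (\int[mu2]_x (e x * powT a x)%:E <= \int[mu2]_v (Gam r v * `|cosT e v|%:E))%E.
  apply: le_trans (powT_parseval La Le) _.
  rewrite (@integral_Gam R r mr (fun v => `|cosT e v|%:E))//; last first.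
    by apply/measurable_EFinP; exact: measurableT_comp.
  have mKF : measurable_fun setT (fun p : T2 * T2 => Kc r p.2 * `|cosT e (psub p.2 p.1)|%:E)%E.
    have mK := measurable_Kc mr; rewrite /Defs.csub; mfun.
  have mK := measurable_Kc mr.
  have KF0 y z : (0 <= Kc r z * `|cosT e (psub z y)|%:E)%E by rewrite mule_ge0// Kc_ge0.
  apply: ge0_le_integral => //.
  - by move=> y _; apply: integral_ge0 => z _; rewrite lee_fin !mulr_ge0.
  - apply: (@measurable_integral R _ _ T2 T2 mu2 (fun y y' => (`|a y| * `|a y'| * `|cosT e (psub y y')|)%:E)).
      by rewrite /Defs.csub; mfun.
    by move=> y y'; rewrite lee_fin !mulr_ge0.
  - apply: emeasurable_funM => //.
    exact: (@measurable_integral R _ _ T2 T2 mu2 (fun y z => Kc r z * `|cosT e (psub z y)|%:E)%E).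
  move=> y _.
  apply: (@le_trans _ _ (`|a y|%:E * \int[mu2]_z (Kc r z * `|cosT e (psub z y)|%:E))%E); last first.
    by apply: lee_wpmul2r => //; apply: integral_ge0 => z _; exact: KF0.
  rewrite -(@ge0_integralZl_EFin _ T2)//; first last.
  - by rewrite /Defs.csub; mfun.
  apply: ge0_le_integral => //.
  - by rewrite /Defs.csub; mfun.
  - by rewrite /Defs.csub; mfun.
  move=> z _; rewrite cosT_psubC -mulrA !EFinM; apply: lee_wpmul2l => //.
  by apply: lee_wpmul2r.
have := le_trans low (le_trans upp pair); rewrite lee_fin => fin.
rewrite lee_fin ler_pdivlMr ?exprn_gt0//.
have fN : N / M * X <= N * (lam / 4).
  rewrite -mulrA ler_wpM2l// mulrC ler_pdivrMr// mulrC.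
  by move: cond; rewrite mulrA.
have g : lam * N / 2 <= X * 25 / lam.
  move: fin fN.
  have -> : X / (2 * (lam / 50)) = X * 25 / lam by field; rewrite gt_eqF.
  by lra.
have : lam * N / 2 * lam <= X * 25 by rewrite -ler_pdivlMr.
by rewrite expr2; lra.
Unshelve. all: by end_near. Qed.

End OneRadius.

(** The levels are those of [layer_cake] with [B = supB]. The truncation height grows like [8 ^ j],
    so that [M * lam] grows like [2 ^ j] and dominates the logarithm, itself linear in [j]; the
    latter is the factor [1 + j] of the level estimate. *)
Lemma strong_bound (h : R) : 2 < h -> exists C : R, forall (r : T1 -> R) (s : seq R) (a : T2 -> R),
  measurable_fun setT r -> (forall x, x \in s -> 0 < x) -> (forall t, r t \in s) ->
  measurable_fun setT a -> (forall y, `|a y|%:E <= Kc r y)%E ->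
  (\int[mu2]_x (powT a x `^ h)%:E <= C%:E)%E.
Proof.
move=> h2.
have G0 := @CGam_gt0 R.
have B1 : 1 <= supB :> R.
  rewrite /supB; have : 2 <= pi :> R by exact: pi_ge2.
  by nra.
(* Large enough for [CGam * 10 * c * 2 ^ j] to be at most [c ^ 2 * supB * 2 ^ j / 4], which implies
   the hypothesis of [weak_bound]; here [supB >= 1] is used. *)
pose c := 40 * @CGam R + 1.
have c1 : 1 <= c by rewrite lerDr mulr_ge0// ltW.
have c0 : 0 < c by exact: lt_le_trans c1.
have cn := ltW c0; have Gn := ltW G0.
pose D := 500 * @CGam R * c.
have D0 : 0 <= D by exact: (mulr_ge0 (mulr_ge0 (ler0n _ _) Gn) cn).
have B0 : 0 < supB :> R by exact: lt_le_trans B1.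
have [C HC] := @layer_cake R _ T2 mu2 supB h D B0 h2 D0.
exists C => r s a mr s0 rs ma aK; apply: HC.
- by apply: measurable_powT; exact: (Kdom_L1 mr s0 rs ma aK).
- by move=> x; rewrite powT_ge0 (Kdom_powT_le mr s0 rs ma aK).
move=> j.
pose M := c ^+ 2 * 8 ^+ j.
have e8 : 1 <= 8 ^+ j :> R by rewrite exprn_ege1// ler1n.
have M0 : 0 < M by rewrite mulr_gt0 ?exprn_gt0.
have c10 : 0 < 1 + c by rewrite addr_gt0.
have lnb : 1 + ln (1 + M) <= 10 * c * (1 + j%:R).
  have : ln (1 + M) <= ln ((1 + c) ^+ 2 * 8 ^+ j).
    rewrite ler_ln ?posrE; [|by rewrite addr_gt0|by rewrite mulr_gt0 ?exprn_gt0].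
    rewrite /M; move: (8 ^+ j) e8 => w w1.
    have : 0 <= (1 + 2 * c) * w by rewrite mulr_ge0 ?addr_ge0 ?mulr_ge0// (le_trans ler01).
    by nra.
  rewrite lnM ?posrE ?exprn_gt0// !lnXn//.
  have l1 : ln (1 + c) <= c by apply: le_ln1Dx; rewrite (lt_trans _ c0)// ltrN10.
  have l8 : ln 8 <= 7 :> R.
    have -> : 8 = 1 + 7 :> R by rewrite -(natrD _ 1 7).
    by apply: le_ln1Dx; rewrite (lt_le_trans (ltrN10 _)).
  have : ln (8 : R) *+ j <= 7 * j%:R by rewrite -[leLHS]mulr_natr ler_wpM2r.
  have j0 : 0 <= j%:R :> R by [].
  rewrite mulr2n; nra.
have e4 : 0 < 4^-1 ^+ j :> R by rewrite exprn_gt0.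
have bern : 1 + j%:R <= 2 ^+ j :> R.
  by rewrite addrC natr1 -natrX ler_nat ltn_expl.
apply: le_trans (weak_bound mr s0 rs ma aK (lam := supB * 4^-1 ^+ j) (M := M) _ M0 _) _.
- by rewrite mulr_gt0.
- have -> : M * (supB * 4^-1 ^+ j) / 4 = c ^+ 2 * supB * 2 ^+ j / 4.
    have : 8 ^+ j * 4^-1 ^+ j = 2 ^+ j :> R.
      by rewrite -exprMn; congr (_ ^+ _); field.
    by move=> <-; rewrite /M; ring.
  apply: (@le_trans _ _ (CGam * (10 * c * 2 ^+ j))).
    apply: ler_wpM2l; first exact: ltW.
    by apply: le_trans lnb _; apply: ler_wpM2l => //; rewrite mulr_ge0.
  have e2 : 0 < 2 ^+ j :> R by rewrite exprn_gt0.
  have -> : c ^+ 2 * supB * 2 ^+ j / 4 = c * supB * 2 ^+ j * c / 4 by ring.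
  rewrite {2}/c.
  have : 10 * CGam * (c * 2 ^+ j) <= 10 * CGam * supB * (c * 2 ^+ j).
    by rewrite ler_wpM2r ?mulr_ge0 ?(ltW c0) ?(ltW e2)// ler_peMr// mulr_ge0// ltW.
  have : 0 <= supB * (c * 2 ^+ j) by exact: (mulr_ge0 (ltW B0) (mulr_ge0 cn (ltW e2))).
  clear; move: (@CGam R) supB (2 ^+ j) c => G B t c.
  by nra.
rewrite lee_fin ler_pdivrMr ?exprn_gt0 ?mulr_gt0//.
have -> : D * (1 + j%:R) * 16 ^+ j * (supB * 4^-1 ^+ j) ^+ 2 = D * (1 + j%:R) * supB ^+ 2.
  have e : 16 ^+ j * (4^-1 ^+ j) ^+ 2 = 1 :> R.
    by rewrite exprAC -exprMn (_ : 16 * 4^-1 ^+ 2 = 1) ?expr1n//; field.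
  rewrite -[RHS]mulr1 -[X in _ = _ * X]e.
  by move: (4^-1 ^+ j) (16 ^+ j) supB (1 + j%:R) => x y z v; ring.
apply: (@le_trans _ _ (50 * (CGam * (10 * c * (1 + j%:R))))).
  by do 2 (apply: ler_wpM2l; first by rewrite ?ltW).
rewrite /D (_ : 50 * _ = 500 * CGam * c * (1 + j%:R)); last by ring.
apply: ler_peMr; last exact: exprn_ege1.
exact: (mulr_ge0 D0 (addr_ge0 ler01 (ler0n _ _))).
all: exact: pi_gt0.
Qed.

End StrongBound.

(** * A dense class of Schwartz functions *)

Section DerivePair.
Context {R : realType}.
Implicit Types (x v : R * R).

(** Directional derivatives are reduced to one real variable along the line through [x], where the
    usual differentiation rules apply. *)
Lemma is_derive_line (f : R * R -> R) x v (df : R) :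
  is_derive (0 : R) 1 (fun h : R => f (h *: v + x)) df -> is_derive x v f df.
Proof.
move=> [D E].
have e : (fun h : R => h^-1 *: (((fun h : R => f (h *: v + x)) \o shift 0) (h *: 1) - f (0 *: v + x))) =
  (fun h : R => h^-1 *: ((f \o shift x) (h *: v) - f x)).
  apply/funext => h /=; rewrite scale0r add0r addr0; congr (_ *: (f (_ *: _ + _) - _)).
  by rewrite /GRing.scale/= mulr1.
split; first by move: D; rewrite /derivable e.
by rewrite -E /derive e.
Qed.

Lemma is_derive_cvg (f : R * R -> R) x v df : is_derive x v f df ->
  (fun h : R => h^-1 *: ((f \o shift x) (h *: v) - f x)) @ 0^' --> df.
Proof. by move=> [D <-]; exact: D. Qed.

Lemma is_derive_pairf (f1 f2 : R * R -> R) x v d1 d2 :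
  is_derive x v f1 d1 -> is_derive x v f2 d2 ->
  is_derive x v (fun y => (f1 y, f2 y)) ((d1, d2) : R * R).
Proof.
move=> /is_derive_cvg c1 /is_derive_cvg c2.
have c : (fun h : R => h^-1 *: (((fun y => (f1 y, f2 y) : R * R) \o shift x) (h *: v) - (f1 x, f2 x)))
    @ 0^' --> ((d1, d2) : R * R).
  have -> : (fun h : R => h^-1 *: (((fun y => (f1 y, f2 y) : R * R) \o shift x) (h *: v) - (f1 x, f2 x))) =
    (fun h : R => (h^-1 *: ((f1 \o shift x) (h *: v) - f1 x), h^-1 *: ((f2 \o shift x) (h *: v) - f2 x))).
    by apply/funext => h.
  exact: cvg_pair c1 c2.
split; first by apply/cvg_ex; eexists; exact: c.
exact: (cvg_lim _ c).
Qed.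

End DerivePair.

Section Multipliers.
Context {R : realType}.
Notation T1 := (measurableTypeR R).
Notation T2 := (T1 * T1)%type.
Notation mu2 := (@leb2 R).

Definition pr (b : bool) (x : R * R) : R := if b then x.2 else x.1.

Lemma pr_line b c x (h : R) : pr b (h *: edir R c + x) = pr b x + h * (b == c)%:R.
Proof.
by case: b; case: c; rewrite /= /GRing.scale/= ?mulr1 ?mulr0 addrC.
Qed.

Definition logistic (t : R) : R := (1 + expR (- t))^-1.

Lemma logistic_den t : 0 < 1 + expR (- t) :> R.
Proof. by rewrite addr_gt0// expR_gt0. Qed.

Lemma logistic_ge0 t : 0 <= logistic t.
Proof. by rewrite invr_ge0 ltW// logistic_den. Qed.

Lemma logistic_le1 t : logistic t <= 1.
Proof. by rewrite invf_le1 ?logistic_den// lerDl expR_ge0. Qed.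

Lemma is_derive_logistic (t : R) : is_derive t 1 logistic (logistic t * (1 - logistic t)).
Proof.
have d := lt0r_neq0 (logistic_den t).
have H : is_derive t 1 (fun t : R => 1 + expR (- t)) (- expR (- t)).
  by apply: is_derive_eq; rewrite /GRing.scale/=; ring.
have := @is_deriveV R (fun t : R => 1 + expR (- t)) t (- expR (- t)) 1 d H.
rewrite /logistic => H2; apply: (@is_derive_eq _ _ _ _ _ _ _ _ H2).
rewrite /GRing.scale/=; move: (expR (- t)) d => e d; field.
by rewrite d.
Qed.

Lemma measurable_logistic : measurable_fun setT logistic.
Proof.
apply: continuous_measurable_fun => t.
apply: differentiable_continuous; apply/derivable1_diffP.
by have [] := is_derive_logistic t.
Qed.

(** The logistic function satisfies s' = s (1 - s), so the class is closed under differentiation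
    while its members grow at most polynomially: multiplied by a Gaussian they are Schwartz. It also
    contains smooth approximations of half-planes. *)
Inductive mclass : (R * R -> R) -> Prop :=
| mc_cst c : mclass (fun=> c)
| mc_x b : mclass (pr b)
| mc_logistic b n c : mclass (fun x => logistic (n * pr b x + c))
| mc_add f g : mclass f -> mclass g -> mclass (fun x => f x + g x)
| mc_mul f g : mclass f -> mclass g -> mclass (fun x => f x * g x).

Lemma is_derive_pr b c x : is_derive x (edir R c) (pr b) (b == c)%:R.
Proof.
apply: is_derive_line; under eq_fun do rewrite pr_line.
by apply: is_derive_eq; rewrite /GRing.scale/=; ring.
Qed.

Lemma is_derive_pr_comp (F dF : R -> R) (n k : R) b c (x : R * R) :
  (forall t : R, is_derive t 1 F (dF t)) ->
  is_derive x (edir R c) (fun x => F (n * pr b x + k)) (n * (b == c)%:R * dF (n * pr b x + k)).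
Proof.
move=> HF; apply: is_derive_line; under eq_fun do rewrite pr_line.
have D : is_derive (0 : R) 1 (fun h : R => n * (pr b x + h * (b == c)%:R) + k) (n * (b == c)%:R).
  by apply: is_derive_eq; rewrite /GRing.scale/=; ring.
have := @is_derive1_comp R F (fun h : R => n * (pr b x + h * (b == c)%:R) + k) 0 _ _ (HF _) D.
by rewrite mul0r addr0 mulrC.
Qed.

Lemma mclass_ext f g : f =1 g -> mclass f -> mclass g.
Proof. by move=> /funext ->. Qed.

Lemma mclass_derive c f : mclass f ->
  exists2 g, mclass g & forall x, is_derive x (edir R c) f (g x).
Proof.
elim=> {f} [k|b|b n k|f g _ [f' mf' Df] _ [g' mg' Dg]|f g mf [f' mf' Df] mg [g' mg' Dg]].
- by exists (fun=> 0); [exact: mc_cst|move=> x; exact: is_derive_cst].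
- by exists (fun=> (b == c)%:R); [exact: mc_cst|move=> x; exact: is_derive_pr].
- exists (fun x => n * (b == c)%:R * (logistic (n * pr b x + k) * (1 + -1 * logistic (n * pr b x + k)))).
    apply: (mc_mul (mc_cst _)); apply: mc_mul; first exact: mc_logistic.
    by apply: (mc_add (mc_cst _)); apply: (mc_mul (mc_cst _)); exact: mc_logistic.
  move=> x; rewrite mulN1r; 
  exact: (@is_derive_pr_comp logistic (fun t => logistic t * (1 - logistic t)) n k b c x is_derive_logistic).
- exists (fun x => f' x + g' x); first exact: mc_add.
  by move=> x; exact: (is_deriveD (Df x) (Dg x)).
- exists (fun x => f x * g' x + g x * f' x); first by apply: mc_add; exact: mc_mul.
  by move=> x; exact: (is_deriveM (Df x) (Dg x)).
Qed.

Lemma dot_ge0 (x : R * R) : 0 <= dot x x.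
Proof. by rewrite /dot addr_ge0// -expr2 sqr_ge0. Qed.

Lemma base_ge1 (x : R * R) : 1 <= 1 + dot x x.
Proof. by rewrite lerDl dot_ge0. Qed.

Lemma mclass_growth f : mclass f ->
  exists C n, 0 <= C /\ forall x, `|f x| <= C * (1 + dot x x) ^+ n.
Proof.
elim=> {f} [k|b|b n k|f g _ [C [n [C0 Hf]]] _ [D [m [D0 Hg]]]|f g _ [C [n [C0 Hf]]] _ [D [m [D0 Hg]]]].
- by exists `|k|, 0%N; split => // x; rewrite expr0 mulr1.
- exists 1, 1%N; split => // x; rewrite mul1r expr1.
  have h (t s : R) : `|t| <= 1 + (t * t + s * s).
    by rewrite ler_norml; apply/andP; split; nra.
  by case: b; rewrite /= /dot; [rewrite (addrC (x.1 * _))|]; exact: h.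
- exists 1, 0%N; split => // x; rewrite mul1r expr0 ger0_norm ?logistic_ge0//.
  exact: logistic_le1.
- exists (C + D), (n + m)%N; split; first exact: addr_ge0.
  move=> x; apply: le_trans (ler_normD _ _) _; rewrite mulrDl; apply: lerD.
    apply: le_trans (Hf x) _; apply: ler_wpM2l => //.
    by rewrite exprD ler_peMr ?exprn_ege1 ?base_ge1// exprn_ge0// (le_trans ler01 (base_ge1 x)).
  apply: le_trans (Hg x) _; apply: ler_wpM2l => //.
  by rewrite exprD ler_peMl ?exprn_ege1 ?base_ge1// exprn_ge0// (le_trans ler01 (base_ge1 x)).
- exists (C * D), (n + m)%N; split; first exact: mulr_ge0.
  move=> x; rewrite normrM exprD mulrACA; exact: ler_pM.
Qed.

Lemma measurable_mclass f : mclass f -> measurable_fun setT (f : T2 -> R).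
Proof.
elim=> {f} [k|b|b n k|f g _ mf _ mg|f g _ mf _ mg].
- exact: measurable_cst.
- by case: b; [exact: measurable_snd|exact: measurable_fst].
- have ml := measurable_logistic.
  apply: (@measurableT_comp _ _ _ _ _ _ logistic _ (fun x : T2 => n * pr b x + k)) => //.
  by case: b; rewrite /pr; mfun.
- exact: measurable_funD.
- exact: measurable_funM.
Qed.

Definition gauss2 (x : R * R) : R := expR (- dot x x).

Lemma gauss2_gt0 x : 0 < gauss2 x. Proof. exact: expR_gt0. Qed.

Lemma gauss2_le1 x : gauss2 x <= 1.
Proof. by rewrite /gauss2 -expR0 ler_expR oppr_le0 dot_ge0. Qed.

Lemma is_derive_gauss2 c x : is_derive x (edir R c) gauss2 (-2 * pr c x * gauss2 x).
Proof.
apply: is_derive_line.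
have e h : gauss2 (h *: edir R c + x) = expR (- (dot x x + 2 * pr c x * h + h * h)).
  by rewrite /gauss2; congr expR; case: c; rewrite /dot /= /GRing.scale/=; ring.
under eq_fun do rewrite e.
have D : is_derive (0 : R) 1 (fun h : R => - (dot x x + 2 * pr c x * h + h * h)) (-2 * pr c x).
  by apply: is_derive_eq; rewrite /GRing.scale/=; ring.
have := @is_derive1_comp R (@expR R) _ 0 _ _ (is_derive_expR _) D.
move=> H; apply: (@is_derive_eq _ _ _ _ _ _ _ _ H).
by rewrite !mulr0 !addr0 mulrC.
Qed.

Definition gclass f := exists2 m, mclass m & f = (fun x => m x * gauss2 x).

Lemma gclass_derive c f : gclass f ->
  exists2 g, gclass g & forall x, is_derive x (edir R c) f (g x).
Proof.
move=> [m mm ->]; have [m' mm' Dm] := mclass_derive c mm.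
exists (fun x => (m' x + -2 * (pr c x * m x)) * gauss2 x).
  exists (fun x => m' x + -2 * (pr c x * m x)) => //.
  by apply: mc_add => //; apply: (mc_mul (mc_cst _)); apply: mc_mul => //; exact: mc_x.
move=> x; have := is_deriveM (Dm x) (is_derive_gauss2 c x).
move=> H; apply: (@is_derive_eq _ _ _ _ _ _ _ _ H).
by rewrite /GRing.scale/=; ring.
Qed.


Lemma pow_expR_bound (k : nat) : exists C : R, forall t : R, 0 <= t -> (1 + t) ^+ k * expR (- t) <= C.
Proof.
(* From [s <= expR s] at [s = (1 + t) / k.+1], raised to the power [k.+1]. *)
exists (k.+1%:R ^+ k.+1 * expR 1) => t t0.
have p1 : 1 <= 1 + t by rewrite lerDl.
apply: (@le_trans _ _ ((1 + t) ^+ k.+1 * expR (- t))).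
  rewrite ler_wpM2r ?expR_ge0// exprS ler_peMl// exprn_ge0//.
  exact: le_trans ler01 p1.
have -> : expR (- t) = expR 1 / expR (1 + t).
  by rewrite -expRN -expRD; congr expR; ring.
rewrite mulrA [X in X / _]mulrC -mulrA [leRHS]mulrC ler_wpM2l ?expR_ge0//.
rewrite ler_pdivrMr ?expR_gt0//.
set s := (1 + t) / k.+1%:R.
have k0 : 0 < k.+1%:R :> R by rewrite ltr0n.
have -> : 1 + t = k.+1%:R * s by rewrite /s mulrC divfK// gt_eqF.
have s0 : 0 <= s by rewrite divr_ge0// (le_trans ler01 p1).
rewrite exprMn ler_wpM2l ?exprn_ge0 ?(ltW k0)//.
rewrite expRM_natl; apply: lerXn2r; rewrite ?nnegrE ?expR_ge0//.
by apply: le_trans (expR_ge1Dx _); rewrite lerDr.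
Qed.

Lemma gclass_decay f (N : nat) : gclass f ->
  exists C, forall x, (1 + dot x x) ^+ N * `|f x| <= C.
Proof.
move=> [m mm ->]; have [C [n [C0 Hm]]] := mclass_growth mm.
have [D HD] := pow_expR_bound (N + n).
exists (C * D) => x; rewrite normrM (gtr0_norm (gauss2_gt0 x)).
have b0 : 0 <= 1 + dot x x by rewrite (le_trans ler01 (base_ge1 x)).
apply: (@le_trans _ _ ((1 + dot x x) ^+ N * (C * (1 + dot x x) ^+ n * gauss2 x))).
  apply: ler_wpM2l; first exact: exprn_ge0.
  by apply: ler_wpM2r; [exact: ltW (gauss2_gt0 x)|exact: Hm].
have -> : (1 + dot x x) ^+ N * (C * (1 + dot x x) ^+ n * gauss2 x) = C * ((1 + dot x x) ^+ (N + n) * gauss2 x).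
  by rewrite exprD; ring.
by apply: ler_wpM2l => //; apply: HD; exact: dot_ge0.
Qed.

Lemma gclass_dpart f1 f2 s : gclass f1 -> gclass f2 ->
  exists g1 g2, [/\ gclass g1, gclass g2 & dpart s (fun x => (f1 x, f2 x)) = (fun x => (g1 x, g2 x))].
Proof.
move=> G1 G2; elim: s => [|b s [g1 [g2 [H1 H2 E]]]]; first by exists f1, f2.
have [h1 K1 D1] := gclass_derive b H1; have [h2 K2 D2] := gclass_derive b H2.
exists h1, h2; split => //=; apply/funext => x; rewrite E.
by have [] := is_derive_pairf (D1 x) (D2 x).
Qed.

Lemma gclass_schwartz f1 f2 : gclass f1 -> gclass f2 -> schwartz (fun x => (f1 x, f2 x)).
Proof.
move=> G1 G2; split=> [s b x|s N].
  have [g1 [g2 [H1 H2 ->]]] := gclass_dpart s G1 G2.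
  have [h1 K1 D1] := gclass_derive b H1; have [h2 K2 D2] := gclass_derive b H2.
  by have [] := is_derive_pairf (D1 x) (D2 x).
have [g1 [g2 [H1 H2 ->]]] := gclass_dpart s G1 G2.
have [C1 B1] := gclass_decay N H1; have [C2 B2] := gclass_decay N H2.
exists (C1 + C2) => x; apply: le_trans (lerD (B1 x) (B2 x)).
rewrite -mulrDr; apply: ler_wpM2l; first by rewrite exprn_ge0// (le_trans ler01 (base_ge1 x)).
rewrite /cmod /= -[leRHS]ger0_norm ?addr_ge0// -sqrtr_sqr ler_wsqrtr//.
rewrite -[g1 x ^+ 2]real_normK ?num_real// -[g2 x ^+ 2]real_normK ?num_real//.
by have := mulr_ge0 (normr_ge0 (g1 x)) (normr_ge0 (g2 x)); rewrite sqrrD; lra.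
Qed.

Lemma measurable_gauss2 : measurable_fun setT (gauss2 : T2 -> R).
Proof.
apply: (@measurableT_comp _ _ _ _ _ _ (@expR R) _ (fun x : T2 => - dot x x)).
  exact: measurable_expR.
by rewrite /dot; mfun.
Qed.

Lemma measurable_gclass f : gclass f -> measurable_fun setT (f : T2 -> R).
Proof.
move=> [m mm ->]; apply: measurable_funM; [exact: measurable_mclass|exact: measurable_gauss2].
Qed.

Lemma L1_gclass f : gclass f -> L1 mu2 (f : T2 -> R).
Proof.
(* Exponent 2, because the square of [1 + dot x x] dominates the product of [1 + x.1 ^+ 2] and
   [1 + x.2 ^+ 2]. *)
move=> Gf; have [C HC] := gclass_decay 2 Gf.
have Lp : L1 (@lebesgue_measure R) (poisson (1 : R)).
  apply: L1P; first exact: measurable_poisson.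
  have -> : (\int[@lebesgue_measure R]_x `|poisson (1 : R) x|%:E = \int[@lebesgue_measure R]_x (poisson (1 : R) x)%:E)%E.
    by apply: (@eq_integral _ T1) => x _; rewrite ger0_norm// poisson_ge0.
  exact: le_lt_trans (integral_poisson ltr01) (ltry _).
apply: (L1_le (g := fun x : T2 => C * (poisson 1 x.1 * poisson 1 x.2))); first exact: measurable_gclass.
  move=> x; rewrite /poisson !mul1r -invfM ler_pdivlMr; last first.
    by rewrite mulr_gt0// ltr_pwDl ?sqr_ge0.
  apply: le_trans (HC x); rewrite mulrC ler_wpM2r// /dot.
  have := mulr_ge0 (sqr_ge0 x.1) (sqr_ge0 x.2); have := sqr_ge0 x.1; have := sqr_ge0 x.2; nra.
by apply: L1Z; exact: L1_prod.
Qed.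

End Multipliers.

(** * Approximation of bounded functions in a weighted L^1 distance *)

Section WeightedDistance.
Context {R : realType} d (T : measurableType d) (m : {measure set T -> \bar R}).
Implicit Types (f g h : T -> R).

Definition wdist (rho : T -> R) f g : \bar R := (\int[m]_x (`|f x - g x| * rho x)%:E)%E.

Variable rho : T -> R.
Hypothesis rho0 : forall x, 0 <= rho x.
Hypothesis Lrho : L1 m rho.

Let mrho : measurable_fun setT rho. Proof. exact: L1_measurable Lrho. Qed.

Let mw f g : measurable_fun setT f -> measurable_fun setT g ->
  measurable_fun setT (fun x => (`|f x - g x| * rho x)%:E).
Proof. by move=> mf mg; mfun. Qed.

(** One estimate for all the errors below: it covers unions, the triangle inequality and
    rescaling. *)
Lemma wdist_le (c : R) f g f1 g1 f2 g2 : 0 <= c ->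
  measurable_fun setT f -> measurable_fun setT g ->
  measurable_fun setT f1 -> measurable_fun setT g1 ->
  measurable_fun setT f2 -> measurable_fun setT g2 ->
  (forall x, `|f x - g x| <= c * (`|f1 x - g1 x| + `|f2 x - g2 x|)) ->
  (wdist rho f g <= c%:E * (wdist rho f1 g1 + wdist rho f2 g2))%E.
Proof.
move=> c0 mf mg mf1 mg1 mf2 mg2 H.
rewrite /wdist -ge0_integralD//; [|by move=> x _; rewrite lee_fin mulr_ge0|exact: mw|by move=> x _; rewrite lee_fin mulr_ge0|exact: mw].
rewrite -ge0_integralZl_EFin//; first last.
- by apply: emeasurable_funD; exact: mw.
- by move=> x _; rewrite adde_ge0// lee_fin mulr_ge0.
apply: ge0_le_integral; [exact: measurableT|by move=> x _; rewrite lee_fin mulr_ge0|exact: mw| |].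
  by apply: emeasurable_funM => //; apply: emeasurable_funD; exact: mw.
move=> x _; rewrite -EFinD -EFinM lee_fin -mulrDl mulrA; exact: ler_wpM2r.
Qed.

Lemma wdist_cvg (h_ : nat -> T -> R) h :
  (forall n, measurable_fun setT (h_ n)) -> measurable_fun setT h ->
  (forall n x, `|h_ n x - h x| <= 1) -> (forall x, h_ n x @[n --> \oo] --> h x) ->
  forall e : R, 0 < e -> exists n, (wdist rho (h_ n) h < e%:E)%E.
Proof.
move=> mh_ mh b c e e0.
have [||||_ _ K] := @dominated_convergence _ T R m setT measurableT
  (fun n x => (`|h_ n x - h x| * rho x)%:E) (cst 0%E) (EFin \o rho) _ _ _ Lrho.
- by move=> n; exact: mw.
- exact: measurable_cst.
- apply: aeW => x _; apply: cvg_EFin; first exact: nearW.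
  rewrite -[X in _ --> X](mul0r (rho x)); apply: cvgM; last exact: cvg_cst.
  rewrite -(normr0 R) -(subrr (h x)); apply: cvg_norm; apply: cvgB; [exact: c|exact: cvg_cst].
- apply: aeW => x n _; rewrite /= lee_fin ger0_norm ?mulr_ge0//.
  by rewrite ler_piMl.
have : \forall n \near \oo, (wdist rho (h_ n) h < e%:E)%E.
  move: K; rewrite integral_cst//= mul0e => K.
  have N : nbhs (0 : \bar R)%E [set y : \bar R | (y < e%:E)%E].
    apply: open_nbhs_nbhs; split; last by rewrite /= lte_fin.
    exact: open_ereal_lt_ereal.
  exact: (K _ N).
by case=> n _ /(_ n (leqnn n)); exists n.
Qed.

End WeightedDistance.

Section Density.
Context {R : realType}.
Notation T1 := (measurableTypeR R).
Notation T2 := (T1 * T1)%type.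
Notation mu2 := (@leb2 R).
Variable rho : T2 -> R.
Hypothesis rho0 : forall x, 0 <= rho x.
Hypothesis Lrho : L1 mu2 rho.
Notation wd := (wdist mu2 rho).

Definition ind (A : set T2) (x : T2) : R := (x \in A)%:R.

(** The bounds on [psi] are carried along with the distance: the approximants must later be bounded,
    and not only close in the mean. *)
Definition good (A : set T2) := measurable A /\
  forall e : R, 0 < e -> exists psi : T2 -> R,
    [/\ mclass psi, forall x, 0 <= psi x <= 1 & (wd psi (ind A) < e%:E)%E].

Lemma measurable_ind A : measurable A -> measurable_fun setT (ind A).
Proof.
move=> mA; have -> : ind A = \1_A by apply/funext => x; rewrite indicE.
exact: measurable_indic.
Qed.

Lemma mclass_opp f : mclass f -> mclass (fun x : R * R => 1 - f x).
Proof.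
move=> mf; apply: (@mclass_ext R (fun x => 1 + -1 * f x)); first by move=> x; rewrite mulN1r.
by apply: (mc_add (mc_cst _)); apply: (mc_mul (mc_cst _)).
Qed.

Lemma good_compl A : good A -> good (~` A).
Proof.
move=> [mA H]; split; first exact: measurableC.
move=> e /H[psi [mpsi b w]]; exists (fun x => 1 - psi x); split.
- exact: mclass_opp.
- by move=> x; have := b x; lra.
- apply: le_lt_trans w; rewrite le_eqVlt; apply/orP; left; apply/eqP.
  apply: eq_integral => x _; congr (_ * _)%:E.
  rewrite -[LHS]normrN; congr (`|_|); rewrite /ind in_setC; case: (x \in A) => /=; ring.
Qed.

Lemma ind01 A x : 0 <= ind A x <= 1.
Proof. by rewrite /ind; case: (x \in A); rewrite /= ?lexx ?ler01. Qed.

Lemma good_union A B : good A -> good B -> good (A `|` B).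
Proof.
move=> [mA HA] [mB HB]; split; first exact: measurableU.
move=> e e0; have e2 : 0 < e / 2 by rewrite divr_gt0.
have [f [mf bf wf]] := HA _ e2; have [g [mg bg wg]] := HB _ e2.
(* The indicator of a union has this form; it keeps values in the unit interval and stays in
   [mclass]. *)
exists (fun x => 1 - (1 - f x) * (1 - g x)); split.
- by apply/mclass_opp/mc_mul; exact: mclass_opp.
- by move=> x; have := bf x; have := bg x; nra.
have Mf := measurable_mclass mf; have Mg := measurable_mclass mg.
have MA := measurable_ind mA; have MB := measurable_ind mB.
apply: le_lt_trans (@wdist_le R _ T2 mu2 rho rho0 Lrho 1 _ _ f (ind A) g (ind B) ler01 _ _ Mf MA Mg MB _) _.
- by mfun.
- exact: measurable_ind (measurableU _ _ mA mB).
- move=> x; rewrite mul1r.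
  have -> : ind (A `|` B) x = 1 - (1 - ind A x) * (1 - ind B x).
    by rewrite /ind in_setU; case: (x \in A); case: (x \in B) => /=; ring.
  move: (bf x) (bg x) (ind01 A x) (ind01 B x).
  move: (f x) (g x) (ind A x) (ind B x) => a b c d /andP[a0 a1] /andP[b0 b1] /andP[c0 c1] /andP[d0 d1].
  have -> : 1 - (1 - a) * (1 - b) - (1 - (1 - c) * (1 - d)) = (a - c) * (1 - b) + (b - d) * (1 - c) by ring.
  apply: le_trans (ler_normD _ _) _; apply: lerD; rewrite normrM ler_piMr// ger0_norm ?subr_ge0//.
    by rewrite lerBlDr lerDl.
  by rewrite lerBlDr lerDl.
by rewrite mul1e [e in e%:E]splitr EFinD; apply: lteD.
Qed.

Lemma good_limit (A_ : nat -> set T2) A : (forall n, good (A_ n)) -> measurable A ->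
  (forall x, ind (A_ n) x @[n --> \oo] --> ind A x) -> good A.
Proof.
move=> GA mA c; split=> // e e0; have e2 : 0 < e / 2 by rewrite divr_gt0.
have MA := measurable_ind mA.
have MA_ n := measurable_ind (proj1 (GA n)).
have b n x : `|ind (A_ n) x - ind A x| <= 1.
  by rewrite ler_norml; have := ind01 (A_ n) x; have := ind01 A x; lra.
have [n wn] := wdist_cvg rho0 Lrho MA_ MA b c e2.
have [f [mf bf wf]] := (proj2 (GA n)) _ e2.
exists f; split => //.
have Mf := measurable_mclass mf.
apply: le_lt_trans (@wdist_le R _ T2 mu2 rho rho0 Lrho 1 _ _ f (ind (A_ n)) (ind (A_ n)) (ind A) ler01 Mf MA Mf (MA_ n) (MA_ n) MA _) _.
  move=> x; rewrite mul1r; apply: le_trans (ler_normD _ _).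
  by rewrite addrA subrK.
by rewrite mul1e [e in e%:E]splitr EFinD; apply: lteD.
Qed.

Lemma good_set0 : good set0.
Proof.
split=> // e e0; exists (fun=> 0); split; [exact: mc_cst|by move=> x; rewrite lexx ler01|].
rewrite /wdist (@eq_integral _ _ _ _ _ (cst 0%E)); first by rewrite integral_cst//= mul0e.
by move=> x _; rewrite /ind in_set0 /= subrr normr0 mul0r.
Qed.

Lemma good_bigcup (F : (set T2)^nat) : (forall n, good (F n)) -> good (\bigcup_k F k).
Proof.
move=> GF; pose U n := \big[setU/set0]_(k < n) F k.
have GU n : good (U n).
  elim: n => [|n IH]; first by rewrite /U big_ord0; exact: good_set0.
  by rewrite /U big_ord_recr /=; exact: good_union.
apply: (@good_limit U) => //.
  by apply: bigcup_measurable => n _; exact: (proj1 (GF n)).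
move=> x; have [|nx] := pselect ((\bigcup_k F k) x).
  move=> [k _ Fk]; have E : ind (\bigcup_k F k) x = 1.
    by rewrite /ind mem_set//; exists k.
  rewrite E; apply: cvg_near_cst; exists k.+1 => // n /= kn.
  rewrite /ind mem_set// /U -bigcup_mkord; exists k => //=.
have E : ind (\bigcup_k F k) x = 0 by rewrite /ind memNset.
rewrite E; apply: cvg_near_cst; apply: nearW => n; rewrite /ind memNset//.
by rewrite /U -bigcup_mkord => -[k _ Fk]; apply: nx; exists k.
Qed.

Lemma logistic_ge (t : R) : 0 <= t -> 1 - (1 + t)^-1 <= logistic t.
Proof.
move=> t0; have p : 0 < 1 + t by rewrite ltr_wpDr.
rewrite /logistic -[leRHS]mul1r ler_pdivlMr ?logistic_den//.
have e1 : expR (- t) <= (1 + t)^-1.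
  by rewrite expRN lef_pV2 ?posrE ?expR_gt0// expR_ge1Dx.
have i0 : 0 < (1 + t)^-1 by rewrite invr_gt0.
have i1 : (1 + t)^-1 <= 1 by rewrite invf_le1// lerDl.
by have := expR_gt0 (- t); nra.
Qed.

Lemma logistic_le (t : R) : 0 <= t -> logistic (- t) <= (1 + t)^-1.
Proof.
move=> t0; rewrite /logistic opprK lef_pV2 ?posrE; first last.
- by rewrite ltr_wpDr.
- by rewrite addr_gt0// expR_gt0.
by rewrite (le_trans (expR_ge1Dx t))// lerDr.
Qed.

(** The argument of the logistic function is [n ^ 2 * (pr b x - c) - n]. The shift by [n] decides
    the boundary: on the line [pr b x = c] the limit is 0 and not 1/2, so that convergence to the
    indicator of the open half-plane holds at every point. *)
Lemma half_plane_cvg (b : bool) (c : R) (x : T2) :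
  logistic ((n%:R * n%:R) * pr b x + (- (n%:R * n%:R * c) - n%:R)) @[n --> \oo] -->
  ind [set x | c < pr b x] x.
Proof.
have h0 : ((1 + n%:R)^-1 : R) @[n --> \oo] --> (0 : R).
  under eq_fun do rewrite addrC natr1; exact: cvg_harmonic.
have [cx|xc] := ltP c (pr b x).
  have -> : ind [set x | c < pr b x] x = 1 - 0 by rewrite /ind mem_set//= subr0.
  apply: (@squeeze_cvgr _ _ _ _ (fun n => 1 - (1 + n%:R)^-1) (fun=> 1 - 0)); last exact: cvg_cst.
    near=> n; rewrite subr0 logistic_le1 andbT.
    have n0 : 0 <= n%:R :> R by [].
    apply: le_trans (logistic_ge n0) _; rewrite /logistic lef_pV2 ?posrE ?logistic_den//.
    rewrite lerD2l ler_expR lerN2.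
    have : 2 / (pr b x - c) <= n%:R by near: n; exact: nbhs_infty_ger.
    rewrite ler_pdivrMr ?subr_gt0// => k.
    have : n%:R * 2 <= n%:R * (n%:R * (pr b x - c)) by rewrite ler_wpM2l.
    by lra.
  by apply: cvgB; [exact: cvg_cst|exact: h0].
have -> : ind [set x | c < pr b x] x = 0.
  by rewrite /ind memNset//= => h; move: xc; rewrite leNgt h.
apply: (@squeeze_cvgr _ _ _ _ (fun=> 0) (fun n => (1 + n%:R)^-1)); [|exact: cvg_cst|exact: h0].
apply: nearW => n; rewrite logistic_ge0/=.
have n0 : 0 <= n%:R :> R by [].
apply: le_trans (logistic_le n0); rewrite /logistic lef_pV2 ?posrE ?logistic_den//.
rewrite lerD2l ler_expR lerN2.
have : 0 <= n%:R * n%:R * (c - pr b x) by rewrite !mulr_ge0// subr_ge0.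
by lra.
Unshelve. all: by end_near. Qed.

Lemma measurable_pr b : measurable_fun setT (pr b : T2 -> R).
Proof. exact: (measurable_mclass (mc_x b)). Qed.

Lemma good_half_plane b (c : R) : good [set x | c < pr b x].
Proof.
have mA : measurable ([set x | c < pr b x] : set T2).
  rewrite -[X in measurable X]setTI; have := @measurable_pr b measurableT `]c, +oo[%classic (measurable_itv _).
  by congr measurable; apply/seteqP; split => x /=; rewrite in_itv/= andbT.
split=> // e e0.
have MA := measurable_ind mA.
pose h n (x : T2) : R := logistic ((n%:R * n%:R) * pr b x + (- (n%:R * n%:R * c) - n%:R)).
have mc n : mclass (h n) by exact: mc_logistic.
have mh n : measurable_fun setT (h n) := measurable_mclass (mc n).
have bb n x : `|h n x - ind [set x | c < pr b x] x| <= 1.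
  rewrite ler_norml; have := ind01 [set x | c < pr b x] x.
  have := logistic_ge0 ((n%:R * n%:R) * pr b x + (- (n%:R * n%:R * c) - n%:R)).
  have := logistic_le1 ((n%:R * n%:R) * pr b x + (- (n%:R * n%:R * c) - n%:R)).
  by rewrite /h; lra.
have [n wn] := wdist_cvg rho0 Lrho mh MA bb (@half_plane_cvg b c) e0.
by exists (h n); split => // x; rewrite logistic_ge0 logistic_le1.
Qed.

Lemma good_preimage b (B : set R) : measurable B -> good (pr b @^-1` B).
Proof.
have : <<s @RGenOInfty.G R >> `<=` [set B | good (pr b @^-1` B)].
  apply: smallest_sub.
    split => /=.
    - by rewrite preimage_set0; exact: good_set0.
    - by move=> A GA; rewrite setTD preimage_setC; exact: good_compl.
    - by move=> A GA; rewrite preimage_bigcup; exact: good_bigcup.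
  move=> _ [c ->] /=.
  rewrite (_ : _ @^-1` _ = [set x | c < pr b x]); first exact: good_half_plane.
  by apply/seteqP; split => x /=; rewrite in_itv/= andbT.
move=> H mB; apply: H.
exact: (eq_ind _ (fun G : set (set R) => G B) mB _ (RGenOInfty.measurableE R)).
Qed.

Lemma good_measurable (A : set T2) : measurable A -> good A.
Proof.
have H : <<s preimage_set_system setT (fst : T2 -> T1) measurable `|`
             preimage_set_system setT (snd : T2 -> T1) measurable >> `<=` good.
  apply: smallest_sub.
    split; first exact: good_set0.
    - by move=> B GB; rewrite setTD; exact: good_compl.
    - by move=> F GF; exact: good_bigcup.
  move=> B [] [C mC <-]; rewrite setTI.
    exact: (@good_preimage false C mC).
  exact: (@good_preimage true C mC).
exact: H.
Qed.

Lemma approx_sum n (A : nat -> set T2) : (forall k, measurable (A k)) ->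
  forall e : R, 0 < e -> exists psi : T2 -> R,
    [/\ mclass psi, forall x, 0 <= psi x <= n%:R &
     (wd psi (fun x => \sum_(k < n) ind (A k) x)%R < e%:E)%E].
Proof.
move=> mA; elim: n => [|n IH] e e0.
  exists (fun=> 0); split; [exact: mc_cst|by move=> x; rewrite lexx|].
  rewrite /wdist (@eq_integral _ _ _ _ _ (cst 0%E)); first by rewrite integral_cst//= mul0e.
  by move=> x _; rewrite big_ord0 subrr normr0 mul0r.
have e2 : 0 < e / 2 by rewrite divr_gt0.
have [f [mf bf wf]] := IH _ e2.
have [g [mg bg wg]] := (proj2 (good_measurable (mA n))) _ e2.
exists (fun x => f x + g x); split; first exact: mc_add.
  by move=> x; rewrite -natr1; have := bf x; have := bg x; lra.
have Mf := measurable_mclass mf; have Mg := measurable_mclass mg.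
have MS k : measurable_fun setT (fun x => \sum_(i < k) ind (A i) x).
  by apply: measurable_sum => i; exact: measurable_ind.
have MA := measurable_ind (mA n).
apply: le_lt_trans (@wdist_le R _ T2 mu2 rho rho0 Lrho 1 _ _ f (fun x => \sum_(k < n) ind (A k) x) g (ind (A n)) ler01 _ _ Mf (MS n) Mg MA _) _.
- exact: measurable_funD.
- exact: MS.
- move=> x; rewrite mul1r big_ord_recr /= opprD addrACA; exact: ler_normD.
by rewrite mul1e [e in e%:E]splitr EFinD; apply: lteD.
Qed.

(** The sum is [y] rounded up. After division by [n] this approximates a function uniformly by
    indicators of its level sets. *)
Lemma count_levels n (y : R) : 0 <= y <= n%:R ->
  `|\sum_(k < n) (k%:R < y)%R%:R - y| <= 1.
Proof.
elim: n => [|n IH] /andP[y0 yn].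
  by rewrite big_ord0 (_ : y = 0) ?subrr ?normr0//; apply/le_anti; rewrite yn.
rewrite big_ord_recr /=; have [ny|yn'] := ltP n%:R y; last by rewrite addr0 IH// y0.
have -> : \sum_(k < n) (k%:R < y)%R%:R = n%:R :> R.
  rewrite (eq_bigr (fun=> 1)) ?sumr_const ?card_ord// => k _.
  by rewrite (lt_trans _ ny)// ltr_nat.
rewrite (_ : true%:R = 1 :> R)//.
by rewrite ler_norml; move: yn; rewrite -natr1; lra.
Qed.

Lemma approx_unit (u : T2 -> R) : measurable_fun setT u -> (forall x, 0 <= u x <= 1) ->
  forall e : R, 0 < e -> exists psi : T2 -> R,
    [/\ mclass psi, forall x, 0 <= psi x <= 1 & (wd psi u < e%:E)%E].
Proof.
move=> mu_ bu e e0; have e2 : 0 < e / 2 by rewrite divr_gt0.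
pose I := (\int[mu2]_x rho x)%R.
have EI : (\int[mu2]_x (rho x)%:E = I%:E)%E by rewrite /I EFin_Rint.
have I0 : 0 <= I by rewrite -lee_fin -EI; apply: integral_ge0 => x _; rewrite lee_fin.
(* Rounding costs at most [I / n] in the weighted distance, [I] being the mass of the weight. *)
pose n := (Num.truncn (I / (e / 2))).+1.
have n0 : 0 < n%:R :> R by rewrite ltr0n.
have In : I / n%:R < e / 2.
  by rewrite ltr_pdivrMr// mulrC -ltr_pdivrMr// truncnS_gt.
pose A (k : nat) : set T2 := [set x | k%:R < n%:R * u x].
have mA k : measurable (A k).
  have mnu : measurable_fun setT (fun x : T2 => n%:R * u x) by mfun.
  rewrite -[X in measurable X]setTI; have := mnu measurableT `]k%:R, +oo[%classic (measurable_itv _).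
  by congr measurable; apply/seteqP; split => x /=; rewrite in_itv/= andbT.
have [f [mf bf wf]] := @approx_sum n A mA (e / 2 * n%:R) (mulr_gt0 e2 n0).
exists (fun x => n%:R^-1 * f x); split.
- exact: (mc_mul (mc_cst _)).
- move=> x; have /andP[f0 f1] := bf x; rewrite mulr_ge0 ?invr_ge0//=.
  by rewrite mulrC ler_pdivrMr// mul1r.
have Mf := measurable_mclass mf.
pose S x := \sum_(k < n) ind (A k) x.
have MS : measurable_fun setT S by apply: measurable_sum => i; exact: measurable_ind.
have i0 : 0 <= n%:R^-1 :> R by rewrite invr_ge0.
apply: le_lt_trans (@wdist_le R _ T2 mu2 rho rho0 Lrho n%:R^-1 _ _ f S (fun=> 1) (fun=> 0) i0 _ mu_ Mf MS (measurable_cst _) (measurable_cst _) _) _.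
- exact: measurable_funM.
- move=> x; rewrite subr0 normr1.
  have bS : `|S x - n%:R * u x| <= 1.
    rewrite /S (eq_bigr (fun k : 'I_n => (k%:R < n%:R * u x)%R%:R)).
      apply: count_levels; have /andP[u0 u1] := bu x; rewrite mulr_ge0//=.
      by rewrite ler_piMr.
    by move=> k _; rewrite /ind /A; congr (nat_of_bool _)%:R; apply/idP/idP; rewrite inE.
  have -> : n%:R^-1 * f x - u x = n%:R^-1 * ((f x - S x) + (S x - n%:R * u x)).
    by field; rewrite gt_eqF.
  rewrite normrM (ger0_norm i0); apply: ler_wpM2l => //.
  by apply: le_trans (ler_normD _ _) _; rewrite lerD2l.
have -> : wd (fun=> 1) (fun=> 0) = I%:E.
  rewrite -EI; apply: eq_integral => x _; by rewrite subr0 normr1 mul1r.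
apply: (@lt_le_trans _ _ (n%:R^-1%:E * ((e / 2 * n%:R)%:E + I%:E))%E).
  rewrite lte_pmul2l ?lte_fin ?invr_gt0//; apply: lte_leD => //.
rewrite -EFinD -EFinM lee_fin mulrC -ler_pdivlMr ?invr_gt0// invrK.
by have := In; rewrite ltr_pdivrMr//; nra.
Qed.

Lemma approx_bounded (u : T2 -> R) (B : R) : 0 < B -> measurable_fun setT u -> (forall x, `|u x| <= B) ->
  forall e : R, 0 < e -> exists psi : T2 -> R,
    [/\ mclass psi, forall x, `|psi x| <= B & (wd psi u < e%:E)%E].
Proof.
move=> B0 mu_ bu e e0; have e2 : 0 < e / (2 * B) by rewrite divr_gt0 ?mulr_gt0.
pose v x := (u x / B + 1) / 2.
have mv : measurable_fun setT v by rewrite /v; mfun.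
have bv x : 0 <= v x <= 1.
  have : -1 <= u x / B <= 1.
    by have := bu x; rewrite ler_norml ler_pdivlMr// ler_pdivrMr// mulN1r mul1r.
  by rewrite /v; lra.
have [f [mf bf wf]] := approx_unit mv bv e2.
exists (fun x => 2 * B * f x + - B); split.
- by apply: mc_add; [exact: (mc_mul (mc_cst _))|exact: mc_cst].
- by move=> x; rewrite ler_norml; have := bf x; nra.
have Mf := measurable_mclass mf.
have B2 : 0 <= 2 * B by rewrite mulr_ge0// ltW.
apply: le_lt_trans (@wdist_le R _ T2 mu2 rho rho0 Lrho (2 * B) _ _ f v (fun=> 0) (fun=> 0) B2 _ mu_ Mf mv (measurable_cst _) (measurable_cst _) _) _.
- by mfun.
- move=> x; rewrite subrr normr0 addr0 -[X in X * `|_|](ger0_norm B2) -normrM.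
  rewrite le_eqVlt; apply/orP; left; apply/eqP; congr `|_|.
  by rewrite /v; field; rewrite gt_eqF.
have -> : wd (fun=> 0) (fun=> 0) = 0%E.
  rewrite /wdist (@eq_integral _ _ _ _ _ (cst 0%E)); first by rewrite integral_cst//= mul0e.
  by move=> x _; rewrite subrr normr0 mul0r.
rewrite adde0; have ee : 2 * B * (e / (2 * B)) = e by rewrite mulrC divfK// gt_eqF// mulr_gt0.
apply: (@lt_le_trans _ _ ((2 * B)%:E * (e / (2 * B))%:E)%E); last by rewrite -EFinM ee.
by rewrite lte_pmul2l// lte_fin mulr_gt0.
Qed.

End Density.

(** * The dual estimate *)

Section KcBounds.
Context {R : realType}.
Notation mu := (@lebesgue_measure R).
Notation T1 := (measurableTypeR R).
Notation T2 := (T1 * T1)%type.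
Variables (r : T1 -> R) (rho1 rho2 : R).
Hypothesis mr : measurable_fun setT r.
Hypothesis rho10 : 0 < rho1.
Hypothesis r1 : forall t, rho1 <= r t.
Hypothesis r2 : forall t, r t <= rho2.

Lemma Kc_le y : (Kc r y <= (rho1 ^- 2 * (2 * pi))%:E)%E.
Proof.
have r0 t : 0 < r t by rewrite (lt_le_trans rho10).
apply: (@le_trans _ _ (\int[mu]_(t in @Defs.arc R) (cst (rho1 ^- 2)%:E t))%E).
  apply: ge0_le_integral => //.
  - exact: measurable_itv.
  - by move=> t _; rewrite lee_fin wk_ge0.
  - apply: measurable_funTS; have mw := measurable_wk mr; mfun.
  - move=> t _ /=; rewrite lee_fin /wk.
    apply: (@le_trans _ _ (r t ^- 2)).
      by rewrite -[leRHS]mulr1 ler_wpM2l// ?invr_ge0 ?sqr_ge0// lern1 leq_b1.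
    by rewrite lef_pV2 ?posrE ?exprn_gt0// lerXn2r ?nnegrE// ltW.
rewrite integral_cst; last exact: measurable_itv.
rewrite EFinM -(@lebesgue_arc R); exact: lexx.
Qed.

Lemma Kc_supp y : (rho2 + 1 < `|y.1|) || (rho2 + 1 < `|y.2|) -> Kc r y = 0%E.
Proof.
move=> H; rewrite /Kc (@eq_integral _ T1 _ mu _ (cst 0%E)); first by rewrite integral_cst ?mul0e//; exact: measurable_itv.
move=> t _; rewrite /wk; case: (boolP (near2 _ _ _)) => [/andP[/= n1 n2]|_]; last by rewrite mulr0.
exfalso; have rt := r2 t.
have a1 : `|y.1| < rho2 + 1.
  rewrite -[y.1](subrK (cos t)) addrC; apply: le_lt_trans (ler_normD _ _) _.
  rewrite addrC ltr_leD//; first by rewrite distrC (lt_le_trans n1).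
  exact: norm_cos_le1.
have a2 : `|y.2| < rho2 + 1.
  rewrite -[y.2](subrK (sin t)) addrC; apply: le_lt_trans (ler_normD _ _) _.
  rewrite addrC ltr_leD//; first by rewrite distrC (lt_le_trans n2).
  exact: norm_sin_le1.
by case/orP: H => h; [have := lt_trans h a1|have := lt_trans h a2]; rewrite ltxx.
Qed.

(** [Kc r] is bounded with bounded support, hence below a multiple of the Gaussian. The multiple
    depends on the radii and serves only to bring [Kc r] into the range of the approximation result,
    not into the final constants. *)
Lemma Kc_gauss_le y : (Kc r y <= (rho1 ^- 2 * (2 * pi) * expR (2 * (rho2 + 1) ^+ 2) * gauss2 y)%:E)%E.
Proof.
have c0 : 0 <= rho1 ^- 2 * (2 * pi) :> R.
  by rewrite mulr_ge0 ?invr_ge0 ?sqr_ge0// mulr_ge0// pi_ge0.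
have [H|] := boolP ((rho2 + 1 < `|y.1|) || (rho2 + 1 < `|y.2|)).
  rewrite Kc_supp// lee_fin mulr_ge0 ?(ltW (gauss2_gt0 _))// mulr_ge0// expR_ge0.
rewrite negb_or -!leNgt => /andP[h1 h2].
apply: le_trans (Kc_le y) _; rewrite lee_fin -mulrA; apply: ler_peMr => //.
rewrite /gauss2 -expRD -[leLHS]expR0 ler_expR subr_ge0 /dot -!expr2.
rewrite mulr_natl mulr2n; apply: lerD; rewrite -[leLHS]real_normK ?num_real// lerXn2r ?nnegrE//.
  by rewrite (le_trans _ h1).
by rewrite (le_trans _ h1).
Qed.

End KcBounds.

(** * Pairings of an L^p function with a transform *)

Section PairBounds.
Context {R : realType}.
Notation T1 := (measurableTypeR R).
Notation T2 := (T1 * T1)%type.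
Notation mu2 := (@leb2 R).
Variable p : R.
Hypothesis p1 : 1 <= p.

Lemma powR_ge_id (x : R) : 1 < x -> x <= x `^ p.
Proof.
move=> x1; have x0 : 0 < x by rewrite (lt_trans ltr01).
by rewrite -[leLHS]powRr1 ?ler_powR ?(ltW x0)// ltW.
Qed.

Lemma powR_exp_le (x q : R) : 0 <= x -> x <= 1 -> p <= q -> x `^ q <= x `^ p.
Proof.
move=> x0 x1 pq; move: x0; rewrite le_eqVlt => /predU1P[<-|x0].
  by rewrite !powR0// gt_eqF// (lt_le_trans ltr01)// (le_trans p1).
have -> : q = p + (q - p) by rewrite subrKC.
rewrite powRD; last by rewrite (gt_eqF x0) implybT.
apply: ler_piMr; first exact: powR_ge0.
have := @ge0_ler_powR R (q - p) _ x 1; rewrite powR1; apply; rewrite ?nnegrE ?subr_ge0//.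
exact: ltW.
Qed.

(** Young's inequality without optimal constants, by comparing [y] with [M] times the power [q - 1]
    of [x]. A large [M] makes the second coefficient as small as desired. *)
Lemma young_split (x y q M : R) : 0 <= x -> 0 <= y -> 1 < q -> 0 < M ->
  x * y <= M * x `^ q + M `^ (- (q - 1)^-1) * y `^ (q / (q - 1)).
Proof.
move=> x0 y0 q1 M0; have k0 : 0 < q - 1 by rewrite subr_gt0.
have t0 : 0 <= M * x `^ q by rewrite mulr_ge0 ?powR_ge0// ltW.
have t1 : 0 <= M `^ (- (q - 1)^-1) * y `^ (q / (q - 1)) by rewrite mulr_ge0 ?powR_ge0.
move: x0; rewrite le_eqVlt => /predU1P[x00|x0]; first by rewrite -{1}x00 mul0r addr_ge0.
have [h|h] := leP y (M * x `^ (q - 1)).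
  apply: (@le_trans _ _ (M * x `^ q)); last by rewrite lerDl.
  apply: (@le_trans _ _ (x * (M * x `^ (q - 1)))).
    by rewrite ler_wpM2l// ltW.
  rewrite mulrCA ler_wpM2l ?(ltW M0)// -{1}(powRr1 (ltW x0)) -powRD ?subrKC//.
  by rewrite (gt_eqF x0) implybT.
have yp : 0 < y by rewrite (le_lt_trans _ h)// mulr_ge0 ?powR_ge0// ltW.
apply: (@le_trans _ _ (M `^ (- (q - 1)^-1) * y `^ (q / (q - 1)))); last by rewrite lerDr.
have xe : x = (x `^ (q - 1)) `^ (q - 1)^-1.
  by rewrite -powRrM mulfV ?gt_eqF// powRr1// ltW.
have xl : x <= (y / M) `^ (q - 1)^-1.
  rewrite {1}xe; apply: ge0_ler_powR; rewrite ?nnegrE ?powR_ge0 ?invr_ge0 ?(ltW k0)//.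
    by rewrite divr_ge0// ltW.
  by rewrite ler_pdivlMr// mulrC ltW.
apply: (@le_trans _ _ ((y / M) `^ (q - 1)^-1 * y)); first by rewrite ler_wpM2r.
rewrite powRM ?invr_ge0 ?(ltW M0)// -(powR_inv1 (ltW M0)) -powRrM mulN1r.
rewrite mulrAC mulrC ler_wpM2l ?powR_ge0// -{2}(powRr1 y0) -powRD; last by rewrite (gt_eqF yp) implybT.
have -> : (q - 1)^-1 + 1 = q / (q - 1) by field; rewrite gt_eqF.
by [].
Qed.

Variables (F : T2 -> R).
Hypothesis mF : measurable_fun setT F.

Let I : \bar R := (\int[mu2]_x (`|F x| `^ p)%:E)%E.

Let mFp : measurable_fun setT (fun x => (`|F x| `^ p)%:E).
Proof.
apply/measurable_EFinP; apply: (@measurableT_comp _ _ _ _ _ _ (@powR R ^~ p)); first exact: measurable_powR.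
exact: measurableT_comp.
Qed.

(** Where [|F| > 1], [|F|] is at most its p-th power and the uniform bound of [c] is used; where
    [|F| <= 1], its square is at most its p-th power and Plancherel is used. For fixed [th] the last
    term is small with [N]: this handles errors that are small in L^1 and merely bounded. *)
Lemma pair_bound_small (p2 : p <= 2) (e c : T2 -> R) (B N th : R) : L1 mu2 e -> 0 < th ->
  measurable_fun setT c -> (forall x, c x ^+ 2 <= powT e x) ->
  (forall x, `|c x| <= N) -> 0 <= N -> (\int[mu2]_x `|e x|%:E <= N%:E)%E ->
  (forall x, `|e x| <= B) -> 0 <= B ->
  (\int[mu2]_x `|F x * c x|%:E <= (N + th)%:E * I + (th^-1 * 25 * (B * N))%:E)%E.
Proof.
move=> Le th0 mc cp cN N0 eN eB B0.
have mp := measurable_powT Le.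
have mec : measurable_fun setT (fun x => (powT e x)%:E) by exact/measurable_EFinP.
apply: (@le_trans _ _ (\int[mu2]_x ((N + th)%:E * (`|F x| `^ p)%:E + th^-1%:E * (powT e x)%:E))%E).
  apply: ge0_le_integral; [exact: measurableT|by []| | |].
  - by apply/measurable_EFinP; apply: measurableT_comp => //; exact: measurable_funM.
  - by apply: emeasurable_funD; apply: emeasurable_funM.
  move=> x _; rewrite -!EFinM -EFinD lee_fin normrM.
  have P0 : 0 <= `|F x| `^ p by exact: powR_ge0.
  have t2 : 0 <= th^-1 * powT e x by rewrite mulr_ge0 ?powT_ge0// invr_ge0 ltW.
  have [F1|F1] := ltP 1 `|F x|.
    apply: (@le_trans _ _ (N * `|F x| `^ p)).
      by rewrite mulrC ler_pM// powR_ge_id.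
    by rewrite mulrDl -addrA lerDl addr_ge0// mulr_ge0// ltW.
  apply: (@le_trans _ _ (th * `|F x| `^ p + th^-1 * powT e x)); last first.
    by rewrite lerD2r mulrDl lerDr mulr_ge0.
  have h1 : `|F x| ^+ 2 <= `|F x| `^ p.
    by rewrite -powR_mulrn// powR_exp_le.
  apply: (@le_trans _ _ (th * `|F x| ^+ 2 + th^-1 * `|c x| ^+ 2)); last first.
    apply: lerD; first by rewrite ler_wpM2l// ltW.
    by rewrite real_normK ?num_real// ler_wpM2l// invr_ge0 ltW.
  have : 0 <= th^-1 * (th * `|F x| - `|c x|) ^+ 2 by rewrite mulr_ge0 ?sqr_ge0// invr_ge0 ltW.
  have -> : th^-1 * (th * `|F x| - `|c x|) ^+ 2 = th * `|F x| ^+ 2 + th^-1 * `|c x| ^+ 2 - 2 * (`|F x| * `|c x|).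
    by field; rewrite gt_eqF.
  have : 0 <= `|F x| * `|c x| by rewrite mulr_ge0.
  by lra.
have ti : 0 <= th^-1 by rewrite invr_ge0 ltW.
rewrite ge0_integralD//; first last.
- exact: emeasurable_funM.
- by move=> x _; rewrite -EFinM lee_fin mulr_ge0// powT_ge0.
- exact: emeasurable_funM.
- by move=> x _; rewrite -EFinM lee_fin mulr_ge0 ?powR_ge0// addr_ge0// ltW.
rewrite !ge0_integralZl_EFin//; first last.
- by rewrite addr_ge0// ltW.
- by move=> x _; rewrite lee_fin powT_ge0.
apply: leeD => //; rewrite -mulrA EFinM; apply: lee_wpmul2l; first by rewrite lee_fin.
apply: le_trans (plancherel_le Le) _; rewrite EFinM; apply: lee_wpmul2l => //.
have me := L1_measurable Le.
apply: (@le_trans _ _ (\int[mu2]_x (B%:E * `|e x|%:E))%E).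
  apply: ge0_le_integral; [exact: measurableT|by move=> x _; rewrite lee_fin sqr_ge0|mfun|mfun|].
  move=> x _; rewrite -EFinM lee_fin -real_normK ?num_real// expr2; exact: ler_wpM2r.
rewrite ge0_integralZl_EFin//; last by mfun.
by rewrite EFinM; apply: lee_wpmul2l.
Qed.

(** The same splitting at height 1. Small values of [F] are measured with the exponent [q], which is
    at least [p], so the L^m bound of the transform enters with m conjugate to [q]. *)
Lemma pair_bound_strong (P c : T2 -> R) (q M B C : R) : p <= q -> 1 < q -> 0 < M -> 0 <= B ->
  measurable_fun setT c -> measurable_fun setT P -> (forall x, c x ^+ 2 <= P x) ->
  (forall x, `|c x| <= B) ->
  (\int[mu2]_x (P x `^ (q / (q - 1) / 2))%:E <= C%:E)%E ->
  (\int[mu2]_x `|F x * c x|%:E <= (B + M)%:E * I + (M `^ (- (q - 1)^-1) * C)%:E)%E.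
Proof.
move=> pq q1 M0 B0 mc mP cP cB IC.
set h := q / (q - 1) / 2 in IC.
have h0 : 0 <= h by rewrite divr_ge0// divr_ge0// ?subr_ge0 ltW// (lt_trans ltr01).
have mPh : measurable_fun setT (fun x => (P x `^ h)%:E).
  by apply/measurable_EFinP; apply: (@measurableT_comp _ _ _ _ _ _ (@powR R ^~ h)) => //; exact: measurable_powR.
have w0 : 0 <= M `^ (- (q - 1)^-1) by exact: powR_ge0.
apply: (@le_trans _ _ (\int[mu2]_x ((B + M)%:E * (`|F x| `^ p)%:E + (M `^ (- (q - 1)^-1))%:E * (P x `^ h)%:E))%E).
  apply: ge0_le_integral; [exact: measurableT|by []| | |].
  - by apply/measurable_EFinP; apply: measurableT_comp => //; exact: measurable_funM.
  - by apply: emeasurable_funD; apply: emeasurable_funM.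
  move=> x _; rewrite -!EFinM -EFinD lee_fin normrM.
  have P0 : 0 <= `|F x| `^ p by exact: powR_ge0.
  have t2 : 0 <= M `^ (- (q - 1)^-1) * P x `^ h by rewrite mulr_ge0 ?powR_ge0.
  have [F1|F1] := ltP 1 `|F x|.
    apply: (@le_trans _ _ (B * `|F x| `^ p)).
      by rewrite mulrC ler_pM// powR_ge_id.
    by rewrite mulrDl -addrA lerDl addr_ge0// mulr_ge0// ltW.
  apply: le_trans (young_split (normr_ge0 _) (normr_ge0 _) q1 M0) _; apply: lerD.
    rewrite mulrDl -[leLHS]add0r; apply: lerD; first by rewrite mulr_ge0.
    by apply: ler_wpM2l; [exact: ltW|exact: powR_exp_le].
  apply: ler_wpM2l => //.
  have -> : q / (q - 1) = 2 * h by rewrite /h [RHS]mulrC divfK.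
  rewrite powRrM powR_mulrn// real_normK ?num_real//; apply: ge0_ler_powR; rewrite ?nnegrE ?sqr_ge0//.
  by rewrite (le_trans (sqr_ge0 (c x))).
rewrite ge0_integralD//; first last.
- exact: emeasurable_funM.
- by move=> x _; rewrite -EFinM lee_fin mulr_ge0// powR_ge0.
- exact: emeasurable_funM.
- by move=> x _; rewrite -EFinM lee_fin mulr_ge0 ?powR_ge0// addr_ge0// ltW.
rewrite !ge0_integralZl_EFin//; first last.
- by rewrite addr_ge0// ltW.
- by move=> x _; rewrite lee_fin powR_ge0.
by apply: leeD => //; rewrite EFinM; apply: lee_wpmul2l; rewrite ?lee_fin.
Qed.

End PairBounds.

Section Core.
Context {R : realType}.
Notation T1 := (measurableTypeR R).
Notation T2 := (T1 * T1)%type.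
Notation mu2 := (@leb2 R).

Lemma cosT_sqr_le (a : T2 -> R) x : cosT a x ^+ 2 <= powT a x.
Proof. by rewrite /powT lerDl sqr_ge0. Qed.

Lemma sinT_sqr_le (a : T2 -> R) x : sinT a x ^+ 2 <= powT a x.
Proof. by rewrite /powT lerDr sqr_ge0. Qed.

Lemma cosT_sub (a b : T2 -> R) x : L1 mu2 a -> L1 mu2 b ->
  cosT (fun y => a y - b y) x = cosT a x - cosT b x.
Proof.
have mk : measurable_fun setT (fun y : T2 => cos (2 * pi * dot y x)) by rewrite /dot; mfun.
move=> La Lb; rewrite /cosT -RintegralB//.
- by apply: eq_Rintegral => y _; rewrite mulrBl.
- exact: (L1_bmul La mk (fun y => norm_cos_le1 _)).
- exact: (L1_bmul Lb mk (fun y => norm_cos_le1 _)).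
Qed.

Lemma sinT_sub (a b : T2 -> R) x : L1 mu2 a -> L1 mu2 b ->
  sinT (fun y => a y - b y) x = sinT a x - sinT b x.
Proof.
have mk : measurable_fun setT (fun y : T2 => sin (2 * pi * dot y x)) by rewrite /dot; mfun.
move=> La Lb; rewrite /sinT -RintegralB//.
- by apply: eq_Rintegral => y _; rewrite mulrBl.
- exact: (L1_bmul La mk (fun y => norm_sin_le1 _)).
- exact: (L1_bmul Lb mk (fun y => norm_sin_le1 _)).
Qed.

Lemma norm_Rint_le (f : T2 -> R) : measurable_fun setT f ->
  (`|(\int[mu2]_x f x)%R|%:E <= \int[mu2]_x `|f x|%:E)%E.
Proof.
move=> mf; have [Lf|] := boolP (\int[mu2]_x `|f x|%:E < +oo)%E.
  have L : L1 mu2 f by exact: L1P.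
  by rewrite -(EFin_Rint (L1_norm L)) lee_fin Rint_norm_le.
by rewrite -leNgt leye_eq => /eqP ->; exact: leey.
Qed.

Lemma four_pair_bound (F1 F2 c1 d1 c2 d2 : T2 -> R) (k : R) :
  measurable_fun setT F1 -> measurable_fun setT F2 -> measurable_fun setT c1 ->
  measurable_fun setT d1 -> measurable_fun setT c2 -> measurable_fun setT d2 ->
  (\int[mu2]_x `|F1 x * c1 x|%:E <= k%:E)%E -> (\int[mu2]_x `|F1 x * d1 x|%:E <= k%:E)%E ->
  (\int[mu2]_x `|F2 x * c2 x|%:E <= k%:E)%E -> (\int[mu2]_x `|F2 x * d2 x|%:E <= k%:E)%E ->
  (`|(\int[mu2]_x (F1 x * (c1 x + d1 x) + F2 x * (c2 x + d2 x)))%R|%:E <= (4 * k)%:E)%E.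
Proof.
move=> mF1 mF2 mc1 md1 mc2 md2 H1 H2 H3 H4.
apply: le_trans (norm_Rint_le _) _; first by mfun.
have mab (u v : T2 -> R) : measurable_fun setT u -> measurable_fun setT v ->
    measurable_fun setT (fun x => `|u x * v x|%:E).
  by move=> mu_ mv; apply/measurable_EFinP; apply: measurableT_comp => //; exact: measurable_funM.
have m1 := mab _ _ mF1 mc1; have m2 := mab _ _ mF1 md1.
have m3 := mab _ _ mF2 mc2; have m4 := mab _ _ mF2 md2.
have m12 := emeasurable_funD m1 m2; have m34 := emeasurable_funD m3 m4.
apply: (@le_trans _ _ (\int[mu2]_x ((`|F1 x * c1 x|%:E + `|F1 x * d1 x|%:E) +
    (`|F2 x * c2 x|%:E + `|F2 x * d2 x|%:E)))%E).
  apply: ge0_le_integral; [exact: measurableT|by []|mfun|exact: emeasurable_funD|].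
  move=> x _; rewrite -!EFinD lee_fin !mulrDr.
  by apply: le_trans (ler_normD _ _) (lerD (ler_normD _ _) (ler_normD _ _)).
rewrite (@ge0_integralD _ T2)//; [|by move=> x _; exact: adde_ge0|by move=> x _; exact: adde_ge0].
rewrite !(@ge0_integralD _ T2)//.
have -> : 4 * k = (k + k) + (k + k) by ring.
by rewrite !EFinD; apply: leeD; apply: leeD.
Qed.

Lemma measurable_weighted (u v : T2 -> R) : measurable_fun setT u -> measurable_fun setT v ->
  measurable_fun setT (fun y => (`|u y| * (1 + `|v y|))%:E).
Proof. by move=> mu_ mv; mfun. Qed.

Lemma measurable_normM (u v : T2 -> R) : measurable_fun setT u -> measurable_fun setT v ->
  measurable_fun setT (fun y => `|u y * v y|%:E).
Proof. by move=> mu_ mv; mfun. Qed.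

Variables (p : R).
Hypothesis p1 : 1 <= p.
Hypothesis p43 : p < 4 / 3.

(** Strictly between [p] and 4/3: thus [q > 1] even for [p = 1], and the conjugate exponent of [q]
    exceeds 4, which is [hq] after halving. *)
Let q := (p + 4 / 3) / 2.
Let q1 : 1 < q. Proof. by move: p1 p43; rewrite /q; lra. Qed.
Let pq : p <= q. Proof. by move: p1 p43; rewrite /q; lra. Qed.
Let q43 : q < 4 / 3. Proof. by move: p1 p43; rewrite /q; lra. Qed.
Let p2 : p <= 2. Proof. by move: p1 p43; lra. Qed.
Let hq : 2 < q / (q - 1) / 2.
Proof.
have k0 : 0 < q - 1 by rewrite subr_gt0.
by rewrite ltr_pdivlMr// ltr_pdivlMr//; move: q43; lra.
Qed.

Definition adm (r : T1 -> R) (s : seq R) := [/\ measurable_fun setT r,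
  (forall x, x \in s -> 0 < x) & (forall t, r t \in s)].

(** [M] is chosen first, to bring the term with [C] below [e / 2], and [dl] afterwards. As [C] is
    uniform, neither depends on the radii. *)
Lemma strong_small : forall e : R, 0 < e -> exists2 dl : R, 0 < dl &
  forall r s (a F c : T2 -> R), adm r s -> measurable_fun setT a ->
  (forall y, `|a y|%:E <= Kc r y)%E -> measurable_fun setT F ->
  measurable_fun setT c -> (forall x, c x ^+ 2 <= powT a x) -> (forall x, `|c x| <= 8 * pi) ->
  (\int[mu2]_x (`|F x| `^ p)%:E <= dl%:E)%E ->
  (\int[mu2]_x `|F x * c x|%:E <= e%:E)%E.
Proof.
have [C HC] := strong_bound hq.
move=> e e0.
pose k := (q - 1)^-1.
have k0 : 0 < k by rewrite invr_gt0 subr_gt0.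
pose M := (2 * (`|C| + 1) / e) `^ k^-1.
have C1 : 0 < `|C| + 1 by rewrite ltr_wpDl.
have b0 : 0 < 2 * (`|C| + 1) / e by rewrite divr_gt0// mulr_gt0.
have M0 : 0 < M by rewrite powR_gt0.
have Mk : M `^ (- k) * C <= e / 2.
  rewrite powRN /M -powRrM mulVf ?gt_eqF// powRr1 ?(ltW b0)//.
  rewrite mulrC ler_pdivrMr//.
  have -> : e / 2 * (2 * (`|C| + 1) / e) = `|C| + 1 by field; rewrite gt_eqF.
  by rewrite (le_trans (ler_norm C))// lerDl.
have P0 : 0 < 8 * pi :> R by rewrite mulr_gt0// pi_gt0.
have BM : 0 < 8 * pi + M by rewrite addr_gt0.
exists (e / 2 / (8 * pi + M)); first by rewrite !divr_gt0.
move=> r s a F c [mr s0 rs] ma aK mF mc cP cB IF.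
have IC := HC r s a mr s0 rs ma aK.
have mP := measurable_powT (Kdom_L1 mr s0 rs ma aK).
apply: le_trans (pair_bound_strong p1 mF pq q1 M0 (ltW P0) mc mP cP cB IC) _.
apply: (@le_trans _ _ ((8 * pi + M)%:E * (e / 2 / (8 * pi + M))%:E + (e / 2)%:E)%E).
  apply: leeD; last by rewrite lee_fin.
  by apply: lee_wpmul2l => //; rewrite lee_fin ltW.
by rewrite -EFinM -EFinD lee_fin mulrC divfK ?gt_eqF// -splitr.
Qed.

Lemma adm_bounds r s : adm r s -> exists rho1 rho2 : R,
  [/\ 0 < rho1, (forall t, rho1 <= r t) & (forall t, r t <= rho2)].
Proof.
move=> [_ s0 rs].
suff [rho1 [rho2 [h0 h]]] : exists rho1 rho2 : R, 0 < rho1 /\ forall x, x \in s -> rho1 <= x <= rho2.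
  by exists rho1, rho2; split => // t; have /andP[] := h _ (rs t).
elim: s s0 {rs} => [_|x s IH s0]; first by exists 1, 1; split.
have [|a [b [a0 h]]] := IH; first by move=> y ys; apply: s0; rewrite inE ys orbT.
exists (Num.min x a), (Num.max x b); split.
  by rewrite lt_min a0 s0// mem_head.
move=> y; rewrite inE => /predU1P[->|/h /andP[h1 h2]].
  by rewrite ge_min lexx le_max lexx.
by rewrite ge_min h1 le_max h2 !orbT.
Qed.

(** [g0] is a real or imaginary part of a transform, known only through pairings with test
    functions. The extremal [a], the sign of [g0] times [Kc r], is no test function; it is
    approximated by one, with a precision that depends on [r] and [g0], while [dl] does not. The
    tolerance is divided by 5: four pairings of [F1], [F2] with transforms of [a] and of the error,
    and one pairing of [g0] with the error. *)
Lemma core_small : forall e : R, 0 < e -> exists2 dl : R, 0 < dl &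
  forall r s (g0 F1 F2 : T2 -> R), adm r s ->
  measurable_fun setT g0 -> measurable_fun setT F1 -> measurable_fun setT F2 ->
  L1 mu2 (fun x => g0 x * gauss2 x) ->
  (forall psi, gclass psi -> (\int[mu2]_x (g0 x * psi x) =
     \int[mu2]_x (F1 x * cosT psi x + F2 x * sinT psi x))%R) ->
  (\int[mu2]_x (`|F1 x| `^ p)%:E <= dl%:E)%E -> (\int[mu2]_x (`|F2 x| `^ p)%:E <= dl%:E)%E ->
  (\int[mu2]_y (Kc r y * `|g0 y|%:E) <= e%:E)%E.
Proof.
move=> e e0; have e5 : 0 < e / 5 by rewrite divr_gt0.
have [dl dl0 Hs] := strong_small e5; exists dl => //.
move=> r s g0 F1 F2 ad mg mF1 mF2 Lg dual I1 I2.
have [mr s0 rs] := ad.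
have [rho1 [rho2 [r10 rr1 rr2]]] := adm_bounds ad.
have Kfin y : Kc r y \is a fin_num.
  by rewrite ge0_fin_numE ?Kc_ge0// (le_lt_trans (Kc_le mr r10 rr1 y)) ?ltry.
have mK := measurable_Kc mr.
pose K y := fine (Kc r y).
have KE y : Kc r y = (K y)%:E by rewrite /K fineK.
have K0 y : 0 <= K y by rewrite -lee_fin -KE Kc_ge0.
have mK' : measurable_fun setT K by exact: measurableT_comp mK.
pose B := rho1 ^- 2 * (2 * pi) * expR (2 * (rho2 + 1) ^+ 2).
have B0 : 0 < B.
  by rewrite /B !mulr_gt0 ?invr_gt0 ?exprn_gt0 ?pi_gt0 ?expR_gt0.
have KB y : K y <= B * gauss2 y by rewrite -lee_fin -KE; exact: Kc_gauss_le.
(* The sign of 0 is taken to be 1, so that [|a|] equals [Kc r] everywhere. *)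
pose sg (t : R) : R := if 0 <= t then 1 else -1.
have sgE t : sg t * t = `|t|.
  by rewrite /sg; case: (leP 0 t) => h; [rewrite mul1r ger0_norm|rewrite mulN1r ltr0_norm].
have sg1 t : `|sg t| = 1 by rewrite /sg; case: ifP => _; rewrite ?normrN normr1.
have msg : measurable_fun setT sg.
  apply: measurable_fun_ifT => //; exact: measurable_fun_ler.
pose a y := sg (g0 y) * K y.
have ma : measurable_fun setT a.
  by apply: measurable_funM => //; exact: (measurableT_comp msg mg).
have aE y : `|a y| = K y by rewrite normrM sg1 mul1r ger0_norm.
have aK y : (`|a y|%:E <= Kc r y)%E by rewrite aE KE.
have La := Kdom_L1 mr s0 rs ma aK.
pose v y := a y / gauss2 y.
have mgau := @measurable_gauss2 R.
have gau0 y := @gauss2_gt0 R y.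
have mv : measurable_fun setT v by rewrite /v; mfun.
have bv y : `|v y| <= B.
  by rewrite normrM aE normfV (gtr0_norm (gau0 y)) ler_pdivrMr.
have Lgau : L1 mu2 (@gauss2 R).
  have := @L1_gclass R (fun x => 1 * gauss2 x) (ex_intro2 _ _ _ (mc_cst 1) erefl).
  by under eq_fun do rewrite mul1r.
(* The summand 1 controls the L^1 norm of the error, the summand [|g0|] its pairing with [g0]; the
   Gaussian turns a difference of multipliers into the error itself. *)
pose w y := (1 + `|g0 y|) * gauss2 y.
have w0 y : 0 <= w y by rewrite mulr_ge0 ?addr_ge0// ltW.
have Lw : L1 mu2 w.
  have -> : w = (fun y => gauss2 y + `|g0 y * gauss2 y|).
    by apply/funext => y; rewrite /w mulrDl mul1r normrM (gtr0_norm (gau0 y)).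
  by apply: L1D => //; exact: L1_norm.
pose th := e / 10 / (dl + 1).
have th0 : 0 < th by rewrite !divr_gt0// addr_gt0.
(* Together [eta * D <= e / 10] and [th * dl <= e / 10] bring the bound of [pair_bound_small] below
   [e / 5]. *)
pose D := dl + th^-1 * 25 * (2 * B) + 1.
have D0 : 0 < D.
  apply: ltr_wpDl => //; apply: addr_ge0; first exact: ltW.
  apply: mulr_ge0; last exact: (mulr_ge0 (ler0n _ _) (ltW B0)).
  by apply: mulr_ge0 => //; rewrite invr_ge0 ltW.
pose eta := Num.min (e / 5) (e / 10 / D).
have eta0 : 0 < eta by rewrite lt_min e5 !divr_gt0.
have [psi0 [mpsi0 bpsi0 wpsi]] := approx_bounded w0 Lw B0 mv bv eta0.
pose psi y := psi0 y * gauss2 y.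
have gpsi : gclass psi by exists psi0.
have Lpsi := L1_gclass gpsi.
pose err y := psi y - a y.
have Le : L1 mu2 err by exact: L1B.
have me := L1_measurable Le.
have errE y : err y = (psi0 y - v y) * gauss2 y.
  by rewrite /err /psi /v mulrBl divfK ?gt_eqF.
have We : (\int[mu2]_y (`|err y| * (1 + `|g0 y|))%:E < eta%:E)%E.
  apply: le_lt_trans wpsi; rewrite le_eqVlt; apply/orP; left; apply/eqP; apply: eq_integral => y _.
  by rewrite errE normrM (gtr0_norm (gau0 y)) /w; congr (_%:E); ring.
have mg1 : measurable_fun setT (fun y => (`|err y| * (1 + `|g0 y|))%:E).
  exact: measurable_weighted.
have ea0 y : (0 <= `|err y|%:E)%E by [].
have N1 : (\int[mu2]_y `|err y|%:E <= eta%:E)%E.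
  apply: le_trans (ltW We); apply: ge0_le_integral; [exact: measurableT|by []| |by []|].
    by apply/measurable_EFinP; exact: measurableT_comp.
  by move=> y _; rewrite lee_fin ler_peMr// lerDl.
have N2 : (\int[mu2]_y `|g0 y * err y|%:E <= (e / 5)%:E)%E.
  apply: (@le_trans _ _ eta%:E); last by rewrite lee_fin ge_min lexx.
  apply: le_trans (ltW We); apply: ge0_le_integral; [exact: measurableT|by []|exact: measurable_normM|by []|].
  by move=> y _; rewrite lee_fin normrM mulrC ler_wpM2l// lerDr.
have bB y : `|err y| <= 2 * B.
  rewrite errE normrM (gtr0_norm (gau0 y)) -[leRHS]mulr1; apply: ler_pM => //; first exact: ltW.
    by rewrite mulr_natl mulr2n (le_trans (ler_normB _ _))// lerD.
  exact: gauss2_le1.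
have Ne : (\int[mu2]_y `|err y|)%R <= eta.
  by rewrite -lee_fin EFin_Rint//; exact: L1_norm.
have small (F c : T2 -> R) : measurable_fun setT F -> measurable_fun setT c ->
    (forall x, c x ^+ 2 <= powT err x) -> (forall x, `|c x| <= (\int[mu2]_y `|err y|)%R) ->
    (\int[mu2]_x (`|F x| `^ p)%:E <= dl%:E)%E ->
    (\int[mu2]_x `|F x * c x|%:E <= (e / 5)%:E)%E.
  move=> mF mc cP cN IF.
  apply: le_trans (pair_bound_small p1 mF p2 (B := 2 * B) (N := eta) Le th0 mc cP _ (ltW eta0) N1 bB _) _.
  - by move=> x; rewrite (le_trans (cN x)).
  - by rewrite mulr_ge0// ltW.
  apply: (@le_trans _ _ ((eta + th)%:E * dl%:E + (th^-1 * 25 * (2 * B * eta))%:E)%E).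
    by apply: leeD => //; apply: lee_wpmul2l => //; rewrite lee_fin addr_ge0// ltW.
  rewrite -EFinM -EFinD lee_fin.
  have h1 : th * dl <= e / 10.
    rewrite /th -mulrA ler_piMr ?divr_ge0 ?(ltW e0)// mulrC ler_pdivrMr ?addr_gt0// mul1r.
    by rewrite lerDl.
  have h2 : eta * D <= e / 10.
    by rewrite -ler_pdivlMr// ge_min lexx orbT.
  have h3 : eta * D = eta * dl + th^-1 * 25 * (2 * B * eta) + eta by rewrite /D; ring.
  have h4 : (eta + th) * dl + th^-1 * 25 * (2 * B * eta) <= eta * D + th * dl.
    by rewrite h3; clear -eta0; move: (th^-1 * 25 * (2 * B * eta)) => z; nra.
  apply: le_trans h4 _; apply: (@le_trans _ _ (e / 10 + e / 10)); first exact: lerD.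
  by rewrite le_eqVlt; apply/orP; left; apply/eqP; field.
have mcT := measurable_cosT La; have msT := measurable_sinT La.
have mce := measurable_cosT Le; have mse := measurable_sinT Le.
have S1 : (\int[mu2]_x `|F1 x * cosT err x|%:E <= (e / 5)%:E)%E.
  by apply: small => // x; [exact: cosT_sqr_le|exact: cosT_bound].
have S2 : (\int[mu2]_x `|F2 x * sinT err x|%:E <= (e / 5)%:E)%E.
  by apply: small => // x; [exact: sinT_sqr_le|exact: sinT_bound].
have Kr := Kdom_Rint mr s0 rs ma aK.
have G1 : (\int[mu2]_x `|F1 x * cosT a x|%:E <= (e / 5)%:E)%E.
  apply: (Hs r s a) => // x; first exact: cosT_sqr_le.
  by rewrite (le_trans (cosT_bound x La)).
have G2 : (\int[mu2]_x `|F2 x * sinT a x|%:E <= (e / 5)%:E)%E.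
  apply: (Hs r s a) => // x; first exact: sinT_sqr_le.
  by rewrite (le_trans (sinT_bound x La)).
have mpsi := L1_measurable Lpsi.
have mcp := measurable_cosT Lpsi; have msp := measurable_sinT Lpsi.
have cpE x : cosT psi x = cosT a x + cosT err x by rewrite /err cosT_sub// subrKC.
have spE x : sinT psi x = sinT a x + sinT err x by rewrite /err sinT_sub// subrKC.
have dualb : (`|(\int[mu2]_x (g0 x * psi x))%R|%:E <= (4 * (e / 5))%:E)%E.
  rewrite (dual _ gpsi); under eq_Rintegral do rewrite cpE spE.
  exact: (four_pair_bound mF1 mF2 mcT mce msT mse G1 S1 G2 S2).
have Lga : L1 mu2 (fun y => g0 y * a y).
  apply: (L1_le (g := fun y => B * `|g0 y * gauss2 y|)); first exact: measurable_funM.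
    move=> y; rewrite (normrM (g0 y) (a y)) (normrM (g0 y) (gauss2 y)) aE (gtr0_norm (gau0 y)) mulrCA.
    exact: ler_wpM2l.
  exact/L1Z/L1_norm.
have Lge : L1 mu2 (fun y => g0 y * err y).
  apply: L1P; first exact: measurable_funM.
  exact: le_lt_trans N2 (ltry _).
have Lgp : L1 mu2 (fun y => g0 y * psi y).
  have -> : (fun y => g0 y * psi y) = (fun y => g0 y * a y + g0 y * err y).
    by apply/funext => y; rewrite /err -mulrDr subrKC.
  exact: L1D.
have -> : (\int[mu2]_y (Kc r y * `|g0 y|%:E) = (\int[mu2]_y (g0 y * a y))%R%:E)%E.
  rewrite EFin_Rint//; apply: eq_integral => y _.
  by rewrite KE -EFinM -sgE /a; congr (_%:E); ring.
have -> : (\int[mu2]_y (g0 y * a y) = \int[mu2]_y (g0 y * psi y) - \int[mu2]_y (g0 y * err y))%R.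
  rewrite -RintegralB//; apply: eq_Rintegral => y _.
  by rewrite /err -mulrBr opprB subrKC.
rewrite lee_fin; move: dualb; rewrite lee_fin => d1.
have d2 : `|(\int[mu2]_y (g0 y * err y))%R| <= e / 5.
  by rewrite -lee_fin; apply: le_trans (norm_Rint_le _) N2; exact: measurable_funM.
by clear -d1 d2; move: d1 d2; rewrite !ler_norml; lra.
Qed.

End Core.

(** * Density of the test functions in L^p *)

Section LpDensity.
Context {R : realType}.
Notation T1 := (measurableTypeR R).
Notation T2 := (T1 * T1)%type.
Notation mu2 := (@leb2 R).
Variable p : R.
Hypothesis p1 : 1 <= p.
Let p0 : 0 < p. Proof. exact: lt_le_trans p1. Qed.

Lemma powR_add_le (x y : R) : 0 <= x -> 0 <= y -> (x + y) `^ p <= 2 `^ p * (x `^ p + y `^ p).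
Proof.
move=> x0 y0; wlog xy : x y x0 y0 / x <= y.
  move=> H; have [xy|/ltW yx] := leP x y; first exact: H.
  by rewrite addrC [X in _ * X]addrC; exact: H.
apply: (@le_trans _ _ ((2 * y) `^ p)).
  apply: ge0_ler_powR; rewrite ?nnegrE ?(ltW p0) ?addr_ge0 ?mulr_ge0//.
  by rewrite mulr_natl mulr2n lerD2r.
by rewrite powRM// ler_wpM2l ?powR_ge0// lerDr powR_ge0.
Qed.

(** For functions bounded by [k], closeness in L^1 thereby becomes closeness in L^p. *)
Lemma powR_le_lin (x k : R) : 0 <= x -> x <= k -> x `^ p <= k `^ (p - 1) * x.
Proof.
move=> x0 xk; move: x0; rewrite le_eqVlt => /predU1P[<-|x0].
  by rewrite powR0 ?gt_eqF// mulr0.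
have -> : x `^ p = x `^ (p - 1) * x.
  rewrite -[X in _ * X](powRr1 (ltW x0)) -powRD ?subrK//.
  by rewrite (gt_eqF x0) implybT.
rewrite ler_wpM2r ?(ltW x0)//; apply: ge0_ler_powR; rewrite ?nnegrE ?subr_ge0 ?(ltW x0)//.
by rewrite (le_trans (ltW x0)).
Qed.

Lemma measurable_normp (F : T2 -> R) : measurable_fun setT F ->
  measurable_fun setT (fun x => (`|F x| `^ p)%:E).
Proof.
move=> mF; apply/measurable_EFinP.
apply: (@measurableT_comp _ _ _ _ _ _ (@powR R ^~ p) _ (fun x => `|F x|)).
  exact: measurable_powR.
exact: measurableT_comp.
Qed.

Lemma L1_gauss2 : L1 mu2 (@gauss2 R).
Proof.
have := @L1_gclass R (fun x => 1 * gauss2 x) (ex_intro2 _ _ _ (mc_cst 1) erefl).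
by under eq_fun do rewrite mul1r.
Qed.

(** A bounded [u] supported in a square stays bounded after division by the Gaussian. The quotient
    is approximated under the same bound, with the Gaussian as weight, and [powR_le_lin] passes to
    L^p. *)
Lemma gclass_dense_bounded (u : T2 -> R) (n : R) : 0 < n -> measurable_fun setT u ->
  (forall x, `|u x| <= n * (near2 n (0, 0) x)%:R) ->
  forall e : R, 0 < e -> exists2 phi, gclass phi & (\int[mu2]_x (`|u x - phi x| `^ p)%:E <= e%:E)%E.
Proof.
move=> n0 mu_ bu e e0.
pose B := n * expR (2 * n ^+ 2).
have B0 : 0 < B by rewrite mulr_gt0// expR_gt0.
have mgau := @measurable_gauss2 R.
have gau0 y := @gauss2_gt0 R y.
pose v y := u y / gauss2 y.
have mv : measurable_fun setT v by rewrite /v; mfun.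
have bv y : `|v y| <= B.
  rewrite normrM normfV (gtr0_norm (gau0 y)) ler_pdivrMr//; apply: le_trans (bu y) _.
  case: (boolP (near2 n (0, 0) y)) => [/andP[/=]|_]; last first.
    by rewrite mulr0 mulr_ge0// ltW.
  rewrite !sub0r !normrN => h1 h2; rewrite mulr1 /B -mulrA; apply: ler_peMr; first exact: ltW.
  rewrite /gauss2 -expRD -[leLHS]expR0 ler_expR subr_ge0 /dot -!expr2.
  rewrite mulr_natl mulr2n; apply: lerD; rewrite -[leLHS]real_normK ?num_real// lerXn2r ?nnegrE//.
  - exact: ltW.
  - exact: ltW.
  - exact: ltW.
  - exact: ltW.
pose K := (2 * B) `^ (p - 1).
have K0 : 0 < K by rewrite powR_gt0// mulr_gt0.
have eK : 0 < e / K by rewrite divr_gt0.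
have [psi0 [mpsi bpsi wpsi]] := approx_bounded (fun x => ltW (gau0 x)) L1_gauss2 B0 mv bv eK.
exists (fun x => psi0 x * gauss2 x); first by exists psi0.
have Mpsi := measurable_mclass mpsi.
have E x : `|u x - psi0 x * gauss2 x| = `|psi0 x - v x| * gauss2 x.
  have -> : `|psi0 x - v x| * gauss2 x = `|(psi0 x - v x) * gauss2 x|.
    by rewrite normrM (gtr0_norm (gau0 x)).
  by rewrite -normrN opprB mulrBl /v divfK// gt_eqF.
apply: (@le_trans _ _ (\int[mu2]_x (K%:E * (`|psi0 x - v x| * gauss2 x)%:E))%E).
  apply: ge0_le_integral; [exact: measurableT|by move=> x _; rewrite lee_fin powR_ge0| | |].
  - by apply: measurable_normp; mfun.
  - by mfun.
  move=> x _; rewrite -EFinM lee_fin E; apply: powR_le_lin.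
    by rewrite mulr_ge0// ltW.
  rewrite -[leRHS]mulr1; apply: ler_pM => //; [exact: ltW| |exact: gauss2_le1].
  by rewrite mulr_natl mulr2n (le_trans (ler_normB _ _))// lerD.
rewrite (@ge0_integralZl_EFin _ T2)//; first last.
- exact: ltW.
- by mfun.
- by move=> x _; rewrite lee_fin mulr_ge0// ltW.
apply: (@le_trans _ _ (K%:E * (e / K)%:E)%E).
  by apply: lee_wpmul2l; [rewrite lee_fin ltW|exact: ltW].
by rewrite -EFinM mulrC divfK// gt_eqF.
Qed.

Lemma truncation_Lp (F : T2 -> R) : measurable_fun setT F ->
  (\int[mu2]_x (`|F x| `^ p)%:E < +oo)%E -> forall e : R, 0 < e ->
  exists n : nat, (\int[mu2]_x (`|F x - F x * ((`|F x| <= n.+1%:R) && near2 n.+1%:R (0, 0) x)%:R| `^ p)%:E <= e%:E)%E.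
Proof.
move=> mF IF e e0.
pose b n (x : T2) := (`|F x| <= n.+1%:R) && near2 n.+1%:R (0, 0) x.
have mb n : measurable_fun setT (b n).
  apply: measurable_and; first by apply: measurable_fun_ler => //; exact: measurableT_comp.
  apply: (@measurableT_comp _ _ _ _ _ _ (fun p : R * (T2 * T2) => near2 p.1 p.2.1 p.2.2) _
    (fun x : T2 => (n.+1%:R, ((0, 0) : T2, x)))); [exact: near2_measurable|mfun].
have mFn n : measurable_fun setT (fun x => F x - F x * (b n x)%:R).
  by apply: measurable_funB => //; apply: measurable_funM => //; exact: measurable_indb.
have [|||||_ _ K] := @dominated_convergence _ T2 R mu2 setT measurableT
  (fun n x => (`|F x - F x * (b n x)%:R| `^ p)%:E) (cst 0%E) (fun x => (`|F x| `^ p)%:E).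
- by move=> n; apply: measurable_normp.
- exact: measurable_cst.
- apply: aeW => x _; apply: cvg_near_cst; near=> n.
  suff -> : b n x by rewrite mulr1 subrr normr0 powR0// gt_eqF.
  have hn : n%:R <= n.+1%:R :> R by rewrite ler_nat.
  rewrite /b /near2 !sub0r !normrN; apply/and3P; split.
  - by rewrite (le_trans _ hn)//; near: n; exact: nbhs_infty_ger.
  - rewrite (@le_lt_trans _ _ n%:R) ?ltr_nat//; near: n; exact: nbhs_infty_ger.
  - rewrite (@le_lt_trans _ _ n%:R) ?ltr_nat//; near: n; exact: nbhs_infty_ger.
- apply/integrableP; split; first exact: measurable_normp.
  apply: le_lt_trans IF; rewrite le_eqVlt; apply/orP; left; apply/eqP; apply: eq_integral => x _.
  by rewrite gee0_abs// lee_fin powR_ge0.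
- apply: aeW => x n _; rewrite gee0_abs ?lee_fin ?powR_ge0//.
  apply: ge0_ler_powR; rewrite ?nnegrE ?(ltW p0)//.
  by case: (b n x); rewrite ?mulr1 ?subrr ?normr0// mulr0 subr0.
have N : nbhs (0 : \bar R)%E [set y : \bar R | (y < e%:E)%E].
  apply: open_nbhs_nbhs; split; last by rewrite /= lte_fin.
  exact: open_ereal_lt_ereal.
move: K; rewrite integral_cst//= mul0e => /(_ _ N)[n _ /(_ n (leqnn n)) /= h].
by exists n; exact: ltW.
Unshelve. all: by end_near. Qed.

Lemma gclass_dense (F : T2 -> R) : measurable_fun setT F ->
  (\int[mu2]_x (`|F x| `^ p)%:E < +oo)%E -> forall e : R, 0 < e ->
  exists2 phi, gclass phi & (\int[mu2]_x (`|F x - phi x| `^ p)%:E <= e%:E)%E.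
Proof.
move=> mF IF e e0.
have t0 : 0 < 2 `^ p :> R by rewrite powR_gt0.
pose h := e / 2 / 2 `^ p.
have h0 : 0 < h by rewrite !divr_gt0.
have [n Hn] := truncation_Lp mF IF h0.
set b := (fun x : T2 => (`|F x| <= n.+1%:R) && near2 n.+1%:R (0, 0) x).
pose u x := F x * (b x)%:R.
have mb : measurable_fun setT b.
  apply: measurable_and; first by apply: measurable_fun_ler => //; exact: measurableT_comp.
  apply: (@measurableT_comp _ _ _ _ _ _ (fun p : R * (T2 * T2) => near2 p.1 p.2.1 p.2.2) _
    (fun x : T2 => (n.+1%:R, ((0, 0) : T2, x)))); [exact: near2_measurable|mfun].
have mu_ : measurable_fun setT u by apply: measurable_funM => //; exact: measurable_indb.
have bu x : `|u x| <= n.+1%:R * (near2 n.+1%:R (0, 0) x)%:R.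
  rewrite /u /b normrM; case: (leP `|F x|) => [Fn|_] /=; last by rewrite normr0 mulr0 mulr_ge0.
  by rewrite (ger0_norm (ler0n _ _)) ler_wpM2r.
have n0 : 0 < n.+1%:R :> R by rewrite ltr0n.
have [phi gphi Hphi] := gclass_dense_bounded n0 mu_ bu h0.
exists phi => //; have mphi := measurable_gclass gphi.
have m1 : measurable_fun setT (fun x => (`|F x - u x| `^ p)%:E) by apply: measurable_normp; exact: measurable_funB.
have m2 : measurable_fun setT (fun x => (`|u x - phi x| `^ p)%:E) by apply: measurable_normp; exact: measurable_funB.
apply: (@le_trans _ _ (\int[mu2]_x ((2 `^ p)%:E * ((`|F x - u x| `^ p)%:E + (`|u x - phi x| `^ p)%:E)))%E).
  apply: ge0_le_integral; [exact: measurableT|by move=> x _; rewrite lee_fin powR_ge0| | |].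
  - by apply: measurable_normp; exact: measurable_funB.
  - by apply: emeasurable_funM => //; exact: emeasurable_funD.
  move=> x _; rewrite -EFinD -EFinM lee_fin; apply: le_trans (powR_add_le (normr_ge0 _) (normr_ge0 _)).
  apply: ge0_ler_powR; rewrite ?nnegrE ?(ltW p0) ?addr_ge0//.
  by apply: le_trans (ler_normD _ _); rewrite addrA subrK.
rewrite (@ge0_integralZl_EFin _ T2)//; first last.
- exact: emeasurable_funD.
- by move=> x _; rewrite adde_ge0// lee_fin powR_ge0.
rewrite (@ge0_integralD _ T2)//.
apply: (@le_trans _ _ ((2 `^ p)%:E * (h%:E + h%:E))%E).
  by apply: lee_wpmul2l; [rewrite lee_fin ltW|exact: leeD].
rewrite -EFinD -EFinM lee_fin (_ : 2 `^ p * (h + h) = e)//.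
by rewrite /h; field; rewrite gt_eqF.
Qed.

End LpDensity.

(** * Duality for the difference of two transforms *)

Section Duality.
Context {R : realType}.
Notation T1 := (measurableTypeR R).
Notation T2 := (T1 * T1)%type.
Notation mu2 := (@leb2 R).

Lemma dotC (x y : R * R) : dot x y = dot y x.
Proof. by rewrite /dot; ring. Qed.

Lemma fourier1_pair (f1 f2 : T2 -> R) xi : L1 mu2 f1 -> L1 mu2 f2 ->
  fourier1 (fun x => (f1 x, f2 x)) xi = (cosT f1 xi + sinT f2 xi, cosT f2 xi - sinT f1 xi).
Proof.
move=> L_1 L_2.
have mc : measurable_fun setT (fun y : T2 => cos (2 * pi * dot y xi)) by rewrite /dot; mfun.
have ms : measurable_fun setT (fun y : T2 => sin (2 * pi * dot y xi)) by rewrite /dot; mfun.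
rewrite /fourier1 /cint; congr (_, _).
  rewrite /cosT /sinT -RintegralD//.
  - by apply: eq_Rintegral => x _; rewrite /cmul /expi /= cosN sinN mulrN opprK.
  - exact: (L1_bmul L_1 mc (fun y => norm_cos_le1 _)).
  - exact: (L1_bmul L_2 ms (fun y => norm_sin_le1 _)).
rewrite /cosT /sinT -RintegralB//.
- by apply: eq_Rintegral => x _; rewrite /cmul /expi /= cosN sinN mulrN addrC.
- exact: (L1_bmul L_2 mc (fun y => norm_cos_le1 _)).
- exact: (L1_bmul L_1 ms (fun y => norm_sin_le1 _)).
Qed.

Lemma gclass0 : gclass (fun=> 0 : R).
Proof. by exists (fun=> 0); [exact: mc_cst|apply/funext => x; rewrite mul0r]. Qed.

Lemma cosT0 xi : cosT (fun=> 0 : R) xi = 0.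
Proof. by rewrite /cosT; under eq_Rintegral do rewrite mul0r; rewrite /Rintegral integral0. Qed.

Lemma sinT0 xi : sinT (fun=> 0 : R) xi = 0.
Proof. by rewrite /sinT; under eq_Rintegral do rewrite mul0r; rewrite /Rintegral integral0. Qed.

Lemma cosT_dual (a b : T2 -> R) : L1 mu2 a -> L1 mu2 b ->
  (\int[mu2]_x (b x * cosT a x) = \int[mu2]_x (a x * cosT b x))%R.
Proof.
move=> La Lb.
have mk : measurable_fun setT (fun z : T2 * T2 => cos (2 * pi * dot z.2 z.1)) by rewrite /dot; mfun.
have := @fubini_kernel R _ _ T2 T2 mu2 mu2 b a (fun x y => cos (2 * pi * dot y x)) 1 Lb La mk ler01
  (fun x y => norm_cos_le1 _).
move=> ->; apply: eq_Rintegral => y _; congr (_ * _); apply: eq_Rintegral => x _.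
by rewrite dotC.
Qed.

Lemma sinT_dual (a b : T2 -> R) : L1 mu2 a -> L1 mu2 b ->
  (\int[mu2]_x (b x * sinT a x) = \int[mu2]_x (a x * sinT b x))%R.
Proof.
move=> La Lb.
have mk : measurable_fun setT (fun z : T2 * T2 => sin (2 * pi * dot z.2 z.1)) by rewrite /dot; mfun.
have := @fubini_kernel R _ _ T2 T2 mu2 mu2 b a (fun x y => sin (2 * pi * dot y x)) 1 Lb La mk ler01
  (fun x y => norm_sin_le1 _).
move=> ->; apply: eq_Rintegral => y _; congr (_ * _); apply: eq_Rintegral => x _.
by rewrite dotC.
Qed.

(** The identity in [is_fourier] concerns the whole pairing; splitting it into real summands
    requires each of them to be integrable. [pair_bound_small] with [th = 1] provides this. *)
Lemma L1_mul_transform (p : R) (F psi c : T2 -> R) : 1 <= p -> p <= 2 -> measurable_fun setT F ->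
  (\int[mu2]_x (`|F x| `^ p)%:E < +oo)%E -> gclass psi -> measurable_fun setT c ->
  (forall x, c x ^+ 2 <= powT psi x) -> (forall x, `|c x| <= (\int[mu2]_y `|psi y|)%R) ->
  L1 mu2 (fun x => F x * c x).
Proof.
move=> p1 p2 mF IF gpsi mc cP cN; have Lpsi := L1_gclass gpsi.
have [B HB] := gclass_decay 0 gpsi.
apply: L1P; first exact: measurable_funM.
have N0 : 0 <= (\int[mu2]_y `|psi y|)%R by rewrite (le_trans _ (cN (0, 0))).
apply: (@le_lt_trans _ _ (((\int[mu2]_y `|psi y|)%R + 1)%:E * (\int[mu2]_x (`|F x| `^ p)%:E) + (1^-1 * 25 * (`|B| * (\int[mu2]_y `|psi y|)%R))%:E)%E); last first.
  apply: lte_add_pinfty; last exact: ltry.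
  by apply: lte_mul_pinfty => //; rewrite lee_fin addr_ge0.
apply: (pair_bound_small p1 mF p2 Lpsi ltr01 mc cP cN N0) => //.
- by rewrite EFin_Rint//; exact: L1_norm.
- move=> x; have := HB x; rewrite expr0 mul1r => /le_trans; apply; exact: ler_norm.
Qed.

Variables (p : R) (f g : T2 -> R * R).
Hypothesis p1 : 1 <= p.
Hypothesis p2 : p <= 2.
Let f1 (x : T2) : R := (f x).1.
Let f2 (x : T2) : R := (f x).2.
Let g1 (x : T2) : R := (g x).1.
Let g2 (x : T2) : R := (g x).2.
Hypothesis mf1 : measurable_fun setT f1.
Hypothesis mf2 : measurable_fun setT f2.
Hypothesis If1 : (\int[mu2]_x (`|f1 x| `^ p)%:E < +oo)%E.
Hypothesis If2 : (\int[mu2]_x (`|f2 x| `^ p)%:E < +oo)%E.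
Hypothesis fg : is_fourier f g.

(** The identity of [is_fourier] is tested on a function with zero imaginary part, and the outcome
    is separated into its two components. *)
Lemma fourier_dual psi : gclass psi -> [/\ L1 mu2 (fun x => g1 x * psi x), L1 mu2 (fun x => g2 x * psi x),
  (\int[mu2]_x (g1 x * psi x) = \int[mu2]_x (f1 x * cosT psi x + f2 x * sinT psi x))%R &
  (\int[mu2]_x (g2 x * psi x) = \int[mu2]_x (f2 x * cosT psi x - f1 x * sinT psi x))%R].
Proof.
move=> gpsi; have Lpsi := L1_gclass gpsi.
have L0 := L1_gclass gclass0.
have [[i1 i2]] := (proj2 fg) _ (gclass_schwartz gpsi gclass0).
have e1 : (fun x => (cmul (g x) (psi x, 0)).1) = (fun x => g1 x * psi x).
  by apply/funext => x; rewrite /cmul /= mulr0 subr0.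
have e2 : (fun x => (cmul (g x) (psi x, 0)).2) = (fun x => g2 x * psi x).
  by apply/funext => x; rewrite /cmul /= mulr0 add0r.
move: i1 i2; rewrite e1 e2 => i1 i2.
have -> : cint mu2 setT (fun x => cmul (f x) (fourier1 (fun y => (psi y, 0)) x)) =
  ((\int[mu2]_x (f1 x * cosT psi x + f2 x * sinT psi x))%R,
   (\int[mu2]_x (f2 x * cosT psi x - f1 x * sinT psi x))%R).
  rewrite /cint; congr (_, _); apply: eq_Rintegral => x _;
    rewrite fourier1_pair// sinT0 cosT0 addr0 sub0r /cmul /= mulrN.
    by rewrite opprK.
  by rewrite addrC.
by rewrite /cint e1 e2 => -[E1 E2]; split.
Qed.

Variables (phi1 phi2 : T2 -> R).
Hypothesis gphi1 : gclass phi1.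
Hypothesis gphi2 : gclass phi2.
Let Lphi1 := L1_gclass gphi1.
Let Lphi2 := L1_gclass gphi2.

(** Real part, then imaginary part, of [g] minus the Fourier transform of [(phi1, phi2)]; the signs
    are those of [fourier1_pair]. *)
Definition gdiff1 (x : T2) : R := (g x).1 - (cosT phi1 x + sinT phi2 x).
Definition gdiff2 (x : T2) : R := (g x).2 - (cosT phi2 x - sinT phi1 x).

Let Nb (h : T2 -> R) := (\int[mu2]_y `|h y|)%R.

Lemma L1_trans_mul (h psi c : T2 -> R) : gclass psi -> L1 mu2 h -> measurable_fun setT c ->
  (forall x, `|c x| <= Nb h) -> L1 mu2 (fun x => psi x * c x).
Proof. by move=> gpsi Lh mc cN; exact: (L1_bmul (L1_gclass gpsi) mc cN). Qed.

Lemma gdiff1_dual psi : gclass psi -> L1 mu2 (fun x => gdiff1 x * psi x) /\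
  (\int[mu2]_x (gdiff1 x * psi x) =
   \int[mu2]_x ((f1 x - phi1 x) * cosT psi x + (f2 x - phi2 x) * sinT psi x))%R.
Proof.
move=> gpsi; have Lpsi := L1_gclass gpsi; have [I1 _ E1 _] := fourier_dual gpsi.
have C1 : L1 mu2 (fun x => psi x * cosT phi1 x).
  exact: (L1_trans_mul gpsi Lphi1 (measurable_cosT Lphi1) (fun x => cosT_bound x Lphi1)).
have C2 : L1 mu2 (fun x => psi x * sinT phi2 x).
  exact: (L1_trans_mul gpsi Lphi2 (measurable_sinT Lphi2) (fun x => sinT_bound x Lphi2)).
have K1 : L1 mu2 (fun x => phi1 x * cosT psi x).
  exact: (L1_trans_mul gphi1 Lpsi (measurable_cosT Lpsi) (fun x => cosT_bound x Lpsi)).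
have K2 : L1 mu2 (fun x => phi2 x * sinT psi x).
  exact: (L1_trans_mul gphi2 Lpsi (measurable_sinT Lpsi) (fun x => sinT_bound x Lpsi)).
have M1 : L1 mu2 (fun x => f1 x * cosT psi x).
  exact: (L1_mul_transform p1 p2 mf1 If1 gpsi (measurable_cosT Lpsi) (cosT_sqr_le psi) (fun x => cosT_bound x Lpsi)).
have M2 : L1 mu2 (fun x => f2 x * sinT psi x).
  exact: (L1_mul_transform p1 p2 mf2 If2 gpsi (measurable_sinT Lpsi) (sinT_sqr_le psi) (fun x => sinT_bound x Lpsi)).
have e : (fun x => gdiff1 x * psi x) = (fun x => g1 x * psi x - (psi x * cosT phi1 x + psi x * sinT phi2 x)).
  by apply/funext => x; rewrite /gdiff1 -/(g1 x); ring.
rewrite e; split; first exact: (L1B I1 (L1D C1 C2)).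
rewrite RintegralB//; [|exact: L1D].
rewrite RintegralD// (cosT_dual Lphi1 Lpsi) (sinT_dual Lphi2 Lpsi) E1 -RintegralD// -RintegralB//; [|exact: L1D|exact: L1D].
by apply: eq_Rintegral => x _; ring.
Qed.

Lemma gdiff2_dual psi : gclass psi -> L1 mu2 (fun x => gdiff2 x * psi x) /\
  (\int[mu2]_x (gdiff2 x * psi x) =
   \int[mu2]_x ((f2 x - phi2 x) * cosT psi x + (- (f1 x - phi1 x)) * sinT psi x))%R.
Proof.
move=> gpsi; have Lpsi := L1_gclass gpsi; have [_ I2 _ E2] := fourier_dual gpsi.
have C1 : L1 mu2 (fun x => psi x * cosT phi2 x).
  exact: (L1_trans_mul gpsi Lphi2 (measurable_cosT Lphi2) (fun x => cosT_bound x Lphi2)).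
have C2 : L1 mu2 (fun x => psi x * sinT phi1 x).
  exact: (L1_trans_mul gpsi Lphi1 (measurable_sinT Lphi1) (fun x => sinT_bound x Lphi1)).
have K1 : L1 mu2 (fun x => phi2 x * cosT psi x).
  exact: (L1_trans_mul gphi2 Lpsi (measurable_cosT Lpsi) (fun x => cosT_bound x Lpsi)).
have K2 : L1 mu2 (fun x => phi1 x * sinT psi x).
  exact: (L1_trans_mul gphi1 Lpsi (measurable_sinT Lpsi) (fun x => sinT_bound x Lpsi)).
have M1 : L1 mu2 (fun x => f2 x * cosT psi x).
  exact: (L1_mul_transform p1 p2 mf2 If2 gpsi (measurable_cosT Lpsi) (cosT_sqr_le psi) (fun x => cosT_bound x Lpsi)).
have M2 : L1 mu2 (fun x => f1 x * sinT psi x).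
  exact: (L1_mul_transform p1 p2 mf1 If1 gpsi (measurable_sinT Lpsi) (sinT_sqr_le psi) (fun x => sinT_bound x Lpsi)).
have e : (fun x => gdiff2 x * psi x) = (fun x => g2 x * psi x - (psi x * cosT phi2 x - psi x * sinT phi1 x)).
  by apply/funext => x; rewrite /gdiff2 -/(g2 x); ring.
rewrite e; split; first exact: (L1B I2 (L1B C1 C2)).
rewrite RintegralB//; [|exact: L1B].
rewrite RintegralB// (cosT_dual Lphi2 Lpsi) (sinT_dual Lphi1 Lpsi) E2 -RintegralB// -RintegralB//; [|exact: L1B|exact: L1B].
by apply: eq_Rintegral => x _; ring.
Qed.

End Duality.

(** * Lebesgue points *)

Section Lipschitz.
Context {R : realType}.
Notation T1 := (measurableTypeR R).
Notation T2 := (T1 * T1)%type.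
Notation mu2 := (@leb2 R).

Lemma lipschitz_of_derive (F dF : R -> R) : (forall t : R, is_derive t 1 F (dF t)) ->
  (forall t, `|dF t| <= 1) -> forall a b, `|F a - F b| <= `|a - b|.
Proof.
move=> HF b1 a b; wlog ab : a b / a <= b.
  move=> H; have [|/ltW ba] := leP a b; first exact: H.
  by rewrite distrC (distrC a); exact: H.
move: ab; rewrite le_eqVlt => /predU1P[->|ab]; first by rewrite !subrr.
have cF : {within `[a, b], continuous F}.
  apply: derivable_within_continuous => t _; by have [] := HF t.
have [c _ E] := MVT ab (fun t _ => HF t) cF.
by rewrite distrC E normrM (distrC a) ler_piMl.
Qed.

Lemma cos_lipschitz (a b : R) : `|cos a - cos b| <= `|a - b|.
Proof.
apply: (@lipschitz_of_derive cos (fun t => - sin t)) => t.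
by rewrite normrN norm_sin_le1.
Qed.

Lemma sin_lipschitz (a b : R) : `|sin a - sin b| <= `|a - b|.
Proof.
by apply: (@lipschitz_of_derive sin cos) => t; exact: norm_cos_le1.
Qed.

Definition lipT (h : T2 -> R) (L : R) := forall x y : T2,
  `|h x - h y| <= L * (`|x.1 - y.1| + `|x.2 - y.2|).

Lemma gclass_pr b (f : T2 -> R) : gclass f -> gclass (fun x => pr b x * f x).
Proof.
move=> [m mm ->]; exists (fun x => pr b x * m x); last by apply/funext => x; rewrite mulrA.
by apply: mc_mul => //; exact: mc_x.
Qed.

Lemma measurable_scaled_dot (w : T2) : measurable_fun setT (fun y : T2 => 2 * pi * dot y w).
Proof. by rewrite /dot; mfun. Qed.

(** The Lipschitz constant comes from the first moments of [phi], finite because the class is closed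
    under multiplication by coordinates. *)
Lemma transform_lip (k : R -> R) (phi : T2 -> R) : measurable_fun setT k ->
  (forall t, `|k t| <= 1) -> (forall a b, `|k a - k b| <= `|a - b|) -> gclass phi ->
  exists2 L, 0 <= L & lipT (fun xi => (\int[mu2]_y (phi y * k (2 * pi * dot y xi)))%R) L.
Proof.
move=> mk k1 kl gphi.
have Lp := L1_gclass gphi; have mp := L1_measurable Lp.
have Lx b := L1_norm (L1_gclass (gclass_pr b gphi)).
pose N b := (\int[mu2]_y `|pr b y * phi y|)%R.
have N0 b : 0 <= N b by apply: Rintegral_ge0.
have p0 : 0 <= 2 * pi :> R by rewrite mulr_ge0// pi_ge0.
exists (2 * pi * (N false + N true)); first by rewrite mulr_ge0// addr_ge0.
move=> x z.
have mkd w : measurable_fun setT (fun y : T2 => k (2 * pi * dot y w)).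
  apply: (@measurableT_comp _ _ _ _ _ _ k _ (fun y : T2 => 2 * pi * dot y w)) => //.
  exact: measurable_scaled_dot.
have Lk w : L1 mu2 (fun y => phi y * k (2 * pi * dot y w)).
  by apply: (L1_bmul Lp (mkd w)) => y; exact: k1.
rewrite -RintegralB//; apply: le_trans (Rint_norm_le (L1B (Lk x) (Lk z))) _.
pose D1 := `|x.1 - z.1|; pose D2 := `|x.2 - z.2|.
apply: (@le_trans _ _ (\int[mu2]_y (2 * pi * D1 * `|pr false y * phi y| + 2 * pi * D2 * `|pr true y * phi y|))%R).
  apply: Rint_le; [exact/L1_norm/L1B|by apply: L1D; apply: L1Z|].
  move=> y; rewrite -mulrBr normrM.
  apply: (@le_trans _ _ (`|phi y| * (2 * pi * (`|y.1| * D1 + `|y.2| * D2)))).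
    apply: ler_wpM2l => //; apply: le_trans (kl _ _) _.
    rewrite -mulrBr normrM (ger0_norm p0) ler_wpM2l// /dot /D1 /D2 -!normrM.
    have -> : y.1 * x.1 + y.2 * x.2 - (y.1 * z.1 + y.2 * z.2) = y.1 * (x.1 - z.1) + y.2 * (x.2 - z.2) by ring.
    exact: ler_normD.
  by rewrite /pr !normrM le_eqVlt; apply/orP; left; apply/eqP; ring.
rewrite RintegralD//; [|exact: L1Z|exact: L1Z].
rewrite !RintegralZl// -/(N false) -/(N true).
have h1 : 0 <= 2 * pi * (N false * D2) by rewrite !mulr_ge0 ?pi_ge0// /D2.
have h2 : 0 <= 2 * pi * (N true * D1) by rewrite !mulr_ge0 ?pi_ge0// /D1.
have -> : 2 * pi * (N false + N true) * (`|x.1 - z.1| + `|x.2 - z.2|) =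
  (2 * pi * D1 * N false + 2 * pi * D2 * N true) + (2 * pi * (N false * D2) + 2 * pi * (N true * D1)).
  by rewrite -/D1 -/D2; ring.
by rewrite lerDl addr_ge0.
Qed.

Lemma cosT_lip phi : gclass phi -> exists2 L, 0 <= L & lipT (cosT phi) L.
Proof.
apply: (@transform_lip cos); [|exact: norm_cos_le1|exact: cos_lipschitz].
by apply: continuous_measurable_fun; exact: continuous_cos.
Qed.

Lemma sinT_lip phi : gclass phi -> exists2 L, 0 <= L & lipT (sinT phi) L.
Proof.
apply: (@transform_lip sin); [|exact: norm_sin_le1|exact: sin_lipschitz].
by apply: continuous_measurable_fun; exact: continuous_sin.
Qed.

End Lipschitz.

(** * From Euclidean balls to dyadic squares *)

Section Balls.
Context {R : realType}.
Notation mu := (@lebesgue_measure R).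
Notation T1 := (measurableTypeR R).
Notation T2 := (T1 * T1)%type.
Notation mu2 := (@leb2 R).

Lemma dyadic_radius (r : R) : 0 < r -> r <= 1 -> exists k : nat, r <= 2^-1 ^+ k <= 2 * r.
Proof.
move=> r0 r1.
have ex : exists k, (fun k => 2^-1 ^+ k.+1 < r) k.
  have cv : (2^-1 : R) ^+ n @[n --> \oo] --> (0 : R).
    by apply: cvg_expr; rewrite ger0_norm// invf_lt1// ltr1n.
  have : \forall n \near \oo, (2^-1 : R) ^+ n < r by apply: (cvgr_lt 0 cv).
  by case=> n _ /(_ n.+1 (leqnSn n)) /= h; exists n.
have [k Ek mink] := find_ex_minn ex; exists k; apply/andP; split.
  case: k Ek mink => [|k] Ek mink; first by rewrite expr0.
  by rewrite leNgt; apply/negP => /mink; rewrite ltnn.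
by move: Ek; rewrite exprS; lra.
Qed.

Lemma measurable_eball x (r : R) : measurable (eball x r : set T2).
Proof.
have mh : measurable_fun setT (fun y : T2 => (y.1 - x.1) ^+ 2 + (y.2 - x.2) ^+ 2) by mfun.
rewrite -[X in measurable X]setTI; have := mh measurableT `]-oo, (r ^+ 2)[%classic (measurable_itv _).
by congr measurable; apply/seteqP; split => y /=; rewrite in_itv/=.
Qed.

Lemma eball_near2 x (r rho : R) y : 0 < r -> r <= rho -> eball x r y -> near2 rho x y.
Proof.
move=> r0 rr; rewrite /eball /= => h.
have k (t s : R) : t ^+ 2 + s ^+ 2 < r ^+ 2 -> `|t| < rho.
  move=> ts; apply: lt_le_trans rr; rewrite -(ltr_pXn2r (n := 2))// ?nnegrE ?(ltW r0)//.
  by rewrite real_normK ?num_real// (le_lt_trans _ ts)// lerDl sqr_ge0.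
rewrite /near2 distrC (distrC x.2) (k _ _ h) /=.
by apply: (k _ (y.1 - x.1)); rewrite addrC.
Qed.

Lemma cmod_le (a b : R) : cmod (a, b) <= `|a| + `|b|.
Proof.
rewrite /cmod /= -[leRHS]ger0_norm ?addr_ge0// -sqrtr_sqr ler_wsqrtr//.
rewrite -[a ^+ 2]real_normK ?num_real// -[b ^+ 2]real_normK ?num_real//.
by have := mulr_ge0 (normr_ge0 a) (normr_ge0 b); rewrite sqrrD; lra.
Qed.

Lemma norm1_le_cmod (z : R * R) : `|z.1| <= cmod z.
Proof. by rewrite /cmod -sqrtr_sqr ler_wsqrtr// lerDl sqr_ge0. Qed.

Lemma norm2_le_cmod (z : R * R) : `|z.2| <= cmod z.
Proof. by rewrite /cmod -sqrtr_sqr ler_wsqrtr// lerDr sqr_ge0. Qed.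

Lemma measurable_cmod (h : T2 -> R * R) :
  measurable_fun setT (fun x => (h x).1) -> measurable_fun setT (fun x => (h x).2) ->
  measurable_fun setT (fun x => cmod (h x)).
Proof.
move=> m1 m2; rewrite /cmod.
apply: (@measurableT_comp _ _ _ _ _ _ (@Num.sqrt R) _ (fun x => (h x).1 ^+ 2 + (h x).2 ^+ 2)).
  by apply: continuous_measurable_fun; exact: sqrt_continuous.
by apply: measurable_funD; apply: measurable_funX.
Qed.

Definition dyavg (G : T2 -> R) (k : nat) (x : T2) : \bar R :=
  avg mu2 (@near2 R) (cst (2^-1 ^+ k)) (EFin \o G) x.

Lemma measurable_near2 (rho : R) x : measurable_fun setT (fun y : T2 => (near2 rho x y)%:R : R).
Proof.
apply: measurable_indb.
apply: (@measurableT_comp _ _ _ _ _ _ (fun p : R * (T2 * T2) => near2 p.1 p.2.1 p.2.2) _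
  (fun y : T2 => (rho, (x, y)))); [exact: near2_measurable|mfun].
Qed.

(** A ball of radius [r] lies in a square of dyadic half-side [rho <= 2 * r], and the change of
    normalisation costs at most [4 / pi <= 2]. The other terms are the oscillation of the Lipschitz
    functions over the square and their distance to [c] at [x]. *)
Lemma ball_avg_le (g : T2 -> R * R) (h1 h2 : T2 -> R) (L r : R) (x : T2) (c : R * R) (S : \bar R) :
  measurable_fun setT (fun y => (g y).1) -> measurable_fun setT (fun y => (g y).2) ->
  measurable_fun setT h1 -> measurable_fun setT h2 -> 0 <= L -> lipT h1 L -> lipT h2 L ->
  0 < r -> r <= 1 ->
  (forall k : nat, dyavg (fun y => `|(g y).1 - h1 y| + `|(g y).2 - h2 y|)%R k x <= S)%E ->
  (((pi * r ^+ 2)^-1)%:E * \int[mu2]_(y in eball x r) (cmod (Defs.csub (g y) c))%:E <=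
   2%:E * S + (8 * (`|h1 x - c.1| + `|h2 x - c.2|) + 64 * L * r)%:E)%E.
Proof.
move=> mg1 mg2 mh1 mh2 L0 l1 l2 r0 r1 HS.
have [k /andP[k1 k2]] := dyadic_radius r0 r1; set rho := 2^-1 ^+ k in k1 k2.
have rho0 : 0 < rho by rewrite (lt_le_trans r0).
pose G y := `|(g y).1 - h1 y| + `|(g y).2 - h2 y|.
have mG : measurable_fun setT G by rewrite /G; mfun.
pose d := `|h1 x - c.1| + `|h2 x - c.2|.
have d0 : 0 <= d by rewrite addr_ge0.
(* Each Lipschitz function moves by at most [2 * L * rho] on the square; the area [4 * rho ^ 2] and
   the factor 2 then give [8 * q]. *)
pose q := 4 * L * rho + d.
have q0 : 0 <= q by rewrite addr_ge0// !mulr_ge0// ltW.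
have mn := measurable_near2 rho x.
have pw y : near2 rho x y -> cmod (Defs.csub (g y) c) <= G y + q.
  move=> /andP[n1 n2]; apply: le_trans (cmod_le _ _) _; rewrite /G /q /d /=.
  have s0 : `|y.1 - x.1| + `|y.2 - x.2| <= 2 * rho by rewrite distrC (distrC y.2); move: n1 n2; lra.
  have b1 : `|h1 y - h1 x| <= 2 * L * rho.
    by apply: le_trans (l1 y x) _; rewrite [2 * L]mulrC -mulrA ler_wpM2l.
  have b2 : `|h2 y - h2 x| <= 2 * L * rho.
    by apply: le_trans (l2 y x) _; rewrite [2 * L]mulrC -mulrA ler_wpM2l.
  have t (u v w z : R) : `|u - z| <= `|u - v| + `|v - w| + `|w - z|.
    by rewrite -(subrKA v) (le_trans (ler_normD _ _))// -addrA lerD2l -(subrKA w) ler_normD.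
  have := t (g y).1 (h1 y) (h1 x) c.1; have := t (g y).2 (h2 y) (h2 x) c.2.
  by move: b1 b2; lra.
have mcm : measurable_fun setT (fun y => (cmod (Defs.csub (g y) c))%:E).
  by apply/measurable_EFinP; apply: measurable_cmod; rewrite /Defs.csub /=; mfun.
have cm0 z : 0 <= cmod z :> R by exact: sqrtr_ge0.
have step1 : (\int[mu2]_(y in eball x r) (cmod (Defs.csub (g y) c))%:E <=
    \int[mu2]_y ((near2 rho x y)%:R%:E * (G y)%:E + (q%:E * (near2 rho x y)%:R%:E)))%E.
  rewrite integral_mkcond; apply: ge0_le_integral; [exact: measurableT| | | |].
  - by move=> y _; rewrite patchE; case: ifP => _ //; rewrite lee_fin.
  - by apply/(measurable_restrictT _ (measurable_eball x r)); exact: measurable_funTS.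
  - by apply: emeasurable_funD; apply: emeasurable_funM => //; exact/measurable_EFinP.
  move=> y _; rewrite patchE; case: ifP => [|_]; last first.
    by rewrite -!EFinM -EFinD lee_fin addr_ge0// mulr_ge0// addr_ge0.
  rewrite inE => yb; have ny := eball_near2 r0 k1 yb.
  by rewrite ny (_ : true%:R = 1 :> R)// -!EFinM -EFinD lee_fin mul1r mulr1 pw.
have step2 : (\int[mu2]_y ((near2 rho x y)%:R%:E * (G y)%:E + (q%:E * (near2 rho x y)%:R%:E)) <=
    (rho ^+ 2)%:E * S + (q * (4 * rho ^+ 2))%:E)%E.
  rewrite (@ge0_integralD _ T2)//; first last.
  - by apply: emeasurable_funM => //; exact/measurable_EFinP.
  - by move=> y _; rewrite -EFinM lee_fin mulr_ge0.
  - by apply: emeasurable_funM; exact/measurable_EFinP.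
  - by move=> y _; rewrite -EFinM lee_fin mulr_ge0// addr_ge0.
  apply: leeD; last first.
    rewrite (@ge0_integralZl_EFin _ T2)//; last exact/measurable_EFinP.
    by rewrite EFinM; apply: lee_wpmul2l; [rewrite lee_fin|exact: near2_growth].
  apply: (@le_trans _ _ ((rho ^+ 2)%:E * dyavg G k x)%E); last first.
    by apply: lee_wpmul2l; [rewrite lee_fin sqr_ge0|exact: HS].
  rewrite /dyavg /avg -(@ge0_integralZl_EFin _ T2)//; first last.
  - by rewrite sqr_ge0.
  - apply: emeasurable_funM; last exact/measurable_EFinP.
    by apply/measurable_EFinP; apply: measurable_funM.
  - by move=> y _; rewrite -EFinM lee_fin mulr_ge0 ?nker_ge0// addr_ge0.
  rewrite le_eqVlt; apply/orP; left; apply/eqP; apply: eq_integral => y _.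
  rewrite -!EFinM /nker /= -/rho; congr (_%:E).
  by rewrite mulrA mulrA divff ?mul1r// expf_neq0// gt_eqF.
have pr0 : 0 < pi * r ^+ 2 by rewrite mulr_gt0 ?pi_gt0 ?exprn_gt0.
have rr : (pi * r ^+ 2)^-1 * rho ^+ 2 <= 2.
  rewrite mulrC ler_pdivrMr//; have : 2 <= pi :> R by exact: pi_ge2.
  have : rho ^+ 2 <= (2 * r) ^+ 2 by rewrite lerXn2r ?nnegrE ?mulr_ge0 ?(ltW rho0) ?(ltW r0).
  have : 0 <= r ^+ 2 by exact: sqr_ge0.
  by rewrite exprMn; nra.
have S0 : (0 <= S)%E.
  apply: le_trans (HS 0%N); apply: avg_ge0 => y; rewrite lee_fin addr_ge0//.
apply: le_trans (lee_wpmul2l _ (le_trans step1 step2)) _; first by rewrite lee_fin invr_ge0 ltW.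
have z1 : (0 <= (rho ^+ 2)%:E * S)%E by rewrite mule_ge0// lee_fin sqr_ge0.
have z2 : (0 <= (q * (4 * rho ^+ 2))%:E)%E.
  by rewrite lee_fin; exact: (mulr_ge0 q0 (mulr_ge0 (ler0n _ _) (sqr_ge0 _))).
rewrite ge0_muleDr//.
rewrite muleA -!EFinM; apply: leeD.
  by apply: lee_wpmul2r => //; rewrite lee_fin.
rewrite lee_fin.
have -> : (pi * r ^+ 2)^-1 * (q * (4 * rho ^+ 2)) = 4 * q * ((pi * r ^+ 2)^-1 * rho ^+ 2) by ring.
apply: (@le_trans _ _ (4 * q * 2)); first by rewrite ler_wpM2l// mulr_ge0.
have : L * rho <= L * (2 * r) by rewrite ler_wpM2l.
by rewrite /q -/d; lra.
Qed.

Lemma eball_measure_ge x (r : R) : 0 < r -> ((r ^+ 2)%:E <= mu2 (eball x r))%E.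
Proof.
move=> r0; pose A (c : R) : set T1 := `](c - r / 2), (c + r / 2)[%classic.
have mA c : measurable (A c) by exact: measurable_itv.
have lA c : mu (A c) = r%:E.
  have := @lebesgue_measure_itv R (`](c - r / 2)%R, (c + r / 2)%R[).
  rewrite /= lte_fin (_ : (c - r / 2 < c + r / 2)%R); last by lra.
  by move=> ->; rewrite -EFinD; congr (_%:E); lra.
have := @product_measure1E _ _ T1 T1 R mu mu (A x.1) (A x.2) (mA _) (mA _).
rewrite /= !lA -EFinM -expr2 => <-.
apply: le_measure; rewrite ?inE; [exact: measurableX|exact: measurable_eball|].
move=> y [/=]; rewrite /A /= !in_itv/= => /andP[a1 a2] /andP[b1 b2].
have k (t s : R) : s - r / 2 < t -> t < s + r / 2 -> (t - s) ^+ 2 <= (r / 2) ^+ 2.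
  move=> h1 h2; rewrite -real_normK ?num_real// lerXn2r ?nnegrE ?divr_ge0 ?(ltW r0)//.
  by rewrite ler_norml; lra.
have := k _ _ a1 a2; have := k _ _ b1 b2; rewrite /eball /= expr_div_n.
by have : 0 < r ^+ 2 by [rewrite exprn_gt0]; lra.
Qed.

(** The averages of [|g - c| + |g - c'|] would stay above [1 / pi] times the distance of a
    coordinate of [c] from that of [c']; for this it is enough that the ball contains a square of
    side [r]. *)
Lemma lebesgue_point_uniq (g : T2 -> R * R) x c c' :
  measurable_fun setT (fun y => (g y).1) -> measurable_fun setT (fun y => (g y).2) ->
  lebesgue_point g x c -> lebesgue_point g x c' -> c = c'.
Proof.
move=> mg1 mg2 H H'.
have mcm b : measurable_fun setT (fun y => (cmod (Defs.csub (g y) b))%:E).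
  by apply/measurable_EFinP; apply: measurable_cmod; rewrite /Defs.csub /=; mfun.
have cm0 z : 0 <= cmod z :> R by exact: sqrtr_ge0.
have key (d : R) : 0 <= d ->
    (forall y, d <= cmod (Defs.csub (g y) c) + cmod (Defs.csub (g y) c')) -> d = 0.
  move=> d0 Hd; apply/le_anti; rewrite d0 andbT leNgt; apply/negP => dpos.
  pose e := d / pi / 2.
  have e0 : 0 < e by rewrite !divr_gt0// pi_gt0.
  have N : nbhs (0 : \bar R)%E [set y : \bar R | (y < e%:E)%E].
    apply: open_nbhs_nbhs; split; last by rewrite /= lte_fin.
    exact: open_ereal_lt_ereal.
  have : \forall r \near (0 : R)^'+, ((d / pi)%:E < (e + e)%:E)%E.
    near=> r.
    have r0 : 0 < r by near: r; exact: nbhs_right_gt.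
    have q0 : 0 < pi * r ^+ 2 by rewrite mulr_gt0 ?pi_gt0 ?exprn_gt0.
    rewrite EFinD; apply: (@le_lt_trans _ _ (
      ((pi * r ^+ 2)^-1)%:E * \int[mu2]_(y in eball x r) (cmod (Defs.csub (g y) c))%:E +
      ((pi * r ^+ 2)^-1)%:E * \int[mu2]_(y in eball x r) (cmod (Defs.csub (g y) c'))%:E)%E); last first.
      by apply: lteD; near: r; [exact: (H _ N)|exact: (H' _ N)].
    have mb := measurable_eball x r.
    rewrite -ge0_muleDr; [|by apply: integral_ge0 => y _; rewrite lee_fin|by apply: integral_ge0 => y _; rewrite lee_fin].
    rewrite -(@ge0_integralD _ T2)//; [|by move=> y _; rewrite lee_fin|by exact: measurable_funTS|by move=> y _; rewrite lee_fin|by exact: measurable_funTS].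
    apply: (@le_trans _ _ (((pi * r ^+ 2)^-1)%:E * (d%:E * mu2 (eball x r)))%E).
      apply: (@le_trans _ _ (((pi * r ^+ 2)^-1)%:E * (d%:E * (r ^+ 2)%:E))%E).
        rewrite -!EFinM lee_fin le_eqVlt; apply/orP; left; apply/eqP.
        have p0 : pi != 0 :> R by rewrite gt_eqF// pi_gt0.
        have rz : r != 0 by rewrite gt_eqF.
        by move: (pi : R) p0 => P p0; field; rewrite p0 rz.
      apply: lee_wpmul2l; first by rewrite lee_fin invr_ge0 ltW.
      by apply: lee_wpmul2l; [rewrite lee_fin|exact: eball_measure_ge].
    apply: lee_wpmul2l; first by rewrite lee_fin invr_ge0 ltW.
    rewrite -integral_cst//; apply: ge0_le_integral => //.
    - by apply: emeasurable_funD; exact: measurable_funTS.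
    - by move=> y _; rewrite -EFinD lee_fin Hd.
  by move=> /(@filter_ex _ _ _)[r]; rewrite lte_fin /e -splitr ltxx.
have E1 : `|c.1 - c'.1| = 0.
  apply: key => // y; apply: le_trans (_ : `|(g y).1 - c.1| + `|(g y).1 - c'.1| <= _).
    by rewrite (distrC (g y).1 c.1) -(subrKA (g y).1) ler_normD.
  apply: lerD; [exact: (norm1_le_cmod (Defs.csub (g y) c))|exact: (norm1_le_cmod (Defs.csub (g y) c'))].
have E2 : `|c.2 - c'.2| = 0.
  apply: key => // y; apply: le_trans (_ : `|(g y).2 - c.2| + `|(g y).2 - c'.2| <= _).
    by rewrite (distrC (g y).2 c.2) -(subrKA (g y).2) ler_normD.
  apply: lerD; [exact: (norm2_le_cmod (Defs.csub (g y) c))|exact: (norm2_le_cmod (Defs.csub (g y) c'))].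
move: E1 E2 => /normr0_eq0/eqP; rewrite subr_eq0 => /eqP E1 /normr0_eq0/eqP; rewrite subr_eq0 => /eqP E2.
by rewrite [c]surjective_pairing [c']surjective_pairing E1 E2.
Unshelve. all: by end_near. Qed.

End Balls.

(** * The maximal function over all dyadic radii *)

Section MaximalIntegral.
Context {R : realType}.
Notation mu := (@lebesgue_measure R).
Notation T1 := (measurableTypeR R).
Notation T2 := (T1 * T1)%type.
Notation mu2 := (@leb2 R).
Notation arcR := (@Defs.arc R).

Lemma measurable_circ : measurable_fun setT (@circ R : T1 -> T2).
Proof. by rewrite /circ; mfun. Qed.

Lemma marcR : measurable (arcR : set T1).
Proof. exact: measurable_itv. Qed.

Section OneFunction.
Variable G : T2 -> R.
Hypothesis mG : measurable_fun setT G.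
Hypothesis G0 : forall x, 0 <= G x.

Let mGE : measurable_fun setT (EFin \o G). Proof. exact/measurable_EFinP. Qed.
Let GE0 y : (0 <= (EFin \o G) y)%E. Proof. by rewrite lee_fin. Qed.

Definition supavg (t : T1) : \bar R := esups (fun k => dyavg G k (circ t)) 0.

Lemma measurable_avg_circ (r : T2 -> R) : measurable_fun setT r ->
  measurable_fun setT (fun t : T1 => avg mu2 (@near2 R) r (EFin \o G) (circ t)).
Proof.
move=> mr; apply: (@measurableT_comp _ _ _ _ _ _ (avg mu2 (@near2 R) r (EFin \o G)) _ (@circ R : T1 -> T2)).
  exact: (measurable_avg mu2 near2_measurable mr mGE GE0).
exact: measurable_circ.
Qed.

Lemma measurable_supavg : measurable_fun arcR supavg.
Proof.
apply: (@measurable_fun_esups _ T1 R arcR (fun k t => dyavg G k (circ t)) _ 0%N) => k.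
by apply: measurable_funTS; exact: measurable_avg_circ.
Qed.

Lemma dyavg_le_supavg k t : (dyavg G k (circ t) <= supavg t)%E.
Proof. by apply: ereal_sup_ubound; exists k. Qed.

Lemma supavg_ge0 t : (0 <= supavg t)%E.
Proof. by apply: le_trans (dyavg_le_supavg 0 t); exact: avg_ge0. Qed.

(** For the first [N + 1] dyadic radii a measurable maximising choice turns the integral of the
    maximum into a pairing with [Kc], bounded uniformly in [N]; Fatou's lemma then reaches all
    radii. *)
Lemma integral_supavg_le (e : R) :
  (forall r s, adm r s -> \int[mu2]_y (Kc r y * (G y)%:E) <= e%:E)%E ->
  (\int[mu]_(t in arcR) supavg t <= e%:E)%E.
Proof.
move=> H.
pose s N : seq R := [seq 2^-1 ^+ k | k <- iota 0 N.+1].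
have /choice[r_ Hr] : forall N, exists r : T2 -> R, [/\ measurable_fun setT r, forall z, r z \in s N &
    forall rho z, rho \in s N -> (avg mu2 (@near2 R) (cst rho) (EFin \o G) z <= avg mu2 (@near2 R) r (EFin \o G) z)%E].
  by move=> N; exact: (@argmax_radius R _ T2 mu2 (@near2 R) near2_measurable (s N) (EFin \o G) isT mGE GE0).
pose A N (t : T1) := avg mu2 (@near2 R) (r_ N) (EFin \o G) (circ t).
have mA N : measurable_fun setT (A N) by apply: measurable_avg_circ; have [] := Hr N.
have A0 N t : (0 <= A N t)%E by exact: avg_ge0.
have IA N : (\int[mu]_(t in arcR) A N t <= e%:E)%E.
  have [mr rs _] := Hr N.
  have mrc : measurable_fun setT (fun t : T1 => r_ N (circ t)).
    by apply: (@measurableT_comp _ _ _ _ _ _ (r_ N) _ (@circ R : T1 -> T2)) => //; exact: measurable_circ.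
  have ad : adm (fun t : T1 => r_ N (circ t)) (s N).
    split => // x /mapP[k _ ->]; by rewrite exprn_gt0.
  apply: le_trans (H _ _ ad); rewrite (@integral_Kc R _ mrc (EFin \o G) mGE GE0).
  exact: lexx.
(* The linearised average over the first [M + 1] radii dominates the [k]-th average as soon as
   [M >= k]. *)
have le t : (supavg t <= limn_einf (A ^~ t))%E.
  apply: ge_ereal_sup => _ [k _ <-].
  rewrite limn_einf_lim; apply: lime_ge; first exact: is_cvg_einfs.
  exists k => // N /= kN; apply: le_ereal_inf_tmp => _ [M /= NM <-].
  have [_ _ Hm] := Hr M; apply: Hm; apply/mapP; exists k => //.
  by rewrite mem_iota add0n ltnS (leq_trans kN).
apply: (@le_trans _ _ (\int[mu]_(t in arcR) limn_einf (A ^~ t))%E).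
  apply: ge0_le_integral => //.
  - exact: marcR.
  - by move=> t _; exact: supavg_ge0.
  - exact: measurable_supavg.
  - have -> : (fun t => limn_einf (A ^~ t)) = (fun t => - limn_esup ((fun n t => - A n t)%E ^~ t))%E.
      by apply/funext => t; rewrite -[LHS]oppeK -limn_esupN.
    apply: (@measurableT_comp _ _ _ _ _ _ (-%E) _ (fun t => limn_esup ((fun n t => - A n t)%E ^~ t))).
      exact: oppe_measurable.
    apply: measurable_fun_limn_esup => N; apply: measurable_funTS.
    by apply: (@measurableT_comp _ _ _ _ _ _ (-%E)) => //; exact: oppe_measurable.
apply: le_trans (fatou _ marcR _ _) _.
- by move=> N; exact: measurable_funTS.
- by move=> N t _; exact: A0.
rewrite limn_einf_lim; apply: lime_le; first exact: is_cvg_einfs.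
apply: nearW => n; apply: le_trans (IA n); apply: ereal_inf_lbound.
by exists n => /=.
Qed.

End OneFunction.
End MaximalIntegral.

(** * Approximation of f by test functions *)

Section Approximation.
Context {R : realType}.
Notation mu := (@lebesgue_measure R).
Notation T1 := (measurableTypeR R).
Notation T2 := (T1 * T1)%type.
Notation mu2 := (@leb2 R).
Notation arcR := (@Defs.arc R).

Lemma measurable_cmodD (D : set T1) (h : T1 -> R * R) :
  measurable_fun D (fun x => (h x).1) -> measurable_fun D (fun x => (h x).2) ->
  measurable_fun D (fun x => cmod (h x)).
Proof.
move=> m1 m2; rewrite /cmod.
apply: (@measurableT_comp _ _ _ _ _ _ (@Num.sqrt R) _ (fun x => (h x).1 ^+ 2 + (h x).2 ^+ 2)).
  by apply: continuous_measurable_fun; exact: sqrt_continuous.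
by apply: measurable_funD; apply: measurable_funX.
Qed.

Section Lp.
Variable p : R.
Hypothesis p1 : 1 <= p.
Let p0 : 0 < p. Proof. exact: lt_le_trans p1. Qed.

Lemma measurable_cmodp (h : T2 -> R * R) :
  measurable_fun setT (fun x => (h x).1) -> measurable_fun setT (fun x => (h x).2) ->
  measurable_fun setT (fun x => (cmod (h x) `^ p)%:E).
Proof.
move=> m1 m2; apply/measurable_EFinP.
apply: (@measurableT_comp _ _ _ _ _ _ (@powR R ^~ p) _ (fun x => cmod (h x))).
  exact: measurable_powR.
exact: measurable_cmod.
Qed.

Lemma cmodp_le (h : T2 -> R * R) (dl : R) :
  measurable_fun setT (fun x => (h x).1) -> measurable_fun setT (fun x => (h x).2) ->
  (\int[mu2]_x (`|(h x).1| `^ p)%:E <= dl%:E)%E -> (\int[mu2]_x (`|(h x).2| `^ p)%:E <= dl%:E)%E ->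
  (\int[mu2]_x (cmod (h x) `^ p)%:E <= (2 `^ p * (dl + dl))%:E)%E.
Proof.
move=> m1 m2 I1 I2.
have q1 := measurable_normp p m1; have q2 := measurable_normp p m2.
apply: (@le_trans _ _ (\int[mu2]_x ((2 `^ p)%:E * ((`|(h x).1| `^ p)%:E + (`|(h x).2| `^ p)%:E)))%E).
  apply: ge0_le_integral; [exact: measurableT|by move=> x _; rewrite lee_fin powR_ge0|exact: measurable_cmodp| |].
    by apply: emeasurable_funM => //; exact: emeasurable_funD.
  move=> x _; rewrite -EFinD -EFinM lee_fin.
  apply: le_trans (powR_add_le p1 (normr_ge0 _) (normr_ge0 _)).
  apply: ge0_ler_powR; rewrite ?nnegrE ?(ltW p0) ?addr_ge0 ?sqrtr_ge0//.
  by rewrite [h x]surjective_pairing; exact: cmod_le.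
rewrite (@ge0_integralZl_EFin _ T2)//; last 2 first.
- by move=> x _; rewrite adde_ge0// lee_fin powR_ge0.
- exact: emeasurable_funD.
- rewrite (@ge0_integralD _ T2)//.
  + by rewrite EFinM; apply: lee_wpmul2l; [rewrite lee_fin powR_ge0|rewrite EFinD; exact: leeD].
Qed.

Lemma Lpnorm_le (h : T2 -> R * R) (dl eta : R) : 0 < dl -> 0 < eta -> 2 `^ p * (dl + dl) <= eta `^ p ->
  measurable_fun setT (fun x => (h x).1) -> measurable_fun setT (fun x => (h x).2) ->
  (\int[mu2]_x (`|(h x).1| `^ p)%:E <= dl%:E)%E -> (\int[mu2]_x (`|(h x).2| `^ p)%:E <= dl%:E)%E ->
  inLp p h /\ Lpnorm p h <= eta.
Proof.
move=> dl0 eta0 H m1 m2 I1 I2; have I := cmodp_le m1 m2 I1 I2.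
have I0 : (0 <= \int[mu2]_x (cmod (h x) `^ p)%:E)%E by apply: integral_ge0 => x _; rewrite lee_fin powR_ge0.
have If : (\int[mu2]_x (cmod (h x) `^ p)%:E < +oo)%E by apply: le_lt_trans I (ltry _).
split; first by split.
rewrite /Lpnorm; apply: (@le_trans _ _ ((eta `^ p) `^ p^-1)).
  apply: ge0_ler_powR; rewrite ?nnegrE ?invr_ge0 ?(ltW p0) ?powR_ge0 ?fine_ge0//.
  by rewrite -lee_fin fineK ?ge0_fin_numE// (le_trans I)// lee_fin.
by rewrite -powRrM mulfV ?gt_eqF// powRr1// ltW.
Qed.

Lemma gclass_Lp (phi : T2 -> R) : gclass phi -> (\int[mu2]_x (`|phi x| `^ p)%:E < +oo)%E.
Proof.
move=> gphi; have [B HB] := gclass_decay 0 gphi; have Lp := L1_gclass gphi; have mp := L1_measurable Lp.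
apply: (@le_lt_trans _ _ (\int[mu2]_x ((`|B| `^ (p - 1))%:E * `|phi x|%:E))%E).
  apply: ge0_le_integral; [exact: measurableT|by move=> x _; rewrite lee_fin powR_ge0|exact: measurable_normp| |].
    by mfun.
  move=> x _; rewrite -EFinM lee_fin; apply: powR_le_lin => //.
  by have := HB x; rewrite expr0 mul1r => /le_trans; apply; exact: ler_norm.
rewrite (@ge0_integralZl_EFin _ T2)//; last by apply/measurable_EFinP; exact: measurableT_comp.
by apply: lte_mul_pinfty; [rewrite lee_fin powR_ge0|by []|exact: L1_lty].
Qed.

Lemma fine_add_ge (x y : \bar R) : (0 <= x -> x < +oo -> 0 <= y -> y < +oo ->
  x <= (fine x + fine y)%:E /\ y <= (fine x + fine y)%:E)%E.
Proof.
case: x => [x||]//; case: y => [y||]//=; rewrite !lee_fin => x0 _ y0 _.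
by rewrite lerDl lerDr.
Qed.

Lemma gclass_inLp (phi1 phi2 : T2 -> R) : gclass phi1 -> gclass phi2 -> inLp p (fun x => (phi1 x, phi2 x)).
Proof.
move=> G1 G2; have I1 := gclass_Lp G1; have I2 := gclass_Lp G2.
have m1 := measurable_gclass G1; have m2 := measurable_gclass G2.
split; first by split.
have z1 : (0 <= \int[mu2]_x (`|phi1 x| `^ p)%:E)%E by apply: integral_ge0 => x _; rewrite lee_fin powR_ge0.
have z2 : (0 <= \int[mu2]_x (`|phi2 x| `^ p)%:E)%E by apply: integral_ge0 => x _; rewrite lee_fin powR_ge0.
have [a1 a2] := fine_add_ge z1 I1 z2 I2.
exact: le_lt_trans (@cmodp_le (fun x => (phi1 x, phi2 x)) _ m1 m2 a1 a2) (ltry _).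
Qed.

End Lp.

Section Step.
Variables (p : R) (T : (R * R -> R * R) -> R * R -> R * R) (f g : R * R -> R * R).
Hypothesis p1 : 1 <= p.
Hypothesis p43 : p < 4 / 3.
Hypothesis hT : restriction_operator p T.
Hypothesis hf : inLp p f.
Hypothesis hg : is_fourier f g.

Let p2 : p <= 2. Proof. by move: p43; lra. Qed.
Let p0 : 0 < p. Proof. exact: lt_le_trans p1. Qed.
Let mf1 : measurable_fun setT (fun x : T2 => (f x).1). Proof. by have [[]] := hf. Qed.
Let mf2 : measurable_fun setT (fun x : T2 => (f x).2). Proof. by have [[]] := hf. Qed.
Let mg1 : measurable_fun setT (fun x : T2 => (g x).1). Proof. by have [[[]]] := hg. Qed.
Let mg2 : measurable_fun setT (fun x : T2 => (g x).2). Proof. by have [[[]]] := hg. Qed.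

Lemma f1_Lp : (\int[mu2]_x (`|(f x).1| `^ p)%:E < +oo)%E.
Proof.
have [_] := hf; apply: le_lt_trans.
apply: ge0_le_integral; [exact: measurableT|by move=> x _; rewrite lee_fin powR_ge0|exact: measurable_normp|exact: measurable_cmodp|].
move=> x _; rewrite lee_fin; apply: ge0_ler_powR; rewrite ?nnegrE ?(ltW p0) ?sqrtr_ge0//.
exact: norm1_le_cmod.
Qed.

Lemma f2_Lp : (\int[mu2]_x (`|(f x).2| `^ p)%:E < +oo)%E.
Proof.
have [_] := hf; apply: le_lt_trans.
apply: ge0_le_integral; [exact: measurableT|by move=> x _; rewrite lee_fin powR_ge0|exact: measurable_normp|exact: measurable_cmodp|].
move=> x _; rewrite lee_fin; apply: ge0_ler_powR; rewrite ?nnegrE ?(ltW p0) ?sqrtr_ge0//.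
exact: norm2_le_cmod.
Qed.

Definition Gdiff (h1 h2 : T2 -> R) (y : T2) : R := `|(g y).1 - h1 y| + `|(g y).2 - h2 y|.
Definition Tdiff (h1 h2 : T2 -> R) (t : T1) : R :=
  `|h1 (circ t) - (T f (circ t)).1| + `|h2 (circ t) - (T f (circ t)).2|.

Lemma measurable_Gdiff h1 h2 : measurable_fun setT h1 -> measurable_fun setT h2 ->
  measurable_fun setT (Gdiff h1 h2).
Proof. by move=> m1 m2; rewrite /Gdiff; mfun. Qed.

Lemma Gdiff_ge0 h1 h2 y : 0 <= Gdiff h1 h2 y.
Proof. by rewrite addr_ge0. Qed.

Lemma measurable_Tdiff h1 h2 : measurable_fun setT h1 -> measurable_fun setT h2 ->
  measurable_fun arcR (Tdiff h1 h2).
Proof.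
move=> m1 m2; have [_ [mT _]] := hT; have [t1 t2] := mT _ hf.
have mc (h : T2 -> R) : measurable_fun setT h -> measurable_fun arcR (fun t : T1 => h (circ t)).
  move=> mh; apply: measurable_funTS.
  by apply: (@measurableT_comp _ _ _ _ _ _ h _ (@circ R : T1 -> T2)) => //; exact: measurable_circ.
have mabs (u : T1 -> R) : measurable_fun arcR u -> measurable_fun arcR (fun t => `|u t|).
  by move=> mu_; exact: (measurableT_comp (@normr_measurable R setT) mu_).
apply: measurable_funD; apply: mabs.
  by apply: measurable_funB; [exact: mc|exact: t1].
by apply: measurable_funB; [exact: mc|exact: t2].
Qed.

(** [core_small] is applied to each component of [g] minus the transform. The imaginary part is the
    real part after multiplication by -i, which exchanges the components of [f - phi] and changes
    one sign. *)
Lemma maximal_step (e : R) : 0 < e -> exists2 dl : R, 0 < dl & forall phi1 phi2, gclass phi1 -> gclass phi2 ->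
  (\int[mu2]_x (`|(f x).1 - phi1 x| `^ p)%:E <= dl%:E)%E ->
  (\int[mu2]_x (`|(f x).2 - phi2 x| `^ p)%:E <= dl%:E)%E ->
  (\int[mu]_(t in arcR) supavg (Gdiff (fun x => cosT phi1 x + sinT phi2 x)%R (fun x => cosT phi2 x - sinT phi1 x)%R) t <= e%:E)%E.
Proof.
move=> e0; have e2 : 0 < e / 2 by rewrite divr_gt0.
have [dl dl0 H] := core_small p1 p43 e2; exists dl => // phi1 phi2 gp1 gp2 I1 I2.
have mp1 := measurable_gclass gp1; have mp2 := measurable_gclass gp2.
have Lp1 := L1_gclass gp1; have Lp2 := L1_gclass gp2.
have c1 := measurable_cosT Lp1; have c2 := measurable_cosT Lp2.
have s1 := measurable_sinT Lp1; have s2 := measurable_sinT Lp2.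
have mh1 : measurable_fun setT (fun x => cosT phi1 x + sinT phi2 x) by exact: measurable_funD.
have mh2 : measurable_fun setT (fun x => cosT phi2 x - sinT phi1 x) by exact: measurable_funB.
have md1 : measurable_fun setT (gdiff1 g phi1 phi2) by exact: measurable_funB.
have md2 : measurable_fun setT (gdiff2 g phi1 phi2) by exact: measurable_funB.
have mF1 : measurable_fun setT (fun x => (f x).1 - phi1 x) by exact: measurable_funB.
have mF2 : measurable_fun setT (fun x => (f x).2 - phi2 x) by exact: measurable_funB.
have D1 psi (gpsi : gclass psi) := @gdiff1_dual R p f g p1 p2 mf1 mf2 f1_Lp f2_Lp hg phi1 phi2 gp1 gp2 psi gpsi.
have D2 psi (gpsi : gclass psi) := @gdiff2_dual R p f g p1 p2 mf1 mf2 f1_Lp f2_Lp hg phi1 phi2 gp1 gp2 psi gpsi.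
have gau : gclass (@gauss2 R).
  by exists (fun=> 1); [exact: mc_cst|apply/funext => x; rewrite mul1r].
apply: integral_supavg_le.
- exact: measurable_Gdiff.
- exact: Gdiff_ge0.
move=> r s ad; have [mr _ _] := ad.
have mK := measurable_Kc mr.
have K1 : (\int[mu2]_y (Kc r y * `|gdiff1 g phi1 phi2 y|%:E) <= (e / 2)%:E)%E.
  exact: (H r s (gdiff1 g phi1 phi2) (fun x => (f x).1 - phi1 x) (fun x => (f x).2 - phi2 x)
    ad md1 mF1 mF2 (proj1 (D1 _ gau)) (fun psi gpsi => proj2 (D1 psi gpsi)) I1 I2).
have K2 : (\int[mu2]_y (Kc r y * `|gdiff2 g phi1 phi2 y|%:E) <= (e / 2)%:E)%E.
  have mN1 : measurable_fun setT (fun x => - ((f x).1 - phi1 x)) by exact: measurable_funN.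
  have IN1 : (\int[mu2]_x (`|- ((f x).1 - phi1 x)| `^ p)%:E <= dl%:E)%E.
    rewrite (@eq_integral _ T2 _ mu2 _ (fun x => (`|(f x).1 - phi1 x| `^ p)%:E))//.
    by move=> x _; rewrite normrN.
  exact: (H r s (gdiff2 g phi1 phi2) (fun x => (f x).2 - phi2 x) (fun x => - ((f x).1 - phi1 x))
    ad md2 mF2 mN1 (proj1 (D2 _ gau)) (fun psi gpsi => proj2 (D2 psi gpsi)) I2 IN1).
apply: (@le_trans _ _ (\int[mu2]_y (Kc r y * `|gdiff1 g phi1 phi2 y|%:E + Kc r y * `|gdiff2 g phi1 phi2 y|%:E))%E).
  rewrite le_eqVlt; apply/orP; left; apply/eqP; apply: eq_integral => y _.
  by rewrite -ge0_muleDr// /Gdiff EFinD.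
have q1 : measurable_fun setT (fun y => (Kc r y * `|gdiff1 g phi1 phi2 y|%:E)%E).
  by apply: emeasurable_funM => //; apply/measurable_EFinP; exact: measurableT_comp.
have q2 : measurable_fun setT (fun y => (Kc r y * `|gdiff2 g phi1 phi2 y|%:E)%E).
  by apply: emeasurable_funM => //; apply/measurable_EFinP; exact: measurableT_comp.
rewrite (@ge0_integralD _ T2)//; [|by move=> y _; rewrite mule_ge0// Kc_ge0|by move=> y _; rewrite mule_ge0// Kc_ge0].
by rewrite [e in e%:E]splitr EFinD; exact: leeD.
Qed.

(** On the circle, [T f] minus the transform of [phi] is almost everywhere [T (f - phi)], by
    linearity and agreement on Schwartz functions; boundedness makes it small in L^1. *)
Lemma operator_step (e : R) : 0 < e -> exists2 dl : R, 0 < dl & forall phi1 phi2, gclass phi1 -> gclass phi2 ->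
  (\int[mu2]_x (`|(f x).1 - phi1 x| `^ p)%:E <= dl%:E)%E ->
  (\int[mu2]_x (`|(f x).2 - phi2 x| `^ p)%:E <= dl%:E)%E ->
  (\int[mu]_(t in arcR) (Tdiff (fun x => cosT phi1 x + sinT phi2 x)%R (fun x => cosT phi2 x - sinT phi1 x)%R t)%:E <= e%:E)%E.
Proof.
move=> e0; have [lin [mT [[C bT] sT]]] := hT.
pose C' := `|C| + 1.
have C0 : 0 < C' by rewrite ltr_wpDl.
pose eta := e / (2 * C').
have eta0 : 0 < eta by rewrite divr_gt0// mulr_gt0.
have t0 : 0 < 2 `^ p :> R by rewrite powR_gt0.
(* Solves [2 ^ p * (dl + dl) = eta ^ p], where the left-hand side is the bound of [cmodp_le]. *)
pose dl := eta `^ p / 2 `^ p / 2.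
have dl0 : 0 < dl by rewrite !divr_gt0// powR_gt0.
exists dl => // phi1 phi2 gp1 gp2 I1 I2.
have mp1 := measurable_gclass gp1; have mp2 := measurable_gclass gp2.
have Lp1 := L1_gclass gp1; have Lp2 := L1_gclass gp2.
pose phi x := (phi1 x, phi2 x).
have Sphi : schwartz phi by exact: gclass_schwartz.
have Pphi : inLp p phi by exact: gclass_inLp.
(* The difference [f - phi], written as a combination with complex coefficients, the form in which
   linearity is assumed. *)
pose h := fun y => Defs.cadd (cmul ((1, 0) : R * R) (f y)) (cmul ((-1, 0) : R * R) (phi y)).
have he : h = (fun x => ((f x).1 - phi1 x, (f x).2 - phi2 x)).
  by apply/funext => x; rewrite /h /cmul /Defs.cadd /=; congr (_, _); ring.
have mF1 : measurable_fun setT (fun x : T2 => (f x).1 - phi1 x) by exact: measurable_funB.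
have mF2 : measurable_fun setT (fun x : T2 => (f x).2 - phi2 x) by exact: measurable_funB.
have dle : 2 `^ p * (dl + dl) <= eta `^ p.
  by rewrite /dl le_eqVlt; apply/orP; left; apply/eqP; field; rewrite gt_eqF.
have [Lh Nh] : inLp p h /\ Lpnorm p h <= eta.
  by rewrite he; exact: (@Lpnorm_le p p1 (fun x => ((f x).1 - phi1 x, (f x).2 - phi2 x)) dl eta
    dl0 eta0 dle mF1 mF2 I1 I2).
have [th1 th2] := mT _ Lh.
have N0 : 0 <= Lpnorm p h by exact: powR_ge0.
have mh1 : measurable_fun setT (fun x => cosT phi1 x + sinT phi2 x).
  by apply: measurable_funD; [exact: measurable_cosT|exact: measurable_sinT].
have mh2 : measurable_fun setT (fun x => cosT phi2 x - sinT phi1 x).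
  by apply: measurable_funB; [exact: measurable_cosT|exact: measurable_sinT].
have mcT : measurable_fun arcR (fun t : T1 => (cmod (T h (circ t)))%:E).
  by apply/measurable_EFinP; apply: measurable_cmodD; [exact: th1|exact: th2].
apply: (@le_trans _ _ (\int[mu]_(t in arcR) (2%:E * (cmod (T h (circ t)))%:E))%E).
  apply: ae_ge0_le_integral => //.
  - exact: marcR.
  - by move=> t _; rewrite lee_fin addr_ge0.
  - by apply/measurable_EFinP; exact: measurable_Tdiff.
  - by move=> t _; rewrite -EFinM lee_fin mulr_ge0// sqrtr_ge0.
  - exact: emeasurable_funM.
  have l1 := lin f phi (1, 0) (-1, 0) hf Pphi; have l2 := sT _ Sphi.
  rewrite /sigma_ae in l1 l2.
  apply: (@filterS2 _ _ (ae_filter_ringOfSetsType mu) _ _ _ _ l1 l2) => t h1 h2 at_.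
  rewrite -EFinM lee_fin (h1 at_) (h2 at_) fourier1_pair//.
  set w := Defs.cadd _ _.
  have w1 : `|cosT phi1 (circ t) + sinT phi2 (circ t) - (T f (circ t)).1| = `|w.1|.
    by rewrite -normrN /w /cmul /Defs.cadd /=; congr `|_|; ring.
  have w2 : `|cosT phi2 (circ t) - sinT phi1 (circ t) - (T f (circ t)).2| = `|w.2|.
    by rewrite -normrN /w /cmul /Defs.cadd /=; congr `|_|; ring.
  rewrite /Tdiff w1 w2 mulr_natl mulr2n; apply: lerD; [exact: norm1_le_cmod|exact: norm2_le_cmod].
rewrite (@ge0_integralZl_EFin _ T1)//; last by move=> t _; rewrite lee_fin sqrtr_ge0.
  apply: (@le_trans _ _ (2%:E * (C' * eta)%:E)%E).
    apply: lee_wpmul2l => //; apply: le_trans (bT _ Lh) _; rewrite lee_fin.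
    apply: (@le_trans _ _ (C' * Lpnorm p h)).
      by rewrite ler_wpM2r// (le_trans (ler_norm C))// lerDl.
    by rewrite ler_wpM2l// ltW.
  rewrite -EFinM lee_fin le_eqVlt; apply/orP; left; apply/eqP; rewrite /eta.
  by field; rewrite gt_eqF.
exact: marcR.
Qed.

(** A single pair of test functions serves both steps, so that the maximal function and the distance
    to [T f] are small for the same Lipschitz functions. *)
Lemma approx_step (e : R) : 0 < e -> exists (h1 h2 : T2 -> R) (L : R),
  [/\ measurable_fun setT h1, measurable_fun setT h2, 0 <= L, lipT h1 L & lipT h2 L] /\
  (\int[mu]_(t in arcR) (supavg (Gdiff h1 h2) t + (Tdiff h1 h2 t)%:E) <= e%:E)%E.
Proof.
move=> e0; have e2 : 0 < e / 2 by rewrite divr_gt0.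
have [d1 d10 H1] := maximal_step e2; have [d2 d20 H2] := operator_step e2.
pose dl := Num.min d1 d2; have dl0 : 0 < dl by rewrite lt_min d10.
have [phi1 gp1 I1] := gclass_dense p1 mf1 f1_Lp dl0.
have [phi2 gp2 I2] := gclass_dense p1 mf2 f2_Lp dl0.
have Lp1 := L1_gclass gp1; have Lp2 := L1_gclass gp2.
have [La La0 Ha] := cosT_lip gp1; have [Lb Lb0 Hb] := sinT_lip gp2.
have [Lc Lc0 Hc] := cosT_lip gp2; have [Ld Ld0 Hd] := sinT_lip gp1.
have mh1 : measurable_fun setT (fun x => cosT phi1 x + sinT phi2 x).
  by apply: measurable_funD; [exact: measurable_cosT|exact: measurable_sinT].
have mh2 : measurable_fun setT (fun x => cosT phi2 x - sinT phi1 x).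
  by apply: measurable_funB; [exact: measurable_cosT|exact: measurable_sinT].
exists (fun x => cosT phi1 x + sinT phi2 x), (fun x => cosT phi2 x - sinT phi1 x), (La + Lb + Lc + Ld).
have comb (a b : T2 -> R) (A B E : R) x y : `|a x - a y| <= A * E -> `|b x - b y| <= B * E ->
    `|a x + b x - (a y + b y)| <= (A + B) * E.
  by move=> h1 h2; rewrite opprD addrACA mulrDl (le_trans (ler_normD _ _))// lerD.
split; first split=> //.
- by rewrite !addr_ge0.
- move=> x y; have q0 : 0 <= `|x.1 - y.1| + `|x.2 - y.2| by rewrite addr_ge0.
  apply: le_trans (comb _ _ _ _ _ x y (Ha x y) (Hb x y)) _.
  by rewrite ler_wpM2r// -addrA lerDl addr_ge0.
- move=> x y; have q0 : 0 <= `|x.1 - y.1| + `|x.2 - y.2| by rewrite addr_ge0.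
  have Hd' : `|- sinT phi1 x - - sinT phi1 y| <= Ld * (`|x.1 - y.1| + `|x.2 - y.2|).
    rewrite (_ : - sinT phi1 x - - sinT phi1 y = - (sinT phi1 x - sinT phi1 y)); last by ring.
    by rewrite normrN; exact: Hd.
  apply: le_trans (comb _ (fun z => - sinT phi1 z) _ _ _ x y (Hc x y) Hd') _.
  by rewrite ler_wpM2r// -addrA lerDr addr_ge0.
have J1 : (dl%:E <= d1%:E)%E by rewrite lee_fin ge_min lexx.
have J2 : (dl%:E <= d2%:E)%E by rewrite lee_fin ge_min lexx orbT.
rewrite (@ge0_integralD _ T1)//; first last.
- by apply/measurable_EFinP; exact: measurable_Tdiff.
- by move=> t _; rewrite lee_fin addr_ge0.
- by apply: measurable_supavg; [exact: measurable_Gdiff|exact: Gdiff_ge0].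
- by move=> t _; apply: supavg_ge0; exact: Gdiff_ge0.
- exact: marcR.
rewrite [e in e%:E]splitr EFinD; apply: leeD.
  by apply: H1 => //; [exact: le_trans I1 J1|exact: le_trans I2 J1].
by apply: H2 => //; [exact: le_trans I1 J2|exact: le_trans I2 J2].
Qed.


End Step.
End Approximation.

(** * From integral bounds to almost every point *)

Section Conclusion.
Context {R : realType}.
Notation mu := (@lebesgue_measure R).
Notation T1 := (measurableTypeR R).
Notation T2 := (T1 * T1)%type.
Notation mu2 := (@leb2 R).
Notation arcR := (@Defs.arc R).
Variables (T : (R * R -> R * R) -> R * R -> R * R) (f g : R * R -> R * R).
Hypothesis mg1 : measurable_fun setT (fun x : T2 => (g x).1).
Hypothesis mg2 : measurable_fun setT (fun x : T2 => (g x).2).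

Lemma lebesgue_point_of_approx (t : T1) :
  (forall e : R, 0 < e -> exists (h1 h2 : T2 -> R) (L : R),
    [/\ measurable_fun setT h1, measurable_fun setT h2, 0 <= L, lipT h1 L & lipT h2 L] /\
    (supavg (Gdiff g h1 h2) t + (Tdiff T f h1 h2 t)%:E < e%:E)%E) ->
  lebesgue_point g (circ t) (T f (circ t)).
Proof.
move=> H.
pose F r := (((pi * r ^+ 2)^-1)%:E *
  \int[mu2]_(y in eball (circ t) r) (cmod (Defs.csub (g y) (T f (circ t))))%:E)%E.
have F0 r : (0 <= F r)%E.
  apply: mule_ge0; last by apply: integral_ge0 => y _; rewrite lee_fin sqrtr_ge0.
  by rewrite lee_fin invr_ge0; exact: (mulr_ge0 (pi_ge0 _) (sqr_ge0 _)).
have key e : 0 < e -> \forall r \near 0^'+, (F r < e%:E)%E.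
  (* In [ball_avg_le] the terms with coefficients 2 and 8 are together at most 8 times the defect,
     hence below [e / 2]; the choice of [L1'] makes the Lipschitz term at most [e / 2]. *)
  move=> e0; have e16 : 0 < e / 16 by rewrite divr_gt0.
  have [h1 [h2 [L [[m1 m2 L0 l1 l2] D]]]] := H _ e16.
  pose L1' := 128 * (L + 1).
  have q0 : 0 < L1' by rewrite mulr_gt0// ltr_wpDl.
  near=> r.
  have r0 : 0 < r by near: r; exact: nbhs_right_gt.
  have r1 : r <= 1 by near: r; apply: nbhs_right_le.
  have r2 : r <= e / L1' by near: r; apply: nbhs_right_le; rewrite divr_gt0.
  have b := @ball_avg_le R g h1 h2 L r (circ t) (T f (circ t)) (supavg (Gdiff g h1 h2) t)
    mg1 mg2 m1 m2 L0 l1 l2 r0 r1 (fun k => dyavg_le_supavg (Gdiff g h1 h2) k t).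
  apply: le_lt_trans b _.
  have S0 : (0 <= supavg (Gdiff g h1 h2) t)%E by apply: supavg_ge0; exact: Gdiff_ge0.
  have d0 : 0 <= Tdiff T f h1 h2 t by rewrite addr_ge0.
  have Sf : supavg (Gdiff g h1 h2) t \is a fin_num.
    rewrite ge0_fin_numE//; apply: le_lt_trans (lt_trans D (ltry _)).
    by rewrite leeDl// lee_fin.
  move: D; rewrite -/(Tdiff T f h1 h2 t) -(fineK Sf) -EFinD -EFinM -EFinD !lte_fin.
  have s0 : 0 <= fine (supavg (Gdiff g h1 h2) t) by rewrite fine_ge0.
  have Lr : 64 * L * r <= e / 2.
    move: r2; rewrite ler_pdivlMr// /L1' => r2.
    have : 0 <= r * L by rewrite mulr_ge0// ltW.
    by lra.
  by lra.
apply/fine_cvgP; split.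
  near=> r; rewrite -/(F r) ge0_fin_numE//; apply: (@lt_trans _ _ 1%:E); last exact: ltry.
  by near: r; exact: key.
apply/cvgrPdist_lt => e e0; near=> r; rewrite sub0r normrN.
have Fe : (F r < e%:E)%E by near: r; exact: key.
have Ff : F r \is a fin_num by rewrite ge0_fin_numE// (lt_trans Fe (ltry _)).
have -> : (fine \o (fun r0 : R => ((pi * r0 ^+ 2)^-1)%:E *
  \int[mu2]_(y in eball (circ t) r0) (cmod (Defs.csub (g y) (T f (circ t))))%:E)%E) r = fine (F r) by [].
by rewrite ger0_norm ?fine_ge0// -lte_fin fineK.
Unshelve. all: by end_near. Qed.

Variable p : R.
Hypothesis p1 : 1 <= p.
Hypothesis p43 : p < 4 / 3.
Hypothesis hT : restriction_operator p T.
Hypothesis hf : inLp p f.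
Hypothesis hg : is_fourier f g.

Lemma measurable_defect (h1 h2 : T2 -> R) : measurable_fun setT h1 -> measurable_fun setT h2 ->
  measurable_fun arcR (fun t => supavg (Gdiff g h1 h2) t + (Tdiff T f h1 h2 t)%:E)%E.
Proof.
move=> m1 m2.
have mG : measurable_fun setT (Gdiff g h1 h2) by rewrite /Gdiff; mfun.
have a := measurable_supavg mG (Gdiff_ge0 g h1 h2).
have b : measurable_fun arcR (fun t => (Tdiff T f h1 h2 t)%:E).
  by apply/measurable_EFinP; exact: (measurable_Tdiff hT hf m1 m2).
exact: (emeasurable_funD a b).
Qed.

Lemma restriction_lebesgue_points : sigma_ae (fun x => lebesgue_point g x (T f x)).
Proof.
have /choice[h1 /choice[h2 /choice[L HL]]] : forall n : nat, exists (h1 h2 : T2 -> R) (L : R),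
  [/\ measurable_fun setT h1, measurable_fun setT h2, 0 <= L, lipT h1 L & lipT h2 L] /\
  (\int[mu]_(t in arcR) (supavg (Gdiff g h1 h2) t + (Tdiff T f h1 h2 t)%:E) <= (n.+1%:R^-1)%:E)%E.
  move=> n; apply: (@approx_step R p T f g p1 p43 hT hf hg).
  by rewrite invr_gt0.
pose D n t := (supavg (Gdiff g (h1 n) (h2 n)) t + (Tdiff T f (h1 n) (h2 n) t)%:E)%E.
have D0 n t : (0 <= D n t)%E.
  by rewrite adde_ge0 ?lee_fin ?addr_ge0//; apply: supavg_ge0; exact: Gdiff_ge0.
have mD n : measurable_fun arcR (D n).
  by have [[m1 m2 _ _ _] _] := HL n; exact: (measurable_defect m1 m2).
(* The infimum over all approximations has zero integral, so almost every [t] admits approximations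
   with arbitrarily small defect, without passing to a subsequence. *)
pose V t := einfs (D ^~ t) 0.
have V0 t : (0 <= V t)%E by apply: le_ereal_inf_tmp => _ [n _ <-]; exact: D0.
have mV : measurable_fun arcR V by exact: (@measurable_fun_einfs _ T1 R arcR D mD 0%N).
have IV : (\int[mu]_(t in arcR) `|V t| = 0)%E.
  apply/le_anti/andP; split; last by apply: integral_ge0.
  apply/lee_addgt0Pr => e e0; rewrite add0e.
  pose n := Num.truncn e^-1.
  have ne : n.+1%:R^-1 <= e.
    rewrite -[leRHS]invrK lef_pV2 ?posrE ?invr_gt0 ?ltr0n//; apply: ltW; exact: truncnS_gt.
  apply: (@le_trans _ _ (n.+1%:R^-1)%:E); last by rewrite lee_fin.
  apply: le_trans (proj2 (HL n)); apply: ge0_le_integral => //.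
  - exact: marcR.
  - exact: measurableT_comp.
  - exact: mD.
  - by move=> t _; rewrite gee0_abs//; apply: ereal_inf_lbound; exists n.
have Hae : ae_eq mu arcR V (cst 0%E) by apply/(ae_eq_integral_abs _ marcR mV).
rewrite /sigma_ae; apply: (@filterS _ _ (ae_filter_ringOfSetsType mu) _ _ _ Hae) => t Vt at_.
apply: lebesgue_point_of_approx => e e0.
have Ve : (V t < e%:E)%E by rewrite (Vt at_) lte_fin.
have [_ [n _ <-] Dn] := ereal_inf_lt Ve.
by exists (h1 n), (h2 n), (L n); split; [have [] := HL n|exact: Dn].
Qed.

End Conclusion.

Theorem theorem1p2 (R : realType) (p : R) (hp1 : 1 <= p) (hp2 : p < 4%:R / 3%:R)
  (T : (R * R -> R * R) -> R * R -> R * R) (hT : restriction_operator p T)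
  (f : R * R -> R * R) (hf : inLp p f)
  (g : R * R -> R * R) (hg : is_fourier f g) :
  sigma_ae (fun x => exists c, lebesgue_point g x c) /\
  sigma_ae (fun x => forall c, lebesgue_point g x c -> c = T f x).
Proof.
have [[[mg1 mg2] _] _] := hg.
(* [T f] itself is exhibited as a regularised value; uniqueness of that value gives the second
   claim. *)
have H := @restriction_lebesgue_points R T f g mg1 mg2 p hp1 hp2 hT hf hg.
rewrite /sigma_ae in H *.
split; apply: (@filterS _ _ (ae_filter_ringOfSetsType (@lebesgue_measure R)) _ _ _ H) => t Ht at_.
  by exists (T f (circ t)); exact: Ht.
move=> c Hc; exact: (lebesgue_point_uniq mg1 mg2 Hc (Ht at_)).
Qed.
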